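(* Let $\Delta^*=\{t\in\mathbb{C}:0<|t|<1\}$, let $\rho_n\in\Delta^*$ with $\rho_n\to0$, and let $r_n=-\log|\rho_n|$. There is an isometric embedding $$\Phi:\mathbb{H}_{Berk}(\mathbb{L})\hookrightarrow{}^r\mathbb{H}^3\cong\mathbb{H}_{Berk}({}^\rho\mathbb{C}).$$ Moreover, if $\mathbf f=f_t$ is a holomorphic family of rational maps of degree $d>1$ defined over $\Delta^*$, all of whose coefficients extend to meromorphic functions on the unit disk $\Delta$, then $$\Phi\circ B=F\circ\Phi,$$ where $F=\lim_\omega\mathscr{E}f_{\rho_n}$ is the limiting map on ${}^r\mathbb{H}^3$ and $B$ is the Berkovich extension to $\mathbb{H}_{Berk}(\mathbb{L})$ of $\mathbf f$, viewed as a rational map with coefficients in $\mathbb{L}$.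
   Context: $\omega$ is a fixed non-principal ultrafilter on $\mathbb{N}$. $\mathbb{L}$ is the complete algebraically closed field of formal Puiseux series $\mathbf a=\sum_{j\ge0}a_jt^{\lambda_j}$, $a_j\in\mathbb{C}$, $\lambda_j\in\mathbb{Q}$ increasing, with $\lambda_j\to\infty$ if infinitely many $a_j$ are nonzero; its absolute value is $|\mathbf a|=\exp(-\min\{\lambda_j:a_j\ne0\})$. The coefficients of $f_t$, being meromorphic at $t=0$, are viewed in $\mathbb{L}$ through their Laurent expansions. ${}^\rho\mathbb{C}$ is the complexified Robinson field: with ${}^*\mathbb{C}$ the ultrapower of $\mathbb{C}$ with respect to $\omega$, let $M_0$ (resp. $M_1$) be the set of classes of $(t_n)$ with $|t_n|<|\rho_n|^{-N}$ $\omega$-almost surely for some $N\in\mathbb{N}$ (resp. $|t_n|<|\rho_n|^N$ $\omega$-almost surely for all $N\in\mathbb{N}$); ${}^\rho\mathbb{C}=M_0/M_1$ with absolute value $|x|=e^{-\nu(x)}$, $\nu(x)=\lim_\omega\log|x_n|/\log|\rho_n|$. It is complete and algebraically closed. For a complete algebraically closed non-Archimedean field $K$, $\mathbb{H}_{Berk}(K)=\mathbb{P}^1_{Berk}(K)\setminus\mathbb{P}^1(K)$, with the metric given on points corresponding to closed balls $B(a,r),B(b,s)$ by $2\log R-\log r-\log s$, $R=\max(r,s,|a-b|)$, and extended continuously. Rational maps over $K$ act naturally on $\mathbb{H}_{Berk}(K)$. $\mathbb{H}^3$ is hyperbolic 3-space (ball model, centre $\mathbf 0$, ideal boundary $S^2=\hat{\mathbb{C}}$).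 A probability measure $\mu$ on $S^2$ without atoms of mass $\ge1/2$ has a unique barycenter $y$, characterized by $\int_{S^2}\zeta\,dM_*\mu(\zeta)=0$ for $M\in\mathrm{PSL}_2(\mathbb{C})$ with $M(y)=\mathbf 0$. For a non-constant rational map $f$, $\mathscr{E}f:\mathbb{H}^3\to\mathbb{H}^3$ sends $x$ to the barycenter of $f_*(M_x)_*\mu_{S^2}$, where $M_x\in\mathrm{PSL}_2(\mathbb{C})$, $M_x(\mathbf 0)=x$ and $\mu_{S^2}$ is the normalized spherical measure; it is $C\deg f$-Lipschitz with $C$ universal. ${}^r\mathbb{H}^3=\lim_\omega(\mathbb{H}^3,\mathbf 0,d_{\mathbb{H}^3}/r_n)$ is the asymptotic cone: classes $[(x_n)]$ of sequences with $d_{\mathbb{H}^3}(\mathbf 0,x_n)/r_n$ bounded, with distance $\lim_\omega d_{\mathbb{H}^3}(x_n,y_n)/r_n$ (sequences at distance $0$ identified). $F([(x_n)])=[(\mathscr{E}f_{\rho_n}(x_n))]$. The identification ${}^r\mathbb{H}^3\cong\mathbb{H}_{Berk}({}^\rho\mathbb{C})$ is the isometric bijection sending the point of $\mathbb{H}_{Berk}({}^\rho\mathbb{C})$ corresponding to a closed ball $M(B(0,1))$, $M(z)=az+b$, to $[(M_n(\mathbf 0))]$, where $M_n(z)=a_nz+b_n$ and $(a_n),(b_n)$ represent $a,b$. *)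

(* Defs.v *)
From HB Require Import structures.
From mathcomp Require Import all_boot all_order all_algebra.
From mathcomp.real_closed Require Import complex.
From mathcomp Require Import finmap ring_quotient.
From mathcomp Require Import all_classical all_reals all_analysis.
From mathcomp Require Import ring lra.

Set Implicit Arguments.
Unset Strict Implicit.
Unset Printing Implicit Defensive.

Import Order.TTheory GRing.Theory Num.Theory.
Import numFieldNormedType.Exports.
Import Normc.

Local Open Scope classical_set_scope.
Local Open Scope ring_scope.
Local Open Scope complex_scope.

(* Inverses chosen classically, for rings in which they merely exist. *)
Section ChosenInverse.
Variable K : comNzRingType.
Hypothesis ex_inv : forall x : K, x != 0 -> exists y, y * x = 1.

Definition chosen_inv (x : K) : K := xget 0 [set y | y * x = 1].

Lemma chosen_mulVf x : x != 0 -> chosen_inv x * x = 1.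
Proof. by case/ex_inv => y yx; rewrite /chosen_inv; case: xgetP => // /(_ y). Qed.

Lemma chosen_inv0 : chosen_inv 0 = 0.
Proof.
rewrite /chosen_inv; case: xgetP => // y _ /= /eqP.
by rewrite mulr0 eq_sym oner_eq0.
Qed.
End ChosenInverse.

Section Puiseux.
Variable R : realType.
Local Notation C := R[i].

Definition left_finite (a : rat -> C) : Prop :=
  forall x : rat, finite_set [set l | l <= x /\ a l != 0].

(* Left-finite support: the exponents form a finite or increasing unbounded    *)
(* sequence of rationals.                                                     *)
Record puiseux := Puiseux {
  coef :> rat -> C;
  coef_left_finite : `[< left_finite coef >] }.

HB.instance Definition _ := [isSub for coef].
HB.instance Definition _ := gen_eqMixin puiseux.
HB.instance Definition _ := gen_choiceMixin puiseux.

Lemma puiseux_supp (a : puiseux) (x : rat) :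
  exists A : {fset rat}, forall l, l <= x -> a l != 0 -> l \in A.
Proof.
have /asboolP/(_ x)/finite_fsetP[A EA] := coef_left_finite a.
by exists A => l lx al; have : [set` A] l by rewrite -EA.
Qed.

Lemma puiseux_low (a : puiseux) : exists N : rat, forall l, a l != 0 -> N <= l.
Proof.
have [A HA] := puiseux_supp a 0.
exists (- \sum_(l <- A) `|l|) => l al.
have [l0|l0] := leP l 0; last first.
  by rewrite (le_trans _ (ltW l0))// oppr_le0 sumr_ge0.
rewrite lerNl (le_trans (ler_norm _))// normrN.
by rewrite (big_fsetD1 l)/= ?HA// lerDl sumr_ge0.
Qed.

Definition puiseux_mul_coef (a b : rat -> C) (l : rat) : C :=
  \sum_(m \in [set: rat]) a m * b (l - m).

Lemma puiseux_mul_coefE (a b : puiseux) (N x : rat) (A : {fset rat}) :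
  (forall l, b l != 0 -> N <= l) ->
  (forall l, l <= x - N -> a l != 0 -> l \in A) ->
  puiseux_mul_coef a b x = \sum_(m <- A) a m * b (x - m).
Proof.
move=> hN hA; rewrite /puiseux_mul_coef (fsbigTE A)// => m mA.
have [->|am] := eqVneq (a m) 0; first by rewrite mul0r.
have [->|bm] := eqVneq (b (x - m)) 0; first by rewrite mulr0.
case/negP: mA; apply: hA => //.
by have := hN _ bm; lra.
Qed.

Lemma puiseux_add_subproof (a b : puiseux) : `[< left_finite (a \+ b) >].
Proof.
apply/asboolP => x.
have [A HA] := puiseux_supp a x; have [B HB] := puiseux_supp b x.
apply: (@sub_finite_set _ _ [set` (A `|` B)%fset]); last exact: finite_fset.
move=> l /= [lx]; rewrite inE.
have [/eqP al|al] := boolP (a l == 0); last by rewrite HA.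
by rewrite al add0r => bl; rewrite HB// orbT.
Qed.

Lemma puiseux_opp_subproof (a : puiseux) : `[< left_finite (fun l => - a l) >].
Proof.
apply/asboolP => x; have /asboolP/(_ x) := coef_left_finite a.
by apply: sub_finite_set => l /= []; rewrite oppr_eq0.
Qed.

Lemma puiseux_monomial_subproof (l : rat) (c : C) :
  `[< left_finite (fun m => if m == l then c else 0) >].
Proof.
apply/asboolP => x; apply: (@sub_finite_set _ _ [set l]).
  by move=> m [_ /=]; case: (eqVneq m l) => [->|_ /eqP].
exact: finite_set1.
Qed.

Lemma puiseux_zero_subproof : `[< left_finite (fun=> 0) >].
Proof.
apply/asboolP => x; apply: (@sub_finite_set _ _ set0) => //.
by move=> l [_ /eqP].
Qed.

Lemma puiseux_mul_subproof (a b : puiseux) :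
  `[< left_finite (puiseux_mul_coef a b) >].
Proof.
apply/asboolP => x.
have [Na HNa] := puiseux_low a; have [Nb HNb] := puiseux_low b.
have [A HA] := puiseux_supp a (x - Nb); have [B HB] := puiseux_supp b (x - Na).
apply: (@sub_finite_set _ _ [set u + v | u in [set` A] & v in [set` B]]).
  move=> l /= [lx]; rewrite (puiseux_mul_coefE HNb (A := A)); last first.
    by move=> m ml; apply: HA; lra.
  rewrite big_seq => s0.
  have [m [mA am bm]] : exists m, [/\ m \in A, a m != 0 & b (l - m) != 0].
    apply/not_existsP => nE; case/eqP: s0; apply: big1 => m mA.
    have [->|am] := eqVneq (a m) 0; first by rewrite mul0r.
    have [->|bm] := eqVneq (b (l - m)) 0; first by rewrite mulr0.
    by case: (nE m).
  exists m => //; exists (l - m); last by rewrite addrC subrK.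
  by apply: HB => //; have := HNa _ am; lra.
by apply: finite_image2; exact: finite_fset.
Qed.

Definition puiseux_add a b := Puiseux (puiseux_add_subproof a b).
Definition puiseux_opp a := Puiseux (puiseux_opp_subproof a).
Definition puiseux_zero := Puiseux puiseux_zero_subproof.
Definition puiseux_monomial l c := Puiseux (puiseux_monomial_subproof l c).
Definition puiseux_mul a b := Puiseux (puiseux_mul_subproof a b).

Lemma puiseuxP (a b : puiseux) : (forall l, a l = b l) -> a = b.
Proof. by move=> ab; apply: val_inj; apply/funext. Qed.

Fact puiseux_addA : associative puiseux_add.
Proof. by move=> a b c; apply: puiseuxP => l /=; rewrite addrA. Qed.
Fact puiseux_addC : commutative puiseux_add.
Proof. by move=> a b; apply: puiseuxP => l /=; rewrite addrC. Qed.
Fact puiseux_add0 : left_id puiseux_zero puiseux_add.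
Proof. by move=> a; apply: puiseuxP => l /=; rewrite add0r. Qed.
Fact puiseux_addN : left_inverse puiseux_zero puiseux_opp puiseux_add.
Proof. by move=> a; apply: puiseuxP => l /=; rewrite addNr. Qed.

HB.instance Definition _ := GRing.isZmodule.Build puiseux
  puiseux_addA puiseux_addC puiseux_add0 puiseux_addN.

Fact puiseux_mulC : commutative puiseux_mul.
Proof.
move=> a b; apply: puiseuxP => l /=; rewrite /puiseux_mul_coef.
rewrite (reindex_fsbigT (fun m => l - m)); last first.
  by exists (fun m => l - m) => m /=; rewrite opprB addrC subrK.
by apply: eq_fsbigr => m _; rewrite mulrC opprB addrC subrK.
Qed.

Fact puiseux_mulA : associative puiseux_mul.
Proof.
move=> a b c.
rewrite [puiseux_mul b c]puiseux_mulC [RHS]puiseux_mulC.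
apply: puiseuxP => l.
rewrite -[LHS]/(puiseux_mul_coef a (puiseux_mul c b) l).
rewrite -[RHS]/(puiseux_mul_coef c (puiseux_mul a b) l).
have [Na HNa] := puiseux_low a; have [Nb HNb] := puiseux_low b.
have [Nc HNc] := puiseux_low c.
have [A HA] := puiseux_supp a (l - Nb - Nc).
have [D HD] := puiseux_supp c (l - Na - Nb).
have [Nab HNab] := puiseux_low (puiseux_mul a b).
have [Ncb HNcb] := puiseux_low (puiseux_mul c b).
have [A' HA'] := puiseux_supp a (l - Ncb).
have [D' HD'] := puiseux_supp c (l - Nab).
rewrite (@puiseux_mul_coefE a _ Ncb l (A `|` A')%fset)//; last first.
  by move=> m ml am; rewrite inE HA' ?orbT.
rewrite (@puiseux_mul_coefE c _ Nab l (D `|` D')%fset)//; last first.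
  by move=> m ml am; rewrite inE HD' ?orbT.
under eq_bigr => m _.
  have -> : a m * puiseux_mul c b (l - m) =
      \sum_(n <- (D `|` D')%fset) a m * (c n * b (l - m - n)).
    rewrite -big_distrr/=; have [->|am] := eqVneq (a m) 0; first by rewrite !mul0r.
    congr (_ * _); apply: (@puiseux_mul_coefE _ _ Nb) => // n nl cn.
    by rewrite inE HD//; have := HNa _ am; lra.
  over.
rewrite exchange_big/=; apply: eq_bigr => n _.
have [cn0|cn] := eqVneq (c n) 0.
  by rewrite cn0 mul0r big1// => m _; rewrite mul0r mulr0.
have -> : puiseux_mul_coef a b (l - n) =
    \sum_(m <- (A `|` A')%fset) a m * b (l - n - m).
  apply: (@puiseux_mul_coefE _ _ Nb) => // m ml am.
  by rewrite inE HA//; have := HNc _ cn; lra.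
rewrite big_distrr/=; apply: eq_bigr => m _.
by rewrite mulrCA addrAC.
Qed.

Lemma puiseux_monomialM l c (a : puiseux) x :
  puiseux_mul (puiseux_monomial l c) a x = c * a (x - l).
Proof.
have [Na HNa] := puiseux_low a.
rewrite [LHS](@puiseux_mul_coefE _ _ Na x [fset l]%fset)//; last first.
  by move=> m _ /=; rewrite inE; case: (eqVneq m l) => // _ /eqP.
by rewrite big_seq_fset1/= eqxx.
Qed.

Fact puiseux_mul1 : left_id (puiseux_monomial 0 1) puiseux_mul.
Proof. by move=> a; apply: puiseuxP => l; rewrite puiseux_monomialM mul1r subr0. Qed.

Fact puiseux_mulDl : left_distributive puiseux_mul +%R.
Proof.
move=> a b c; apply: puiseuxP => l.
rewrite -[LHS]/(puiseux_mul_coef (a + b) c l).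
rewrite -[RHS]/(puiseux_mul_coef a c l + puiseux_mul_coef b c l).
have [N HN] := puiseux_low c.
have [A HA] := puiseux_supp a (l - N); have [B HB] := puiseux_supp b (l - N).
rewrite (@puiseux_mul_coefE a c N l (A `|` B)%fset)//; last first.
  by move=> m ml am; rewrite inE HA.
rewrite (@puiseux_mul_coefE b c N l (A `|` B)%fset)//; last first.
  by move=> m ml am; rewrite inE HB ?orbT.
rewrite -big_split/= (@puiseux_mul_coefE (a + b) c N l (A `|` B)%fset)//.
  by apply: eq_bigr => m _; rewrite mulrDl.
move=> m ml; rewrite inE /=.
have [/eqP al|al] := boolP (a m == 0); last by rewrite HA.
by rewrite al add0r => bl; rewrite HB// orbT.
Qed.

Fact puiseux_1neq0 : puiseux_monomial 0 1 != 0.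
Proof.
apply/eqP => /(congr1 (fun a : puiseux => a 0))/=/eqP.
by rewrite ?eqxx oner_eq0.
Qed.

HB.instance Definition _ := GRing.Zmodule_isComNzRing.Build puiseux
  puiseux_mulA puiseux_mulC puiseux_mul1 puiseux_mulDl puiseux_1neq0.

Lemma puiseux_coefM (a b : puiseux) (N x : rat) (A : {fset rat}) :
  (forall l, b l != 0 -> N <= l) ->
  (forall l, l <= x - N -> a l != 0 -> l \in A) ->
  (a * b) x = \sum_(m <- A) a m * b (x - m).
Proof. exact: puiseux_mul_coefE. Qed.

Lemma puiseux_supp_exp (u : puiseux) (e : rat) (k : nat) :
  (forall l, u l != 0 -> e <= l) ->
  forall l, (u ^+ k) l != 0 -> e *+ k <= l.
Proof.
move=> ue; elim: k => [|k IH] l.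
  rewrite expr0 mulr0n => l0.
  have [->//|ln0] := eqVneq l 0; case/eqP: l0.
  by rewrite /= (negbTE ln0).
rewrite exprS; have [A HA] := puiseux_supp u (l - e *+ k).
rewrite (puiseux_coefM IH HA) => s0.
have [m [um ukm]] : exists m, u m != 0 /\ (u ^+ k) (l - m) != 0.
  apply/not_existsP => nE; case/eqP: s0; apply: big1 => m mA.
  have [->|am] := eqVneq (u m) 0; first by rewrite mul0r.
  have [->|bm] := eqVneq ((u ^+ k) (l - m)) 0; first by rewrite mulr0.
  by case: (nE m).
by rewrite mulrS; have := ue _ um; have := IH _ ukm; lra.
Qed.

Lemma puiseux_geometric (u : puiseux) (e : rat) : 0 < e ->
  (forall l, u l != 0 -> e <= l) -> exists b, b * (1 - u) = 1.
Proof.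
move=> e0 ue.
have S_stable (m n : nat) (l : rat) : (m <= n)%N -> l < e *+ m ->
    (\sum_(i < n) u ^+ i : puiseux) l = (\sum_(i < m) u ^+ i : puiseux) l.
  move=> mn lm; rewrite -(subnKC mn); elim: (n - m)%N => [|k IH]; first by rewrite addn0.
  rewrite addnS big_ord_recr -[LHS]/((\sum_(i < m + k) u ^+ i : puiseux) l + (u ^+ (m + k)) l) IH.
  have [->|/(puiseux_supp_exp ue)] := eqVneq ((u ^+ (m + k)) l) 0.
    by rewrite addr0.
  rewrite mulrnDr => h; exfalso.
  by have : 0 <= e *+ k by [rewrite mulrn_wge0// ltW]; lra.
pose N (l : rat) := (Num.bound (`|l| / e)).
have NP l : l < e *+ N l.
  rewrite -mulr_natr -ltr_pdivrMl// mulrC.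
  apply: le_lt_trans (archi_boundP _); last by rewrite divr_ge0// ltW.
  by rewrite ler_pM2r ?invr_gt0// ler_norm.
pose bf l := (\sum_(i < N l) u ^+ i : puiseux) l.
have bfE n l : l < e *+ n -> bf l = (\sum_(i < n) u ^+ i : puiseux) l.
  move=> ln; have [le|/ltnW le] := leqP (N l) n; last by rewrite /bf (S_stable _ _ _ le).
  by rewrite (S_stable _ _ _ le).
have bP : `[< left_finite bf >].
  apply/asboolP => x.
  have /asboolP/(_ x) := coef_left_finite (\sum_(i < N x) u ^+ i : puiseux).
  apply: sub_finite_set => l [lx bl]; split => //.
  by rewrite -bfE// (le_lt_trans lx).
exists (Puiseux bP); rewrite mulrC; apply: puiseuxP => x.
have u1 l : (1 - u) l != 0 -> 0 <= l.
  move=> h; have [ul|/ue] := eqVneq (u l) 0; last by lra.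
  have [->//|l0] := eqVneq l 0; case/eqP: h.
  by rewrite -[LHS]/((1 : puiseux) l - u l) ul /= (negbTE l0) subr0.
have [M HM] := puiseux_low (Puiseux bP).
have [M' HM'] := puiseux_low (\sum_(i < N x) u ^+ i : puiseux).
have [A HA] := puiseux_supp (1 - u) (x - M).
have [A' HA'] := puiseux_supp (1 - u) (x - M').
rewrite (@puiseux_coefM _ _ M x (A `|` A')%fset)//; last first.
  by move=> l lx ul; rewrite inE HA.
have -> : (1 : puiseux) x = ((1 - u) * (\sum_(i < N x) u ^+ i)) x.
  rewrite -[1 - u]opprB mulNr -subrX1 opprB.
  rewrite -[RHS]/((1 : puiseux) x - (u ^+ N x) x).
  have [->|/(puiseux_supp_exp ue)] := eqVneq ((u ^+ N x) x) 0.
    by rewrite subr0.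
  by rewrite leNgt NP.
rewrite (@puiseux_coefM _ _ M' x (A `|` A')%fset)//; last first.
  by move=> l lx ul; rewrite inE HA' ?orbT.
apply: eq_bigr => m _.
have [->|/u1 m0] := eqVneq ((1 - u) m) 0; first by rewrite !mul0r.
congr (_ * _); apply: bfE; apply: le_lt_trans (NP x); lra.
Qed.

Lemma puiseux_min (a : puiseux) (x : rat) : a x != 0 ->
  exists m, a m != 0 /\ forall l, a l != 0 -> m <= l.
Proof.
move=> ax; have [A HA] := puiseux_supp a x.
have seq_min (s : seq rat) y : y \in s -> exists2 m, m \in s & {in s, forall l, m <= l}.
  elim: s y => // z [|z' s] IH y _; first by exists z; rewrite ?inE// => l /[!inE]/eqP->.
  have [m ms mP] := IH z' (mem_head _ _).
  have [mz|zm] := leP m z.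
    by exists m => [|l]; rewrite inE ?ms ?orbT// => /orP[/eqP->//|/mP].
  exists z => [|l]; first exact: mem_head.
  by rewrite inE => /orP[/eqP->//|/mP]; apply: le_trans; exact: ltW.
have xA : x \in [seq l <- A | a l != 0] by rewrite mem_filter ax HA.
have [m] := seq_min _ _ xA; rewrite mem_filter => /andP[am mA] mP.
exists m; split => // l al; have [lx|/ltW] := leP l x.
  by apply: mP; rewrite mem_filter al HA.
exact: le_trans (mP _ xA).
Qed.

Fact puiseux_ex_inv (a : puiseux) : a != 0 -> exists b, b * a = 1.
Proof.
move=> a0.
have [x ax] : exists x, a x != 0.
  apply/not_existsP => nE; case/eqP: a0; apply: puiseuxP => l.
  by have /negP := nE l; rewrite negbK => /eqP.
have [m [am mP]] := puiseux_min ax.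
pose t : puiseux := puiseux_monomial (- m) (a m)^-1.
pose u := 1 - t * a.
have tE l : (t * a) l = (a m)^-1 * a (l + m).
  by rewrite [LHS]puiseux_monomialM opprK.
have uE l : u l = (1 : puiseux) l - (a m)^-1 * a (l + m).
  by rewrite -tE.
have u_gt0 l : u l != 0 -> 0 < l.
  rewrite uE; have [l0|//|->] := ltgtP l 0; last first.
    by rewrite /= add0r mulVf// subrr eqxx.
  rewrite /= (lt_eqF l0) sub0r oppr_eq0 mulf_eq0 negb_or => /andP[_ /mP].
  by lra.
have [e e0 ue] : exists2 e, 0 < e & forall l, u l != 0 -> e <= l.
  have [u0|/existsNP[y uy]] := pselect (forall l, u l = 0 :> C).
    by exists 1 => // l; rewrite u0 eqxx.
  have [e [ue eP]] := puiseux_min (introN eqP uy).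
  by exists e => //; exact: u_gt0.
have [b bP] := puiseux_geometric e0 ue.
by exists (b * t); rewrite -bP /u opprB addrC subrK mulrA.
Qed.

HB.instance Definition _ := GRing.ComNzRing_isField.Build puiseux
  (chosen_mulVf puiseux_ex_inv) (@chosen_inv0 puiseux).

End Puiseux.

Record scale (R : realType) := Scale {
  ultra : set_system nat;
  ultra_ultra : UltraFilter ultra;
  ultra_nonprincipal : forall n, ~ ultra [set n];
  rho : nat -> R[i];
  rho_disk : forall n, 0 < normc (rho n) < 1;
  rho_cvg0 : (rho : nat -> R[i]^o) @ \oo --> (0 : R[i]^o) }.

Section Robinson.
Variables (R : realType) (S : scale R).
Local Notation C := R[i].
Local Notation omega := (ultra S).
Local Notation rho := (rho S).

#[local] Instance ultra_omega : UltraFilter omega := ultra_ultra S.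

Definition moderate : {pred nat -> C} := fun x =>
  `[< exists N : nat, \forall n \near omega, normc (x n) < normc (rho n) ^- N >].

Definition negligible (x : nat -> C) : Prop :=
  forall N : nat, \forall n \near omega, normc (x n) < normc (rho n) ^+ N.

Let r_gt0 n : 0 < normc (rho n). Proof. by have /andP[] := rho_disk S n. Qed.
Let r_lt1 n : normc (rho n) < 1. Proof. by have /andP[] := rho_disk S n. Qed.

Lemma ultra_eventually (A : set nat) (N : nat) :
  (forall n, (N <= n)%N -> A n) -> omega A.
Proof.
move=> NA; apply: (filterS (P := [set n | (N <= n)%N])) => //.
elim: N {NA} => [|N IH]; first by apply: filterS filterT.
have [//|h] := in_ultra_setVsetC [set N] ultra_omega.
  by have := @ultra_nonprincipal _ S N.
apply: filterS (filterI IH h) => n [/= Nn nN].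
by rewrite ltn_neqAle Nn andbT; apply/eqP => E; exact: nN.
Qed.

Lemma rho_near_half : \forall n \near omega, normc (rho n) <= 2^-1.
Proof.
have e0 : (0 : C) < (2^-1)%:C by rewrite ltcR.
have /cvgrPdist_lt/(_ _ e0)[N _ NP] := @rho_cvg0 _ S.
apply: (@ultra_eventually _ N) => n Nn.
by have := NP n Nn; rewrite sub0r normrN normc_def ltcR; case: (rho n) => ? ? /= /ltW.
Qed.

Let invXE n N : normc (rho n) ^- N = (normc (rho n))^-1 ^+ N.
Proof. by rewrite exprVn. Qed.

Let normcD (x y : C) : normc (x + y) <= normc x + normc y.
Proof. exact: (@le_normcD R). Qed.
Let normcNE (x : C) : normc (- x) = normc x.
Proof. exact: (@normcN R). Qed.
Let normc_ge0 (x : C) : 0 <= normc x.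
Proof. by case: x => a b; exact: sqrtr_ge0. Qed.

Lemma moderate_near x : x \in moderate ->
  exists N, forall M, (N <= M)%N -> \forall n \near omega, normc (x n) < normc (rho n) ^- M.
Proof.
move=> /asboolP[N xN]; exists N => M NM; near=> n.
apply: (@lt_le_trans _ _ (normc (rho n) ^- N)); first by near: n.
rewrite !invXE ler_weXn2l// invf_ge1//; exact: ltW.
Unshelve. all: by end_near. Qed.

Fact moderate_subring : subring_closed moderate.
Proof.
split.
- apply/asboolP; exists 1%N; near=> n.
  by rewrite normc1 expr1 invf_gt1.
- move=> x y /moderate_near[N xN] /moderate_near[M yM].
  apply/asboolP; exists (maxn N M).+1; near=> n.
  apply: (@lt_le_trans _ _ (normc (rho n) ^- (maxn N M) + normc (rho n) ^- (maxn N M))).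
    apply: le_lt_trans (normcD _ _) _; rewrite normcNE ltrD//.
      by near: n; exact: xN (leq_maxl _ _).
    by near: n; exact: yM (leq_maxr _ _).
  rewrite -mulr2n -mulr_natl !invXE exprS ler_wpM2r ?exprn_ge0 ?invr_ge0//.
  rewrite -[leLHS]invrK lef_pV2 ?posrE ?invr_gt0//.
  by near: n; exact: rho_near_half.
- move=> x y /moderate_near[N xN] /moderate_near[M yM].
  apply/asboolP; exists (N + M)%N; near=> n.
  rewrite normcM exprD invfM ltr_pM//; near: n; [exact: xN|exact: yM].
Unshelve. all: by end_near. Qed.

HB.instance Definition _ :=
  GRing.isSubringClosed.Build (nat -> C) moderate moderate_subring.

(* M0 and M1 consist of sequences rather than of classes in the ultrapower of *)
(* C: omega-almost surely equal sequences differ by an element of M1, so that *)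
(* M0 / M1 is the same field.                                                 *)
Record M0 := MkM0 { M0_seq :> nat -> C; M0_moderate : M0_seq \in moderate }.
HB.instance Definition _ := [isSub for M0_seq].
HB.instance Definition _ := [Choice of M0 by <:].
HB.instance Definition _ := [SubChoice_isSubComNzRing of M0 by <:].

Definition M1 : {pred M0} := fun x => `[< negligible x >].

Fact M1_idealr : idealr_closed M1.
Proof.
split.
- apply/asboolP => N; near=> n.
  by rewrite normc0 exprn_gt0.
- apply/asboolP => /(_ 0%N) h.
  suff : omega set0 by exact: filter_not_empty.
  by apply: filterS h => n; rewrite normc1 expr0 ltxx.
- move=> a x y /asboolP xM /asboolP yM; apply/asboolP => N.
  have [K aK] := moderate_near (M0_moderate a).
  near=> n.
  apply: (@lt_le_trans _ _ (normc (rho n) ^+ N.+1 + normc (rho n) ^+ N.+1)).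
    apply: le_lt_trans (normcD _ _) _; rewrite ltrD//; last by near: n; exact: yM.
    rewrite normcM; apply: (@lt_le_trans _ _ (normc (rho n) ^- K * normc (rho n) ^+ (K + N.+1))).
      rewrite ltr_pM//; near: n; [exact: aK|exact: xM].
    by rewrite exprD mulKf// expf_neq0// gt_eqF.
  rewrite -mulr2n -mulr_natl exprS mulrA -[leRHS]mul1r ler_wpM2r ?exprn_ge0 ?normc_ge0//.
  rewrite mulrC -ler_pdivlMr// mul1r.
  by near: n; exact: rho_near_half.
Unshelve. all: by end_near. Qed.

HB.instance Definition _ := isIdealr.Build M0 M1 M1_idealr.

Definition robinson : Type := {ideal_quot M1}.
HB.instance Definition _ := GRing.ComNzRing.on robinson.

Local Open Scope quotient_scope.

Definition robinson_class (x : M0) : robinson := \pi_({ideal_quot M1}) x.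

Fact robinson_ex_inv (x : robinson) : x != 0 -> exists y, y * x = 1.
Proof.
rewrite -[x](@reprK _ {ideal_quot M1}); move: (repr x) => s.
rewrite -(rmorph0 (\pi_({ideal_quot M1}))) -Quotient.idealrBE subr0 => /asboolP.
move=> /existsNP[N sN].
have {}sN : \forall n \near omega, normc (rho n) ^+ N <= normc (s n).
  have [//|h] := in_ultra_setVsetC [set n | normc (s n) < normc (rho n) ^+ N] ultra_omega.
  by apply: filterS h => n /= /negP; rewrite -leNgt.
pose t n := (s n)^-1.
have tM : t \in moderate.
  apply/asboolP; exists N.+1; near=> n.
  rewrite normcV; apply: (@le_lt_trans _ _ (normc (rho n) ^- N)).
    rewrite lef_pV2 ?posrE ?exprn_gt0//; first by near: n.
    by apply: (@lt_le_trans _ _ (normc (rho n) ^+ N)); [rewrite exprn_gt0|near: n].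
  by rewrite !invXE exprS ltr_pMl ?exprn_gt0 ?invr_gt0// invf_gt1.
exists (\pi_({ideal_quot M1}) (MkM0 tM)).
rewrite -rmorphM -(rmorph1 (\pi_({ideal_quot M1}))); apply/eqP.
rewrite -Quotient.idealrBE; apply/asboolP => K; near=> n.
rewrite -[X in normc X]/(t n * s n - 1) /t mulVf ?subrr ?normc0 ?exprn_gt0//.
apply/eqP => s0.
have : normc (rho n) ^+ N <= normc (s n) by near: n.
by rewrite s0 normc0 leNgt exprn_gt0.
Unshelve. all: by end_near. Qed.

HB.instance Definition _ := GRing.ComNzRing_isField.Build robinson
  (chosen_mulVf robinson_ex_inv) (@chosen_inv0 robinson).

End Robinson.

Section RobinsonAbs.
Variables (R : realType) (S : scale R).

(* nu(x) = lim_omega log|x_n| / log|rho_n| is finite for x != 0. *)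
Definition robinson_abs (x : robinson S) : R :=
  let s : M0 S := repr (x : {ideal_quot (@M1 R S)}) in
  if x == 0 then 0
  else expR (- lim ((fun n => ln (normc (s n)) / ln (normc (rho S n))) @ ultra S)).
End RobinsonAbs.

Section Puiseux_abs.
Variable R : realType.

(* The infimum is attained, supports being left-finite. *)
Definition puiseux_abs (a : puiseux R) : R :=
  if a == 0 then 0
  else expR (- inf [set (ratr l : R) | l in [set l : rat | a l != 0]]).
End Puiseux_abs.

(* H_Berk(K) = P^1_Berk(K) \ P^1(K): the points of P^1_Berk(K) other than      *)
(* infinity are the multiplicative seminorms on K[X] extending the absolute   *)
(* value of K, those of K being the evaluations p |-> |p(a)|.                 *)
Section Berkovich.
Variables (R : realType) (K : fieldType) (abs : K -> R).

Definition berk_seminorm (s : {poly K} -> R) : Prop :=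
  [/\ forall p, 0 <= s p,
      forall c, s c%:P = abs c,
      forall p q, s (p * q) = s p * s q &
      forall p q, s (p + q) <= s p + s q].

Record hberk := HBerk {
  berk_norm :> {poly K} -> R;
  berk_normP : berk_seminorm berk_norm;
  berk_not_classical : forall a : K, berk_norm <> (fun p => abs p.[a]) }.

Definition ball_norm (a : K) (r : R) (p : {poly K}) : R :=
  sup [set abs p.[z] | z in [set z | abs (z - a) <= r]].

Definition is_ball_point (z : hberk) (a : K) (r : R) : Prop :=
  berk_norm z = ball_norm a r.

Definition ball_dist (a : K) (r : R) (b : K) (s : R) : R :=
  2 * ln (Num.max (Num.max r s) (abs (a - b))) - ln r - ln s.

(* Every point of H_Berk(K) is the limit of the points of a nested sequence   *)
(* of closed balls; the balls may have empty intersection (type IV points).   *)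
Definition nested_balls_to (a : nat -> K) (r : nat -> R) (z : hberk) : Prop :=
  [/\ forall n, 0 < r n,
      forall n, r n.+1 <= r n /\ abs (a n.+1 - a n) <= r n &
      forall p, ball_norm (a n) (r n) p @[n --> \oo] --> z p].

(* The continuous extension of ball_dist. *)
Definition hberk_dist (z w : hberk) : R :=
  xget 0 [set l : R | exists a r b s,
    [/\ nested_balls_to a r z, nested_balls_to b s w &
        ball_dist (a n) (r n) (b n) (s n) @[n --> \oo] --> l]].

(* den ^ deg g * g(num / den) *)
Definition poly_subst (num den g : {poly K}) : {poly K} :=
  \sum_(i < size g) g`_i *: (num ^+ i * den ^+ ((size g).-1 - i)).

(* B z is the push-forward of z: |g|_(B z) = |g o (num / den)|_z. *)
Definition is_berk_extension (num den : {poly K}) (B : hberk -> hberk) : Prop :=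
  forall (z : hberk) (g : {poly K}),
    B z g = z (poly_subst num den g) / z den ^+ (size g).-1.

End Berkovich.

(* The Riemann sphere is option C, None being the point at infinity. *)
Definition rat_eval (F : fieldType) (num den : {poly F}) (z : option F) : option F :=
  let d := (maxn (size num) (size den)).-1 in
  let: (u, v) := if z is Some x then (num.[x], den.[x]) else (num`_d, den`_d) in
  if v == 0 then None else Some (u / v).

Section Hyperbolic.
Variable R : realType.
Local Notation C := R[i].
Local Notation R3 := (R * R * R)%type.

Definition sqnorm3 (p : R3) : R := p.1.1 ^+ 2 + p.1.2 ^+ 2 + p.2 ^+ 2.

Definition H3 := {p : R3 | sqnorm3 p < 1}.

Fact origin_subproof : sqnorm3 (0, 0, 0) < 1.
Proof. by rewrite /sqnorm3 /= expr0n /= !addr0 ltr01. Qed.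

Definition origin : H3 := exist _ (0, 0, 0) origin_subproof.

(* Curvature -1; the last expression is arcosh u. *)
Definition hdist (x y : H3) : R :=
  let p := val x in let q := val y in
  let u := 1 + 2 * sqnorm3 (p - q) / ((1 - sqnorm3 p) * (1 - sqnorm3 q)) in
  ln (u + Num.sqrt (u ^+ 2 - 1)).

Definition sphere : set R3 := [set p | sqnorm3 p = 1].

Definition stereo (z : option C) : R3 :=
  if z is Some w then
    let n := normc w ^+ 2 in
    (2 * complex.Re w / (n + 1), 2 * complex.Im w / (n + 1), (n - 1) / (n + 1))
  else (0, 0, 1).

Definition unstereo (p : R3) : option C :=
  if p.2 == 1 then None else Some ((p.1.1 +i* p.1.2) / (1 - p.2)%:C).

Definition on_sphere (g : option C -> option C) (p : R3) : R3 :=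
  stereo (g (unstereo p)).

(* A Moebius transformation is given by an invertible matrix, up to scalars:  *)
(* PSL_2(C) = PGL_2(C).                                                       *)
Definition moebius (M : 'M[C]_2) : option C -> option C :=
  rat_eval (M 0 0 *: 'X + (M 0 1)%:P) (M 1 0 *: 'X + (M 1 1)%:P).

(* The closed ball as the projectivized cone of nonnegative Hermitian         *)
(* matrices, on which M acts by H |-> M H M^*: hermitian p is a scalar        *)
(* multiple of the determinant 1 representative of an interior point p, and   *)
(* hermitian (stereo [u : v]) is proportional to (u, v)^T (u, v)^*, so that   *)
(* moebius_ball M is the isometric extension of moebius M to the ball.        *)
Definition mx2 (a b c d : C) : 'M[C]_2 :=
  \matrix_(i < 2, j < 2)
    (if i == 0 then if j == 0 then a else b else if j == 0 then c else d).

Definition hermitian (p : R3) : 'M[C]_2 :=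
  let: (x, y, z) := p in let n := sqnorm3 p in
  mx2 (1 + n + 2 * z)%:C ((2 * x) +i* (2 * y))
      ((2 * x) -i* (2 * y)) (1 + n - 2 * z)%:C.

Definition ball_point (H : 'M[C]_2) : R3 :=
  let s := complex.Re (H 0 0 + H 1 1) + 2 * Num.sqrt (complex.Re (\det H)) in
  (2 * complex.Re (H 0 1) / s, 2 * complex.Im (H 0 1) / s,
   complex.Re (H 0 0 - H 1 1) / s).

Definition moebius_ball (M : 'M[C]_2) (p : R3) : R3 :=
  ball_point (M *m hermitian p *m (map_mx (@conjc R) M)^T).

Fact ltrN1_1 : -1 < 1 :> R. Proof. by lra. Qed.
Fact two_pi_gt0 : 0 < 2 * pi :> R. Proof. by rewrite mulr_gt0 ?pi_gt0. Qed.

(* In cylindrical coordinates (height, longitude) the area element of the     *)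
(* unit sphere is dz dphi (Archimedes).                                       *)
Definition sphere_measure : set R3 -> \bar R :=
  pushforward (uniform_prob ltrN1_1 \x uniform_prob two_pi_gt0)%E
    (fun q : R * R => let s := Num.sqrt (1 - q.1 ^+ 2) in
       (s * cos q.2, s * sin q.2, q.1)).

Definition is_barycenter (mu : set R3 -> \bar R) (y : H3) : Prop :=
  forall M : 'M[C]_2, M \in unitmx -> moebius_ball M (val y) = val origin ->
    let nu := pushforward mu (on_sphere (moebius M)) in
    [/\ (\int[nu]_(p in sphere) (p.1.1)%:E = 0)%E,
        (\int[nu]_(p in sphere) (p.1.2)%:E = 0)%E &
        (\int[nu]_(p in sphere) (p.2)%:E = 0)%E].

(* The value does not depend on the choice of M, since rotations preserve     *)
(* sphere_measure.                                                            *)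
Definition bary_ext (num den : {poly C}) (x : H3) : H3 :=
  xget origin [set y | exists M : 'M[C]_2,
    [/\ M \in unitmx, moebius_ball M (val origin) = val x &
        is_barycenter
          (pushforward (pushforward sphere_measure (on_sphere (moebius M)))
             (on_sphere (rat_eval num den))) y]].

End Hyperbolic.

Section AsymptoticCone.
Variables (R : realType) (omega : set_system nat) (r : nat -> R).

Definition bseq :=
  {x : nat -> H3 R | exists c, forall n, hdist (origin R) (x n) / r n <= c}.

Definition seq_dist (x y : bseq) : R :=
  lim ((fun n => hdist (sval x n) (sval y n) / r n) @ omega).

Definition cone :=
  {c : set bseq | exists x, c = [set y | seq_dist x y = 0]}.

Definition cone_class (x : bseq) : cone :=
  exist _ [set y | seq_dist x y = 0] (ex_intro _ x erefl).

Definition cone_repr (c : cone) : bseq := sval (cid (svalP c)).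

Definition cone_dist (c c' : cone) : R := seq_dist (cone_repr c) (cone_repr c').

Definition is_limit_map (g : nat -> H3 R -> H3 R) (F : cone -> cone) : Prop :=
  forall x : bseq, exists2 y : bseq,
    forall n, sval y n = g n (sval x n) & F (cone_class x) = cone_class y.

End AsymptoticCone.

(* The closed ball M(B(0,1)), M(z) = a z + b, is B(b,|a|). The sequences       *)
(* (a_n), (b_n) are only meaningful omega-almost surely (a_n may vanish for    *)
(* other n), whence the auxiliary sequence x.                                 *)
Definition is_cone_identification (R : realType) (S : scale R) (r : nat -> R)
    (iota : hberk (@robinson_abs R S) -> cone (ultra S) r) : Prop :=
  forall (a b : M0 S) (z : hberk (@robinson_abs R S)),
    robinson_class a != 0 ->
    is_ball_point z (robinson_class b) (robinson_abs (robinson_class a)) ->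
    exists2 x : bseq r,
      \forall n \near ultra S,
        val (sval x n) = moebius_ball (mx2 (a n) (b n) 0 1) (val (origin R)) &
      iota z = cone_class (ultra S) x.

Section Families.
Variable R : realType.
Local Notation C := R[i].

Definition disk : set C := [set t | normc t < 1].
Definition punctured_disk : set C := [set t | 0 < normc t < 1].

Definition holomorphic_on (D : set C) (f : C -> C) : Prop :=
  forall t, D t -> derivable (f : C^o -> C^o) t 1.

(* A function on the punctured disk extending meromorphically to the disk. *)
Definition meromorphic_extends (f : C -> C) : Prop :=
  exists N (g : C -> C), holomorphic_on disk g /\
    forall t, punctured_disk t -> f t = t ^- N * g t.

Definition laurent_expansion (f : C -> C) (a : puiseux R) : Prop :=
  (forall l : rat, a l != 0 -> exists k : int, l = k%:~R) /\
  exists N : nat,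
    (forall k : int, k < - N%:Z -> a k%:~R = 0) /\
    forall t : C, punctured_disk t ->
      (series (fun k : nat => a (k%:Z - N%:Z)%:~R * t ^ (k%:Z - N%:Z)) : nat -> C^o)
        @ \oo --> (f t : C^o).

Definition family_poly (d : nat) (a : nat -> C -> C) (t : C) : {poly C} :=
  \poly_(i < d.+1) a i t.

Definition rational_family (d : nat) (a b : nat -> C -> C) : Prop :=
  (forall i, (i <= d)%N ->
     [/\ holomorphic_on punctured_disk (a i), meromorphic_extends (a i),
         holomorphic_on punctured_disk (b i) & meromorphic_extends (b i)]) /\
  forall t, punctured_disk t ->
    let num := family_poly d a t in let den := family_poly d b t in
    coprimep num den /\ maxn (size num) (size den) = d.+1.

End Families.

(* Main.v *)
(* Over a spherically complete field every point of H_Berk is the point of a  *)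
(* ball B(beta, delta). The Robinson field is spherically complete            *)
(* (saturation of the ultrapower), and evaluating Puiseux series at rho_n     *)
(* embeds L into it, so a point of H_Berk(L), even of type IV, becomes a      *)
(* Robinson ball B(beta, delta). It is sent to the class of the points at     *)
(* height a_n above b_n in the half-space, where (b_n) represents beta and    *)
(* |a_n|^(1/r_n) tends to delta; the explicit formula for the hyperbolic      *)
(* distance, divided by r_n, tends to the Berkovich distance.                 *)
(*                                                                            *)
(* For num, den of degree d, expand num (b + a X) and den (b + a X), choose   *)
(* a dominant coefficient of the denominator and use it to translate away     *)
(* the corresponding coefficient of the numerator. Polynomials of degree d    *)
(* with bounded coefficients, one of them of size 1, are small only on a set  *)
(* of small spherical measure; hence the barycentric extension sends (b, a)   *)
(* within a distance bounded in terms of d alone of the point read off from   *)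
(* the coefficients. That recipe is the rule for the image of a ball over a   *)
(* non-Archimedean field, and the bounded error vanishes after division by    *)
(* r_n.                                                                       *)

Require Import Defs.
From HB Require Import structures.
From mathcomp Require Import all_boot all_order all_algebra.
From mathcomp.real_closed Require Import complex.
From mathcomp Require Import finmap ring_quotient.
From mathcomp Require Import all_classical all_reals all_analysis.
From mathcomp Require Import measurable_realfun.
From mathcomp Require Import zify ring lra.

Set Implicit Arguments.
Unset Strict Implicit.
Unset Printing Implicit Defensive.

Import Order.TTheory GRing.Theory Num.Theory.
Import numFieldNormedType.Exports.
Import Normc.

Local Open Scope classical_set_scope.
Local Open Scope ring_scope.
Local Open Scope complex_scope.

(** * Barycenters of measures on the sphere *)

(** A ball B(beta, delta) over the Robinson field, with beta the class of (b_n), is to be pictured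
    as the sequence of points at height about delta^(r_n) above b_n in the half-space. There the
    distance of (b, a) and (b', a') is 2 log max(a, a', |b - b'|) - log a - log a' up to a bounded
    error ([cdist_max]), which is the formula for the distance of two balls. Division by r_n kills
    the error, and |x_n|^(1/r_n) tends to the Robinson absolute value. The asymptotic cone is thus
    the set of Robinson balls with the ball distance ([locates_dist], [bounded_locates],
    [cone_distE]). The Robinson field is spherically complete ([robinson_spherical]), so every point
    of its hyperbolic Berkovich space is a ball, and this yields the identification.

    Substituting rho_n for t embeds the Puiseux field isometrically into the Robinson field
    ([embed], [rabs_embed]). A Berkovich point z over the Puiseux field is a limit of nested balls;
    their images have a common Robinson point beta ([center_exists]), and Phi sends z to B(beta,
    diam z). On polynomials with Puiseux coefficients z is the Gauss norm of that ball, even for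
    type IV ([hberk_gauss]), and distances depend on beta and [diam] alone ([hberk_dist_center]), so
    Phi is isometric.

    For the dynamics, expand N / D at a ball B(beta, delta), let i0 be an index where D attains its
    Gauss norm and w0 the quotient of the two coefficients there. Then the norm of N - w D is max(|N
    - w0 D|, |w0 - w| |D|) ([gauss_optimal]): the image is the ball with centre w0 and radius |N -
    w0 D| / |D|. This describes the Berkovich side ([push_center], [diam_push]). On the hyperbolic
    side the same recipe, carried out over the complex numbers for each n, finds the barycentric
    extension up to an error depending on d alone ([bary_ext_close]). Indeed, once w0 and the radius
    are normalized away, every unit linear combination of numerator and denominator keeps a
    coefficient of definite size, hence is small only on d + 1 thin slabs of the sphere. No small
    cap then carries mass above 1/3 ([renorm_caps]), and a measure with this property has a
    barycenter in a bounded region ([barycentric_exists], [barycentric_bound]).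

    The ultrafilter selects the same dominant indices for almost every n, and the coefficient
    sequences represent the embedded Laurent expansions ([laurent_class]); so the two recipes
    compute one ball ([family_locates]), and [limit_map_conjugate] follows. *)

Section BoundedExpectation.
Context {disp : measure_display} {T : measurableType disp} {R : realType}.
Variable P : probability T R.
Implicit Types f g : T -> R.

Definition bm f := measurable_fun setT f /\ exists M : R, forall x, `|f x| <= M.

Definition Ex f : R := \int[P]_(x in setT) f x.

Lemma bm_integrable f : bm f -> P.-integrable setT (EFin \o f).
Proof.
move=> [mf [M fM]]; apply: measurable_bounded_integrable => //.
  exact: fin_num_fun_lty.
apply: filterS (nbhs_pinfty_ge (num_real M)) => N MN x _ /=; exact: le_trans MN.
Qed.

Lemma bm_cst c : bm (fun=> c).
Proof. by split; [exact: measurable_cst|exists `|c|]. Qed.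

Lemma bmD f g : bm f -> bm g -> bm (fun x => f x + g x).
Proof.
move=> [mf [M fM]] [mg [N gN]]; split; first exact: measurable_funD.
by exists (M + N) => x; rewrite (le_trans (ler_normD _ _))// lerD.
Qed.

Lemma bmM f g : bm f -> bm g -> bm (fun x => f x * g x).
Proof.
move=> [mf [M fM]] [mg [N gN]]; split; first exact: measurable_funM.
by exists (M * N) => x; rewrite normrM ler_pM.
Qed.

Lemma bmZ c f : bm f -> bm (fun x => c * f x).
Proof. by apply: bmM; exact: bm_cst. Qed.

Lemma bmV f (c : R) : 0 < c -> measurable_fun setT f -> (forall x, c <= f x) ->
  bm (fun x => (f x)^-1).
Proof.
move=> c0 mf fc; have f0 x : 0 < f x by exact: lt_le_trans (fc x).
split; last by exists c^-1 => x; 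
    rewrite gtr0_norm ?invr_gt0// lef_pV2 ?posrE//.
have -> : (fun x => (f x)^-1) = (fun y : R => y `^ (-1)) \o f.
  by apply/funext => x /=; rewrite powR_inv1// ltW.
by apply: measurableT_comp => //; exact: measurable_powR.
Qed.

Lemma bm_ln f (c : R) : 0 < c -> bm f -> (forall x, c <= f x) ->
  bm (fun x => ln (f x)).
Proof.
move=> c0 [mf [M fM]] fc; have f0 x : 0 < f x by exact: lt_le_trans (fc x).
split; first by apply: measurableT_comp => //; exact: measurable_ln.
exists (Num.max `|ln c| `|ln M|) => x.
have fMx : f x <= M by rewrite (le_trans (ler_norm _)).
have lc : ln c <= ln (f x) by rewrite ler_ln ?posrE.
have lM : ln (f x) <= ln M by rewrite ler_ln ?posrE// (lt_le_trans (f0 x)).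
have := ler_norm (ln M); have := ler_norm (- ln c); rewrite normrN.
by rewrite ler_norml; case: (leP `|ln c| `|ln M|); lra.
Qed.

Lemma ExD f g : bm f -> bm g -> Ex (fun x => f x + g x) = Ex f + Ex g.
Proof. by move=> bf bg; apply: RintegralD => //; exact: bm_integrable. Qed.

Lemma ExZ c f : bm f -> Ex (fun x => c * f x) = c * Ex f.
Proof. by move=> bf; apply: RintegralZl => //; exact: bm_integrable. Qed.

Lemma Ex_cst c : Ex (fun=> c) = c.
Proof.
rewrite /Ex Rintegral_cst//; transitivity (c * fine (1%E : \bar R)).
  by congr (_ * fine _); exact: probability_setT.
by rewrite mulr1.
Qed.

Lemma Ex_le f g : bm f -> bm g -> (forall x, f x <= g x) -> Ex f <= Ex g.
Proof.
by move=> bf bg fg; apply: le_Rintegral => //; exact: bm_integrable.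
Qed.

Lemma bm_indic A : measurable A -> bm (\1_A : T -> R).
Proof.
move=> mA; split; first exact: measurable_indic.
by exists 1 => x; rewrite indicE; case: (_ \in _); rewrite ?normr1 ?normr0.
Qed.

Lemma Ex_indic A : measurable A -> Ex (\1_A : T -> R) = fine (P A).
Proof. by move=> mA; rewrite /Ex /Rintegral integral_indic// setIT. Qed.

End BoundedExpectation.

(** * Existence and location of the conformal barycenter of a measure without heavy caps *)

Section Barycenter.
Context {disp : measure_display} {T : measurableType disp} {R : realType}.
Variable P : probability T R.
Variables s1 s2 s3 : T -> R.
Hypotheses (bs1 : bm s1) (bs2 : bm s2) (bs3 : bm s3).
Hypothesis unit_s : forall x, s1 x ^+ 2 + s2 x ^+ 2 + s3 x ^+ 2 = 1.
Variable c : R.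
Hypotheses (c0 : 0 < c) (c1 : c <= 1).

Local Notation R3 := (R * R * R)%type.
Implicit Type k : R3.

Definition affine (k0 : R) k (x : T) : R :=
  k0 + (k.1.1 * s1 x + k.1.2 * s2 x + k.2 * s3 x).

(** The set is the spherical cap around -k. A bound 1/3 at a fixed cap size is the quantitative
    substitute for the absence of atoms of mass at least 1/2; any bound below 1/2 would serve the
    same purpose. *)
Definition small_caps := forall k : R3, sqnorm3 k = 1 ->
  fine (P [set x | affine 1 k x <= c]) <= 3^-1.
Hypothesis caps : small_caps.

Lemma bm_affine (k0 : R) k : bm (affine k0 k).
Proof.
by apply: bmD; [exact: bm_cst|apply: bmD; [apply: bmD|]; exact: bmZ].
Qed.

Lemma measurable_cap k : measurable [set x | affine 1 k x <= c].
Proof.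
have -> : [set x | affine 1 k x <= c] = setT `&` affine 1 k @^-1` `]-oo, c].
  by apply/seteqP; split => x /=; rewrite in_itv /= => // -[].
by apply: (bm_affine 1 k).1.
Qed.

Lemma cauchy_schwarz3 (a1 a2 a3 b1 b2 b3 : R) :
  (a1 * b1 + a2 * b2 + a3 * b3) ^+ 2 <=
  (a1 ^+ 2 + a2 ^+ 2 + a3 ^+ 2) * (b1 ^+ 2 + b2 ^+ 2 + b3 ^+ 2).
Proof.
rewrite -subr_ge0.
have -> : (a1 ^+ 2 + a2 ^+ 2 + a3 ^+ 2) * (b1 ^+ 2 + b2 ^+ 2 + b3 ^+ 2) -
    (a1 * b1 + a2 * b2 + a3 * b3) ^+ 2 =
    (a1 * b2 - a2 * b1) ^+ 2 + (a1 * b3 - a3 * b1) ^+ 2 +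
    (a2 * b3 - a3 * b2) ^+ 2 by ring.
by rewrite !addr_ge0 ?sqr_ge0.
Qed.

Lemma sqnorm3_ge0 k : 0 <= sqnorm3 k.
Proof. by rewrite /sqnorm3 !addr_ge0 ?sqr_ge0. Qed.

Lemma affine_lb k (k0 : R) x : affine k0 k x >= k0 - Num.sqrt (sqnorm3 k).
Proof.
rewrite /affine lerD2l lerNl (le_trans (ler_norm _))// normrN.
rewrite -ler_sqr ?nnegrE ?normr_ge0 ?sqrtr_ge0// sqr_sqrtr ?sqnorm3_ge0//.
rewrite real_normK ?num_real//.
by rewrite (le_trans (cauchy_schwarz3 _ _ _ _ _ _))// unit_s mulr1.
Qed.

Lemma affine_off_cap k r x : 0 <= r <= 1 ->
  c <= affine 1 k x -> c <= affine 1 (r * k.1.1, r * k.1.2, r * k.2) x.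
Proof.
move=> /andP[r0 r1]; rewrite /affine /= => h.
have -> : 1 + (r * k.1.1 * s1 x + r * k.1.2 * s2 x + r * k.2 * s3 x) =
  (1 - r) + r * (1 + (k.1.1 * s1 x + k.1.2 * s2 x + k.2 * s3 x)) by ring.
rewrite -[leLHS](subrK (r * c)) lerD//; last exact: ler_wpM2l.
by rewrite -{1}[c]mul1r -mulrBl ler_piMr// subr_ge0.
Qed.

Lemma polar3 k : sqnorm3 k < 1 -> exists r u,
  [/\ 0 <= r < 1, sqnorm3 u = 1, sqnorm3 k = r ^+ 2 &
      k = (r * u.1.1, r * u.1.2, r * u.2)].
Proof.
move=> k1; have [k0|k0] := eqVneq (sqnorm3 k) 0.
  exists 0, (1, 0, 0); split; rewrite ?lexx ?ltr01 ?k0 ?expr0n//.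
    by rewrite /sqnorm3 /= expr0n expr1n !addr0.
  move: k k1 k0 => [[x y] z] _; rewrite /sqnorm3 /= => /eqP.
  rewrite paddr_eq0 ?addr_ge0 ?sqr_ge0// paddr_eq0 ?sqr_ge0// !sqrf_eq0.
  by move=> /andP[/andP[/eqP-> /eqP->] /eqP->]; rewrite !mul0r.
have kp : 0 < sqnorm3 k by rewrite lt0r k0 sqnorm3_ge0.
have rp : 0 < Num.sqrt (sqnorm3 k) by rewrite sqrtr_gt0.
exists (Num.sqrt (sqnorm3 k)).
exists (k.1.1 / Num.sqrt (sqnorm3 k), k.1.2 / Num.sqrt (sqnorm3 k),
        k.2 / Num.sqrt (sqnorm3 k)).
split.
- rewrite sqrtr_ge0/= -ltr_sqr ?nnegrE ?sqrtr_ge0//.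
  by rewrite sqr_sqrtr ?sqnorm3_ge0// expr1n.
- rewrite /sqnorm3 /= !expr_div_n sqr_sqrtr ?sqnorm3_ge0// -!mulrDl.
  by rewrite -/(sqnorm3 k) divff.
- by rewrite sqr_sqrtr ?sqnorm3_ge0.
- by rewrite /= !(mulrC (Num.sqrt _)) !divfK ?gt_eqF//; case: k {k1 k0 kp rp} => [[]].
Qed.

(** In the Klein model, ln ((1 - <p, x>) / sqrt (1 - |p|^2)) is the Busemann function of the
    boundary point x at p. With p = -k this is the Busemann function averaged over the measure; its
    critical points are the conformal barycenters. *)
Definition energy k : R :=
  Ex P (fun x => ln (affine 1 k x)) - 2^-1 * ln (1 - sqnorm3 k).

Lemma affine_gt0 k : sqnorm3 k < 1 ->
  exists2 e, 0 < e & forall x, e <= affine 1 k x.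
Proof.
move=> k1; exists (1 - Num.sqrt (sqnorm3 k)); last by move=> x; exact: affine_lb.
rewrite subr_gt0 -ltr_sqr ?nnegrE ?sqrtr_ge0//.
by rewrite sqr_sqrtr ?sqnorm3_ge0// expr1n.
Qed.

Lemma bm_ln_affine k : sqnorm3 k < 1 -> bm (fun x => ln (affine 1 k x)).
Proof.
by move=> /affine_gt0[e e0 h]; apply: bm_ln e0 _ h; exact: bm_affine.
Qed.

(** With r = |k|, the cap around -k contributes at least ln (1 - r) / 3 to the mean and its
    complement at least ln c, while the second term gives -ln (1 - r) / 2. The difference of the
    weights 1/2 and 1/3 wins as soon as 1 - r < c^6 / 16. *)
Lemma energy_proper k : sqnorm3 k < 1 ->
  (1 - c ^+ 6 / 16) ^+ 2 < sqnorm3 k -> 0 < energy k.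
Proof.
move=> k1 kc; have [r [u [/andP[r0 r1] u1 kr ku]]] := polar3 k1.
have c6 : 0 < c ^+ 6 by rewrite exprn_gt0.
have c61 : c ^+ 6 <= 1 by rewrite exprn_ile1// ltW.
have rc : 1 - r < c ^+ 6 / 16.
  move: kc; rewrite kr ltr_sqr ?nnegrE//; first by lra.
  by lra.
pose A := [set x | affine 1 u x <= c].
have mA : measurable A by exact: measurable_cap.
have lnr : ln (1 - r) <= 0 by apply: ln_le0; lra.
have lnc : ln c <= 0 by exact: ln_le0.
have low : ln (1 - r) * 3^-1 + ln c <= Ex P (fun x => ln (affine 1 k x)).
  apply: (@le_trans _ _ (Ex P (fun x => ln (1 - r) * \1_A x + ln c))).
    rewrite ExD; [|by apply: bmZ; exact: bm_indic|exact: bm_cst].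
    rewrite Ex_cst ExZ; last exact: bm_indic.
    by rewrite Ex_indic// lerD2r ler_wnM2l// caps.
  apply: Ex_le.
  - apply: bmD; last exact: bm_cst.
    by apply: bmZ; exact: bm_indic.
  - exact: bm_ln_affine.
  move=> x; have [e e0 he] := affine_gt0 k1.
  have ap : 0 < affine 1 k x by exact: lt_le_trans (he x).
  rewrite indicE; case: (boolP (x \in A)) => [_|].
    rewrite mulr1 -[leRHS]addr0 lerD// ler_ln ?posrE//; last by lra.
    have := affine_lb k 1 x; rewrite kr sqrtr_sqr ger0_norm//.
  rewrite mulr0 add0r => /negP xA; rewrite ler_ln ?posrE// ku.
  apply: affine_off_cap; first by rewrite r0 ltW.
  by rewrite ltW// ltNge; apply/negP => h; apply: xA; rewrite inE.
have E : ln (1 - sqnorm3 k) = ln (1 - r) + ln (1 + r).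
  have -> : 1 - sqnorm3 k = (1 - r) * (1 + r) by rewrite kr; ring.
  by rewrite lnM ?posrE//; lra.
have ln2r : ln (1 + r) <= ln 2 by rewrite ler_ln ?posrE; lra.
have h : ln (1 - r) < ln (c ^+ 6 / 16) by rewrite ltr_ln ?posrE; lra.
have e16 : (16 : R) = 2 ^+ 4 by rewrite -natrX.
rewrite lnM ?posrE ?invr_gt0// lnV ?posrE// in h.
rewrite e16 lnXn// lnXn// in h.
have ln20 : 0 < ln (2 : R) by rewrite ln_gt0// ltr1n.
rewrite /energy E; lra.
Qed.

Lemma ln_diff_le (x y : R) : 0 < x -> 0 < y -> ln x - ln y <= (x - y) / y.
Proof.
move=> x0 y0; rewrite -ln_div ?posrE//.
have -> : x / y = 1 + (x - y) / y by rewrite mulrBl divff ?gt_eqF// addrC subrK.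
by apply: le_ln1Dx; rewrite mulrBl divff ?gt_eqF// ltrBrDr addNr divr_gt0.
Qed.

Lemma ln_max_lipschitz (e x y : R) : 0 < e ->
  `|ln (Num.max x e) - ln (Num.max y e)| <= `|x - y| / e.
Proof.
move=> e0.
have half (u v : R) : ln (Num.max u e) - ln (Num.max v e) <= `|u - v| / e.
  have ue : 0 < Num.max u e by rewrite lt_max e0 orbT.
  have ve : 0 < Num.max v e by rewrite lt_max e0 orbT.
  apply: le_trans (ln_diff_le ue ve) _.
  rewrite (@le_trans _ _ (`|u - v| / Num.max v e))//.
    rewrite ler_pM2r ?invr_gt0//.
    have := ler_norm (u - v); have := normr_ge0 (u - v).
    by case: (leP u e); case: (leP v e); lra.
  by rewrite ler_wpM2l// lef_pV2 ?posrE// le_max lexx orbT.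
rewrite ler_norml half andbT lerNl opprB distrC; exact: half.
Qed.

(** A version of [energy] that is continuous on all of R^3, so that the extreme value theorem
    applies directly; it agrees with [energy] on a ball where both logarithms have arguments at
    least e. *)
Definition energy_clamped (e : R) k : R :=
  Ex P (fun x => ln (Num.max (affine 1 k x) e)) -
  2^-1 * ln (Num.max (1 - sqnorm3 k) e).

Lemma bm_max (f : T -> R) e : bm f -> bm (fun x => Num.max (f x) e).
Proof.
move=> [mf [M fM]]; split.
  by apply: measurable_maxr => //; exact: measurable_cst.
exists (M + `|e|) => x; have := fM x.
by case: (leP (f x) e); have := normr_ge0 (f x); have := normr_ge0 e; lra.
Qed.

Lemma s_le1 x : [/\ `|s1 x| <= 1, `|s2 x| <= 1 & `|s3 x| <= 1].
Proof.
have := unit_s x.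
have := sqr_ge0 (s1 x); have := sqr_ge0 (s2 x); have := sqr_ge0 (s3 x).
have h (y : R) : y ^+ 2 <= 1 -> `|y| <= 1.
  by move=> y1; rewrite -ler_sqr ?nnegrE// expr1n real_normK ?num_real.
by move=> *; split; apply: h; lra.
Qed.

Lemma energy_clamped_continuous e : 0 < e -> continuous (energy_clamped e).
Proof.
move=> e0 k; apply: cvgB.
  apply/cvgrPdist_lt => eps eps0.
  have d0 : 0 < eps * e / 3 by rewrite !mulr_gt0.
  have /cvgrPdist_lt/(_ _ d0) h1 : fst (fst k') @[k' --> k] --> k.1.1.
    by apply: (@cvg_comp _ _ _ fst fst _ (nbhs k.1)); exact: cvg_fst.
  have /cvgrPdist_lt/(_ _ d0) h2 : snd (fst k') @[k' --> k] --> k.1.2.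
    by apply: (@cvg_comp _ _ _ fst snd _ (nbhs k.1)); [exact: cvg_fst|exact: cvg_snd].
  have /cvgrPdist_lt/(_ _ d0) h3 : snd k' @[k' --> k] --> k.2.
    exact: cvg_snd.
  near=> k'.
  have b' k'' : bm (fun x => ln (Num.max (affine 1 k'' x) e)).
    apply: (bm_ln e0); first by apply: bm_max; exact: bm_affine.
    by move=> x; rewrite le_max lexx orbT.
  have -> : Ex P (fun x => ln (Num.max (affine 1 k x) e)) -
            Ex P (fun x => ln (Num.max (affine 1 k' x) e)) =
     Ex P (fun x => ln (Num.max (affine 1 k x) e) +
                    (-1) * ln (Num.max (affine 1 k' x) e)).
    by rewrite ExD ?ExZ ?mulN1r//; exact: bmZ.
  have bb : bm (fun x => ln (Num.max (affine 1 k x) e) +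
                    (-1) * ln (Num.max (affine 1 k' x) e)).
    by apply: bmD => //; exact: bmZ.
  pose B := (`|k.1.1 - k'.1.1| + `|k.1.2 - k'.1.2| + `|k.2 - k'.2|) / e.
  have Blt : B < eps.
    rewrite /B ltr_pdivrMr//.
    have : `|k.1.1 - k'.1.1| < eps * e / 3 by near: k'.
    have : `|k.1.2 - k'.1.2| < eps * e / 3 by near: k'.
    have : `|k.2 - k'.2| < eps * e / 3 by near: k'.
    by lra.
  have pt x : `|ln (Num.max (affine 1 k x) e) +
                    (-1) * ln (Num.max (affine 1 k' x) e)| <= B.
    rewrite mulN1r (le_trans (ln_max_lipschitz _ _ e0))//.
    rewrite ler_pM2r ?invr_gt0//.
    have -> : affine 1 k x - affine 1 k' x = (k.1.1 - k'.1.1) * s1 x +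
       (k.1.2 - k'.1.2) * s2 x + (k.2 - k'.2) * s3 x by rewrite /affine; ring.
    have [h1' h2' h3'] := s_le1 x.
    rewrite (le_trans (ler_normD _ _))// lerD//.
      rewrite (le_trans (ler_normD _ _))// lerD// normrM ler_piMr//.
    by rewrite normrM ler_piMr.
  apply: le_lt_trans Blt; rewrite ler_norml -(Ex_cst P B) -[X in X <= _ <= _]mulN1r.
  rewrite -ExZ; last exact: bm_cst.
  apply/andP; split; apply: Ex_le => //; try exact: bm_cst.
  - by move=> x; have := pt x; rewrite ler_norml !mulN1r => /andP[].
  - by move=> x; have := pt x; rewrite ler_norml => /andP[].
apply: cvgM; first exact: cvg_cst.
apply: (@cvg_comp _ _ _ (fun k' => Num.max (1 - sqnorm3 k') e) (@ln R) _
   (nbhs (Num.max (1 - sqnorm3 k) e))); last first.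
  by apply: continuous_ln; rewrite lt_max e0 orbT.
apply: (@continuous_max R _ (fun k' => 1 - sqnorm3 k') (fun=> e)); last exact: cvg_cst.
apply: cvgB; first exact: cvg_cst.
have c11 : fst (fst k') @[k' --> k] --> k.1.1.
  by apply: (@cvg_comp _ _ _ fst fst _ (nbhs k.1)); exact: cvg_fst.
have c12 : snd (fst k') @[k' --> k] --> k.1.2.
  by apply: (@cvg_comp _ _ _ fst snd _ (nbhs k.1)); [exact: cvg_fst|exact: cvg_snd].
have c2 : snd k' @[k' --> k] --> k.2 by exact: cvg_snd.
apply: cvgD; last exact: cvgM.
by apply: cvgD; exact: cvgM.
Unshelve. all: by end_near. Qed.

(** Compactness inside the ball of radius 1 - eta; outside of it the energy is positive, hence above
    its value 0 at the centre. *)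
Lemma energy_min : exists k, sqnorm3 k < 1 /\
  forall k', sqnorm3 k' < 1 -> energy k <= energy k'.
Proof.
pose eta := c ^+ 6 / 16.
have c6 : 0 < c ^+ 6 by rewrite exprn_gt0.
have c61 : c ^+ 6 <= 1 by rewrite exprn_ile1// ltW.
have eta0 : 0 < eta by rewrite divr_gt0.
have eta1 : eta < 1 by rewrite /eta; lra.
pose A : set R3 := [set k | sqnorm3 k <= (1 - eta) ^+ 2].
have A0 : A !=set0.
  exists (0, 0, 0); rewrite /A /= /sqnorm3 /= expr0n !addr0; exact: sqr_ge0.
have cA : compact A.
  apply: (@subclosed_compact _ _ 
    ((`[-1, 1]%classic : set R) `*` (`[-1, 1]%classic : set R) `*`
     (`[-1, 1]%classic : set R))).
  - have cn : continuous (@sqnorm3 R).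
      move=> k.
      have c11 : fst (fst k') @[k' --> k] --> k.1.1.
        by apply: (@cvg_comp _ _ _ fst fst _ (nbhs k.1)); exact: cvg_fst.
      have c12 : snd (fst k') @[k' --> k] --> k.1.2.
        by apply: (@cvg_comp _ _ _ fst snd _ (nbhs k.1)); [exact: cvg_fst|exact: cvg_snd].
      have c2 : snd k' @[k' --> k] --> k.2 by exact: cvg_snd.
      apply: cvgD; last exact: cvgM.
      by apply: cvgD; exact: cvgM.
    exact: (closed_comp (fun k _ => cn k) (@closed_le R ((1 - eta) ^+ 2))).
  - by apply: compact_setX; [apply: compact_setX|]; exact: segment_compact.
  move=> [[x y] z]; rewrite /A /= /sqnorm3 /= => h.
  have : (1 - eta) ^+ 2 <= 1 by rewrite expr_le1// ; lra.
  have := sqr_ge0 x; have := sqr_ge0 y; have := sqr_ge0 z.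
  have g (t : R) : t ^+ 2 <= 1 -> -1 <= t <= 1.
    by move=> t1; rewrite -ler_norml -ler_sqr ?nnegrE// expr1n real_normK ?num_real.
  by move=> *; rewrite !in_itv /=; split; first split; apply: g; lra.
have [k kA kmin] := compact_EVT_min A0 cA
   (continuous_subspaceT (energy_clamped_continuous eta0)).
have A1 k' : A k' -> sqnorm3 k' < 1.
  move=> /le_lt_trans; apply; rewrite expr_lt1//; lra.
(* On [A] both clamped quantities are at least eta: the affine function is at least 1 - |k'|, and 1
   - (1 - eta)^2 is at least eta. *)
have clampE k' : A k' -> energy_clamped eta k' = energy k'.
  move=> Ak'; congr (_ - _ * ln _).
    congr Ex; apply/funext => x; congr ln; apply/max_idPl.
    apply: le_trans (affine_lb k' 1 x); rewrite lerBrDr -lerBrDl.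
    rewrite -ler_sqr ?nnegrE ?sqrtr_ge0//; last by lra.
    by rewrite sqr_sqrtr ?sqnorm3_ge0.
  apply/max_idPl; move: Ak'; rewrite /A /=.
  have : eta * eta <= eta by rewrite ler_piMl// ltW.
  by rewrite expr2; lra.
rewrite inE in kA; exists k; split; first exact: A1.
move=> k' k'1; have [k'A|k'A] := leP (sqnorm3 k') ((1 - eta) ^+ 2).
  by rewrite -!clampE//; apply: kmin; rewrite inE.
apply: (@le_trans _ _ 0); last by rewrite ltW// energy_proper.
have A00 : A (0, 0, 0).
  rewrite /A /= /sqnorm3 /= expr0n !addr0; exact: sqr_ge0.
rewrite -clampE// (le_trans (kmin (0, 0, 0) _)) ?inE// clampE//.
rewrite /energy.
have -> : (fun x => ln (affine 1 (0, 0, 0) x)) = (fun=> 0).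
  by apply/funext => x; rewrite /affine /= !mul0r !addr0 ln1.
by rewrite Ex_cst /sqnorm3 /= expr0n /= !addr0 subr0 ln1 mulr0 subrr.
Qed.

(** The Moebius map taking the point with Klein coordinates -k to the centre acts on the sphere by
    quotients of this shape, so the condition says that the moved measure has mean 0; quantifying
    over all s avoids choosing a frame. It is also the vanishing of the gradient of [energy]. *)
Definition barycentric k := forall s : R3,
  Ex P (fun x => affine (k.1.1 * s.1.1 + k.1.2 * s.1.2 + k.2 * s.2) s x /
                 affine 1 k x) = 0.

Lemma bm_quotient k (s0 : R) s : sqnorm3 k < 1 ->
  bm (fun x => affine s0 s x / affine 1 k x).
Proof.
move=> /affine_gt0[e e0 he]; apply: bmM; first exact: bm_affine.
by apply: bmV e0 _ he; exact: (bm_affine 1 k).1.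
Qed.

(* First variation of the energy, with ln (1 + x) <= x in place of a          *)
(* differentiation under the integral sign.                                   *)
Lemma barycentric_exists : exists k, sqnorm3 k < 1 /\ barycentric k.
Proof.
have [k [k1 kmin]] := energy_min; exists k; split => //.
have [e e0 he] := affine_gt0 k1.
have k'0 : 0 < 1 - sqnorm3 k by rewrite subr_gt0.
suff ge0 (s : R3) : 0 <= Ex P (fun x =>
    affine (k.1.1 * s.1.1 + k.1.2 * s.1.2 + k.2 * s.2) s x / affine 1 k x).
  move=> s; apply/eqP; rewrite eq_le ge0 andbT.
  rewrite -oppr_ge0 -mulN1r -ExZ; last exact: bm_quotient.
  rewrite (le_trans (ge0 (- s.1.1, - s.1.2, - s.2)))//.
  rewrite le_eqVlt; apply/orP; left; apply/eqP; congr Ex; apply/funext => x.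
  by rewrite /affine /= mulrA; congr (_ / _); ring.
set s0 := _ + k.2 * s.2; set f := fun x => _ / _.
have bf : bm f by exact: bm_quotient.
have [_ [M fM]] := bf.
(* (s0, s) is Lorentz-orthogonal to (1, k), so moving along (1, k) + t (s0, s) changes 1 - |k|^2,
   apart from the projective factor, only to second order; q is the relative squared length of this
   direction, nonnegative by Cauchy-Schwarz. *)
pose q := (sqnorm3 s - s0 ^+ 2) / (1 - sqnorm3 k).
have q0 : 0 <= q.
  rewrite divr_ge0 ?(ltW k'0)// subr_ge0 /s0.
  rewrite (le_trans (cauchy_schwarz3 _ _ _ _ _ _))//.
  by rewrite -/(sqnorm3 k) ler_piMl ?sqnorm3_ge0// ltW.
rewrite leNgt; apply/negP => fneg.
(* The step t = 1 / D is small enough that 1 + t s0 > 0, t^2 q <= 1/2 and t q < - E f. The energy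
   then changes by at most t E f + t^2 q < 0, against minimality. *)
pose D := 1 + 2 * `|s0| + 2 * `|M| + 2 * q + q / (- Ex P f) * 2.
have fpos : 0 < - Ex P f by rewrite oppr_gt0.
have D1 : 1 <= D.
  have := divr_ge0 q0 (ltW fpos).
  by rewrite /D; have := normr_ge0 s0; have := normr_ge0 M; lra.
pose t := D^-1.
have t0 : 0 < t by rewrite invr_gt0; lra.
have tD y : y <= D -> t * y <= 1.
  by move=> yD; rewrite mulrC ler_pdivrMr ?mul1r//; lra.
have qf0 := divr_ge0 q0 (ltW fpos).
have t1 : t <= 1 by rewrite -[t]mulr1 tD.
have ts0 : t * `|s0| <= 2^-1.
  have := tD (2 * `|s0|); rewrite /D; have := normr_ge0 M; lra.
have tq : t * q <= 2^-1.
  have := tD (2 * q); rewrite /D; have := normr_ge0 M; have := normr_ge0 s0; lra.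
have tqf : t * (q / (- Ex P f)) <= 2^-1.
  have := tD (q / (- Ex P f) * 2); rewrite /D.
  have := normr_ge0 M; have := normr_ge0 s0; lra.
have s0p : 0 < 1 + t * s0.
  have : - (t * s0) <= t * `|s0|.
    by rewrite -mulrN ler_wpM2l ?(ltW t0)// -normrN ler_norm.
  lra.
have ttq : t * (t * q) <= 2^-1.
  by rewrite (le_trans _ tq)// ler_piMl// mulr_ge0// ltW.
pose k' : R3 := ((k.1.1 + t * s.1.1) / (1 + t * s0),
  (k.1.2 + t * s.1.2) / (1 + t * s0), (k.2 + t * s.2) / (1 + t * s0)).
have k'E : 1 - sqnorm3 k' =
   (1 - sqnorm3 k) * (1 - t * (t * q)) / (1 + t * s0) ^+ 2.
  rewrite /k' /q /s0 /sqnorm3 /=; rewrite /s0 in s0p.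
  by field; rewrite gt_eqF//=; move: k'0; rewrite /sqnorm3 => /lt0r_neq0.
have k'1 : sqnorm3 k' < 1.
  rewrite -subr_gt0 k'E divr_gt0 ?exprn_gt0// mulr_gt0//; lra.
have := kmin _ k'1; apply/negP; rewrite -ltNge /energy.
have affE x : affine 1 k' x = affine 1 k x * (1 + t * f x) / (1 + t * s0).
  rewrite /f mulrDr mulr1 mulrCA (mulrC (affine s0 s x)) mulVKf; last first.
    by rewrite gt_eqF// (lt_le_trans e0).
  rewrite /affine /k' /=; field.
  by rewrite gt_eqF.
have [e' e'0 he'] := affine_gt0 k'1.
have lnk : Ex P (fun x => ln (affine 1 k' x)) <=
  Ex P (fun x => ln (affine 1 k x)) + t * Ex P f - ln (1 + t * s0).
  rewrite -ExZ// -ExD; [|exact: bm_ln_affine|exact: bmZ].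
  rewrite -[X in _ <= _ + X](Ex_cst P) -ExD; last first.
  - exact: bm_cst.
  - by apply: bmD; [exact: bm_ln_affine|exact: bmZ].
  apply: Ex_le; first exact: bm_ln_affine.
    apply: bmD; last exact: bm_cst.
    by apply: bmD; [exact: bm_ln_affine|exact: bmZ].
  move=> x; have ap : 0 < affine 1 k x by exact: lt_le_trans (he x).
  have ap' : 0 < affine 1 k' x by exact: lt_le_trans (he' x).
  have fp : 0 < 1 + t * f x.
    move: ap'; rewrite affE pmulr_lgt0 ?invr_gt0//.
    by rewrite pmulr_rgt0.
  rewrite affE lnM ?posrE ?invr_gt0 ?mulr_gt0// lnV ?posrE// lerD2r.
  rewrite lnM ?posrE// lerD2l; apply: le_ln1Dx; lra.
rewrite k'E lnM ?posrE ?invr_gt0 ?exprn_gt0//; last first.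
  by rewrite mulr_gt0//; lra.
rewrite lnV ?posrE ?exprn_gt0// lnXn// lnM ?posrE//; last by lra.
have lnq : - ln (1 - t * (t * q)) <= 2 * (t * (t * q)).
  have tq0 : 0 <= t * (t * q) by rewrite !(mulr_ge0 (ltW t0)).
  have := @ln_diff_le 1 (1 - t * (t * q)) ltr01.
  rewrite ln1 => /(_ _)/le_trans; rewrite sub0r; apply; first by lra.
  rewrite opprB addrC subrK ler_pdivrMr; last by lra.
  rewrite mulrAC -[leLHS]mul1r ler_wpM2r//; lra.
have : t * q < - Ex P f.
  move: tqf; rewrite mulrA ler_pdivrMr// => /le_lt_trans; apply.
  by lra.
rewrite -(ltr_pM2l t0) => h.
rewrite mulrN in h; move: lnk lnq h.
move: (t * Ex P f) (t * (t * q)) => y z; clear; lra.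
Qed.

(** Testing with s = k gives 1 = (1 - |k|^2) E (1 / (1 + <k, x>)). The cap contributes at most (1/3)
    / (1 - |k|) to the expectation and the rest at most 1 / c, so 1 <= (1 + |k|) / 3 + (1 - |k|^2) /
    c. *)
Lemma barycentric_bound k : sqnorm3 k < 1 -> barycentric k ->
  c / 3 <= 1 - sqnorm3 k.
Proof.
move=> k1 /(_ k); have [r [u [/andP[r0 r1] u1 kr ku]]] := polar3 k1.
have [e e0 he] := affine_gt0 k1.
have ap x : 0 < affine 1 k x by exact: lt_le_trans (he x).
have binv : bm (fun x => (affine 1 k x)^-1).
  by apply: bmV e0 _ he; exact: (bm_affine 1 k).1.
have -> : (fun x => affine (k.1.1 * k.1.1 + k.1.2 * k.1.2 + k.2 * k.2) k x /
     affine 1 k x) = (fun x => 1 + (- (1 - sqnorm3 k)) * (affine 1 k x)^-1).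
  apply/funext => x; apply: (mulIf (lt0r_neq0 (ap x))).
  rewrite divfK ?gt_eqF// mulrDl mul1r mulfVK ?gt_eqF//.
  by rewrite /affine /sqnorm3; ring.
rewrite ExD; [|exact: bm_cst|exact: bmZ].
rewrite ExZ// Ex_cst mulNr => /eqP; rewrite subr_eq0 => /eqP E1.
pose A := [set x | affine 1 u x <= c].
have mA : measurable A by exact: measurable_cap.
have k'0 : 0 < 1 - sqnorm3 k by rewrite subr_gt0.
have up : Ex P (fun x => (affine 1 k x)^-1) <= (1 - r)^-1 * 3^-1 + c^-1.
  apply: (@le_trans _ _ (Ex P (fun x => (1 - r)^-1 * \1_A x + c^-1))).
    apply: Ex_le => //.
      by apply: bmD; [apply: bmZ; exact: bm_indic|exact: bm_cst].
    move=> x; rewrite indicE; case: (boolP (x \in A)) => [_|].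
      rewrite mulr1 -[leLHS]addr0 lerD ?invr_ge0 ?(ltW c0)//.
      rewrite lef_pV2 ?posrE//; last by lra.
      by have := affine_lb k 1 x; rewrite kr sqrtr_sqr ger0_norm.
    rewrite mulr0 add0r => /negP xA; rewrite lef_pV2 ?posrE// ku.
    apply: affine_off_cap; first by rewrite r0 ltW.
    by rewrite ltW// ltNge; apply/negP => h; apply: xA; rewrite inE.
  rewrite ExD; [|by apply: bmZ; exact: bm_indic|exact: bm_cst].
  rewrite Ex_cst ExZ; last exact: bm_indic.
  by rewrite Ex_indic// lerD2r ler_wpM2l ?caps// invr_ge0; lra.
have : 1 <= (1 - sqnorm3 k) * ((1 - r)^-1 * 3^-1 + c^-1).
  by rewrite {1}E1 ler_wpM2l// ltW.
rewrite mulrDr mulrA.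
have -> : (1 - sqnorm3 k) / (1 - r) = 1 + r.
  rewrite kr; apply: (mulIf (_ : 1 - r != 0)); first by rewrite gt_eqF; lra.
  by rewrite divfK ?gt_eqF//; [ring|lra].
move=> h; have : 3^-1 <= (1 - sqnorm3 k) / c by lra.
by rewrite ler_pdivlMr// mulrC.
Qed.

End Barycenter.

(** * Half-space coordinates and the Hopf map *)

Section ComplexCoordinates.
Context {R : realType}.
Local Notation C := R[i].
Implicit Types x y z : C.

Lemma complex_ext x y : complex.Re x = complex.Re y ->
  complex.Im x = complex.Im y -> x = y.
Proof. by case: x; case: y => a b c d /= -> ->. Qed.

Lemma reM x y : complex.Re (x * y) =
  complex.Re x * complex.Re y - complex.Im x * complex.Im y.
Proof. by case: x; case: y. Qed.

Lemma imM x y : complex.Im (x * y) =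
  complex.Re x * complex.Im y + complex.Im x * complex.Re y.
Proof. by case: x => a b; case: y => c d. Qed.

Lemma reD x y : complex.Re (x + y) = complex.Re x + complex.Re y.
Proof. by case: x; case: y. Qed.

Lemma imD x y : complex.Im (x + y) = complex.Im x + complex.Im y.
Proof. by case: x; case: y. Qed.

Lemma reN x : complex.Re (- x) = - complex.Re x.
Proof. by case: x. Qed.

Lemma imN x : complex.Im (- x) = - complex.Im x.
Proof. by case: x. Qed.

Definition sq x : R := complex.Re x ^+ 2 + complex.Im x ^+ 2.

Lemma sq_ge0 x : 0 <= sq x.
Proof. by rewrite addr_ge0 ?sqr_ge0. Qed.

Lemma sq_normc x : normc x ^+ 2 = sq x.
Proof. by case: x => a b; rewrite /= sqr_sqrtr// addr_ge0 ?sqr_ge0. Qed.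

Lemma normc_ge0 x : 0 <= normc x.
Proof. by case: x => a b; exact: sqrtr_ge0. Qed.

Lemma normc_gt0 x : (0 < normc x) = (x != 0).
Proof.
rewrite lt0r normc_ge0 andbT; congr (~~ _); apply/eqP/eqP => [/eq0_normc//|->].
exact: normc0.
Qed.

Lemma normcE x : normc x = Num.sqrt (sq x).
Proof. by case: x. Qed.

Lemma normc_real (a : R) : normc a%:C = `|a|.
Proof. by rewrite normcE /sq /= expr0n addr0 sqrtr_sqr. Qed.

Lemma normcX x n : normc (x ^+ n) = normc x ^+ n.
Proof.
by elim: n => [|n IH]; rewrite ?expr0 ?normc1// !exprS normcM IH.
Qed.

Lemma normc_sum (I : Type) (s : seq I) (P : pred I) (F : I -> C) :
  normc (\sum_(i <- s | P i) F i) <= \sum_(i <- s | P i) normc (F i).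
Proof.
elim/big_ind2: _ => //; first by rewrite normc0.
by move=> u u' w w' h h'; rewrite (le_trans (le_normcD _ _))// lerD.
Qed.

Lemma sqM x y : sq (x * y) = sq x * sq y.
Proof. by rewrite /sq reM imM; ring. Qed.

Lemma reJ x : complex.Re x^*%C = complex.Re x.
Proof. by case: x. Qed.

Lemma imJ x : complex.Im x^*%C = - complex.Im x.
Proof. by case: x. Qed.

Lemma mulJ x : x * x^*%C = (sq x)%:C.
Proof.
by apply: complex_ext; rewrite ?reM ?imM reJ imJ /sq /=; ring.
Qed.

Lemma sq1 : sq 1 = 1. Proof. by rewrite /sq /= expr0n expr1n addr0. Qed.
Lemma sq0 : sq 0 = 0. Proof. by rewrite /sq /= expr0n addr0. Qed.

Lemma sq_real (a : R) : sq a%:C = a ^+ 2.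
Proof. by rewrite /sq /= expr0n addr0. Qed.

Lemma sq_eq0 x : (sq x == 0) = (x == 0).
Proof.
case: x => a b; rewrite /sq /= paddr_eq0 ?sqr_ge0// !sqrf_eq0.
by rewrite eq_complex.
Qed.

Lemma sq_gt0 x : (0 < sq x) = (x != 0).
Proof. by rewrite lt0r sq_ge0 andbT sq_eq0. Qed.

Lemma reV x : complex.Re x^-1 = complex.Re x / sq x.
Proof. by case: x. Qed.

Lemma imV x : complex.Im x^-1 = - (complex.Im x / sq x).
Proof. by case: x. Qed.

End ComplexCoordinates.

(** * The Riemann sphere in homogeneous coordinates *)

Section Hopf.
Context {R : realType}.
Local Notation C := R[i].
Implicit Types v w : C * C.

Definition sqn v : R := sq v.1 + sq v.2.

(** Stereographic image of v.1 / v.2, including infinity. Homogeneous coordinates remove the case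
    distinction at infinity and turn Moebius and rational maps into linear and homogeneous ones. *)
Definition hopf v : R * R * R :=
  (2 * (complex.Re v.1 * complex.Re v.2 + complex.Im v.1 * complex.Im v.2) / sqn v,
   2 * (complex.Im v.1 * complex.Re v.2 - complex.Re v.1 * complex.Im v.2) / sqn v,
   (sq v.1 - sq v.2) / sqn v).

Lemma sqn_ge0 v : 0 <= sqn v.
Proof. by rewrite addr_ge0 ?sq_ge0. Qed.

Lemma sqn_gt0 v : (0 < sqn v) = (v != 0).
Proof.
rewrite lt0r sqn_ge0 andbT /sqn paddr_eq0 ?sq_ge0// !sq_eq0.
by case: v.
Qed.

Lemma hopf_scale (c : C) v : c != 0 -> hopf (c * v.1, c * v.2) = hopf v.
Proof.
move=> c0; have k0 : sq c != 0 by rewrite sq_eq0.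
have n : sqn (c * v.1, c * v.2) = sq c * sqn v by rewrite /sqn /= !sqM -mulrDr.
rewrite /hopf n /= !sqM.
have E (x y : R) : x = sq c * y -> x / (sq c * sqn v) = y / sqn v.
  by move=> ->; rewrite -mulf_div divff// mul1r.
congr (_, _, _); apply: E; rewrite ?reM ?imM /sq; ring.
Qed.

Lemma sqnorm3_hopf v : v != 0 -> sqnorm3 (hopf v) = 1.
Proof.
rewrite -sqn_gt0 => /lt0r_neq0 n0; move: n0; rewrite /sqnorm3 /hopf /= /sqn /sq => n0.
by field.
Qed.

Lemma stereo_hopf v : v != 0 ->
  stereo (if v.2 == 0 then None else Some (v.1 / v.2)) = hopf v.
Proof.
case: v => v1 v2 /= v0; have [v20|v20] := eqVneq v2 0.
  move: v0; rewrite v20 xpair_eqE eqxx andbT => v10.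
  have k0 : sq v1 != 0 by rewrite sq_eq0.
  rewrite /hopf /sqn /= sq0 subr0 addr0 divff// !mulr0 subrr addr0.
  by rewrite !mulr0 !mul0r.
have -> : hopf (v1, v2) = hopf (v1 / v2, 1).
  rewrite -(hopf_scale (v1 / v2, 1) v20) /= mulr1 mulrC divfK//.
rewrite /= sq_normc /hopf /sqn /= sq1 !mulr0 !mulr1.
by rewrite addr0 subr0.
Qed.

Lemma unstereo_hopf v : v != 0 ->
  unstereo (hopf v) = if v.2 == 0 then None else Some (v.1 / v.2).
Proof.
move=> v0; rewrite /unstereo.
have n0 : sqn v != 0 by rewrite gt_eqF// sqn_gt0.
have -> : ((hopf v).2 == 1) = (v.2 == 0).
  rewrite /hopf /= -(inj_eq (mulIf n0)) divfK// mul1r /sqn.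
  rewrite -sq_eq0 -subr_eq0.
  have -> : sq v.1 - sq v.2 - (sq v.1 + sq v.2) = sq v.2 *- 2 by ring.
  by rewrite oppr_eq0 mulrn_eq0.
case: ifPn => // v20; congr Some.
have k0 : sq v.2 != 0 by rewrite sq_eq0.
have E : 1 - (hopf v).2 = 2 * sq v.2 / sqn v.
  rewrite /hopf /= -{1}(divff n0) -mulrBl; congr (_ / _).
  by rewrite /sqn; ring.
rewrite E; apply: complex_ext.
- rewrite !reM !reV !imV sq_real /hopf /=.
  by field; rewrite k0 n0.
- rewrite !imM !reV !imV sq_real /hopf /=.
  by field; rewrite k0 n0.
Qed.

(** Homogenization in formal degree d: a polynomial of smaller degree acquires zeros at infinity. *)
Definition hom (d : nat) (p : {poly C}) v : C :=
  \sum_(i < d.+1) p`_i * v.1 ^+ i * v.2 ^+ (d - i).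

Lemma hom_infty d (p : {poly C}) (x : C) : hom d p (x, 0) = p`_d * x ^+ d.
Proof.
rewrite /hom big_ord_recr /= subnn expr0 mulr1 big1 ?add0r// => i _.
by rewrite expr0n subn_eq0 leqNgt ltn_ord mulr0.
Qed.

Lemma hom_finite d (p : {poly C}) v : (size p <= d.+1)%N -> v.2 != 0 ->
  hom d p v = v.2 ^+ d * p.[v.1 / v.2].
Proof.
move=> sp v0; rewrite (horner_coef_wide _ sp) big_distrr /=.
apply: eq_bigr => i _; rewrite expr_div_n.
have -> : v.2 ^+ d = v.2 ^+ (d - i) * v.2 ^+ i.
  by rewrite -exprD subnK// -ltnS.
have vi : v.2 ^+ i != 0 by rewrite expf_neq0.
field.
by rewrite vi.
Qed.

Lemma on_sphere_rat (num den : {poly C}) d v : v != 0 ->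
  (maxn (size num) (size den)).-1 = d ->
  (hom d num v, hom d den v) != 0 ->
  on_sphere (rat_eval num den) (hopf v) = hopf (hom d num v, hom d den v).
Proof.
move=> v0 dE h0; rewrite /on_sphere unstereo_hopf//.
have szd (p : {poly C}) : (size p <= maxn (size num) (size den))%N ->
    (size p <= d.+1)%N.
  by move=> h; rewrite (leq_trans h)// -dE leqSpred.
have sn : (size num <= d.+1)%N by rewrite szd// leq_maxl.
have sd : (size den <= d.+1)%N by rewrite szd// leq_maxr.
have key (c n e : C) : c != 0 -> hom d num v = c * n -> hom d den v = c * e ->
    stereo (if e == 0 then None else Some (n / e)) = hopf (hom d num v, hom d den v).
  move=> c0 En Ee; rewrite En Ee (hopf_scale (n, e))// -stereo_hopf//.
  by apply: contraNneq h0; rewrite En Ee => -[-> ->]; rewrite !mulr0.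
rewrite /rat_eval dE; case: v v0 h0 key => v1 v2 /= v0 h0 key.
have [v20|v20] := eqVneq v2 0; last first.
  by apply: (key (v2 ^+ d)); rewrite ?expf_neq0// hom_finite.
apply: (key (v1 ^+ d)); last 2 first.
- by rewrite v20 hom_infty mulrC.
- by rewrite v20 hom_infty mulrC.
by move: v0; rewrite v20 xpair_eqE eqxx andbT => v10; rewrite expf_neq0.
Qed.

Lemma sum2 (F : 'I_2 -> C) : \sum_(i < 2) F i = F 0 + F 1.
Proof.
rewrite big_ord_recl big_ord1; congr (_ + F _); exact: val_inj.
Qed.

Lemma det22 (M : 'M[C]_2) : \det M = M 0 0 * M 1 1 - M 0 1 * M 1 0.
Proof.
rewrite (expand_det_row M 0) sum2 /cofactor !det_mx11 !mxE /= expr0 mul1r.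
by rewrite expr1 mulN1r mulrN; congr (_ * M _ _ - _ * M _ _); exact: val_inj.
Qed.

Definition lin2 (M : 'M[C]_2) v : C * C :=
  (M 0 0 * v.1 + M 0 1 * v.2, M 1 0 * v.1 + M 1 1 * v.2).

Lemma lin2_neq0 M v : M \in unitmx -> v != 0 -> lin2 M v != 0.
Proof.
rewrite unitmxE det22 unitfE => dM; apply: contraNneq => -[e1 e2].
have f1 : (M 0 0 * M 1 1 - M 0 1 * M 1 0) * v.1 = 0.
  transitivity (M 1 1 * (M 0 0 * v.1 + M 0 1 * v.2) -
                M 0 1 * (M 1 0 * v.1 + M 1 1 * v.2)); first by ring.
  by rewrite e1 e2 !mulr0 subrr.
have f2 : (M 0 0 * M 1 1 - M 0 1 * M 1 0) * v.2 = 0.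
  transitivity (M 0 0 * (M 1 0 * v.1 + M 1 1 * v.2) -
                M 1 0 * (M 0 0 * v.1 + M 0 1 * v.2)); first by ring.
  by rewrite e1 e2 !mulr0 subrr.
move/eqP: f1; move/eqP: f2; rewrite !mulf_eq0 (negbTE dM) /=.
by case: v {e1 e2} => v1 v2 /= /eqP-> /eqP->.
Qed.

Lemma on_sphere_moebius M v : M \in unitmx -> v != 0 ->
  on_sphere (moebius M) (hopf v) = hopf (lin2 M v).
Proof.
move=> uM v0.
have homE (a b : C) : hom 1 (a *: 'X + b%:P) v = a * v.1 + b * v.2.
  rewrite /hom big_ord_recl big_ord1 /= !coefE /bump /=.
  by rewrite ?addn0 ?subn0 ?subnn ?expr0 ?expr1; ring.
have sz (a b : C) : (size (a *: 'X + b%:P)%R <= 2)%N.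
  rewrite (leq_trans (size_polyD _ _))// geq_max (leq_trans (size_scale_leq _ _)) ?size_polyX//.
  by rewrite (leq_trans (size_polyC_leq1 _)).
have sz2 (a b : C) : a != 0 -> size (a *: 'X + b%:P) = 2%N.
  move=> a0; rewrite size_polyDl size_scale// size_polyX//.
  by rewrite ltnS size_polyC_leq1.
rewrite /moebius (@on_sphere_rat _ _ 1 v)//; first by rewrite !homE.
  2: by rewrite !homE; exact: (lin2_neq0 uM v0).
have : (M 0 0 != 0) || (M 1 0 != 0).
  rewrite -negb_and; apply/negP => /andP[/eqP m0 /eqP m1].
  by move: uM; rewrite unitmxE det22 m0 m1 mul0r mulr0 subrr unitr0.
have s0 := sz (M 0 0) (M 0 1); have s1 := sz (M 1 0) (M 1 1).
move=> /orP[] m; have := sz2 _ _ m => E; rewrite E.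
- by rewrite (maxn_idPl _).
- by rewrite (maxn_idPr _).
Qed.

End Hopf.

(** * Upper half-space coordinates on hyperbolic space *)

Section HalfSpace.
Context {R : realType}.
Local Notation C := R[i].

(** [ball_point] of the Hermitian matrix with diagonal h0, h1 and upper right entry h, written over
    the reals. *)
Definition bpt (h0 h1 : R) (h : C) : R * R * R :=
  let s := h0 + h1 + 2 * Num.sqrt (h0 * h1 - sq h) in
  (2 * complex.Re h / s, 2 * complex.Im h / s, (h0 - h1) / s).

Lemma bpt_sum_gt0 (h0 h1 : R) (h : C) : 0 < h0 -> 0 < h1 ->
  0 < h0 + h1 + 2 * Num.sqrt (h0 * h1 - sq h).
Proof. by move=> p q; have := sqrtr_ge0 (h0 * h1 - sq h); lra. Qed.

Lemma sqnorm3_bpt h0 h1 h : 0 < h0 -> 0 < h1 -> 0 < h0 * h1 - sq h ->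
  sqnorm3 (bpt h0 h1 h) = (h0 + h1 - 2 * Num.sqrt (h0 * h1 - sq h)) /
                          (h0 + h1 + 2 * Num.sqrt (h0 * h1 - sq h)).
Proof.
move=> p q D; have s0 := bpt_sum_gt0 h p q.
have E := sqr_sqrtr (ltW D).
rewrite /sqnorm3 /bpt /=; move: s0 E; set w := Num.sqrt _ => s0 E.
rewrite !expr_div_n -!mulrDl.
have -> : (2 * complex.Re h) ^+ 2 + (2 * complex.Im h) ^+ 2 + (h0 - h1) ^+ 2 =
   (h0 + h1 - 2 * w) * (h0 + h1 + 2 * w).
  transitivity ((h0 + h1) ^+ 2 - 4 * w ^+ 2); last by ring.
  by rewrite E /sq; ring.
by rewrite expr2 invfM mulrA mulfK ?gt_eqF.
Qed.

Lemma bpt_coords h0 h1 h : 0 < h0 -> 0 < h1 -> 0 < h0 * h1 - sq h ->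
  let s := h0 + h1 + 2 * Num.sqrt (h0 * h1 - sq h) in
  let p := bpt h0 h1 h in
  [/\ 1 + sqnorm3 p + 2 * p.2 = 4 * h0 / s, 1 + sqnorm3 p - 2 * p.2 = 4 * h1 / s,
      2 * p.1.1 = 4 * complex.Re h / s & 2 * p.1.2 = 4 * complex.Im h / s].
Proof.
move=> p q D /=; have s0 := bpt_sum_gt0 h p q.
rewrite sqnorm3_bpt//; split; rewrite /bpt /=; field; by rewrite gt_eqF.
Qed.

(** The point recovers all entries up to the common factor 4 / s ([bpt_coords]), so it determines
    the positive definite matrix up to a positive scalar. *)
Lemma bpt_inj h0 h1 h k0 k1 k : 0 < h0 -> 0 < h1 -> 0 < h0 * h1 - sq h ->
  0 < k0 -> 0 < k1 -> 0 < k0 * k1 - sq k -> bpt h0 h1 h = bpt k0 k1 k ->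
  exists2 l : R, 0 < l & [/\ h0 = l * k0, h1 = l * k1 & h = l%:C * k].
Proof.
move=> p q D p' q' D' E.
have s0 := bpt_sum_gt0 h p q; have s0' := bpt_sum_gt0 k p' q'.
have [a1 a2 a3 a4] := bpt_coords p q D; have [b1 b2 b3 b4] := bpt_coords p' q' D'.
move: a1 a2 a3 a4; rewrite E b1 b2 b3 b4.
move: s0 s0'; set s := _ + 2 * _; set s' := k0 + k1 + _ => s0 s0' a1 a2 a3 a4.
have u (x y : R) : 4 * y / s' = 4 * x / s -> x = s / s' * y.
  move=> e; have e2 : y / s' = x / s by move: e; rewrite -!mulrA; lra.
  by rewrite mulrAC -mulrA e2 mulrC divfK ?gt_eqF.
exists (s / s'); first exact: divr_gt0.
split; [exact: u|exact: u|].
by apply: complex_ext; rewrite ?reM ?imM /= mul0r ?subr0 ?addr0; exact: u.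
Qed.

Lemma bpt_scale (l h0 h1 : R) h : 0 < l ->
  bpt (l * h0) (l * h1) (l%:C * h) = bpt h0 h1 h.
Proof.
move=> l0; rewrite /bpt.
have -> : l * h0 * (l * h1) - sq (l%:C * h) = l ^+ 2 * (h0 * h1 - sq h).
  by rewrite sqM sq_real; ring.
rewrite sqrtrM ?sqr_ge0// sqrtr_sqr gtr0_norm//.
have -> : l * h0 + l * h1 + 2 * (l * Num.sqrt (h0 * h1 - sq h)) =
  l * (h0 + h1 + 2 * Num.sqrt (h0 * h1 - sq h)) by ring.
set s := _ + 2 * _.
have E (x y : R) : x = l * y -> x / (l * s) = y / s.
  by move=> ->; rewrite -mulf_div divff ?mul1r// gt_eqF.
congr (_, _, _); apply: E; rewrite ?reM ?imM /= ?mul0r; ring.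
Qed.

Definition hp_val (b : C) (a : R) : R * R * R := bpt (sq b + a ^+ 2) 1 b.

Lemma hp_val_disc (b : C) (a : R) : 0 < a ->
  [/\ 0 < sq b + a ^+ 2, 0 < (sq b + a ^+ 2) * 1 - sq b &
      Num.sqrt ((sq b + a ^+ 2) * 1 - sq b) = a].
Proof.
move=> a0; have -> : (sq b + a ^+ 2) * 1 - sq b = a ^+ 2 by ring.
have a2 : 0 < a ^+ 2 by rewrite exprn_gt0.
by split => //; [have := sq_ge0 b; lra|rewrite sqrtr_sqr gtr0_norm].
Qed.

Lemma hp_subproof b a : 0 < a -> sqnorm3 (hp_val b a) < 1.
Proof.
move=> a0; have [h0 D sD] := hp_val_disc b a0.
rewrite sqnorm3_bpt// sD.
have s0 := sq_ge0 b; have a2 := sqr_ge0 a.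
by rewrite ltr_pdivrMr; lra.
Qed.

(* The point of H3 with upper half-space coordinates (b, a), the image of the *)
(* origin under z |-> a z + b; junk value for a <= 0.                         *)
Definition hp (b : C) (a : R) : H3 R := insubd (origin R) (hp_val b a).

Lemma val_hp b a : 0 < a -> val (hp b a) = hp_val b a.
Proof. by move=> a0; rewrite /hp insubdK//; exact: hp_subproof. Qed.

Lemma origin_hp : origin R = hp 0 1.
Proof.
apply: val_inj; rewrite val_hp//= /hp_val /bpt /= sq0.
by rewrite expr1n add0r subrr !mulr0 !mul0r.
Qed.

Lemma hp_surj (x : H3 R) : exists b a, 0 < a /\ x = hp b a.
Proof.
case: x => [[[x y] z] p]; have := p; rewrite /sqnorm3 /= => p'.
set n := x ^+ 2 + y ^+ 2 + z ^+ 2 in p'.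
have m0 : 0 < 1 + n - 2 * z.
  have -> : 1 + n - 2 * z = (1 - z) ^+ 2 + (x ^+ 2 + y ^+ 2) by rewrite /n; ring.
  have := sqr_ge0 x; have := sqr_ge0 y; have := sqr_ge0 (1 - z) => z2 y2 x2.
  have [zz|zz] := eqVneq z 1.
    by move: p'; rewrite /n zz expr1n; lra.
  have : 0 < (1 - z) ^+ 2 by rewrite lt0r sqr_ge0 sqrf_eq0 subr_eq0 eq_sym zz.
  by lra.
pose a := (1 - n) / (1 + n - 2 * z).
have a0 : 0 < a by rewrite divr_gt0//; lra.
exists ((2 * x / (1 + n - 2 * z)) +i* (2 * y / (1 + n - 2 * z))), a.
split => //; apply: val_inj; rewrite val_hp//=.
rewrite /hp_val; have [_ _] := hp_val_disc ((2 * x / (1 + n - 2 * z)) +i* (2 * y / (1 + n - 2 * z))) a0.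
rewrite /bpt => ->; rewrite /sq /=.
have S : (2 * x / (1 + n - 2 * z)) ^+ 2 + (2 * y / (1 + n - 2 * z)) ^+ 2 + a ^+ 2
    = (1 + n + 2 * z) / (1 + n - 2 * z).
  rewrite /a; apply: (mulIf (_ : (1 + n - 2 * z) ^+ 2 != 0)).
    by rewrite expf_neq0// gt_eqF.
  rewrite !expr_div_n -!mulrDl divfK ?expf_neq0 ?gt_eqF//.
  rewrite [(_ - _) ^+ 2 in RHS]expr2 mulrA divfK ?gt_eqF// /n; ring.
rewrite S /a.
have E : (1 + n + 2 * z) / (1 + n - 2 * z) + 1 + 2 * ((1 - n) / (1 + n - 2 * z)) =
  4 / (1 + n - 2 * z) by field; rewrite gt_eqF.
rewrite E; congr (_, _, _); field; by rewrite gt_eqF.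
Qed.

(** The hyperbolic cosine of the distance in half-space coordinates. *)
Definition cdist (b : C) (a : R) (b' : C) (a' : R) : R :=
  (sq (b - b') + a ^+ 2 + a' ^+ 2) / (2 * (a * a')).

Lemma hdist_hp b a b' a' : 0 < a -> 0 < a' ->
  let u := cdist b a b' a' in
  hdist (hp b a) (hp b' a') = ln (u + Num.sqrt (u ^+ 2 - 1)).
Proof.
move=> a0 a0'; rewrite /hdist !val_hp//=.
suff -> : 1 + 2 * sqnorm3 (hp_val b a - hp_val b' a') /
   ((1 - sqnorm3 (hp_val b a)) * (1 - sqnorm3 (hp_val b' a'))) = cdist b a b' a'.
  by [].
have [h0 D sD] := hp_val_disc b a0; have [h0' D' sD'] := hp_val_disc b' a0'.
rewrite !sqnorm3_bpt// sD sD' /cdist /hp_val /bpt sD sD' /sqnorm3 /=.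
have s0 := sq_ge0 b; have s0' := sq_ge0 b'.
have a2 := sqr_ge0 a; have a2' := sqr_ge0 a'.
have n1 : 0 < sq b + a ^+ 2 + 1 + 2 * a by lra.
have n2 : 0 < sq b' + a' ^+ 2 + 1 + 2 * a' by lra.
move: n1 n2; rewrite /sq !reD !imD !reN !imN => n1 n2.
move: (complex.Re b) (complex.Im b) (complex.Re b') (complex.Im b') n1 n2 => x y x' y' n1 n2.
field; rewrite !gt_eqF//=.
- by lra.
- by lra.
Qed.

Lemma cdist_ge1 b a b' a' : 0 < a -> 0 < a' -> 1 <= cdist b a b' a'.
Proof.
move=> a0 a0'; rewrite /cdist ler_pdivlMr ?mulr_gt0// mul1r.
have := sqr_ge0 (a - a'); have := sq_ge0 (b - b'); rewrite sqrrB; lra.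
Qed.

(** arcosh u lies between ln u and ln (2 u); an error of ln 2 is harmless at the scale r_n. *)
Lemma hdist_bounds b a b' a' : 0 < a -> 0 < a' ->
  ln (cdist b a b' a') <= hdist (hp b a) (hp b' a') <= ln (2 * cdist b a b' a').
Proof.
move=> a0 a0'; rewrite hdist_hp//.
have u1 := cdist_ge1 b b' a0 a0'; set u := cdist _ _ _ _ in u1 *.
have s0 := sqrtr_ge0 (u ^+ 2 - 1).
have su : Num.sqrt (u ^+ 2 - 1) <= u.
  rewrite -ler_sqr ?nnegrE//; last by lra.
  rewrite sqr_sqrtr; first by lra.
  by rewrite subr_ge0 exprn_ege1.
by rewrite !ler_ln ?posrE; [apply/andP; split|..]; lra.
Qed.

(** The two diagonal entries and the upper right entry of M times its adjoint. *)
Definition gram (M : 'M[C]_2) : R * R * C :=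
  (sq (M 0 0) + sq (M 0 1), sq (M 1 0) + sq (M 1 1),
   M 0 0 * (M 1 0)^*%C + M 0 1 * (M 1 1)^*%C).

Lemma gram_det M : (gram M).1.1 * (gram M).1.2 - sq (gram M).2 = sq (\det M).
Proof.
rewrite det22 /gram /= /sq !(reD, imD, reN, imN, reM, imM, reJ, imJ).
by ring.
Qed.

Lemma gram_gt0 M : M \in unitmx ->
  [/\ 0 < (gram M).1.1, 0 < (gram M).1.2 &
      0 < (gram M).1.1 * (gram M).1.2 - sq (gram M).2].
Proof.
rewrite unitmxE unitfE => dM; have D : 0 < sq (\det M) by rewrite sq_gt0.
have h0 : 0 <= (gram M).1.1 by rewrite addr_ge0 ?sq_ge0.
have h1 : 0 <= (gram M).1.2 by rewrite addr_ge0 ?sq_ge0.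
have := D; rewrite -gram_det => D'; split => //.
- rewrite lt0r h0 andbT; apply: contraTneq D' => ->.
  by rewrite mul0r sub0r -leNgt oppr_le0 sq_ge0.
- rewrite lt0r h1 andbT; apply: contraTneq D' => ->.
  by rewrite mulr0 sub0r -leNgt oppr_le0 sq_ge0.
Qed.

Lemma ball_point_bpt (H : 'M[C]_2) h0 h1 h :
  H 0 0 = h0%:C -> H 1 1 = h1%:C -> H 0 1 = h -> H 1 0 = h^*%C ->
  ball_point H = bpt h0 h1 h.
Proof.
move=> e00 e11 e01 e10; rewrite /ball_point /bpt det22 e00 e11 e01 e10 mulJ.
have -> : complex.Re (h0%:C * h1%:C - (sq h)%:C) = h0 * h1 - sq h.
  by rewrite reD reN reM /=; ring.
have -> : complex.Re (h0%:C + h1%:C) = h0 + h1 by [].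
by have -> : complex.Re (h0%:C - h1%:C) = h0 - h1 by [].
Qed.

Lemma ball_point_gram (l : R) Q : 0 < l ->
  ball_point (l%:C *: (Q *m (map_mx (@conjc R) Q)^T)) =
  bpt (gram Q).1.1 (gram Q).1.2 (gram Q).2.
Proof.
move=> l0; rewrite -[RHS](bpt_scale _ _ _ l0); apply: ball_point_bpt.
- by rewrite !mxE sum2 !mxE !mulJ -rmorphD -rmorphM.
- by rewrite !mxE sum2 !mxE !mulJ -rmorphD -rmorphM.
- by rewrite !mxE sum2 !mxE.
- rewrite !mxE sum2 !mxE !(rmorphM, rmorphD) /= !conjcK.
  congr (_ * (_ + _)); [|exact: mulrC|exact: mulrC].
  by apply: complex_ext; rewrite //= oppr0.
Qed.

(** The Hermitian matrix of the point (b, a) is a positive multiple of A A^* with A the matrix of z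
    |-> a z + b, so M carries it to a multiple of the Gram matrix of M A. *)
Lemma moebius_ball_hp M b a : 0 < a ->
  let Q := M *m mx2 a%:C b 0 1 in
  moebius_ball M (val (hp b a)) = bpt (gram Q).1.1 (gram Q).1.2 (gram Q).2.
Proof.
move=> a0 Q; rewrite val_hp//.
have [h0 D sD] := hp_val_disc b a0.
have [e1 e2 e3 e4] := bpt_coords h0 ltr01 D.
have s0 := bpt_sum_gt0 b h0 ltr01.
move: e1 e2 e3 e4 s0; rewrite -/(hp_val b a) sD; set s := _ + 2 * a => e1 e2 e3 e4 s0.
have l0 : 0 < 4 / s by rewrite divr_gt0.
rewrite -(ball_point_gram Q l0) /moebius_ball; congr ball_point.
have -> : Defs.hermitian (hp_val b a) = (4 / s)%:C *:
    (mx2 a%:C b 0 1 *m (map_mx (@conjc R) (mx2 a%:C b 0 1))^T).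
  move: e1 e2 e3 e4; rewrite /Defs.hermitian; case: (hp_val b a) => [[x y] z] /= e1 e2 e3 e4.
  rewrite e1 e2 e3 e4 mulr1; apply/matrixP => i j; rewrite !mxE sum2 !mxE /=.
  case: i j => [[|[|]]//= ?] [[|[|]]//= ?]; rewrite ?mulJ ?conjc0 ?conjc1 ?mulr0 ?mul0r ?mulr1 ?mul1r ?addr0 ?add0r.
  - by rewrite -rmorphD -rmorphM sq_real addrC mulrAC.
  - by apply: complex_ext; rewrite !(reD, imD, reM, imM) /=; ring.
  - by apply: complex_ext; rewrite !(reD, imD, reM, imM, reJ, imJ) /=; ring.
  - by rewrite sq0 sq1 add0r mulr1.
rewrite -scalemxAr -scalemxAl; congr (_ *: _).
by rewrite /Q map_mxM trmx_mul !mulmxA.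
Qed.

End HalfSpace.

(** * The spherical measure and sublevel sets of homogeneous forms *)

Section SphereParam.
Context {R : realType}.
Local Notation C := R[i].

Definition sphere_param : probability _ R :=
  (uniform_prob (@ltrN1_1 R) \x uniform_prob (@two_pi_gt0 R))%E.

Definition cylinder (q : R * R) : R * R * R :=
  let s := Num.sqrt (1 - q.1 ^+ 2) in (s * cos q.2, s * sin q.2, q.1).

(* For |h| > 1 the square root in [cylinder] is the junk value 0, so that the *)
(* point lies on the axis and has unstereo equal to 0.                        *)
Definition lift (q : R * R) : C * C :=
  if -1 <= q.1 <= 1
  then ((Num.sqrt (1 + q.1) * cos q.2) +i* (Num.sqrt (1 + q.1) * sin q.2),
        (Num.sqrt (1 - q.1))%:C)
  else (0, 1).

Lemma sqn_lift q : sqn (lift q) = 2 \/ sqn (lift q) = 1.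
Proof.
rewrite /lift; case: ifPn => [/andP[h1 h2]|_]; [left|right]; last first.
  by rewrite /sqn sq0 sq1 add0r.
rewrite /sqn /sq /= !exprMn !sqr_sqrtr; [|lra|lra].
by rewrite expr0n addr0 -mulrDr cos2Dsin2; ring.
Qed.

Lemma lift_neq0 q : lift q != 0.
Proof. by rewrite -sqn_gt0; case: (sqn_lift q) => ->. Qed.

Lemma hopf_lift q : (-1 <= q.1 <= 1) -> hopf (lift q) = cylinder q.
Proof.
move=> h; rewrite /hopf.
have -> : sqn (lift q) = 2.
  case/andP: h => h1 h2.
  rewrite /lift h1 h2 /= /sqn /sq /= !exprMn !sqr_sqrtr; [|lra|lra].
  by rewrite expr0n addr0 -mulrDr cos2Dsin2; ring.
rewrite /lift h /= /cylinder.
case/andP: h => h1 h2.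
have -> : Num.sqrt (1 - q.1 ^+ 2) = Num.sqrt (1 + q.1) * Num.sqrt (1 - q.1).
  by rewrite -sqrtrM; [congr Num.sqrt; ring|lra].
rewrite /sq /= !exprMn !sqr_sqrtr; [|lra|lra].
have := cos2Dsin2 q.2; set cc := cos _; set ss := sin _ => cs.
congr (_, _, _).
- by field.
- by field.
- rewrite -mulrDr cs; by field.
Qed.

Lemma unstereo_cylinder q : unstereo (cylinder q) = unstereo (hopf (lift q)).
Proof.
have [h|h] := boolP (-1 <= q.1 <= 1); first by rewrite hopf_lift.
rewrite unstereo_hopf ?lift_neq0// /lift (negbTE h) /= oner_eq0 mul0r.
have q1 : 1 - q.1 ^+ 2 <= 0.
  rewrite subr_le0 -[leLHS](expr1n _ 2) -[leRHS]real_normK ?num_real//.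
  rewrite ler_sqr ?nnegrE//; move: h; rewrite -ler_norml -ltNge; exact: ltW.
rewrite /unstereo /cylinder /= ler0_sqrtr//.
case: ifPn => [/eqP E|_].
  by case/negP: h; rewrite E lexx andbT; lra.
by rewrite !mul0r; congr Some; apply: complex_ext; rewrite ?reM ?imM /= !mul0r ?subr0 ?addr0.
Qed.

Lemma on_sphere_cylinder g q :
  on_sphere g (cylinder q) = on_sphere g (hopf (lift q)).
Proof. by rewrite /on_sphere unstereo_cylinder. Qed.

Lemma hopf_lift3 q : (hopf (lift q)).2 = if -1 <= q.1 <= 1 then q.1 else -1.
Proof.
case: ifPn => h; first by rewrite hopf_lift.
by rewrite /lift (negbTE h) /hopf /sqn /= sq0 sq1 sub0r add0r divr1.
Qed.

(** Heights outside [-1, 1] have measure 0; including them absorbs the default value of [lift]. *)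
Definition band (l e : R) : set R := [set h | `|h - l| <= e \/ ~~ (-1 <= h <= 1)].

Definition strip (l e : R) : set (R * R) := band l e `*` setT.

Lemma measurable_band l e : measurable (band l e).
Proof.
have -> : band l e =
   (`[l - e, l + e]%classic : set R) `|` ~` (`[-1, 1]%classic : set R).
  apply/seteqP; split => h; rewrite /band /= !in_itv /= ler_distl => -[]; auto.
  - by move/negP; right.
  - by move/negP; right.
apply: measurableU; first exact: measurable_itv.
by apply: measurableC; exact: measurable_itv.
Qed.

Lemma measurable_strip l e : measurable (strip l e).
Proof. by apply: measurableX => //; exact: measurable_band. Qed.

(** Archimedes: the height is uniform on [-1, 1], hence a slab of thickness 2 e has mass at most e,
    wherever it lies. *)
Lemma sphere_param_strip l e : 0 <= e -> (sphere_param (strip l e) <= e%:E)%E.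
Proof.
move=> e0; rewrite /sphere_param /strip; have mS := measurable_band l e.
set S := band l e in mS *.
apply: (@le_trans _ _ (uniform_prob (@ltrN1_1 R) S * uniform_prob (@two_pi_gt0 R) setT)%E).
  by rewrite le_eqVlt; apply/orP; left; apply/eqP; exact: product_measure1E.
have -> : uniform_prob (@two_pi_gt0 R) setT = 1%E by exact: probability_setT.
rewrite mule1 /uniform_prob integral_uniform_pdf.
have mI : measurable (S `&` `[-1, 1]%classic).
  by apply: measurableI => //; exact: measurable_itv.
apply: (@le_trans _ _ (\int[lebesgue_measure]_(x in (`[(l - e)%R, (l + e)%R]%classic : set R)) (2^-1 : R)%R%:E)%E).
  apply: (@le_trans _ _ (\int[lebesgue_measure]_(x in (S `&` `[(-1)%R, 1%R]%classic)) (2^-1 : R)%R%:E)%E).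
    apply: ge0_le_integral => //=.
    - by move=> x _; rewrite lee_fin uniform_pdf_ge0.
    - by apply/measurable_EFinP/measurable_funTS; exact: measurable_uniform_pdf.
    - move=> x [_]; rewrite /= in_itv /= /uniform_pdf => ->.
      by rewrite lee_fin opprK.
  apply: ge0_subset_integral => //=.
  move=> x [[]]; rewrite /= !in_itv /= ?ler_distl; first by [].
  by move=> /negP.
rewrite integral_cst//=.
rewrite lebesgue_measure_itv /= lte_fin.
case: ifPn => [_|_]; last by rewrite mule0 lee_fin.
by rewrite -EFinD -EFinM lee_fin; lra.
Qed.

Lemma sphere_param_cover (E : set (R * R)) (ls : seq R) (e : R) : 0 <= e ->
  measurable E -> (forall q, E q -> exists2 l, l \in ls & strip l e q) ->
  fine (sphere_param E) <= (size ls)%:R * e.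
Proof.
move=> e0 mE cov.
suff : (sphere_param E <= ((size ls)%:R * e)%:E)%E.
  move=> h; rewrite -lee_fin fineK//.
  by rewrite ge0_fin_numE// (le_lt_trans h)// ltry.
elim: ls E mE cov => [|l ls IH] E mE cov.
  have -> : E = set0.
    by apply/seteqP; split => // q /cov[].
  by rewrite measure0 mul0r.
have mE1 := measurableI _ _ mE (measurable_strip l e).
have mE2 := measurableD mE (measurable_strip l e).
rewrite -(setDUK (_ : E `&` strip l e `<=` E)); last exact: subIsetl.
rewrite setDIr setDv set0U.
apply: (le_trans (@measureU2 _ _ _ sphere_param _ _ mE1 mE2)).
have -> : ((size (l :: ls))%:R * e)%:E = (e%:E + ((size ls)%:R * e)%:E)%E.
  by rewrite -EFinD /= -addn1 natrD; congr EFin; ring.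
apply: leeD.
  apply: le_trans (sphere_param_strip l e0).
  by apply: le_measure; rewrite ?inE//; exact: measurable_strip.
apply: IH => // q [Eq nq]; have [l'] := cov q Eq.
by rewrite inE => /orP[/eqP->//|l'ls] ?; exists l'.
Qed.

End SphereParam.

(** * Sublevel sets of linear forms and of polynomials lie in few slabs *)

Section LinearForms.
Context {R : realType}.
Local Notation C := R[i].

Definition pairing (l v : C * C) : C := l.1 * v.1 + l.2 * v.2.

Definition conj2 (v : C * C) : C * C := ((v.1)^*%C, (v.2)^*%C).

Definition dot3 (p q : R * R * R) : R :=
  p.1.1 * q.1.1 + p.1.2 * q.1.2 + p.2 * q.2.

Lemma sqn_conj2 v : sqn (conj2 v) = sqn v.
Proof. by rewrite /sqn /sq /conj2 /= !(reJ, imJ) !sqrrN. Qed.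

(** The relative size of a linear form at a point of the sphere measures the distance of that point
    from the zero of the form, which is the antipode of [hopf (conj2 l)]. *)
Lemma hopf_pairing l v : l != 0 -> v != 0 ->
  1 + dot3 (hopf (conj2 l)) (hopf v) = 2 * sq (pairing l v) / (sqn l * sqn v).
Proof.
rewrite -!sqn_gt0 => /lt0r_neq0 l0 /lt0r_neq0 v0.
rewrite /dot3 /hopf sqn_conj2 /conj2 /pairing /=.
move: l0 v0; rewrite /sqn /sq !(reD, imD, reM, imM, reJ, imJ) => l0 v0.
by field; rewrite v0 l0.
Qed.

Lemma hopf_surj (k : R * R * R) : sqnorm3 k = 1 ->
  exists l : C * C, sqn l = 1 /\ hopf (conj2 l) = k.
Proof.
case: k => [[x y] z]; rewrite /sqnorm3 /= => k1.
have [z1|z1] := eqVneq z (-1).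
  have : x ^+ 2 + y ^+ 2 = 0 by move: k1; rewrite z1 sqrrN expr1n; lra.
  move=> /eqP; rewrite paddr_eq0 ?sqr_ge0// !sqrf_eq0 => /andP[/eqP-> /eqP->].
  have E01 : conj2 (0, 1) = (0, 1).
    by rewrite /conj2 /=; congr pair; apply: complex_ext; rewrite /= ?oppr0.
  exists (0, 1); rewrite E01 /hopf /sqn /= sq0 sq1.
  by rewrite add0r !divr1; split => //; congr (_, _, _); [ring|ring|rewrite z1; ring].
have x2 := sqr_ge0 x; have y2 := sqr_ge0 y.
have zp : 0 < 1 + z.
  have : z ^+ 2 <= 1 by lra.
  rewrite -[leRHS](expr1n _ 2) -[leLHS]real_normK ?num_real// ler_sqr ?nnegrE//.
  by rewrite ler_norml => /andP[h _]; move: z1; lra.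
pose t := Num.sqrt ((1 + z) / 2).
have tt : t ^+ 2 = (1 + z) / 2 by rewrite sqr_sqrtr// ltW// divr_gt0.
have t0 : t != 0 by rewrite gt_eqF// sqrtr_gt0 divr_gt0.
exists (t%:C, (x / (2 * t)) +i* (y / (2 * t))).
have Sn : sqn (t%:C, (x / (2 * t)) +i* (y / (2 * t))) = 1.
  rewrite /sqn /sq /= expr0n addr0 !expr_div_n exprMn tt -mulrDl.
  have -> : x ^+ 2 + y ^+ 2 = (1 - z) * (1 + z) by move: k1; lra.
  by field; rewrite gt_eqF.
split => //; rewrite /hopf sqn_conj2 Sn; move: Sn; rewrite /sqn /conj2 /sq /= => Sn.
congr (_, _, _); rewrite divr1.
- by field.
- by field.
- by rewrite oppr0 sqrrN; lra.
Qed.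

(** Q Q^* = l, that is, Q is a nonzero scalar multiple of a unitary matrix; its Moebius map is a
    rotation. *)
Definition conformal (Q : 'M[C]_2) (l : R) : Prop :=
  [/\ 0 < l, sq (Q 0 0) + sq (Q 0 1) = l, sq (Q 1 0) + sq (Q 1 1) = l &
      Q 0 0 * (Q 1 0)^*%C + Q 0 1 * (Q 1 1)^*%C = 0].

Lemma conformal_cols Q l : conformal Q l ->
  [/\ sq (Q 0 0) + sq (Q 1 0) = l, sq (Q 0 1) + sq (Q 1 1) = l &
      (Q 0 0)^*%C * Q 0 1 + (Q 1 0)^*%C * Q 1 1 = 0].
Proof.
move=> [l0 e0 e1 e01].
have lC : (l%:C : C) != 0 by rewrite -sq_eq0 sq_real sqrf_eq0 gt_eqF.
have QQ : Q *m (l%:C^-1 *: (map_mx (@conjc R) Q)^T) = 1%:M.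
  apply/matrixP => i j; rewrite !mxE sum2 !mxE.
  have e10 : Q 1 0 * (Q 0 0)^*%C + Q 1 1 * (Q 0 1)^*%C = 0.
    rewrite -[LHS]conjcK rmorphD !rmorphM /= !conjcK -[RHS]conjc0 -e01.
    by congr (_ + _)^*%C; rewrite mulrC.
  case: i j => [[|[|]]//= i2] [[|[|]]//= j2] /=.
  - have -> : Ordinal i2 = 0 by exact: val_inj.
    have -> : Ordinal j2 = 0 by exact: val_inj.
    rewrite !(mulrCA _ l%:C^-1) -mulrDr !mulJ -rmorphD e0 mulVf//.
  - have -> : Ordinal i2 = 0 by exact: val_inj.
    have -> : Ordinal j2 = 1 by exact: val_inj.
    by rewrite !(mulrCA _ l%:C^-1) -mulrDr e01 mulr0.
  - have -> : Ordinal i2 = 1 by exact: val_inj.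
    have -> : Ordinal j2 = 0 by exact: val_inj.
    by rewrite !(mulrCA _ l%:C^-1) -mulrDr e10 mulr0.
  - have -> : Ordinal i2 = 1 by exact: val_inj.
    have -> : Ordinal j2 = 1 by exact: val_inj.
    rewrite !(mulrCA _ l%:C^-1) -mulrDr !mulJ -rmorphD e1 mulVf//.
have QQ' := mulmx1C QQ.
have ent i j : (Q 0 i)^*%C * Q 0 j + (Q 1 i)^*%C * Q 1 j = l%:C * (i == j)%:R.
  have /matrixP/(_ i j) := QQ'; rewrite !mxE sum2 !mxE => E.
  by rewrite -E mulrDr !mulrA divff// !mul1r.
have entR i : sq (Q 0 i) + sq (Q 1 i) = l.
  have := ent i i; rewrite eqxx mulr1 ![_^*%C * _]mulrC !mulJ -rmorphD.
  by move=> /(congr1 (@complex.Re R)).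
by split; [exact: entR|exact: entR|rewrite ent mulr0].
Qed.

Lemma sqn_conformal Q l v : conformal Q l -> sqn (lin2 Q v) = l * sqn v.
Proof.
move=> /conformal_cols[e0 e1 e01].
move: (congr1 (@complex.Re R) e01) (congr1 (@complex.Im R) e01).
rewrite !(reD, imD, reM, imM, reJ, imJ) /= => r01 i01.
rewrite /sqn mulrDr -{1}e0 -e1 /lin2 /=.
move: r01 i01; rewrite /sq !(reD, imD, reM, imM).
move: (complex.Re v.1) (complex.Im v.1) (complex.Re v.2) (complex.Im v.2) => a1 b1 a2 b2.
move: (complex.Re (Q 0 0)) (complex.Im (Q 0 0)) (complex.Re (Q 0 1)) (complex.Im (Q 0 1)) => x y z t.
move: (complex.Re (Q 1 0)) (complex.Im (Q 1 0)) (complex.Re (Q 1 1)) (complex.Im (Q 1 1)) => x' y' z' t' r i.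
apply/eqP; rewrite -subr_eq0.
set r01 := (_ + _) in r; set i01 := (_ + _) in i.
rewrite (_ : _ - _ = 2 * (a1 * a2 + b1 * b2) * r01 + 2 * (a2 * b1 - a1 * b2) * i01);
  last by rewrite /r01 /i01; ring.
by rewrite r i !mulr0 addr0.
Qed.

Definition pull (Q : 'M[C]_2) (l : C * C) : C * C :=
  (l.1 * Q 0 0 + l.2 * Q 1 0, l.1 * Q 0 1 + l.2 * Q 1 1).

Lemma pairing_lin2 Q l v : pairing l (lin2 Q v) = pairing (pull Q l) v.
Proof. by rewrite /pairing /lin2 /pull /=; ring. Qed.

Lemma sqn_pull Q l v : conformal Q l -> sqn (pull Q v) = l * sqn v.
Proof.
move=> [_ e0 e1 e01].
move: (congr1 (@complex.Re R) e01) (congr1 (@complex.Im R) e01).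
rewrite !(reD, imD, reM, imM, reJ, imJ) /= => r01 i01.
rewrite /sqn mulrDr -{1}e0 -e1 /pull /=.
move: r01 i01; rewrite /sq !(reD, imD, reM, imM).
move: (complex.Re v.1) (complex.Im v.1) (complex.Re v.2) (complex.Im v.2) => a1 b1 a2 b2.
move: (complex.Re (Q 0 0)) (complex.Im (Q 0 0)) (complex.Re (Q 0 1)) (complex.Im (Q 0 1)) => x y z t.
move: (complex.Re (Q 1 0)) (complex.Im (Q 1 0)) (complex.Re (Q 1 1)) (complex.Im (Q 1 1)) => x' y' z' t' r i.
apply/eqP; rewrite -subr_eq0.
set r01 := (_ + _) in r; set i01 := (_ + _) in i.
rewrite (_ : _ - _ = 2 * (a1 * a2 + b1 * b2) * r01 + 2 * (a1 * b2 - a2 * b1) * i01);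
  last by rewrite /r01 /i01; ring.
by rewrite r i !mulr0 addr0.
Qed.

(** If u and v are the unit vectors of the pulled-back form and of the point, smallness of the form
    gives 1 + <u, v> <= 2 e^2, so |u + v| <= 2 e; comparing third coordinates gives the slab. The
    rotation Q only changes where the slab lies, not its thickness. *)
Lemma small_form_strip Q lam l e q : conformal Q lam -> l != 0 -> 0 <= e ->
  sq (pairing l (lin2 Q (lift q))) <= e ^+ 2 * sqn l * sqn (lin2 Q (lift q)) ->
  strip (- (hopf (conj2 (pull Q l))).2) (2 * e) q.
Proof.
move=> cQ l0 e0; have [lam0 _ _ _] := cQ.
rewrite pairing_lin2 (sqn_conformal _ cQ).
have -> : e ^+ 2 * sqn l * (lam * sqn (lift q)) =
   e ^+ 2 * sqn (pull Q l) * sqn (lift q) by rewrite (sqn_pull _ cQ); ring.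
have p0 : pull Q l != 0 by rewrite -sqn_gt0 (sqn_pull _ cQ) mulr_gt0// sqn_gt0.
have v0 := lift_neq0 q; move=> h; split => //.
change (`|q.1 - - (hopf (conj2 (pull Q l))).2| <= 2 * e \/ ~~ (-1 <= q.1 <= 1)).
have := hopf_lift3 q; case: ifPn => [_ E|]; last by right.
left; rewrite opprK -E.
have := hopf_pairing p0 v0.
have c0 : conj2 (pull Q l) != 0 by rewrite -sqn_gt0 sqn_conj2 sqn_gt0.
have := sqnorm3_hopf v0; have := sqnorm3_hopf c0.
have : 2 * sq (pairing (pull Q l) (lift q)) / (sqn (pull Q l) * sqn (lift q)) <=
   2 * e ^+ 2.
  rewrite ler_pdivrMr; first by move: h; lra.
  by rewrite mulr_gt0// sqn_gt0.
move: (hopf _) (hopf _) => [[a b] c] [[x y] z]; rewrite /dot3 /sqnorm3 /=.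
move=> h1 h2 h3 h4; rewrite -ler_sqr ?nnegrE ?mulr_ge0// real_normK ?num_real//.
have := sqr_ge0 (x + a); have := sqr_ge0 (y + b); rewrite -h4 in h1.
by lra.
Qed.

(** Chosen so that d + 1 strips of half-width 2 [cap_size] have total mass at most 1/6, below the
    1/3 of [small_caps]. *)
Definition cap_size (d : nat) : R := (12 * d.+1%:R)^-1.

Definition cap_const (d : nat) : R := (cap_size d ^+ 2 / 4) ^+ d.+1.

Lemma cap_size_gt0 d : 0 < cap_size d.
Proof. by rewrite invr_gt0 mulr_gt0. Qed.

Lemma coef_prod_XsubC_le (rs : seq C) i :
  normc (\prod_(z <- rs) ('X - z%:P))`_i <= \prod_(z <- rs) (1 + normc z).
Proof.
elim: rs i => [|z rs IH] i.
  rewrite !big_nil coef1; case: (i == _); rewrite ?normc1 ?normc0//.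
rewrite !big_cons mulrBl coefB coefXM coefCM.
rewrite (le_trans (le_normcD _ _))// mulrDl mul1r lerD//.
  by case: (i == _); [rewrite normc0 prodr_ge0// => y _; rewrite addr_ge0 ?normc_ge0|exact: IH].
by rewrite normcN normcM ler_wpM2l ?normc_ge0.
Qed.

Lemma poly_split (p : {poly C}) : exists c rs,
  p = c *: \prod_(z <- rs) ('X - z%:P) /\ (p != 0 -> c != 0 /\ size p = (size rs).+1).
Proof.
have [rs E] := closed_field_poly_normal p.
exists (lead_coef p), rs; split => // p0; rewrite lead_coef_eq0; split => //.
by rewrite E size_scale ?lead_coef_eq0// size_prod_XsubC.
Qed.

Lemma hom_split d (c : C) rs (v : C * C) : (size rs <= d)%N ->
  hom d (c *: \prod_(z <- rs) ('X - z%:P)) v =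
  c * \prod_(z <- rs) (v.1 - z * v.2) * v.2 ^+ (d - size rs).
Proof.
move=> srs; have [v2|v2] := eqVneq v.2 0.
  case: v v2 => v1 v2 /= ->; rewrite hom_infty coefZ.
  have -> : \prod_(z <- rs) (v1 - z * 0) = v1 ^+ size rs.
    rewrite -iter_mulr_1 -count_predT -big_const_seq.
    by apply: eq_bigr => z _; rewrite mulr0 subr0.
  case: ltngtP srs => // [lt|<-] _.
    rewrite nth_default ?size_prod_XsubC ?mulr0 ?mul0r; last by [].
    by rewrite expr0n subn_eq0 leqNgt lt mulr0.
  rewrite subnn expr0 mulr1; congr (_ * _).
  have := monic_prod_XsubC rs xpredT id.
  by rewrite monicE lead_coefE size_prod_XsubC => /eqP->; rewrite mulr1.
rewrite hom_finite//; last first.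
  by rewrite (leq_trans (size_scale_leq _ _))// size_prod_XsubC.
rewrite hornerZ horner_prod mulrCA -mulrA; congr (_ * _).
rewrite -{1}(subnK srs) exprD -mulrA mulrC; congr (_ * _).
have -> : v.2 ^+ size rs = \prod_(z <- rs) v.2.
  by rewrite big_const_seq count_predT iter_mulr_1.
rewrite -big_split; apply: eq_bigr => z _ /=.
by rewrite hornerXsubC mulrBr mulrC divfK// mulrC.
Qed.

Lemma sq_prod (rs : seq C) (F : C -> C) :
  sq (\prod_(z <- rs) F z) = \prod_(z <- rs) sq (F z).
Proof. by elim: rs => [|z rs IH]; rewrite ?big_nil ?sq1// !big_cons sqM IH. Qed.

Lemma sqX (x : C) n : sq (x ^+ n) = sq x ^+ n.
Proof. by elim: n => [|n IH]; rewrite ?expr0 ?sq1// !exprS sqM IH. Qed.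

(** Split the form into d linear factors. Away from the slabs around their zeros each factor is at
    least [cap_size] times its norm, so the product is large compared with |c| times the product of
    the (1 + |z|), and this bounds every coefficient. The estimate is uniform in the position of the
    roots. *)
Lemma small_poly_cover d (p : {poly C}) (H : R) Q lam :
  conformal Q lam -> (size p <= d.+1)%N -> 0 < H -> (exists i, H <= normc p`_i) ->
  exists ls : seq R, (size ls <= d.+1)%N /\ forall q,
   let w := lin2 Q (lift q) in
   sq (hom d p w) <= H ^+ 2 * cap_const d * sqn w ^+ d ->
   exists2 l, l \in ls & strip l (2 * cap_size d) q.
Proof.
move=> cQ sp H0 [i Hi]; have [c [rs [pE]]] := poly_split p.
have p0 : p != 0.
  by apply: contraTneq Hi => ->; rewrite coef0 normc0 -ltNge.
move=> /(_ p0)[c0 srs].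
have srs' : (size rs <= d)%N by rewrite -ltnS -srs.
pose f l := - (hopf (conj2 (pull Q l))).2.
have e0 := cap_size_gt0 d.
(* The form (0, 1) stands for all zeros at infinity, the form (1, -z) for the root z. *)
exists (f (0, 1) :: [seq f (1, - z) | z <- rs]); split.
  by rewrite /= size_map.
move=> q w hw.
pose e := cap_size d.
have [h|h] := boolP (sq w.2 <= e ^+ 2 * sqn w).
  exists (f (0, 1)); first by rewrite mem_head.
  apply: (small_form_strip cQ) (ltW e0) _; first by rewrite -sqn_gt0 /sqn sq0 sq1 add0r.
  by rewrite /pairing /sqn /= mul0r mul1r add0r sq0 sq1 add0r mulr1.
have [/hasP[z zrs zw]|/hasPn nh] :=
    boolP (has (fun z => sq (w.1 - z * w.2) <= e ^+ 2 * (1 + sq z) * sqn w) rs).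
  exists (f (1, - z)); first by rewrite inE; apply/orP; right; apply/mapP; exists z.
  apply: (small_form_strip cQ) (ltW e0) _.
    by rewrite -sqn_gt0 /sqn /= sq1 ltr_pwDl// sq_ge0.
  rewrite /pairing /sqn /= mul1r mulNr sq1.
  by have -> : sq (- z) = sq z by rewrite /sq reN imN !sqrrN.
exfalso; move: hw; apply/negP; rewrite -ltNge.
have w0 : 0 < sqn w.
  by rewrite (sqn_conformal _ cQ); case: cQ => l0 _ _ _; rewrite mulr_gt0// sqn_gt0 lift_neq0.
have e20 : 0 < e ^+ 2 by rewrite exprn_gt0.
have e21 : e ^+ 2 <= 1.
  rewrite exprn_ile1// ?(ltW e0)// /e /cap_size invf_le1 ?mulr_gt0//.
  have : 1 <= (d.+1%:R : R) by rewrite ler1n.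
  by lra.
have es : 0 <= e ^+ 2 * sqn w by exact: mulr_ge0 (ltW e20) (ltW w0).
have low : (e ^+ 2 * sqn w) ^+ d * \prod_(z <- rs) (1 + sq z) <=
    \prod_(z <- rs) sq (w.1 - z * w.2) * sq w.2 ^+ (d - size rs).
  rewrite -{1}(subnK srs') exprD -mulrA mulrC ler_pM//.
  - apply: mulr_ge0; first exact: exprn_ge0.
    by apply: prodr_ge0 => z _; rewrite addr_ge0// sq_ge0.
  - exact: exprn_ge0.
  - have -> : (e ^+ 2 * sqn w) ^+ size rs = \prod_(z <- rs) (e ^+ 2 * sqn w).
      by rewrite big_const_seq count_predT iter_mulr_1.
    rewrite -big_split /= big_seq [leRHS]big_seq; apply: ler_prod => z zrs.
    rewrite (mulr_ge0 es (addr_ge0 ler01 (sq_ge0 z)))/=.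
    by have := nh z zrs; rewrite -ltNge mulrAC => /ltW.
  - rewrite lerXn2r ?nnegrE ?sq_ge0//.
    by move: h; rewrite -ltNge => /ltW.
have Hc : H ^+ 2 <= sq c * (4 ^+ d * \prod_(z <- rs) (1 + sq z)).
  have H1 : H <= normc c * \prod_(z <- rs) (1 + normc z).
    apply: (le_trans Hi); rewrite pE coefZ normcM ler_wpM2l ?normc_ge0//.
    exact: coef_prod_XsubC_le.
  have H2 : H ^+ 2 <= (normc c * \prod_(z <- rs) (1 + normc z)) ^+ 2.
    by rewrite ler_sqr ?nnegrE ?(ltW H0)// (le_trans (ltW H0)).
  apply: (le_trans H2); rewrite exprMn sq_normc ler_wpM2l ?sq_ge0//.
  rewrite -prodrXl.
  apply: (@le_trans _ _ (\prod_(z <- rs) (4 * (1 + sq z)))).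
    apply: ler_prod => z _; rewrite sqr_ge0 /= -sq_normc.
    have := sqr_ge0 (normc z); have := sqr_ge0 (normc z - 1); rewrite sqrrB sqrrD; lra.
  rewrite big_split /= big_const_seq count_predT iter_mulr_1 ler_wpM2r//.
    by apply: prodr_ge0 => z _; rewrite addr_ge0// sq_ge0.
  by rewrite ler_eXn2l// ltr1n.
rewrite pE hom_split// !sqM sq_prod sqX.
apply: (@lt_le_trans _ _ (sq c * ((e ^+ 2 * sqn w) ^+ d * \prod_(z <- rs) (1 + sq z)))); last first.
  by rewrite -!mulrA ler_wpM2l ?sq_ge0// mulrA.
apply: (@lt_le_trans _ _ (H ^+ 2 * ((e ^+ 2 / 4) ^+ d * sqn w ^+ d))).
  rewrite -mulrA ltr_pM2l ?exprn_gt0// ltr_pM2r ?exprn_gt0//.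
  (* The exponent d + 1 in [cap_const] carries one factor e^2 / 4 < 1 more than the estimate
     requires, which makes the inequality strict. *)
  rewrite /cap_const -/e exprS gtr_pMl ?exprn_gt0 ?divr_gt0//; lra.
apply: (le_trans (ler_wpM2r _ Hc)).
  by apply: mulr_ge0; apply: exprn_ge0; rewrite ?(ltW w0)// divr_ge0// ltW.
have f0 : (4 : R) ^+ d != 0 by rewrite expf_neq0.
rewrite [(e ^+ 2 * sqn w) ^+ d]exprMn [(e ^+ 2 / 4) ^+ d]expr_div_n.
rewrite le_eqVlt; apply/orP; left; apply/eqP.
by field.
Qed.

End LinearForms.

(** * Measurability of the maps between spheres *)

Section ComplexMeasurable.
Context {disp : measure_display} {T : measurableType disp} {R : realType}.
Local Notation C := R[i].
Implicit Types f g : T -> C.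

Definition mc f := measurable_fun setT (fun x => complex.Re (f x)) /\
  measurable_fun setT (fun x => complex.Im (f x)).

Lemma mc_cst (c : C) : mc (fun=> c).
Proof. by split; exact: measurable_cst. Qed.

Lemma mcD f g : mc f -> mc g -> mc (fun x => f x + g x).
Proof.
move=> [rf jf] [rg jg]; split.
- by under eq_fun do rewrite reD; exact: measurable_funD.
- by under eq_fun do rewrite imD; exact: measurable_funD.
Qed.

Lemma mcM f g : mc f -> mc g -> mc (fun x => f x * g x).
Proof.
move=> [rf jf] [rg jg]; split.
- by under eq_fun do rewrite reM; apply: measurable_funB; exact: measurable_funM.
- by under eq_fun do rewrite imM; apply: measurable_funD; exact: measurable_funM.
Qed.

Lemma mcX f n : mc f -> mc (fun x => f x ^+ n).
Proof.
move=> mf; elim: n => [|n IH]; first exact: mc_cst.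
by under eq_fun do rewrite exprS; exact: mcM.
Qed.

Lemma mc_sum (n : nat) (F : nat -> T -> C) : (forall i, mc (F i)) ->
  mc (fun x => \sum_(i < n) F i x).
Proof.
move=> mF; elim: n => [|n IH].
  by under eq_fun do rewrite big_ord0; exact: mc_cst.
by under eq_fun do rewrite big_ord_recr /=; exact: mcD.
Qed.

Lemma mc_hom d p f g : mc f -> mc g -> mc (fun x => hom d p (f x, g x)).
Proof.
move=> mf mg; rewrite /hom /=.
apply: (mc_sum _ (F := fun i x => p`_i * f x ^+ i * g x ^+ (d - i))) => i.
by apply: mcM; [apply: mcM; [exact: mc_cst|exact: mcX]|exact: mcX].
Qed.

Lemma measurable_sq f : mc f -> measurable_fun setT (fun x => sq (f x)).
Proof.
by move=> [rf jf]; apply: measurable_funD; exact: measurable_funX.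
Qed.

Lemma measurable_divr (f g : T -> R) : measurable_fun setT f ->
  measurable_fun setT g -> (forall x, 0 <= g x) ->
  measurable_fun setT (fun x => f x / g x).
Proof.
move=> mf mg g0; apply: measurable_funM => //.
have -> : (fun x => (g x)^-1) = (fun y : R => y `^ (-1)) \o g.
  by apply/funext => x /=; rewrite powR_inv1.
by apply: measurableT_comp => //; exact: measurable_powR.
Qed.

Lemma hopf_bm f g : mc f -> mc g -> (forall x, (f x, g x) != 0) ->
  [/\ bm (fun x => (hopf (f x, g x)).1.1), bm (fun x => (hopf (f x, g x)).1.2) &
      bm (fun x => (hopf (f x, g x)).2)].
Proof.
move=> mf mg fg0; have [rf jf] := mf; have [rg jg] := mg.
have mn : measurable_fun setT (fun x => sqn (f x, g x)).
  by apply: measurable_funD; exact: measurable_sq.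
have b1 x : [/\ `|(hopf (f x, g x)).1.1| <= 1, `|(hopf (f x, g x)).1.2| <= 1 &
      `|(hopf (f x, g x)).2| <= 1].
  have := sqnorm3_hopf (fg0 x); rewrite /sqnorm3.
  move: (hopf _) => [[y1 y2] y3] /= E.
  have := sqr_ge0 y1; have := sqr_ge0 y2; have := sqr_ge0 y3.
  have h (y : R) : y ^+ 2 <= 1 -> `|y| <= 1.
    by move=> y1'; rewrite -ler_sqr ?nnegrE// expr1n real_normK ?num_real.
  by move=> *; split; apply: h; lra.
split; split; try by exists 1 => x; case: (b1 x).
- apply: measurable_divr => // [|x]; last exact: sqn_ge0.
  apply: measurable_funM; first exact: measurable_cst.
  by apply: measurable_funD; exact: measurable_funM.
- apply: measurable_divr => // [|x]; last exact: sqn_ge0.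
  apply: measurable_funM; first exact: measurable_cst.
  by apply: measurable_funB; exact: measurable_funM.
- apply: measurable_divr => // [|x]; last exact: sqn_ge0.
  by apply: measurable_funB; exact: measurable_sq.
Qed.

End ComplexMeasurable.

Section LiftMeasurable.
Context {R : realType}.
Local Notation C := R[i].

Lemma mc_lift : mc (fun q : R * R => (lift q).1) /\ mc (fun q : R * R => (lift q).2).
Proof.
have mb : measurable_fun setT (fun q : R * R => -1 <= q.1 <= 1).
  by apply: measurable_and; apply: measurable_fun_ler.
have ms (g : R -> R) : continuous g -> measurable_fun setT (fun q : R * R => g q.1).
  move=> cg; apply: (measurableT_comp (f := g)) => //.
  exact: continuous_measurable_fun.
have mt (g : R -> R) : continuous g -> measurable_fun setT (fun q : R * R => g q.2).
  move=> cg; apply: (measurableT_comp (f := g)) => //.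
  exact: continuous_measurable_fun.
have cs (e : R) : continuous (fun h : R => Num.sqrt (1 + e * h)).
  move=> h; apply: (@continuous_comp _ _ _ (fun h => 1 + e * h) Num.sqrt); last exact: sqrt_continuous.
  by apply: cvgD; [exact: cvg_cst|apply: cvgM; [exact: cvg_cst|exact: cvg_id]].
have E1 (h : R) : Num.sqrt (1 + h) = Num.sqrt (1 + 1 * h) by rewrite mul1r.
have E2 (h : R) : Num.sqrt (1 - h) = Num.sqrt (1 + (-1) * h) by rewrite mulN1r.
split; split.
- have -> : (fun q : R * R => complex.Re (lift q).1) = fun q : R * R =>
     if -1 <= q.1 <= 1 then Num.sqrt (1 + 1 * q.1) * cos q.2 else 0.
    by apply/funext => q; rewrite /lift; case: ifPn => //= _; rewrite -E1.
  apply: measurable_fun_ifT => //.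
  apply: measurable_funM; first exact: (ms (fun h => Num.sqrt (1 + 1 * h))).
  by apply: mt; exact: continuous_cos.
- have -> : (fun q : R * R => complex.Im (lift q).1) = fun q : R * R =>
     if -1 <= q.1 <= 1 then Num.sqrt (1 + 1 * q.1) * sin q.2 else 0.
    by apply/funext => q; rewrite /lift; case: ifPn => //= _; rewrite -E1.
  apply: measurable_fun_ifT => //.
  apply: measurable_funM; first exact: (ms (fun h => Num.sqrt (1 + 1 * h))).
  by apply: mt; exact: continuous_sin.
- have -> : (fun q : R * R => complex.Re (lift q).2) = fun q : R * R =>
     if -1 <= q.1 <= 1 then Num.sqrt (1 + (-1) * q.1) else 1.
    by apply/funext => q; rewrite /lift; case: ifPn => //= _; rewrite -E2.
  apply: measurable_fun_ifT => //.
  exact: (ms (fun h => Num.sqrt (1 + (-1) * h))).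
- have -> : (fun q : R * R => complex.Im (lift q).2) = fun=> 0.
    by apply/funext => q; rewrite /lift; case: ifPn.
  exact: measurable_cst.
Qed.

Lemma integral_pushforward_sphere (Th : R * R -> R * R * R) (f : R * R * R -> R) :
  measurable_fun setT Th -> measurable_fun setT f -> (forall q, sphere (Th q)) ->
  bm (f \o Th) ->
  (\int[pushforward (@sphere_param R) Th]_(p in @sphere R) (f p)%:E)%E =
  (Ex sphere_param (f \o Th))%:E.
Proof.
move=> mTh mf sTh bf.
have msphere : measurable (@sphere R).
  have -> : @sphere R = (@sqnorm3 R) @^-1` [set 1] by [].
  rewrite -[X in measurable X]setTI.
  suff : measurable_fun setT (@sqnorm3 R) by apply=> //; exact: measurable_set1.
  apply: measurable_funD; last by apply: measurable_funX.
  apply: measurable_funD; apply: measurable_funX.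
    by apply: measurableT_comp.
  by apply: measurableT_comp.
have pre : Th @^-1` (@sphere R) = setT.
  by apply/seteqP; split => // q _; exact: sTh.
have int : sphere_param.-integrable setT (EFin \o (f \o Th)) by exact: bm_integrable.
transitivity (\int[sphere_param]_(x in Th @^-1` (@sphere R)) ((EFin \o f) \o Th) x)%E.
  apply: integral_pushforward => //; last by rewrite pre.
  exact/measurable_EFinP.
rewrite pre /Ex /Rintegral fineK//.
exact: integrable_fin_num.
Qed.

End LiftMeasurable.

(** * Moebius frames and Klein coordinates *)

Section Frames.
Context {R : realType}.
Local Notation C := R[i].

(** Minus the Klein-model coordinates of [hp b a]; the sign turns the Busemann factor 1 - <p, x>
    into 1 + <k, x>. *)
Definition klein (b : C) (a : R) : R * R * R :=
  let B := sq b + a ^+ 2 in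
  (- 2 * complex.Re b / (1 + B), - 2 * complex.Im b / (1 + B), (1 - B) / (1 + B)).

(** The map z |-> (z - b) / a in homogeneous coordinates; it moves [hp b a] to the origin. *)
Definition frame (b : C) (a : R) (w : C * C) : C * C := (w.1 - b * w.2, a%:C * w.2).

Lemma oneB_gt0 (b : C) (a : R) : 0 < 1 + (sq b + a ^+ 2).
Proof. by rewrite ltr_pwDl// addr_ge0 ?sq_ge0 ?sqr_ge0. Qed.

Lemma sqnorm3_klein b a : 1 - sqnorm3 (klein b a) = 4 * a ^+ 2 / (1 + (sq b + a ^+ 2)) ^+ 2.
Proof.
have n0 := lt0r_neq0 (oneB_gt0 b a); move: n0.
by rewrite /sqnorm3 /klein /= /sq => n0; field.
Qed.

Lemma klein_surj k : sqnorm3 k < 1 -> exists b a, 0 < a /\ klein b a = k.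
Proof.
case: k => [[x y] z]; rewrite /sqnorm3 /= => k1.
have x2 := sqr_ge0 x; have y2 := sqr_ge0 y.
have zp : 0 < 1 + z.
  have : z ^+ 2 < 1 by lra.
  rewrite -[ltRHS](expr1n _ 2) -[ltLHS]real_normK ?num_real// ltr_sqr ?nnegrE//.
  by rewrite ltr_norml => /andP[h _]; lra.
pose D := 1 - (x ^+ 2 + y ^+ 2 + z ^+ 2).
have D0 : 0 < D by rewrite /D; lra.
exists ((- x / (1 + z)) +i* (- y / (1 + z))), (Num.sqrt D / (1 + z)).
split; first by rewrite divr_gt0// sqrtr_gt0.
rewrite /klein /sq /= (expr_div_n (Num.sqrt D)) (sqr_sqrtr (ltW D0)).
have E : (- x / (1 + z)) ^+ 2 + (- y / (1 + z)) ^+ 2 + D / (1 + z) ^+ 2 =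
   (1 - z) / (1 + z) by rewrite /D; field; rewrite gt_eqF.
have E' : 1 + (1 - z) / (1 + z) = 2 / (1 + z) by field; rewrite gt_eqF.
by rewrite E E'; congr (_, _, _); field; rewrite gt_eqF.
Qed.

Lemma frame_neq0 b a w : 0 < a -> w != 0 -> frame b a w != 0.
Proof.
move=> a0; apply: contraNneq => -[/eqP e1 /eqP e2].
have aC : (a%:C : C) != 0 by rewrite -sq_eq0 sq_real sqrf_eq0 gt_eqF.
case: w e1 e2 => w1 w2 /= e1; rewrite mulf_eq0 (negbTE aC) /= => /eqP w20.
by move: e1; rewrite w20 mulr0 subr0 => /eqP ->.
Qed.

Lemma klein_denom b a w : 0 < a -> w != 0 ->
  1 + dot3 (klein b a) (hopf w) =
  2 * sqn (frame b a w) / ((1 + (sq b + a ^+ 2)) * sqn w).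
Proof.
move=> a0; rewrite -sqn_gt0 => /lt0r_neq0 w0; have B0 := lt0r_neq0 (oneB_gt0 b a).
move: w0 B0; rewrite /dot3 /klein /hopf /frame /sqn /sq /=.
rewrite !(reD, imD, reN, imN, reM, imM) /= => w0 B0.
by field; rewrite w0 B0.
Qed.

Definition frame_vec (b : C) (a : R) : (R * R * R) * (R * R * R) * (R * R * R) :=
  let n := 1 + (sq b + a ^+ 2) in
  ((2 * a / n, 0, 2 * a * complex.Re b / n), (0, 2 * a / n, 2 * a * complex.Im b / n),
   (- 2 * complex.Re b / n, - 2 * complex.Im b / n, (1 - (sq b - a ^+ 2)) / n)).

Definition quot3 (k s h : R * R * R) : R :=
  (dot3 k s + dot3 s h) / (1 + dot3 k h).

(** A Moebius map acts on the sphere as a Lorentz transformation, hence projectively: [klein_denom]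
    gives the common denominator and [frame_vec] the three numerators. *)
Lemma hopf_frame b a w : 0 < a -> w != 0 ->
  hopf (frame b a w) = (quot3 (klein b a) (frame_vec b a).1.1 (hopf w),
    quot3 (klein b a) (frame_vec b a).1.2 (hopf w),
    quot3 (klein b a) (frame_vec b a).2 (hopf w)).
Proof.
move=> a0 w0; rewrite /quot3 (klein_denom _ a0 w0).
have u0 : sqn (frame b a w) != 0 by rewrite gt_eqF// sqn_gt0 frame_neq0.
have B0 := lt0r_neq0 (oneB_gt0 b a).
have n0 : sqn w != 0 by rewrite gt_eqF// sqn_gt0.
have E (x y : R) : x = 2 * y / ((1 + (sq b + a ^+ 2)) * sqn w) ->
   y / sqn (frame b a w) = x / (2 * sqn (frame b a w) / ((1 + (sq b + a ^+ 2)) * sqn w)).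
  by move=> ->; field; rewrite B0 n0 u0.
rewrite /hopf; congr (_, _, _); apply: E; rewrite -/(hopf w);
  move: B0 n0; rewrite /dot3 /klein /hopf /frame_vec /frame /sqn /sq /=;
  rewrite !(reD, imD, reN, imN, reM, imM) /= => B0 n0; field; by rewrite B0 n0.
Qed.

(** The three numerators span, so mean 0 in the three coordinates is the same as [barycentric],
    which tests all s. *)
Lemma frame_vec_span b a s : 0 < a -> exists c1 c2 c3 : R,
  s = (c1 * (frame_vec b a).1.1.1.1 + c2 * (frame_vec b a).1.2.1.1 + c3 * (frame_vec b a).2.1.1,
       c1 * (frame_vec b a).1.1.1.2 + c2 * (frame_vec b a).1.2.1.2 + c3 * (frame_vec b a).2.1.2,
       c1 * (frame_vec b a).1.1.2 + c2 * (frame_vec b a).1.2.2 + c3 * (frame_vec b a).2.2).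
Proof.
case: s => [[x y] z] a0; have B0 := lt0r_neq0 (oneB_gt0 b a).
pose c3 := z - complex.Re b * x - complex.Im b * y.
exists (((1 + (sq b + a ^+ 2)) * x + 2 * complex.Re b * c3) / (2 * a)).
exists (((1 + (sq b + a ^+ 2)) * y + 2 * complex.Im b * c3) / (2 * a)), c3.
rewrite /frame_vec /= /c3; move: B0; rewrite /sq => B0.
by congr (_, _, _); field; rewrite B0 gt_eqF.
Qed.

(** The double cover SU(2) -> SO(3): a unitary matrix acts linearly on the Hopf coordinates, so it
    preserves the condition of having mean 0. *)
Lemma conformal_rotation Q l : conformal Q l -> exists r1 r2 r3 : R * R * R,
  forall v : C * C, v != 0 -> hopf (lin2 Q v) =
    (dot3 r1 (hopf v), dot3 r2 (hopf v), dot3 r3 (hopf v)).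
Proof.
move=> cQ; have [l0 e0 e1 e01] := cQ.
pose al := Q 0 0 * (Q 1 0)^*%C.
pose be := Q 0 0 * (Q 1 1)^*%C.
pose ga := Q 0 1 * (Q 1 0)^*%C.
pose de := Q 0 0 * (Q 0 1)^*%C - Q 1 0 * (Q 1 1)^*%C.
exists ((complex.Re be + complex.Re ga) / l, - (complex.Im be - complex.Im ga) / l,
        2 * complex.Re al / l).
exists ((complex.Im be + complex.Im ga) / l, (complex.Re be - complex.Re ga) / l,
        2 * complex.Im al / l).
exists (complex.Re de / l, - complex.Im de / l, (sq (Q 0 0) - sq (Q 1 0)) / l).
move=> v; rewrite -sqn_gt0 => /lt0r_neq0 v0.
have l0' : l != 0 by rewrite gt_eqF.
rewrite /hopf (sqn_conformal _ cQ) /dot3 /al /be /ga /de /=.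
have r01 := congr1 (@complex.Re R) e01; have i01 := congr1 (@complex.Im R) e01.
have d : sq (Q 0 0) + sq (Q 0 1) - (sq (Q 1 0) + sq (Q 1 1)) = 0 by rewrite e0 e1 subrr.
move: r01 i01 d; rewrite /sq !(reD, imD, reM, imM, reN, imN, reJ, imJ) /=.
move: (complex.Re (Q 0 0)) (complex.Im (Q 0 0)) (complex.Re (Q 0 1)) (complex.Im (Q 0 1)) => x y z t.
move: (complex.Re (Q 1 0)) (complex.Im (Q 1 0)) (complex.Re (Q 1 1)) (complex.Im (Q 1 1)) => x' y' z' t'.
move: v0; rewrite /sqn /sq.
move: (complex.Re v.1) (complex.Im v.1) (complex.Re v.2) (complex.Im v.2) => a1 b1 a2 b2 v0.
set n := a1 ^+ 2 + b1 ^+ 2 + (a2 ^+ 2 + b2 ^+ 2) in v0 *.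
move=> r01 i01 d.
set R0 := (_ + _) in r01; set I0 := (_ + _) in i01; set D0 := (_ - _) in d.
have K (p q : R) : (exists c1 c2 c3, p = q + c1 * R0 + c2 * I0 + c3 * D0) -> p = q.
  by move=> [c1 [c2 [c3 ->]]]; rewrite r01 i01 d !mulr0 !addr0.
congr (_, _, _); apply: K.
- exists (2 * (a2 ^+ 2 + b2 ^+ 2) / (l * n)), 0, 0.
  by rewrite /R0 /I0 /D0; field; rewrite v0 l0'.
- exists 0, (2 * (a2 ^+ 2 + b2 ^+ 2) / (l * n)), 0.
  by rewrite /R0 /I0 /D0; field; rewrite v0 l0'.
- exists 0, 0, ((a2 ^+ 2 + b2 ^+ 2) / (l * n)).
  by rewrite /R0 /I0 /D0; field; rewrite v0 l0'.
Qed.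

Lemma mx2_unit (a : R) (b : C) : 0 < a -> mx2 a%:C b 0 1 \in unitmx.
Proof.
move=> a0; rewrite unitmxE det22 !mxE /= mulr1 mulr0 subr0 unitfE.
by rewrite -sq_eq0 sq_real sqrf_eq0 gt_eqF.
Qed.

Lemma moebius_origin (b : C) (a : R) : 0 < a ->
  moebius_ball (mx2 a%:C b 0 1) (val (origin R)) = val (hp b a).
Proof.
move=> a0; rewrite origin_hp moebius_ball_hp// val_hp// /hp_val /gram !mxE !sum2 !mxE /=.
rewrite !(mulr0, mulr1, mul0r, add0r, addr0) sq0 sq1 sq_real add0r addrC.
congr bpt; apply: complex_ext; rewrite !(reD, imD, reM, imM) /=; ring.
Qed.

(** M and z |-> a z + b take the origin to the same point, so by [bpt_inj] their Gram matrices are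
    proportional and they differ by a rotation Q on the right. *)
Lemma conformal_origin (M : 'M[C]_2) (b : C) (a : R) : M \in unitmx -> 0 < a ->
  moebius_ball M (val (origin R)) = val (hp b a) ->
  exists Q l, conformal Q l /\ forall v, lin2 M v =
    (a%:C * (lin2 Q v).1 + b * (lin2 Q v).2, (lin2 Q v).2).
Proof.
move=> uM a0; rewrite origin_hp moebius_ball_hp// val_hp//.
have -> : M *m mx2 1%:C 0 0 1 = M.
  have -> : mx2 1%:C 0 0 1 = 1%:M :> 'M[C]_2.
    apply/matrixP => i j; rewrite !mxE.
    by case: i j => [[|[|]]//= ?] [[|[|]]//= ?].
  by rewrite mulmx1.
have [g1 g2 g3] := gram_gt0 uM; have [h0 D _] := hp_val_disc b a0.
move=> /(bpt_inj g1 g2 g3 h0 ltr01 D)[l l0 []]; rewrite /gram /= mulr1 => E0 E1 E01.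
have aC : (a%:C : C) != 0 by rewrite -sq_eq0 sq_real sqrf_eq0 gt_eqF.
exists (mx2 ((M 0 0 - b * M 1 0) / a%:C) ((M 0 1 - b * M 1 1) / a%:C) (M 1 0) (M 1 1)), l.
split; last first.
  by move=> v; rewrite /lin2 !mxE /=; congr pair; field.
have aV : (a%:C : C)^-1 = (a^-1)%:C by rewrite fmorphV.
rewrite aV; split => //; rewrite ?mxE /=.
- rewrite !sqM sq_real -mulrDl exprVn.
  apply: (mulIf (_ : a ^+ 2 != 0)); first by rewrite expf_neq0// gt_eqF.
  rewrite mulfVK ?expf_neq0 ?gt_eqF//.
  have r01 := congr1 (@complex.Re R) E01; have i01 := congr1 (@complex.Im R) E01.
  move: r01 i01 E0 E1; rewrite /sq !(reD, imD, reM, imM, reN, imN, reJ, imJ) /=.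
  move: (complex.Re (M 0 0)) (complex.Im (M 0 0)) (complex.Re (M 0 1)) (complex.Im (M 0 1)) => x y z t.
  move: (complex.Re (M 1 0)) (complex.Im (M 1 0)) (complex.Re (M 1 1)) (complex.Im (M 1 1)) => x' y' z' t'.
  move: (complex.Re b) (complex.Im b) => b1 b2 e1 e2 e3 e4.
  transitivity ((x ^+ 2 + y ^+ 2 + (z ^+ 2 + t ^+ 2)) +
    (b1 ^+ 2 + b2 ^+ 2) * (x' ^+ 2 + y' ^+ 2 + (z' ^+ 2 + t' ^+ 2))
    - 2 * b1 * (x * x' - y * - y' + (z * z' - t * - t'))
    - 2 * b2 * (x * - y' + y * x' + (z * - t' + t * z'))); first by ring.
  by rewrite e1 e2 e3 e4; ring.
- exact: E1.
- transitivity ((a^-1)%:C * ((M 0 0 * (M 1 0)^*%C + M 0 1 * (M 1 1)^*%C) -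
     b * (M 1 0 * (M 1 0)^*%C + M 1 1 * (M 1 1)^*%C))); first by ring.
  by rewrite E01 !mulJ -rmorphD E1 mulrC [b * _]mulrC subrr mul0r.
Qed.

Lemma conformal_to_origin (M : 'M[C]_2) (b : C) (a : R) : M \in unitmx -> 0 < a ->
  moebius_ball M (val (hp b a)) = val (origin R) ->
  exists Q l, conformal Q l /\
    forall v, lin2 Q (frame b a v) = (a%:C * (lin2 M v).1, a%:C * (lin2 M v).2).
Proof.
move=> uM a0; rewrite moebius_ball_hp// origin_hp val_hp//.
set Q := M *m _.
have uQ : Q \in unitmx by rewrite unitmx_mul uM mx2_unit.
have [g1 g2 g3] := gram_gt0 uQ; have [h0 D _] := hp_val_disc 0 (@ltr01 R).
move=> /(bpt_inj g1 g2 g3 h0 ltr01 D)[l l0 []].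
rewrite /gram /= sq0 add0r expr1n !mulr1 mulr0 => E0 E1 E01.
exists Q, l; split; first by split.
move=> v; rewrite /lin2 /frame /Q /= !mxE !sum2 !mxE /=.
by congr pair; ring.
Qed.

Lemma moebius_frame (b : C) (a : R) : 0 < a ->
  mx2 1 (- b) 0 a%:C \in unitmx /\
  moebius_ball (mx2 1 (- b) 0 a%:C) (val (hp b a)) = val (origin R).
Proof.
move=> a0; have aC : (a%:C : C) != 0 by rewrite -sq_eq0 sq_real sqrf_eq0 gt_eqF.
split; first by rewrite unitmxE det22 !mxE /= mul1r mulr0 subr0 unitfE.
rewrite moebius_ball_hp// /gram !mxE !sum2 !mxE /=.
rewrite !(mul1r, mulr1, mulr0, mul0r, addr0, add0r) addrN sq0 addr0 add0r mul0r addr0.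
have -> : a%:C * ((- 0 - 0) -i* 0) = 0.
  by apply: complex_ext; rewrite !(reM, imM) /=; ring.
by rewrite /bpt /= subrr !mulr0 !mul0r.
Qed.

(** After the similarity by (w0, rr) this is the distance from the origin in the Klein model; it
    turns a lower bound for 1 - |k|^2 into a bound on the distance. *)
Lemma cdist_klein (w0 b : C) (rr a : R) : 0 < rr -> 0 < a ->
  cdist (w0 + rr%:C * b) (rr * a) w0 rr ^+ 2 = (1 - sqnorm3 (klein b a))^-1.
Proof.
move=> r0 a0; rewrite sqnorm3_klein /cdist.
have -> : w0 + rr%:C * b - w0 = rr%:C * b by ring.
rewrite sqM sq_real.
have B0 := lt0r_neq0 (oneB_gt0 b a).
by field; rewrite B0 !gt_eqF.
Qed.

Lemma hom_affine d (p : {poly C}) (a b : C) (w : C * C) : a != 0 ->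
  (size p <= d.+1)%N ->
  hom d p (a * w.1 + b * w.2, w.2) = hom d (p \Po (a *: 'X + b%:P)) w.
Proof.
move=> a0 sp.
have s2 : size (a *: 'X + b%:P) = 2%N.
  by rewrite size_polyDl size_scale// size_polyX// ltnS size_polyC_leq1.
have [w0|w0] := eqVneq w.2 0; last first.
  rewrite !hom_finite ?size_comp_poly2// horner_comp !hornerE.
  by congr (_ * _.[_]) => /=; field.
case: w w0 => w1 w2 /= ->; rewrite mulr0 addr0 !hom_infty.
rewrite exprMn mulrA; congr (_ * _).
rewrite coef_comp_poly.
have sX i : size ((a *: 'X + b%:P) ^+ i) = i.+1.
  have q0 : a *: 'X + b%:P != 0 by rewrite -size_poly_gt0 s2.
  have := size_exp (a *: 'X + b%:P) i; rewrite s2 mul1n => E.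
  by rewrite -[in RHS]E prednK// size_poly_gt0 expf_neq0.
have lX : ((a *: 'X + b%:P) ^+ d)`_d = a ^+ d.
  have : lead_coef ((a *: 'X + b%:P) ^+ d) = a ^+ d.
    rewrite lead_coef_exp; congr (_ ^+ _).
    rewrite lead_coefDl ?size_scale ?size_polyX ?ltnS ?size_polyC_leq1//.
    by rewrite lead_coefZ lead_coefX mulr1.
  by rewrite lead_coefE sX.
move: sp; rewrite leq_eqVlt => /orP[/eqP E|lt].
  rewrite E big_ord_recr /= lX big1 ?add0r// => i _.
  by rewrite [X in _ * X]nth_default ?mulr0// sX.
rewrite nth_default ?mul0r// big1// => i _.
by rewrite [X in _ * X]nth_default ?mulr0// sX (leq_trans (ltn_ord i)).
Qed.

Lemma homD d (p q : {poly C}) (v : C * C) : hom d (p + q) v = hom d p v + hom d q v.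
Proof.
by rewrite /hom -big_split; apply: eq_bigr => i _ /=; rewrite coefD; ring.
Qed.

Lemma homZ d (c : C) (p : {poly C}) (v : C * C) : hom d (c *: p) v = c * hom d p v.
Proof.
by rewrite /hom big_distrr; apply: eq_bigr => i _ /=; rewrite coefZ; ring.
Qed.

Lemma hom_bound d (p : {poly C}) (H : R) (v : C * C) :
  (forall i, (i <= d)%N -> normc p`_i <= H) ->
  sq (hom d p v) <= (d.+1%:R * H) ^+ 2 * sqn v ^+ d.
Proof.
move=> pH; pose t := Num.sqrt (sqn v).
have t0 : 0 <= t by exact: sqrtr_ge0.
have tt : t ^+ 2 = sqn v by rewrite sqr_sqrtr// sqn_ge0.
have H0 : 0 <= H by rewrite (le_trans _ (pH 0%N isT))// normc_ge0.
have v1 : normc v.1 <= t.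
  by rewrite normcE ler_wsqrtr// lerDl sq_ge0.
have v2 : normc v.2 <= t.
  by rewrite normcE ler_wsqrtr// lerDr sq_ge0.
have h : normc (hom d p v) <= d.+1%:R * H * t ^+ d.
  rewrite /hom (le_trans (normc_sum _ _ _))//.
  apply: (@le_trans _ _ (\sum_(i < d.+1) H * t ^+ d)); last first.
    by rewrite sumr_const card_ord -[leLHS]mulr_natl mulrA.
  apply: ler_sum => i _; rewrite !normcM !normcX.
  have id : (i <= d)%N by rewrite -ltnS.
  have -> : t ^+ d = t ^+ i * t ^+ (d - i) by rewrite -exprD subnKC.
  rewrite mulrA ler_pM ?mulr_ge0 ?exprn_ge0 ?normc_ge0//.
    by rewrite ler_pM ?exprn_ge0 ?normc_ge0 ?pH// lerXn2r ?nnegrE ?normc_ge0.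
  by rewrite lerXn2r ?nnegrE ?normc_ge0.
rewrite -sq_normc -tt -exprM mulnC exprM -exprMn ler_sqr ?nnegrE ?normc_ge0//.
by rewrite !mulr_ge0// exprn_ge0.
Qed.

End Frames.

(** * The barycentric extension *)

Section BaryExt.
Context {R : realType}.
Local Notation C := R[i].
Variables (num den : {poly C}) (d : nat).
Hypothesis size_nd : maxn (size num) (size den) = d.+1.
Hypothesis cop : coprimep num den.

Let sn : (size num <= d.+1)%N. Proof. by rewrite -size_nd leq_maxl. Qed.
Let sd : (size den <= d.+1)%N. Proof. by rewrite -size_nd leq_maxr. Qed.

(** Coprimality excludes a common finite zero, and attaining the degree d excludes a common zero at
    infinity. *)
Lemma hom_pair_neq0 v : v != 0 -> (hom d num v, hom d den v) != 0.
Proof.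
move=> v0; apply/negP => /eqP[e1 e2].
have [v20|v20] := eqVneq v.2 0.
  case: v v0 v20 e1 e2 => v1 v2 /= v0 v20; rewrite v20 !hom_infty => /eqP e1 /eqP e2.
  have v10 : v1 ^+ d != 0.
    by move: v0; rewrite v20 xpair_eqE eqxx andbT => ?; rewrite expf_neq0.
  move: e1 e2; rewrite !mulf_eq0 (negbTE v10) !orbF => e1 e2.
  have lt (p : {poly C}) : p`_d == 0 -> (size p <= d.+1)%N -> (size p <= d)%N.
    move=> pd; rewrite leq_eqVlt => /orP[/eqP E|//].
    move: pd; have -> : p`_d = lead_coef p by rewrite lead_coefE E.
    by rewrite lead_coef_eq0 => /eqP p0; move: E; rewrite p0 size_poly0.
  have : (maxn (size num) (size den) <= d)%N by rewrite geq_max !lt.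
  by rewrite size_nd ltnn.
move: e1 e2; rewrite !hom_finite// => /eqP e1 /eqP e2.
have vd : v.2 ^+ d != 0 by rewrite expf_neq0.
move: e1 e2; rewrite !mulf_eq0 (negbTE vd) /= => e1 e2.
by have := coprimep_root cop e1; rewrite (eqP e2) eqxx.
Qed.

Definition img (M : 'M[C]_2) (q : R * R) : C * C :=
  (hom d num (lin2 M (lift q)), hom d den (lin2 M (lift q))).

Lemma img_neq0 M q : M \in unitmx -> img M q != 0.
Proof. by move=> uM; apply: hom_pair_neq0; apply: lin2_neq0 => //; exact: lift_neq0. Qed.

Lemma mc_img M : mc (fun q => (img M q).1) /\ mc (fun q => (img M q).2).
Proof.
have [m1 m2] := @mc_lift R.
have l i : mc (fun q => M i 0 * (lift q).1 + M i 1 * (lift q).2).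
  by apply: mcD; apply: mcM => //; exact: mc_cst.
by split; apply: mc_hom; exact: l.
Qed.

Definition image_measure (M : 'M[C]_2) : set (R * R * R) -> \bar R :=
  pushforward (pushforward (@sphere_measure R) (on_sphere (moebius M)))
    (on_sphere (rat_eval num den)).

Lemma integral_image M M' (f : R * R * R -> R) : M \in unitmx -> M' \in unitmx ->
  measurable_fun setT f -> bm (fun q => f (hopf (lin2 M' (img M q)))) ->
  (\int[pushforward (image_measure M) (on_sphere (moebius M'))]_(p in @sphere R)
      (f p)%:E)%E = (Ex sphere_param (fun q => f (hopf (lin2 M' (img M q)))))%:E.
Proof.
move=> uM uM' mf bf.
pose Th := on_sphere (moebius M') \o on_sphere (rat_eval num den) \o
           on_sphere (moebius M) \o @cylinder R.
have ThE : Th = fun q => hopf (lin2 M' (img M q)).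
  apply/funext => q; rewrite /Th /= on_sphere_cylinder on_sphere_moebius ?lift_neq0//.
  have l0 := lin2_neq0 uM (lift_neq0 q).
  rewrite (@on_sphere_rat _ _ _ d) ?size_nd ?hom_pair_neq0//.
  by rewrite on_sphere_moebius// hom_pair_neq0.
have [m1 m2] := mc_img M.
have l i : mc (fun q => M' i 0 * (img M q).1 + M' i 1 * (img M q).2).
  by apply: mcD; apply: mcM => //; exact: mc_cst.
have n0 q : lin2 M' (img M q) != 0 by rewrite lin2_neq0// img_neq0.
have [b1 b2 b3] := hopf_bm (l 0) (l 1) n0.
have -> : (\int[pushforward (image_measure M) (on_sphere (moebius M'))]_(p in @sphere R)
      (f p)%:E)%E = (\int[pushforward (@sphere_param R) Th]_(p in @sphere R) (f p)%:E)%E.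
  by [].
rewrite ThE; apply: integral_pushforward_sphere => //.
- apply/measurable_fun_pairP; split; last exact: b3.1.
  by apply/measurable_fun_pairP; split; [exact: b1.1|exact: b2.1].
- by move=> q; rewrite /sphere /= sqnorm3_hopf.
Qed.

Definition centered (V : R * R -> C * C) : Prop :=
  [/\ Ex sphere_param (fun q => (hopf (V q)).1.1) = 0,
      Ex sphere_param (fun q => (hopf (V q)).1.2) = 0 &
      Ex sphere_param (fun q => (hopf (V q)).2) = 0].

Lemma mpr11 : measurable_fun setT (fun p : R * R * R => p.1.1).
Proof. by apply: measurableT_comp. Qed.
Lemma mpr12 : measurable_fun setT (fun p : R * R * R => p.1.2).
Proof. by apply: measurableT_comp. Qed.

Lemma lin2_bm M' M : M \in unitmx -> M' \in unitmx ->
  [/\ bm (fun q => (hopf (lin2 M' (img M q))).1.1),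
      bm (fun q => (hopf (lin2 M' (img M q))).1.2) &
      bm (fun q => (hopf (lin2 M' (img M q))).2)].
Proof.
move=> uM uM'; have [m1 m2] := mc_img M.
have l i : mc (fun q => M' i 0 * (img M q).1 + M' i 1 * (img M q).2).
  by apply: mcD; apply: mcM => //; exact: mc_cst.
have n0 q : lin2 M' (img M q) != 0 by rewrite lin2_neq0// img_neq0.
exact: (hopf_bm (l 0) (l 1) n0).
Qed.

Lemma lin2_frame (b : C) (a : R) v : lin2 (mx2 1 (- b) 0 a%:C) v = frame b a v.
Proof. by rewrite /lin2 /frame !mxE /=; congr pair; ring. Qed.

(** All Moebius maps taking the point to the origin differ by rotations ([conformal_to_origin],
    [conformal_rotation]), so it is enough to test the explicit [frame]. *)
Lemma is_barycenterP M b a : M \in unitmx -> 0 < a ->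
  is_barycenter (image_measure M) (hp b a) <-> centered (fun q => frame b a (img M q)).
Proof.
move=> uM a0; have [uF Fo] := moebius_frame b a0; split.
  move=> /(_ _ uF Fo).
  have [b1 b2 b3] := lin2_bm uM uF.
  rewrite /= !integral_image//; [|exact: mpr12|exact: mpr11].
  have -> : (fun q => frame b a (img M q)) =
      fun q => lin2 (mx2 1 (- b) 0 a%:C) (img M q).
    by apply/funext => q; rewrite lin2_frame.
  by move=> [[e1] [e2] [e3]]; split.
move=> [c1 c2 c3] M' uM' M'o /=.
have [b1 b2 b3] := lin2_bm uM uM'.
rewrite !integral_image//; [|exact: mpr12|exact: mpr11].
have [Q [l [cQ QE]]] := conformal_to_origin uM' a0 M'o.
have [r1 [r2 [r3 rE]]] := conformal_rotation cQ.
have aC : (a%:C : C) != 0 by rewrite -sq_eq0 sq_real sqrf_eq0 gt_eqF.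
have E q : hopf (lin2 M' (img M q)) = (dot3 r1 (hopf (frame b a (img M q))),
   dot3 r2 (hopf (frame b a (img M q))), dot3 r3 (hopf (frame b a (img M q)))).
  by rewrite -(hopf_scale _ aC) -QE rE// frame_neq0// img_neq0.
have [f1 f2 f3] := lin2_bm uM uF.
have D (r : R * R * R) : Ex sphere_param (fun q => dot3 r (hopf (frame b a (img M q)))) = 0.
  have F (g : R * R * R -> R) : bm (fun q => g (hopf (lin2 (mx2 1 (- b) 0 a%:C) (img M q)))) ->
      bm (fun q => g (hopf (frame b a (img M q)))).
    by under eq_fun do rewrite lin2_frame.
  have {}f1 := F (fun p => p.1.1) f1; have {}f2 := F (fun p => p.1.2) f2.
  have {}f3 := F (fun p => p.2) f3.
  rewrite /dot3 ExD; [|by apply: bmD; exact: bmZ|exact: bmZ].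
  rewrite ExD; [|exact: bmZ|exact: bmZ].
  by rewrite !ExZ// c1 c2 c3 !mulr0 !addr0.
split; congr EFin; [rewrite -[RHS](D r1)|rewrite -[RHS](D r2)|rewrite -[RHS](D r3)].
- by congr Ex; apply/funext => q; rewrite E.
- by congr Ex; apply/funext => q; rewrite E.
- by congr Ex; apply/funext => q; rewrite E.
Qed.

End BaryExt.

Section KleinFrame.
Context {R : realType}.
Local Notation C := R[i].
Variable W : R * R -> C * C.
Hypotheses (mW1 : mc (fun q => (W q).1)) (mW2 : mc (fun q => (W q).2)).
Hypothesis W0 : forall q, W q != 0.

Definition hx q := (hopf (W q)).1.1.
Definition hy q := (hopf (W q)).1.2.
Definition hz q := (hopf (W q)).2.

Lemma hopfW_bm : [/\ bm hx, bm hy & bm hz].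
Proof.
have e q : W q = ((W q).1, (W q).2) by case: (W q).
have n0 q : ((W q).1, (W q).2) != 0 by rewrite -e.
have [b1 b2 b3] := hopf_bm mW1 mW2 n0.
by rewrite /hx /hy /hz; split; under eq_fun do rewrite e.
Qed.

Lemma hopfW_unit q : hx q ^+ 2 + hy q ^+ 2 + hz q ^+ 2 = 1.
Proof. exact: sqnorm3_hopf. Qed.

Lemma klein_lt1 (b : C) (a : R) : 0 < a -> sqnorm3 (klein b a) < 1.
Proof.
by move=> a0; rewrite -subr_gt0 sqnorm3_klein divr_gt0 ?mulr_gt0 ?exprn_gt0// oneB_gt0.
Qed.

Lemma centered_klein (b : C) (a : R) : 0 < a ->
  centered (fun q => frame b a (W q)) <->
  barycentric sphere_param hx hy hz (klein b a).
Proof.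
move=> a0; have [bx by_ bz] := hopfW_bm.
have FE q := hopf_frame b a0 (W0 q).
split; last first.
  by move=> bar; split; [rewrite -[RHS](bar (frame_vec b a).1.1)|
    rewrite -[RHS](bar (frame_vec b a).1.2)|rewrite -[RHS](bar (frame_vec b a).2)];
    congr Ex; apply/funext => q; rewrite FE.
move=> [c1 c2 c3] s; have [x1 [x2 [x3 sE]]] := frame_vec_span b s a0.
pose f v q := quot3 (klein b a) v (hopf (W q)).
have bf v : bm (f v).
  apply: (bm_quotient bx by_ bz hopfW_unit).
  exact: klein_lt1.
have E1 : Ex sphere_param (f (frame_vec b a).1.1) = 0.
  by rewrite -[RHS]c1; congr Ex; apply/funext => q; rewrite FE.
have E2 : Ex sphere_param (f (frame_vec b a).1.2) = 0.
  by rewrite -[RHS]c2; congr Ex; apply/funext => q; rewrite FE.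
have E3 : Ex sphere_param (f (frame_vec b a).2) = 0.
  by rewrite -[RHS]c3; congr Ex; apply/funext => q; rewrite FE.
transitivity (Ex sphere_param (fun q => x1 * f (frame_vec b a).1.1 q +
    x2 * f (frame_vec b a).1.2 q + x3 * f (frame_vec b a).2 q)).
  congr Ex; apply/funext => q; rewrite [in LHS]sE /f /quot3 /affine /dot3 /hx /hy /hz /=.
  ring.
have bfZ x v : bm (fun q => x * f v q) by exact: (bmZ x (bf v)).
rewrite ExD; [|by apply: bmD; exact: bfZ|exact: bfZ].
rewrite ExD; [|exact: bfZ|exact: bfZ].
have Z x v : Ex sphere_param (f v) = 0 -> Ex sphere_param (fun q => x * f v q) = 0.
  move=> e; transitivity (x * Ex sphere_param (f v)); last by rewrite e mulr0.
  exact: (@ExZ _ _ _ sphere_param x (f v) (bf v)).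
by rewrite (Z _ _ E1) (Z _ _ E2) (Z _ _ E3) !addr0.
Qed.

End KleinFrame.

(** * The barycentric extension lies near the point read off from the coefficients *)

Section Quantitative.
Context {R : realType}.
Local Notation C := R[i].

(** The 9 comes from the coefficient bound Hh / 3, the (d + 1)^2 from estimating a form by its d + 1
    coefficients. *)
Definition cap_level (d : nat) : R := cap_const d / (9 * d.+1%:R ^+ 2).

Lemma cap_level_gt0 d : 0 < cap_level d.
Proof.
rewrite divr_gt0 ?mulr_gt0 ?exprn_gt0//.
by rewrite divr_gt0 ?exprn_gt0 ?cap_size_gt0.
Qed.

Lemma cap_level_le1 d : cap_level d <= 1.
Proof.
have d1 : 1 <= (d.+1%:R : R) by rewrite ler1n.
have e1 : cap_size d <= (1 : R).
  by rewrite invf_le1 ?mulr_gt0//; lra.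
have e0 := @cap_size_gt0 R d.
have e2 : cap_size d ^+ 2 <= (1 : R) by rewrite exprn_ile1// ltW.
have c1 : cap_const d <= (1 : R).
  rewrite exprn_ile1//; last by lra.
  by rewrite divr_ge0// sqr_ge0.
rewrite ler_pdivrMr ?mulr_gt0 ?exprn_gt0// mul1r (le_trans c1)//.
have : 1 <= (d.+1%:R : R) ^+ 2 by rewrite exprn_ege1.
by lra.
Qed.

Variables (num den : {poly C}) (d : nat).
Hypothesis size_nd : maxn (size num) (size den) = d.+1.
Hypothesis cop : coprimep num den.
Variables (b : C) (a : R).
Hypothesis a0 : 0 < a.
Let N := num \Po (a%:C *: 'X + b%:P).
Let D := den \Po (a%:C *: 'X + b%:P).
Variables (i0 j0 : nat).
Hypothesis Di0 : D`_i0 != 0.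
Hypothesis maxD : forall i, (i <= d)%N -> normc D`_i <= normc D`_i0.
(** Subtracting w0 times [D] removes the i0-th coefficient of [N]; thus [P] and [D] cannot cancel
    each other at the index where [D] is largest, and rr brings their largest coefficients to the
    same size. *)
Let w0 := N`_i0 / D`_i0.
Let P := N - w0 *: D.
Hypothesis Pj0 : P`_j0 != 0.
Hypothesis maxP : forall i, (i <= d)%N -> normc P`_i <= normc P`_j0.
Let rr := normc P`_j0 / normc D`_i0.

Let rr0 : 0 < rr.
Proof. by rewrite divr_gt0// normc_gt0. Qed.

Section Frame.
Variable M : 'M[C]_2.
Hypothesis uM : M \in unitmx.
Hypothesis Mo : moebius_ball M (val (origin R)) = val (hp b a).

Let V := img num den d M.
Definition renorm q : C * C := ((V q).1 - w0 * (V q).2, rr%:C * (V q).2).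
Local Notation W := renorm.

Lemma renorm_frame q : renorm q = frame w0 rr (V q).
Proof. by []. Qed.

Lemma renorm_neq0 q : W q != 0.
Proof. by rewrite renorm_frame frame_neq0// img_neq0. Qed.

Lemma mc_renorm : mc (fun q => (W q).1) /\ mc (fun q => (W q).2).
Proof.
have [m1 m2] := mc_img num den d M.
split; last by apply: mcM => //; exact: mc_cst.
under eq_fun do rewrite /renorm /= -mulNr.
by apply: mcD => //; apply: mcM => //; exact: mc_cst.
Qed.

Lemma frame_renorm b' a' q : frame b' a' (W q) = frame (w0 + rr%:C * b') (rr * a') (V q).
Proof.
have E : (rr * a')%:C = rr%:C * a'%:C by rewrite rmorphM.
by rewrite /frame E /renorm; move: (V q) => [x y]; congr pair => /=; ring.
Qed.

Let Hh := normc P`_j0.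
Let Hh0 : 0 < Hh. Proof. by rewrite normc_gt0. Qed.

(** A cap of the image is where a unit linear form l is small on W, that is, where the homogeneous
    form of p = l.1 P + l.2 rr D is small. As p has a coefficient of size at least Hh / 3,
    [small_poly_cover] applies. *)
Lemma renorm_caps : small_caps sphere_param (hx W) (hy W) (hz W) (cap_level d).
Proof.
move=> k k1; have [l [l1 lk]] := hopf_surj k1.
have [Q [lam [cQ QE]]] := conformal_origin uM a0 Mo.
have aC : (a%:C : C) != 0 by rewrite -sq_eq0 sq_real sqrf_eq0 gt_eqF.
have sn : (size num <= d.+1)%N by rewrite -size_nd leq_maxl.
have sd : (size den <= d.+1)%N by rewrite -size_nd leq_maxr.
have V1 q : (V q).1 = hom d N (lin2 Q (lift q)).
  by rewrite /V /img /= QE hom_affine.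
have V2 q : (V q).2 = hom d D (lin2 Q (lift q)).
  by rewrite /V /img /= QE hom_affine.
have PE : P = N + (- w0) *: D by rewrite /P scaleNr.
pose p := l.1 *: P + (l.2 * rr%:C) *: D.
have pairE q : pairing l (W q) = hom d p (lin2 Q (lift q)).
  have -> : pairing l (W q) = l.1 * ((V q).1 - w0 * (V q).2) + l.2 * (rr%:C * (V q).2).
    by [].
  by rewrite V1 V2 /p PE !(homD, homZ); ring.
have DH : normc (rr%:C) * normc D`_i0 = Hh.
  by rewrite normc_real gtr0_norm// /rr divfK// gt_eqF// normc_gt0.
have sW q : sqn (W q) <= 2 * (d.+1%:R * Hh) ^+ 2 * sqn (lin2 Q (lift q)) ^+ d.
  rewrite -mulrA mulr2n mulrDl !mul1r /sqn lerD//.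
    have -> : (W q).1 = hom d P (lin2 Q (lift q)).
      transitivity ((V q).1 - w0 * (V q).2); first by [].
      by rewrite V1 V2 PE homD homZ; ring.
    exact: hom_bound.
  have -> : (W q).2 = hom d (rr%:C *: D) (lin2 Q (lift q)).
    transitivity (rr%:C * (V q).2); first by [].
    by rewrite V2 homZ.
  apply: hom_bound => i id; rewrite coefZ normcM -DH ler_wpM2l ?normc_ge0//.
  exact: maxD.
have szP (q : {poly C}) : (size q <= d.+1)%N -> (size (q \Po (a%:C *: 'X + b%:P)) <= d.+1)%N.
  by rewrite size_comp_poly2// size_polyDl size_scale// size_polyX// ltnS size_polyC_leq1.
have sp : (size p <= d.+1)%N.
  rewrite (leq_trans (size_polyD _ _))// geq_max.
  rewrite !(leq_trans (size_scale_leq _ _)) ?szP//.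
  rewrite (leq_trans (size_polyD _ _))// geq_max szP// size_polyN.
  by rewrite (leq_trans (size_scale_leq _ _)) ?szP.
have Pi0 : P`_i0 = 0.
  by rewrite /P coefB coefZ /w0 divfK// subrr.
have pj i : p`_i = l.1 * P`_i + l.2 * rr%:C * D`_i by rewrite /p [LHS]coefD !coefZ.
(* If |l.2| >= 1/3, the index i0 serves, since [P] vanishes there. Otherwise |l.1| >= 2/3 and at j0
   the term of [P] outweighs the other one by Hh / 3. *)
have pbig : exists i, Hh / 3 <= normc p`_i.
  have := l1; rewrite /sqn -!sq_normc => l1'.
  have n1 := normc_ge0 l.1; have n2 := normc_ge0 l.2.
  have [h|h] := leP (1 / 3) (normc l.2).
    exists i0; rewrite pj Pi0 mulr0 add0r !normcM -mulrA DH.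
    by rewrite mulrC ler_wpM2r ?(ltW Hh0)//; lra.
  exists j0; have : normc (l.1 * P`_j0) <= normc p`_j0 + normc (- (l.2 * rr%:C * D`_j0)).
    have -> : l.1 * P`_j0 = p`_j0 + - (l.2 * rr%:C * D`_j0).
      by rewrite pj addrK.
    exact: le_normcD.
  rewrite normcN !normcM -/Hh => h1.
  have h2 : normc l.2 * (normc rr%:C * normc D`_j0) <= 1 / 3 * Hh.
    apply: ler_pM => //; [by rewrite mulr_ge0 ?normc_ge0|exact: ltW|].
    rewrite -DH ler_wpM2l ?normc_ge0//.
    have [jd|jd] := leqP j0 d; first exact: maxD.
    rewrite [D`_j0]nth_default ?normc0 ?normc_ge0//.
    by rewrite (leq_trans (szP _ sd)).
  have h3 : 2 / 3 <= normc l.1.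
    rewrite leNgt; apply/negP => h4.
    have : normc l.1 ^+ 2 <= (2 / 3) ^+ 2 by rewrite ler_sqr ?nnegrE// ltW.
    have : normc l.2 ^+ 2 <= (1 / 3) ^+ 2 by rewrite ler_sqr ?nnegrE// ltW.
    by lra.
  have : 2 / 3 * Hh <= normc l.1 * Hh by rewrite ler_wpM2r// ltW.
  by move: h1 h2; rewrite -!mulrA; lra.
have H3 : 0 < Hh / 3 by rewrite divr_gt0.
have [ls [sls cov]] := small_poly_cover cQ sp H3 pbig.
have [m1 m2] := mc_renorm.
have [bx by_ bz] := hopfW_bm m1 m2 renorm_neq0.
have e0 := @cap_size_gt0 R d.
apply: (@le_trans _ _ ((size ls)%:R * (2 * cap_size d))).
  apply: sphere_param_cover.
  - by rewrite mulr_ge0// ltW.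
  - exact: (measurable_cap bx by_ bz (cap_level d) k).
  move=> q /= hq; apply: cov.
  have l0 : l != 0 by rewrite -sqn_gt0 l1.
  have := hopf_pairing l0 (renorm_neq0 q); rewrite lk l1 mul1r => E.
  have {}hq : 2 * sq (pairing l (W q)) / sqn (W q) <= cap_level d by rewrite -E.
  move: hq; rewrite ler_pdivrMr ?sqn_gt0 ?renorm_neq0// pairE => hq.
  have := ler_wpM2l (ltW (cap_level_gt0 d)) (sW q) => /(le_trans hq) h.
  have -> : (Hh / 3) ^+ 2 * cap_const d * sqn (lin2 Q (lift q)) ^+ d =
     cap_level d * (d.+1%:R * Hh) ^+ 2 * sqn (lin2 Q (lift q)) ^+ d.
    have dn : (d.+1%:R : R) != 0 by rewrite pnatr_eq0.
    by rewrite /cap_level; move: (sqn _ ^+ d) => y; field.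
  by move: h; rewrite !mulrA; lra.
have ds : (size ls)%:R <= (d.+1%:R : R) by rewrite ler_nat.
apply: (@le_trans _ _ (d.+1%:R * (2 * cap_size d))).
  by rewrite ler_wpM2r// mulr_ge0// ltW.
have dn : (d.+1%:R : R) != 0 by rewrite pnatr_eq0.
rewrite /cap_size [leLHS](_ : _ = 6^-1); last by field.
by rewrite lef_pV2 ?posrE// ler_nat.
Qed.

Lemma renorm_barycenterP b' a' : 0 < a' ->
  is_barycenter (image_measure num den M) (hp (w0 + rr%:C * b') (rr * a')) <->
  barycentric sphere_param (hx W) (hy W) (hz W) (klein b' a').
Proof.
move=> a'0; have [m1 m2] := mc_renorm.
have ra : 0 < rr * a' by rewrite mulr_gt0.
apply: iff_trans (is_barycenterP size_nd cop _ uM ra) _.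
apply: iff_trans (centered_klein m1 m2 renorm_neq0 b' a'0).
suff -> : (fun q => frame (w0 + rr%:C * b') (rr * a') (img num den d M q)) =
   (fun q => frame b' a' (W q)) by [].
by apply/funext => q; rewrite frame_renorm.
Qed.

End Frame.

Definition bary_const (d : nat) : R := ln (2 * Num.sqrt (3 / cap_level d)).

(* The barycentric extension of num / den sends the point of the half-space   *)
(* with coordinates (b, a) within bounded distance of the image of the ball   *)
(* B(b, a) as it would be computed in non-Archimedean geometry.               *)
Lemma bary_ext_close :
  hdist (bary_ext num den (hp b a)) (hp w0 rr) <= bary_const d.
Proof.
rewrite /bary_ext; case: xgetP => [y yE|].
  case=> M [uM Mo bar]; have [b' [a' [a'0 yE']]] := hp_surj y.
  rewrite yE'; rewrite yE' in bar.
  have [m1 m2] := mc_renorm M.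
  have [bx by_ bz] := hopfW_bm m1 m2 (renorm_neq0 uM).
  pose b1 := (b' - w0) / rr%:C; pose a1 := a' / rr.
  have rC : (rr%:C : C) != 0 by rewrite -sq_eq0 sq_real sqrf_eq0 gt_eqF.
  have a10 : 0 < a1 by rewrite divr_gt0.
  have E1 : b' = w0 + rr%:C * b1 by rewrite /b1 mulrC divfK// addrC subrK.
  have E2 : a' = rr * a1 by rewrite /a1 mulrC divfK// gt_eqF.
  rewrite E1 E2 in bar *.
  have {}bar := (renorm_barycenterP uM b1 a10).1 bar.
  have c0 := cap_level_gt0 d.
  have := barycentric_bound (P := sphere_param) bx by_ bz (hopfW_unit (renorm_neq0 uM)) c0
    (cap_level_le1 d) (renorm_caps uM Mo) (klein_lt1 b1 a10) bar.
  have ra : 0 < rr * a1 by rewrite mulr_gt0.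
  have /andP[_ hd] := hdist_bounds (w0 + rr%:C * b1) w0 ra rr0.
  move=> cb; apply: (le_trans hd); rewrite /bary_const.
  have u1 := cdist_ge1 (w0 + rr%:C * b1) w0 ra rr0.
  have c3 : 0 < 3 / cap_level d by rewrite divr_gt0.
  rewrite ler_ln ?posrE; [|by lra|by rewrite mulr_gt0 ?sqrtr_gt0].
  rewrite ler_wpM2l// -ler_sqr ?nnegrE ?sqrtr_ge0//; last by lra.
  rewrite sqr_sqrtr ?(ltW c3)// cdist_klein//.
  rewrite -[3 / _]invrK lef_pV2 ?posrE ?invr_gt0//.
    by rewrite invf_div.
  by rewrite subr_gt0 klein_lt1.
(* The default value of [xget] never occurs: the minimizer of the energy for the explicit matrix z
   |-> a z + b is a barycenter. *)
move=> none; exfalso.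
have uA := mx2_unit b a0; have Ao := moebius_origin b a0.
have [m1 m2] := mc_renorm (mx2 a%:C b 0 1).
have [bx by_ bz] := hopfW_bm m1 m2 (renorm_neq0 uA).
have [k [k1 bar]] := barycentric_exists (P := sphere_param) bx by_ bz (hopfW_unit (renorm_neq0 uA))
   (cap_level_gt0 d) (cap_level_le1 d) (renorm_caps uA Ao).
have [b1 [a1 [a10 kE]]] := klein_surj k1.
apply: (none (hp (w0 + rr%:C * b1) (rr * a1))).
exists (mx2 a%:C b 0 1); split => //.
by apply/(renorm_barycenterP uA b1 a10); rewrite kE.
Qed.

End Quantitative.

(** * Gauss norms and the points of balls *)

(** What the Puiseux and the Robinson fields have in common: an algebraically closed non-Archimedean
    field of residue characteristic 0 ([vf_abs_nat]), with dense values and complete for sequences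
    whose increments decay like e^(-k). *)
Record valued_field (R : realType) (K : fieldType) (abs : K -> R) : Prop := {
  vf_abs0 : abs 0 = 0;
  vf_abs_gt0 : forall x, x != 0 -> 0 < abs x;
  vf_absM : forall x y, abs (x * y) = abs x * abs y;
  vf_absD : forall x y, abs (x + y) <= Num.max (abs x) (abs y);
  vf_abs_nat : forall n : nat, abs n.+1%:R = 1;
  vf_dense : forall s r : R, 0 < s -> s < r -> exists x, s < abs x <= r;
  vf_root : forall p : {poly K}, (1 < size p)%N -> exists x, root p x;
  vf_complete : forall a : nat -> K,
    (forall k, abs (a k.+1 - a k) <= expR (- k%:R)) ->
    exists x, forall k, abs (x - a k) <= expR (- k%:R) }.

Section ValuedField.
Variables (R : realType) (K : fieldType) (abs : K -> R).
Hypothesis V : valued_field abs.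

Let abs0 := vf_abs0 V.
Let absM := vf_absM V.
Let absD := vf_absD V.

Lemma abs_eq0 x : (abs x == 0) = (x == 0).
Proof.
by have [->|x0] := eqVneq x 0; rewrite ?abs0 ?eqxx// gt_eqF// (vf_abs_gt0 V).
Qed.

Lemma abs_ge0 x : 0 <= abs x.
Proof.
by have [->|x0] := eqVneq x 0; rewrite ?abs0// ltW// (vf_abs_gt0 V).
Qed.

Lemma abs1 : abs 1 = 1. Proof. exact: (vf_abs_nat V 0). Qed.

Lemma absN x : abs (- x) = abs x.
Proof.
suff n1 : abs (-1) = 1 by rewrite -mulN1r absM n1 mul1r.
have : abs (-1) ^+ 2 = 1 by rewrite expr2 -absM mulrNN mulr1 abs1.
by move/eqP; rewrite sqrf_eq1 => /orP[/eqP//|/eqP h]; have := abs_ge0 (-1); rewrite h lerNr oppr0 leNgt ltr01.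
Qed.

Lemma absB x y : abs (x - y) = abs (y - x).
Proof. by rewrite -absN opprB. Qed.

Lemma abs_subD x y z : abs (x - z) <= Num.max (abs (x - y)) (abs (y - z)).
Proof. by rewrite -(subrKA y x) (le_trans (absD _ _)). Qed.

Lemma absX x n : abs (x ^+ n) = abs x ^+ n.
Proof. by elim: n => [|n IH]; rewrite ?expr0 ?abs1// !exprS absM IH. Qed.

Lemma abs_natr_le1 (n : nat) : abs n%:R <= 1.
Proof. by case: n => [|n]; rewrite ?abs0// (vf_abs_nat V). Qed.

Lemma abs_strict x y : abs y < abs x -> abs (x + y) = abs x.
Proof.
move=> yx; apply/eqP; rewrite eq_le; apply/andP; split.
  by rewrite (le_trans (absD _ _))// ge_max lexx ltW.
have := absD (x + y) (- y); rewrite addrK absN le_max => /orP[//|].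
by rewrite leNgt yx.
Qed.

Lemma max_center r x y w : abs (x - y) <= r ->
  Num.max r (abs (x - w)) = Num.max r (abs (y - w)).
Proof.
move=> xy; apply/eqP; rewrite eq_le !ge_max !le_max lexx /=; apply/andP; split.
  have := abs_subD x y w; rewrite le_max => /orP[h|->]; rewrite ?orbT//.
  by rewrite (le_trans h).
have := abs_subD y x w; rewrite le_max => /orP[h|->]; rewrite ?orbT//.
by rewrite (le_trans h)// absB.
Qed.

Lemma abs_sum_le (I : Type) (s : seq I) (F : I -> K) (m : R) : 0 <= m ->
  (forall i, abs (F i) <= m) -> abs (\sum_(i <- s) F i) <= m.
Proof.
move=> m0 Fm; elim: s => [|i s IH]; first by rewrite big_nil abs0.
by rewrite big_cons (le_trans (absD _ _))// ge_max Fm.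
Qed.

Lemma abs_prod (s : seq K) (F : K -> K) :
  abs (\prod_(z <- s) F z) = \prod_(z <- s) abs (F z).
Proof. by elim: s => [|z s IH]; rewrite ?big_nil ?abs1// !big_cons absM IH. Qed.

Lemma poly_splits (p : {poly K}) :
  exists c rs, p = c *: \prod_(z <- rs) ('X - z%:P) /\ (p != 0 -> c != 0 /\ size p = (size rs).+1).
Proof.
have [n] := ubnP (size p); elim: n p => // n IH p.
have [p1 _|p1 pn] := leqP (size p) 1.
  exists p`_0, [::]; rewrite big_nil alg_polyC; split; last first.
    by rewrite (size1_polyC p1) polyC_eq0 coefC eqxx => c0; rewrite size_polyC c0.
  exact: size1_polyC.
have [x rx] := vf_root V p1; have [q pq] := factor_theorem p x rx.
have p0 : p != 0 by rewrite -size_poly_gt0 ltnW.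
have q0 : q != 0 by apply: contraNneq p0; rewrite pq => ->; rewrite mul0r.
have sp : size p = (size q).+1.
  by rewrite pq size_Mmonic ?monicXsubC// size_XsubC addn2.
have [|c [rs [E]]] := IH q; first by move: pn; rewrite sp ltnS.
move=> /(_ q0)[c0 sq]; exists c, (x :: rs); split; last by rewrite sp sq.
by rewrite big_cons pq {1}E -scalerAl mulrC.
Qed.

(** The Gauss norm of the ball B(a, r). The range m is a parameter, so that polynomials of different
    degrees can be compared index by index. *)
Definition gauss (m : nat) (a : K) (r : R) (p : {poly K}) : R :=
  \big[Num.max/0]_(i < m) (abs (p \Po ('X + a%:P))`_i * r ^+ i).

Lemma gauss_ge0 m a r (p : {poly K}) : 0 <= gauss m a r p.
Proof. by rewrite /gauss; elim/big_rec: _ => // i x _ x0; rewrite le_max x0 orbT. Qed.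

Lemma gauss_ge m a r (p : {poly K}) i : (i < m)%N ->
  abs (p \Po ('X + a%:P))`_i * r ^+ i <= gauss m a r p.
Proof.
move=> im; rewrite /gauss (bigD1 (Ordinal im)) //= le_max lexx//.
Qed.

Lemma gauss_le m a r p (M : R) : 0 <= M ->
  (forall i, (i < m)%N -> abs (p \Po ('X + a%:P))`_i * r ^+ i <= M) ->
  gauss m a r p <= M.
Proof.
move=> M0 h; rewrite /gauss; elim/big_ind: _ => // [x y xM yM|i _]; last exact: h.
by rewrite ge_max xM.
Qed.

Lemma size_comp_XaddC (p : {poly K}) a : size (p \Po ('X + a%:P)) = size p.
Proof. by rewrite size_comp_poly2// size_XaddC. Qed.

Lemma gauss_horner m a r (p : {poly K}) z : (size p <= m)%N -> abs (z - a) <= r ->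
  abs p.[z] <= gauss m a r p.
Proof.
move=> sp za.
have -> : p.[z] = (p \Po ('X + a%:P)).[z - a].
  by rewrite horner_comp hornerD hornerX hornerC subrK.
rewrite (@horner_coef_wide _ m) ?size_comp_XaddC//.
apply: abs_sum_le; first exact: gauss_ge0.
move=> i; apply: le_trans (gauss_ge a r p (ltn_ord i)).
rewrite absM absX ler_wpM2l ?abs_ge0// lerXn2r ?nnegrE ?abs_ge0//.
by rewrite (le_trans _ za) ?abs_ge0.
Qed.

Lemma coef_prod_shift a r (rs : seq K) i : 0 <= r ->
  abs ((\prod_(z <- rs) ('X - z%:P)) \Po ('X + a%:P))`_i * r ^+ i <=
  \prod_(z <- rs) Num.max r (abs (a - z)).
Proof.
move=> r0; elim: rs i => [|z rs IH] i.
  rewrite !big_nil comp_polyC coefC; case: eqP => [->|_].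
    by rewrite abs1 mulr1.
  by rewrite abs0 mul0r.
rewrite !big_cons comp_polyM comp_polyD comp_polyX -polyCN comp_polyC.
rewrite -addrA -polyCD mulrDl coefD coefXM coefCM.
set q := _ \Po _ in IH *.
have m0 : 0 <= Num.max r (abs (a - z)) by rewrite le_max r0.
have P0 : 0 <= \prod_(y <- rs) Num.max r (abs (a - y)).
  by apply: prodr_ge0 => y _; rewrite le_max r0.
apply: (@le_trans _ _ (Num.max (abs (if i == 0%N then 0 else q`_i.-1) * r ^+ i)
    (abs ((a - z) * q`_i) * r ^+ i))).
  by rewrite -maxr_pMl ?exprn_ge0// ler_wpM2r ?exprn_ge0.
rewrite ge_max; apply/andP; split.
  case: i => [|i] /=; first by rewrite abs0 mul0r mulr_ge0.
  by rewrite exprS mulrCA ler_pM ?mulr_ge0 ?abs_ge0 ?exprn_ge0// le_max lexx.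
by rewrite absM -mulrA ler_pM ?mulr_ge0 ?abs_ge0 ?exprn_ge0// le_max lexx orbT.
Qed.

Lemma gauss_prod_le m a r c rs : 0 <= r ->
  gauss m a r (c *: \prod_(z <- rs) ('X - z%:P)) <=
  abs c * \prod_(z <- rs) Num.max r (abs (a - z)).
Proof.
move=> r0; apply: gauss_le => [|i _].
  by rewrite mulr_ge0 ?abs_ge0//; apply: prodr_ge0 => y _; rewrite le_max r0.
rewrite comp_polyZ coefZ absM -mulrA ler_wpM2l ?abs_ge0//.
exact: coef_prod_shift.
Qed.

(* The multiples k x of x by integers k <> 0 all have absolute value |x| and  *)
(* mutual distance |x|, so each root is close to at most one of them.         *)
Lemma avoid_roots (x a : K) (rs : seq K) (ks : seq nat) : x != 0 ->
  uniq ks -> 0%N \notin ks -> (size rs < size ks)%N ->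
  exists2 k, k \in ks & forall z, z \in rs ->
    Num.max (abs x) (abs (a - z)) <= abs (a + k%:R * x - z).
Proof.
move=> x0; have kx k : k != 0%N -> abs (k%:R * x) = abs x.
  by case: k => // k _; rewrite absM (vf_abs_nat V) mul1r.
elim: rs ks => [|z rs IH] ks uks nks sks.
  by case: ks uks nks sks => // k ks _ _ _; exists k; rewrite ?mem_head.
have [/hasP[k kks bad]|/hasPn good] := boolP (has (fun k => abs (a + k%:R * x - z) <
    Num.max (abs x) (abs (a - z))) ks).
  have [||k' k'ks h] := IH (rem k ks) (rem_uniq k uks).
  - by apply: contra nks; exact: mem_rem.
  - by rewrite size_rem// -ltnS prednK// (leq_ltn_trans _ sks).
  exists k'; first exact: mem_rem k'ks.
  move=> y; rewrite inE => /orP[/eqP->|/h//].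
  have kk' : k != k'.
    by apply: contraTneq k'ks => <-; rewrite mem_rem_uniqF.
  have k0 : k != 0%N by apply: contraNneq nks => <-.
  have diff : abs (a + k'%:R * x - z - (a + k%:R * x - z)) = abs x.
    have -> : a + k'%:R * x - z - (a + k%:R * x - z) = (k'%:R - k%:R) * x by ring.
    have [lt|lt|/eqP] := ltngtP k k'; last by rewrite (negbTE kk').
      by rewrite -natrB ?(ltnW lt)// kx// subn_eq0 -ltnNge.
    by rewrite -opprB mulNr absN -natrB ?(ltnW lt)// kx// subn_eq0 -ltnNge.
  have az : abs (a - z) <= abs x.
    rewrite leNgt; apply/negP => lt; move: bad; rewrite (max_idPr _) ?(ltW lt)//.
    have -> : a + k%:R * x - z = (a - z) + k%:R * x by ring.
    by rewrite abs_strict ?ltxx// kx.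
  move: bad; rewrite !(max_idPl _)// => bad.
  have := absD (a + k'%:R * x - z) (- (a + k%:R * x - z)).
  by rewrite diff absN le_max => /orP[//|]; rewrite leNgt bad.
case: ks uks nks sks good => // k0 ks uks nks sks good.
have [|k kks h] := IH (k0 :: ks) uks nks; first exact: ltnW.
exists k => // y; rewrite inE => /orP[/eqP->|/h//].
by have := good k kks; rewrite -leNgt.
Qed.

Lemma bernoulli_ineq (e : R) n : 0 <= e -> e <= 1 -> 1 - n%:R * e <= (1 - e) ^+ n.
Proof.
move=> e0 e1; elim: n => [|n IH]; first by rewrite mul0r subr0.
rewrite exprS; apply: (@le_trans _ _ ((1 - e) * (1 - n%:R * e))); last first.
  by rewrite ler_wpM2l//; lra.
have : 0 <= n%:R * e * e by rewrite !mulr_ge0.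
by rewrite -natr1; lra.
Qed.

Lemma le_pow_lt1 (x y : R) n : 0 <= x ->
  (forall q, 0 < q -> q < 1 -> q ^+ n * x <= y) -> x <= y.
Proof.
move=> x0 h; rewrite leNgt; apply/negP => yx.
have [y0|y0] := leP 0 y; last first.
  have := h (2^-1) _ _; rewrite invr_gt0 ltr0n invf_lt1// ltr1n => /(_ isT isT).
  by move=> h1; have := mulr_ge0 (exprn_ge0 n (_ : 0 <= 2^-1 :> R)) x0; rewrite invr_ge0 ler0n => /(_ isT); lra.
have xp : 0 < x by lra.
have [N NE N2] : exists2 N : R, N = n%:R + 2 & 2 <= N.
  by exists (n%:R + 2); rewrite ?lerDr.
pose e := (x - y) / (x * N).
have N0 : 0 < N by lra.
have e0 : 0 < e by rewrite divr_gt0 ?mulr_gt0//; lra.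
have xe : x * e * N = x - y by rewrite /e; field; rewrite !gt_eqF.
have e1 : e < 1.
  rewrite /e ltr_pdivrMr ?mulr_gt0// mul1r.
  have : x * 2 <= x * N by rewrite ler_wpM2l// ltW.
  by lra.
have := h (1 - e); rewrite subr_gt0 e1 => /(_ isT); have -> : 1 - e < 1 by lra.
move=> /(_ isT) h1.
have := ler_wpM2r (ltW xp) (bernoulli_ineq n (ltW e0) (ltW e1)).
move=> /le_trans/(_ h1).
have xe0 : 0 < x * e by rewrite mulr_gt0.
rewrite NE mulrDr in xe; move=> h2.
have h3 : (1 - n%:R * e) * x = x - x * e * n%:R by ring.
by rewrite h3 in h2; lra.
Qed.

(** For q < 1 choose x with q r < |x| <= r; some multiple k x keeps a + k x away from all roots, and
    the value of the polynomial there is at least q^deg times the product. Then q tends to 1 by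
    [le_pow_lt1]. *)
Lemma ball_norm_lower a r c rs : 0 < r ->
  abs c * \prod_(z <- rs) Num.max r (abs (a - z)) <=
  ball_norm abs a r (c *: \prod_(z <- rs) ('X - z%:P)).
Proof.
move=> r0; set p := c *: _.
have ub z : abs (z - a) <= r -> abs p.[z] <= ball_norm abs a r p.
  move=> za; apply: ub_le_sup; last by exists z.
  exists (gauss (size p) a r p) => _ [y /= ya <-]; exact: gauss_horner.
have P0 : 0 <= \prod_(y <- rs) Num.max r (abs (a - y)).
  by apply: prodr_ge0 => y _; rewrite le_max ltW.
apply: (@le_pow_lt1 _ _ (size rs)) => [|q q0 q1].
  by rewrite mulr_ge0// abs_ge0.
have qr : q * r < r by rewrite gtr_pMl.
have [x /andP[sx xr]] := vf_dense V (mulr_gt0 q0 r0) qr.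
have x0 : x != 0 by rewrite -abs_eq0 gt_eqF// (lt_trans _ sx)// mulr_gt0.
have [|||k kks h] := @avoid_roots x a rs (iota 1 (size rs).+1) x0.
- exact: iota_uniq.
- by rewrite mem_iota.
- by rewrite size_iota.
have kn0 : k != 0%N by apply: contraTneq kks => ->; rewrite mem_iota.
apply: (le_trans _ (ub (a + k%:R * x) _)); last first.
  rewrite addrC addKr absM; case: k {kks h} kn0 => // k _.
  by rewrite (vf_abs_nat V) mul1r.
rewrite /p hornerZ absM mulrCA ler_wpM2l ?abs_ge0// horner_prod abs_prod.
have -> : q ^+ size rs = \prod_(y <- rs) q.
  by rewrite big_const_seq count_predT iter_mulr_1.
rewrite -big_split /= big_seq [leRHS]big_seq; apply: ler_prod => z zrs.
rewrite hornerXsubC mulr_ge0 ?le_max ?(ltW q0) ?(ltW r0)//=.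
apply: le_trans (h z zrs); rewrite maxr_pMr ?(ltW q0)// ge_max !le_max.
rewrite (ltW sx) /=; apply/orP; right.
by rewrite ler_piMl ?abs_ge0// ltW.
Qed.

Lemma ball_norm_has_sup a r (p : {poly K}) m : (size p <= m)%N -> 0 <= r ->
  ball_norm abs a r p <= gauss m a r p.
Proof.
move=> sp r0; apply: ge_sup.
  by exists (abs p.[a]), a => //=; rewrite subrr abs0.
by move=> _ [z /= za <-]; exact: gauss_horner.
Qed.

Lemma size_split_le (c : K) rs m :
  (size (c *: \prod_(z <- rs) ('X - z%:P)) <= m)%N -> c = 0 \/ (size rs < m)%N.
Proof.
have [->|c0] := eqVneq c 0; first by left.
by rewrite size_scale// size_prod_XsubC; right.
Qed.

(** The supremum is at most the Gauss norm, which is at most the product over the roots, which is at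
    most the supremum; all three agree, and multiplicativity of the ball norm follows. *)
Lemma ball_norm_split a r c rs : 0 < r ->
  ball_norm abs a r (c *: \prod_(z <- rs) ('X - z%:P)) =
  abs c * \prod_(z <- rs) Num.max r (abs (a - z)).
Proof.
move=> r0; apply/eqP; rewrite eq_le ball_norm_lower// andbT.
apply: le_trans; first exact: ball_norm_has_sup (leqnn _) (ltW r0).
by apply: gauss_prod_le; exact: ltW.
Qed.

Lemma ball_norm_gauss m a r (p : {poly K}) : 0 < r -> (size p <= m)%N ->
  ball_norm abs a r p = gauss m a r p.
Proof.
move=> r0 sp; apply/eqP; rewrite eq_le ball_norm_has_sup ?(ltW r0)//=.
have [c [rs [E _]]] := poly_splits p.
rewrite E ball_norm_split//; exact: gauss_prod_le (ltW r0).
Qed.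

Lemma ball_norm_XsubC a r w : 0 < r ->
  ball_norm abs a r ('X - w%:P) = Num.max r (abs (a - w)).
Proof.
move=> r0; have -> : 'X - w%:P = 1 *: \prod_(z <- [:: w]) ('X - z%:P).
  by rewrite big_seq1 scale1r.
by rewrite ball_norm_split// big_seq1 abs1 mul1r.
Qed.

Lemma ball_seminorm a r : 0 < r -> berk_seminorm abs (ball_norm abs a r).
Proof.
move=> r0; split.
- move=> p; rewrite (ball_norm_gauss _ _ (leqnn (size p)))//; exact: gauss_ge0.
- move=> c; have -> : c%:P = c *: \prod_(z <- [::]) ('X - z%:P).
    by rewrite big_nil alg_polyC.
  by rewrite ball_norm_split// big_nil mulr1.
- move=> p q; have [c [rs [Ep _]]] := poly_splits p.
  have [e [ts [Eq _]]] := poly_splits q.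
  have -> : p * q = (c * e) *: \prod_(z <- rs ++ ts) ('X - z%:P).
    by rewrite big_cat Ep Eq -scalerAl -scalerAr scalerA.
  by rewrite {1}Ep {1}Eq !ball_norm_split// big_cat absM mulrACA.
- move=> p q; apply: ge_sup.
    by exists (abs (p + q).[a]), a => //=; rewrite subrr abs0 ltW.
  move=> _ [z /= za <-]; rewrite hornerD (le_trans (absD _ _))//.
  have ub t : abs t.[z] <= ball_norm abs a r t.
    by rewrite (ball_norm_gauss _ r0 (leqnn (size t))) gauss_horner.
  have ge t : 0 <= ball_norm abs a r t.
    by rewrite (ball_norm_gauss _ r0 (leqnn (size t))) gauss_ge0.
  by rewrite ge_max; apply/andP; split; rewrite (le_trans (ub _))// ?lerDl ?lerDr.
Qed.

Lemma ball_not_classical a r : 0 < r ->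
  forall e : K, ball_norm abs a r <> (fun p => abs p.[e]).
Proof.
move=> r0 e /(congr1 (fun s => s ('X - e%:P))).
rewrite ball_norm_XsubC// hornerXsubC subrr abs0 => E.
have : 0 < Num.max r (abs (a - e)) by rewrite lt_max r0.
by rewrite E ltxx.
Qed.

Definition ball_point a r (r0 : 0 < r) : hberk abs :=
  HBerk (ball_seminorm a r0) (ball_not_classical (a := a) r0).

Lemma gaussD m a r p q : 0 <= r ->
  gauss m a r (p + q) <= Num.max (gauss m a r p) (gauss m a r q).
Proof.
move=> r0; apply: gauss_le => [|i im]; first by rewrite le_max gauss_ge0.
rewrite comp_polyD coefD.
apply: (@le_trans _ _ (Num.max (abs (p \Po ('X + a%:P))`_i * r ^+ i)
   (abs (q \Po ('X + a%:P))`_i * r ^+ i))).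
  by rewrite -maxr_pMl ?exprn_ge0// ler_wpM2r ?exprn_ge0.
by rewrite ge_max !le_max !gauss_ge ?orbT.
Qed.

Lemma gaussZ m a r c p : 0 <= r -> gauss m a r (c *: p) = abs c * gauss m a r p.
Proof.
move=> r0; rewrite /gauss.
elim/big_rec2: _ => [|i x y _ ->]; first by rewrite mulr0.
by rewrite comp_polyZ coefZ absM -mulrA maxr_pMr ?abs_ge0.
Qed.

(* [w0] is the centre of the image of the ball B(a, r) under N / D: it        *)
(* cancels the dominant coefficient of the denominator.                       *)
Lemma gauss_optimal m a r (N D : {poly K}) i0 : 0 <= r -> (i0 < m)%N ->
  abs (D \Po ('X + a%:P))`_i0 * r ^+ i0 = gauss m a r D -> gauss m a r D != 0 ->
  let w0 := (N \Po ('X + a%:P))`_i0 / (D \Po ('X + a%:P))`_i0 in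
  forall w, gauss m a r (N - w *: D) =
    Num.max (gauss m a r (N - w0 *: D)) (abs (w0 - w) * gauss m a r D).
Proof.
move=> r0 im DE D0 w0 w.
have Di0 : (D \Po ('X + a%:P))`_i0 != 0.
  by rewrite -abs_eq0; apply: contraNneq D0 => e; rewrite -DE e mul0r.
have E : N - w *: D = (N - w0 *: D) + (w0 - w) *: D.
  by rewrite scalerBl addrA subrK.
have low : abs (w0 - w) * gauss m a r D <= gauss m a r (N - w *: D).
  apply: le_trans (gauss_ge a r (N - w *: D) im).
  rewrite -DE mulrA -absM E comp_polyD coefD.
  have -> : ((N - w0 *: D) \Po ('X + a%:P))`_i0 = 0.
    by rewrite comp_polyB comp_polyZ coefB coefZ /w0 divfK// subrr.
  by rewrite add0r comp_polyZ coefZ.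
apply/eqP; rewrite eq_le; apply/andP; split.
  by rewrite {1}E -(gaussZ m a (w0 - w) D r0); exact: gaussD.
rewrite ge_max low andbT.
have {1}-> : N - w0 *: D = (N - w *: D) + (w - w0) *: D.
  by rewrite scalerBl addrA subrK.
rewrite (le_trans (gaussD _ _ _ _ r0))// ge_max lexx /= gaussZ// absB//.
Qed.

Lemma gauss_argmax m a r D : gauss m a r D != 0 -> exists2 i0, (i0 < m)%N &
  abs (D \Po ('X + a%:P))`_i0 * r ^+ i0 = gauss m a r D.
Proof.
rewrite /gauss; elim/big_ind: _ => [|x y hx hy|i _ _]; first by rewrite eqxx.
  by case: leP.
by exists i.
Qed.

Lemma gauss_gt0 m a r (p : {poly K}) : 0 < r -> p != 0 -> (size p <= m)%N -> 0 < gauss m a r p.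
Proof.
move=> r0 p0 sp; rewrite -(ball_norm_gauss _ r0 sp).
have [c [rs [E]]] := poly_splits p; move=> /(_ p0)[c0 _].
rewrite E ball_norm_split// mulr_gt0 ?(vf_abs_gt0 V)//.
by apply: prodr_gt0 => z _; rewrite lt_max r0.
Qed.

(** In the product over the roots, enlarging the radius from r to s multiplies each of the at most d
    factors by at most s / r. *)
Lemma gauss_radius m a b r s (p : {poly K}) d : 0 < r -> r <= s -> abs (a - b) <= s ->
  (size p <= d.+1)%N -> (size p <= m)%N ->
  gauss m a s p <= (s / r) ^+ d * gauss m b r p /\ gauss m b r p <= gauss m a s p.
Proof.
move=> r0 rs ab sd sm; have s0 := lt_le_trans r0 rs.
rewrite -!ball_norm_gauss//.
have [c [rs' [E _]]] := poly_splits p.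
have sr1 : 1 <= s / r by rewrite ler_pdivlMr// mul1r.
have [c0|srs] : c = 0 \/ (size rs' < d.+1)%N by apply: size_split_le; rewrite -E.
  by rewrite E !ball_norm_split// c0 abs0 !mul0r mulr0.
rewrite E !ball_norm_split//; split; last first.
  rewrite ler_wpM2l ?abs_ge0//; apply: ler_prod => z _.
  rewrite le_max (ltW r0) /= (max_center z ab) ge_max !le_max rs lexx orbT//.
rewrite mulrCA ler_wpM2l ?abs_ge0//.
apply: (@le_trans _ _ ((s / r) ^+ size rs' * \prod_(z <- rs') Num.max r (abs (b - z)))); last first.
  rewrite ler_wpM2r//; first by apply: prodr_ge0 => z _; rewrite le_max ltW.
  by rewrite ler_weXn2l.
have -> : (s / r) ^+ size rs' = \prod_(z <- rs') (s / r).
  by rewrite big_const_seq count_predT iter_mulr_1.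
rewrite -big_split /=; apply: ler_prod => z _; rewrite le_max (ltW s0) /=.
rewrite (max_center z ab) maxr_pMr ?(le_trans ler01)// divfK ?gt_eqF//.
by rewrite ge_max !le_max lexx /= ler_peMl ?abs_ge0 ?orbT.
Qed.

End ValuedField.

(** * Approximation of Berkovich points by balls *)

Section PowerTrick.
Variable R : realType.

Lemma pow_subexp_le (s m : R) : 0 <= s -> 0 <= m ->
  (forall n, s ^+ n <= n.+1%:R * m ^+ n) -> s <= m.
Proof.
move=> s0 m0 h; rewrite leNgt; apply/negP => ms.
have [mz|mn] := eqVneq m 0.
  by have := h 1%N; rewrite mz expr1n || rewrite mz expr1 mulr0; rewrite leNgt -mz ms.
have mp : 0 < m by rewrite lt0r mn.
pose e := s / m - 1.
have e0 : 0 < e by rewrite /e subr_gt0 ltr_pdivlMr// mul1r.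
have g n : (1 + e) ^+ n <= n.+1%:R.
  rewrite /e addrC subrK expr_div_n ler_pdivrMr ?exprn_gt0//.
have b k : 1 + k%:R * e <= (1 + e) ^+ k.
  elim: k => [|k IH]; first by rewrite mul0r addr0.
  rewrite exprS; apply: (@le_trans _ _ ((1 + e) * (1 + k%:R * e))).
    have : 0 <= k%:R * e * e by rewrite !mulr_ge0// ltW.
    by rewrite -natr1; lra.
  by rewrite ler_wpM2l//; lra.
pose k := Num.bound (2 / e ^+ 2).
have e2 : 0 < e ^+ 2 by rewrite exprn_gt0.
have k0 : 2 / e ^+ 2 < k%:R.
  by apply: archi_boundP; rewrite divr_ge0// ltW.
have := g (k * 2)%N; rewrite exprM.
have ke : 0 <= k%:R * e by rewrite mulr_ge0// ltW.
have : (1 + k%:R * e) ^+ 2 <= ((1 + e) ^+ k) ^+ 2.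
  by rewrite ler_sqr ?nnegrE ?exprn_ge0//; lra.
have kk : 2 < k%:R * e ^+ 2 by move: k0; rewrite ltr_pdivrMr.
have kpos : 0 < (k%:R : R).
  by rewrite (lt_trans _ k0)// divr_gt0.
have : k%:R * 2 < k%:R * (k%:R * e ^+ 2) by rewrite ltr_pM2l.
have E : ((k * 2).+1%:R : R) = k%:R * 2 + 1 by rewrite -[(k * 2).+1]addn1 natrD natrM.
rewrite E => h1 h2 h3.
have h4 : (1 + k%:R * e) ^+ 2 = 1 + 2 * (k%:R * e) + k%:R * (k%:R * e ^+ 2) by ring.
have h5 := le_trans h2 h3; rewrite h4 in h5.
by lra.
Qed.

End PowerTrick.

Section Hberk.
Variables (R : realType) (K : fieldType) (abs : K -> R).
Hypothesis V : valued_field abs.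
Implicit Type z : hberk abs.

Definition lin z (w : K) : R := z ('X - w%:P).

Lemma hberk_ge0 z p : 0 <= z p. Proof. by have [] := berk_normP z. Qed.
Lemma hberkC z c : z c%:P = abs c. Proof. by have [_ + _ _] := berk_normP z; exact. Qed.
Lemma hberkM z p q : z (p * q) = z p * z q.
Proof. by have [_ _ + _] := berk_normP z; exact. Qed.
Lemma hberkD z p q : z (p + q) <= z p + z q.
Proof. by have [_ _ _ +] := berk_normP z; exact. Qed.

Lemma hberk1 z : z 1 = 1. Proof. by rewrite -polyC1 hberkC (abs1 V). Qed.

Lemma hberkX z p n : z (p ^+ n) = z p ^+ n.
Proof. by elim: n => [|n IH]; rewrite ?expr0 ?hberk1// !exprS hberkM IH. Qed.

Lemma hberkZ z c p : z (c *: p) = abs c * z p.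
Proof. by rewrite -mul_polyC hberkM hberkC. Qed.

Lemma hberkN z p : z (- p) = z p.
Proof. by rewrite -scaleN1r hberkZ (absN V) (abs1 V) mul1r. Qed.

(** [berk_seminorm] only provides the triangle inequality. Expanding (p + q)^n, whose binomial
    coefficients have absolute value at most 1, costs a factor n + 1, which disappears after taking
    n-th roots ([pow_subexp_le]). *)
Lemma hberk_ultra z p q : z (p + q) <= Num.max (z p) (z q).
Proof.
set m := Num.max _ _; have m0 : 0 <= m by rewrite le_max hberk_ge0.
apply: pow_subexp_le => // [|n]; first exact: hberk_ge0.
rewrite -hberkX exprDn.
have zs (s : seq 'I_n.+1) (F : 'I_n.+1 -> {poly K}) : z (\sum_(i <- s) F i) <= \sum_(i <- s) z (F i).
  elim: s => [|i s IH]; first by rewrite !big_nil -polyC0 hberkC (vf_abs0 V).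
  by rewrite !big_cons (le_trans (hberkD _ _ _))// lerD2l.
apply: (le_trans (zs _ _)).
apply: (@le_trans _ _ (\sum_(i < n.+1) m ^+ n)); last first.
  by rewrite sumr_const card_ord -[leLHS]mulr_natl.
apply: ler_sum => i _.
rewrite -[_ *+ 'C(_, _)]scaler_nat hberkZ hberkM !hberkX.
have id : (i <= n)%N by rewrite -ltnS.
have -> : m ^+ n = 1 * (m ^+ (n - i) * m ^+ i) by rewrite mul1r -exprD subnK.
rewrite ler_pM ?mulr_ge0 ?exprn_ge0 ?hberk_ge0 ?(abs_ge0 V) ?(abs_natr_le1 V)//.
by rewrite ler_pM ?exprn_ge0 ?hberk_ge0// lerXn2r ?nnegrE ?hberk_ge0// le_max lexx ?orbT.
Qed.

Lemma hberk_split z c rs : z (c *: \prod_(w <- rs) ('X - w%:P)) =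
  abs c * \prod_(w <- rs) lin z w.
Proof.
rewrite hberkZ; congr (_ * _); elim: rs => [|w rs IH]; first by rewrite !big_nil hberk1.
by rewrite !big_cons hberkM IH.
Qed.

Lemma lin_ge0 z w : 0 <= lin z w. Proof. exact: hberk_ge0. Qed.

Lemma lin_le z w w' : lin z w <= Num.max (lin z w') (abs (w' - w)).
Proof.
have -> : lin z w = z (('X - w'%:P) + (w' - w)%:P).
  by rewrite /lin polyCB addrA subrK.
by rewrite (le_trans (hberk_ultra _ _ _))// hberkC.
Qed.

Lemma abs_le_lin z w w' : abs (w - w') <= Num.max (lin z w) (lin z w').
Proof.
rewrite -(hberkC z).
have -> : (w - w')%:P = - ('X - w%:P) + ('X - w'%:P).
  by rewrite polyCB opprB addrA subrK.
by rewrite (le_trans (hberk_ultra _ _ _))// hberkN.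
Qed.

Definition diam z : R := inf [set lin z w | w in setT].

Lemma diam_has_inf z : has_inf [set lin z w | w in setT].
Proof.
by split; [exists (lin z 0), 0|exists 0 => _ [w _ <-]; exact: lin_ge0].
Qed.

Lemma diam_le z w : diam z <= lin z w.
Proof. by apply: ge_inf; [case: (diam_has_inf z)|exists w]. Qed.

Lemma diam_approx z (e : R) : 0 < e -> exists w, lin z w < diam z + e.
Proof. by move=> e0; have [_ [w _ <-] h] := inf_adherent e0 (diam_has_inf z); exists w. Qed.

Lemma le_diam z (m : R) : (forall w, m <= lin z w) -> m <= diam z.
Proof.
move=> h; apply: lb_le_inf; first by exists (lin z 0), 0.
by move=> _ [w _ <-].
Qed.

Lemma le_expN (x : R) : (forall k : nat, x <= expR (- k%:R)) -> x <= 0.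
Proof.
move=> h; rewrite leNgt; apply/negP => x0.
have := h (Num.bound (`|ln x|)); apply/negP; rewrite -ltNge.
rewrite -{2}(lnK x0) ltr_expR ltrNl (le_lt_trans (ler_norm _))// normrN.
exact: archi_boundP.
Qed.

(** If the diameter were 0, almost optimal centres would converge to some x in K by completeness,
    and z would be the evaluation at x. *)
Lemma diam_gt0 z : 0 < diam z.
Proof.
have d0 : 0 <= diam z by apply: le_diam => w; exact: lin_ge0.
rewrite lt0r d0 andbT; apply/eqP => dz.
have ex k : exists w, lin z w <= expR (- k%:R).
  have [w] := diam_approx z (expR_gt0 (- k%:R)); rewrite dz add0r => h.
  by exists w; exact: ltW.
pose a k := sval (cid (ex k)).
have aP k : lin z (a k) <= expR (- k%:R) := svalP (cid (ex k)).
have mono k : expR (- k.+1%:R) <= expR (- k%:R) :> R by rewrite ler_expR lerN2 ler_nat.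
have [|x xa] := vf_complete V (a := a).
  move=> k; rewrite (le_trans (abs_le_lin z _ _))// ge_max aP andbT.
  by rewrite (le_trans (aP _)).
have lx : lin z x = 0.
  apply/eqP; rewrite eq_le lin_ge0 andbT; apply: le_expN => k.
  by rewrite (le_trans (lin_le z x (a k)))// ge_max aP (absB V) xa.
apply: (berk_not_classical (h := z) (a := x)); apply/funext => p.
have [c [rs [E _]]] := poly_splits V p.
rewrite {1}E hberk_split E hornerZ horner_prod (vf_absM V) (abs_prod V).
congr (_ * _); apply: eq_bigr => w _; rewrite hornerXsubC.
apply/eqP; rewrite eq_le; apply/andP; split.
  by have := lin_le z w x; rewrite lx (max_idPr (abs_ge0 V _)).
by have := abs_le_lin z x w; rewrite lx (max_idPr (lin_ge0 _ _)).
Qed.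

Lemma hberk_gt0 z p : p != 0 -> 0 < z p.
Proof.
move=> p0; have [c [rs [E]]] := poly_splits V p; move=> /(_ p0)[c0 _].
rewrite E hberk_split mulr_gt0 ?(vf_abs_gt0 V)//.
by apply: prodr_gt0 => w _; rewrite (lt_le_trans (diam_gt0 z))// diam_le.
Qed.

Lemma hberk_eq z z' : (forall w, lin z w = lin z' w) -> z = z'.
Proof.
move=> h; have e : berk_norm z = berk_norm z'.
  apply/funext => p; have [c [rs [E _]]] := poly_splits V p.
  by rewrite E !hberk_split; congr (_ * _); apply: eq_bigr.
case: z z' e {h} => [s sP sc] [s' sP' sc'] /= e.
move: sP sc; rewrite e => sP sc.
by congr HBerk; exact: Prop_irrelevance.
Qed.

Lemma lin_max z a w : Num.max (lin z a) (abs (a - w)) = Num.max (lin z a) (lin z w).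
Proof.
apply/eqP; rewrite eq_le !ge_max !le_max lexx /=; apply/andP; split.
  by have := abs_le_lin z a w; rewrite le_max.
by have := lin_le z w a; rewrite le_max.
Qed.

Lemma nested_dist (a : nat -> K) (r : nat -> R) :
  (forall n, r n.+1 <= r n /\ abs (a n.+1 - a n) <= r n) ->
  forall k n, (k <= n)%N -> r n <= r k /\ abs (a n - a k) <= r k.
Proof.
move=> h k n kn; rewrite -(subnKC kn); elim: (n - k)%N => [|m [IH1 IH2]].
  by rewrite addn0 subrr (vf_abs0 V) lexx; split=> //; rewrite (le_trans (abs_ge0 V (a k.+1 - a k)))//; case: (h k).
rewrite addnS; have [h1 h2] := h (k + m)%N; split; first exact: le_trans IH1.
rewrite (le_trans (abs_subD V _ (a (k + m)%N) _))// ge_max IH2 andbT.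
exact: le_trans IH1.
Qed.

Lemma nested_facts z a r : nested_balls_to a r z ->
  [/\ forall k, lin z (a k) <= r k,
      forall k n, (k <= n)%N -> r n <= r k /\ abs (a n - a k) <= r k,
      forall k, diam z <= r k & r n @[n --> \oo] --> diam z].
Proof.
move=> [r0 h lim]; have nd := nested_dist h.
have linP w : Num.max (r n) (abs (a n - w)) @[n --> \oo] --> lin z w.
  have := lim ('X - w%:P); apply: cvg_trans; apply: near_eq_cvg; near=> n.
  by rewrite (ball_norm_XsubC V).
have lk k : lin z (a k) <= r k.
  have lcv := linP (a k).
  rewrite -(cvg_lim _ lcv)//; apply: limr_le; first by apply/cvg_ex; exists (lin z (a k)).
  near=> n; have kn : (k <= n)%N by near: n; exact: nbhs_infty_ge.
  by rewrite ge_max; have [-> ->] := nd k n kn.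
have dk k : diam z <= r k by rewrite (le_trans (diam_le z (a k))).
have rni : nonincreasing_seq r.
  by move=> k n kn; have [] := nd k n kn.
have rc : cvgn r.
  by apply: nonincreasing_is_cvgn => //; exists (diam z) => _ [n _ <-].
split => //; suff -> : diam z = limn r by [].
apply/eqP; rewrite eq_le; apply/andP; split.
  by apply: limr_ge => //; near=> n.
apply: le_diam => w; have lcv := linP w.
rewrite -(cvg_lim _ lcv)//; apply: ler_lim => //; first by apply/cvg_ex; exists (lin z w).
by near=> n; rewrite le_max lexx.
Unshelve. all: by end_near. Qed.

Lemma cvg_prod_seq (I : Type) (s : seq I) (F : nat -> I -> R) (G : I -> R) :
  (forall i, F n i @[n --> \oo] --> G i) ->
  \prod_(i <- s) F n i @[n --> \oo] --> \prod_(i <- s) G i.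
Proof.
move=> FG; elim: s => [|i s IH].
  by under eq_fun do rewrite big_nil; rewrite big_nil; exact: cvg_cst.
under eq_fun do rewrite big_cons.
by rewrite big_cons; apply: cvgM.
Qed.

(** Balls with centres of almost minimal [lin]; the convergence need only be checked on linear
    factors. *)
Lemma nested_exists z : exists a r, [/\ nested_balls_to a r z,
  forall k, lin z (a k) = r k & r n @[n --> \oo] --> diam z].
Proof.
have ex k : exists w, lin z w < diam z + k.+1%:R^-1 by apply: diam_approx; rewrite invr_gt0.
pose c k := sval (cid (ex k)).
have cP k : lin z (c k) < diam z + k.+1%:R^-1 := svalP (cid (ex k)).
(* Keeping the best centre found so far makes the radii nonincreasing. *)
pose a := fix a k := match k with 0%N => c 0%N
  | k'.+1 => if lin z (c k) < lin z (a k') then c k else a k' end.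
have aS k : a k.+1 = if lin z (c k.+1) < lin z (a k) then c k.+1 else a k by [].
have ac k : lin z (a k) <= lin z (c k).
  by case: k => // k; rewrite aS; case: ltP.
pose r k := lin z (a k).
have r0 k : 0 < r k by rewrite (lt_le_trans (diam_gt0 z))// diam_le.
have rS k : r k.+1 <= r k by rewrite /r aS; case: ltP => // /ltW.
have rlim : r n @[n --> \oo] --> diam z.
  apply/cvgrPdist_lt => e e0; near=> n.
  rewrite distrC ger0_norm ?subr_ge0 ?diam_le// ltrBlDl.
  apply: (le_lt_trans (ac n)); apply: (lt_trans (cP n)); rewrite ltrD2l.
  by near: n; exact: near_infty_natSinv_lt (PosNum e0).
exists a, r; split => //; split => // [k|p].
  split => //; rewrite (le_trans (abs_le_lin z _ _))// ge_max -/(r k) -/(r k.+1) rS lexx//.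
have [cc [rs [E _]]] := poly_splits V p.
rewrite E hberk_split.
have -> : (fun n => ball_norm abs (a n) (r n) (cc *: \prod_(w <- rs) ('X - w%:P))) =
   (fun n => abs cc * \prod_(w <- rs) Num.max (r n) (lin z w)).
  apply/funext => n; rewrite (ball_norm_split V)//; congr (_ * _).
  by apply: eq_bigr => w _; rewrite lin_max.
apply: cvgM; first exact: cvg_cst.
apply: cvg_prod_seq => w.
rewrite -[X in _ --> X](max_idPr (diam_le z w)).
apply: (@cvg_comp _ _ _ r (fun x => Num.max x (lin z w)) _ (nbhs (diam z))) => //.
apply: (@continuous_max R _ id (fun=> lin z w)); [exact: cvg_id|exact: cvg_cst].
Unshelve. all: by end_near. Qed.

End Hberk.

(** * The Berkovich extension seen through centers *)

Section PadSubst.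
Variables (K : fieldType) (num den : {poly K}).

(** [poly_subst] with the degree of g replaced by an arbitrary m: this is additive in g, whereas the
    degrees of p, q and p + q may differ. *)
Definition padded_subst (m : nat) (g : {poly K}) : {poly K} :=
  \sum_(i < m.+1) g`_i *: (num ^+ i * den ^+ (m - i)).

Lemma poly_subst_padded g : poly_subst num den g = padded_subst (size g).-1 g.
Proof.
rewrite /poly_subst /padded_subst; have [->|g0] := eqVneq g 0.
  by rewrite size_poly0 big_ord0 big_ord1 coef0 scale0r.
by rewrite prednK// size_poly_gt0.
Qed.

Lemma padded_substD m (p q : {poly K}) : padded_subst m (p + q) = padded_subst m p + padded_subst m q.
Proof. by rewrite -big_split /=; apply: eq_bigr => i _; rewrite coefD scalerDl. Qed.

Lemma padded_substZ m c (p : {poly K}) : padded_subst m (c *: p) = c *: padded_subst m p.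
Proof. by rewrite scaler_sumr; apply: eq_bigr => i _; rewrite coefZ scalerA. Qed.

Lemma padded_substS m (g : {poly K}) : (size g <= m.+1)%N ->
  padded_subst m.+1 g = den * padded_subst m g.
Proof.
move=> sg; rewrite /padded_subst big_ord_recr /= nth_default// scale0r addr0.
rewrite big_distrr /=; apply: eq_bigr => i _.
by rewrite -scalerAr mulrCA -exprS subSn// -ltnS.
Qed.

Lemma padded_substX m (g : {poly K}) : padded_subst m.+1 ('X * g) = num * padded_subst m g.
Proof.
rewrite /padded_subst big_ord_recl coefXM /= scale0r add0r.
rewrite big_distrr /=; apply: eq_bigr => i _.
by rewrite coefXM /= /bump /= add1n subSS -scalerAr exprS mulrA.
Qed.

Lemma padded_subst_prod c rs :
  padded_subst (size rs) (c *: \prod_(w <- rs) ('X - w%:P)) =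
  c *: \prod_(w <- rs) (num - w *: den).
Proof.
rewrite padded_substZ; congr (_ *: _); elim: rs => [|w rs IH].
  by rewrite !big_nil /padded_subst big_ord1 subn0 mul1r coef1 scale1r.
rewrite !big_cons -IH /= mulrBl -scaleN1r padded_substD padded_substZ.
rewrite padded_substX mul_polyC padded_substZ padded_substS; last by rewrite size_prod_XsubC.
by rewrite scaleN1r mulrBl scalerAl.
Qed.

Lemma padded_substDn m k (g : {poly K}) : (size g <= m.+1)%N ->
  padded_subst (m + k) g = den ^+ k * padded_subst m g.
Proof.
move=> sg; elim: k => [|k IH]; first by rewrite addn0 expr0 mul1r.
rewrite addnS padded_substS ?IH ?exprS ?mulrA//.
by rewrite (leq_trans sg)// ltnS leq_addr.
Qed.

End PadSubst.

Section BerkExtension.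
Variables (R : realType) (K : fieldType) (abs : K -> R).
Hypothesis V : valued_field abs.
Variables (num den : {poly K}).
Hypothesis den0 : den != 0.
Hypothesis num_den : forall e, num - e *: den != 0.

Section AtPoint.
Variable z : hberk abs.

Definition push_norm (g : {poly K}) : R :=
  z (poly_subst num den g) / z den ^+ (size g).-1.

Let zd : 0 < z den := hberk_gt0 V z den0.

Lemma push_norm_padded m (g : {poly K}) : (size g <= m.+1)%N ->
  push_norm g = z (padded_subst num den m g) / z den ^+ m.
Proof.
move=> sg; rewrite /push_norm poly_subst_padded.
have le : ((size g).-1 <= m)%N by rewrite -[m]/(m.+1.-1) -!subn1 leq_sub2r.
rewrite -{1 2}(subnKC le) padded_substDn ?leqSpred//.
rewrite hberkM (hberkX V) exprD [X in _ = X / _]mulrC -mulf_div divff ?mulr1//.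
by rewrite expf_neq0// gt_eqF.
Qed.

Lemma push_norm_prod c rs : push_norm (c *: \prod_(w <- rs) ('X - w%:P)) =
  abs c * \prod_(w <- rs) (z (num - w *: den) / z den).
Proof.
rewrite (@push_norm_padded (size rs)); last first.
  by rewrite (leq_trans (size_scale_leq _ _))// size_prod_XsubC.
rewrite padded_subst_prod hberkZ -mulrA; congr (_ * _).
elim: rs => [|w rs IH]; first by rewrite !big_nil (hberk1 V) expr0 divr1.
by rewrite !big_cons -IH hberkM exprS invfM mulrACA.
Qed.

Lemma push_seminorm : berk_seminorm abs push_norm.
Proof.
split.
- by move=> p; rewrite divr_ge0 ?exprn_ge0 ?hberk_ge0.
- move=> c; have -> : c%:P = c *: \prod_(z <- [::]) ('X - z%:P).
    by rewrite big_nil alg_polyC.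
  by rewrite push_norm_prod big_nil mulr1.
- move=> p q; have [c [rs [Ep _]]] := poly_splits V p.
  have [e [ts [Eq _]]] := poly_splits V q.
  have -> : p * q = (c * e) *: \prod_(z <- rs ++ ts) ('X - z%:P).
    by rewrite big_cat Ep Eq -scalerAl -scalerAr scalerA.
  by rewrite {1}Ep {1}Eq !push_norm_prod big_cat (vf_absM V) mulrACA.
- move=> /= p q; rewrite -[p]/(p : {poly K}) -[q]/(q : {poly K}); pose m := maxn (size p) (size q).
  have sp : (size p <= m.+1)%N by rewrite leqW// leq_maxl.
  have sq : (size q <= m.+1)%N by rewrite leqW// leq_maxr.
  have spq : (size (p + q)%R <= m.+1)%N by rewrite (leq_trans (size_polyD _ _))// geq_max sp.
  rewrite !(@push_norm_padded m)// padded_substD -mulrDl.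
  by rewrite ler_wpM2r ?invr_ge0 ?exprn_ge0 ?hberk_ge0// hberkD.
Qed.

Lemma push_norm_lin w : push_norm ('X - w%:P) = z (num - w *: den) / z den.
Proof.
have -> : 'X - w%:P = 1 *: \prod_(z <- [:: w]) ('X - z%:P) by rewrite big_seq1 scale1r.
by rewrite push_norm_prod big_seq1 (abs1 V) mul1r.
Qed.

Lemma push_not_classical e : push_norm <> (fun p => abs p.[e]).
Proof.
move=> /(congr1 (fun s => s ('X - e%:P))).
rewrite push_norm_lin hornerXsubC subrr (vf_abs0 V) => E.
by have := divr_gt0 (hberk_gt0 V z (num_den e)) zd; rewrite E ltxx.
Qed.

Definition push_point : hberk abs := HBerk push_seminorm push_not_classical.

Lemma lin_push w : lin push_point w = z (num - w *: den) / z den.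
Proof. exact: push_norm_lin. Qed.

End AtPoint.

Lemma push_berk_extension : is_berk_extension num den push_point.
Proof. by []. Qed.

End BerkExtension.

(* A center of a Berkovich point in a spherically complete extension turns it *)
(* into the point of a ball, including the points of type IV.                 *)
Section Center.
Variables (R : realType) (K K2 : fieldType) (abs : K -> R) (abs2 : K2 -> R).
Hypotheses (V : valued_field abs) (V2 : valued_field abs2).
Variable J : {rmorphism K -> K2}.
Hypothesis J_abs : forall x, abs2 (J x) = abs x.
Implicit Types z : hberk abs.

Definition center z (beta : K2) : Prop :=
  forall w, Num.max (diam z) (abs2 (beta - J w)) = lin z w.

Definition spherically_complete : Prop :=
  forall (a : nat -> K2) (r : nat -> R), (forall n, 0 < r n) ->
    (forall n, r n.+1 <= r n /\ abs2 (a n.+1 - a n) <= r n) ->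
    exists beta, forall n, abs2 (beta - a n) <= r n.

Lemma le_max_cvg (r : nat -> R) (m x y : R) : r n @[n --> \oo] --> m ->
  (forall k, x <= Num.max (r k) y) -> x <= Num.max m y.
Proof.
move=> rm h; rewrite leNgt gt_max; apply/negP => /andP[mx yx].
have := @cvgr_lt _ _ _ _ _ _ rm x mx; move=> [N _ /(_ N (leqnn N)) /= rN].
by have := h N; rewrite leNgt gt_max rN yx.
Qed.

(** The images of nested balls converging to z have a common point beta, which then sees every w of
    K at the same distance as z does. *)
Lemma center_exists z : spherically_complete -> exists beta, center z beta.
Proof.
move=> sc; have [a [r [[r0 nest _] lr rd]]] := nested_exists V z.
have [|beta bP] := sc (fun n => J (a n)) r r0.
  by move=> n; rewrite -rmorphB J_abs.
exists beta => w.
have E k : Num.max (r k) (abs2 (beta - J w)) = Num.max (r k) (lin z w).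
  by rewrite (max_center V2 _ (bP k)) -rmorphB J_abs -lr lin_max.
rewrite -[RHS](max_idPr (diam_le z w)); apply/eqP; rewrite eq_le; apply/andP; split.
  rewrite ge_max le_max lexx /=; apply: (le_max_cvg rd) => k.
  by rewrite -E le_max lexx orbT.
rewrite ge_max le_max lexx /=; apply: (le_max_cvg rd) => k.
by rewrite E le_max lexx orbT.
Qed.

Lemma center_nested z beta a r : center z beta -> nested_balls_to a r z ->
  forall k, abs2 (beta - J (a k)) <= r k.
Proof.
move=> cz /(nested_facts V)[lr _ _ _] k.
by rewrite (le_trans _ (lr k))// -cz le_max lexx orbT.
Qed.

Lemma max_max_center (r s : R) x y x' y' : abs2 (x - x') <= r -> abs2 (y - y') <= s ->
  Num.max (Num.max r s) (abs2 (x - y)) = Num.max (Num.max r s) (abs2 (x' - y')).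
Proof.
move=> xx yy; have [xx' yy'] : abs2 (x - x') <= Num.max r s /\ abs2 (y' - y) <= Num.max r s.
  by rewrite !le_max xx (absB V2 y') yy orbT.
by rewrite (max_center V2 _ xx') (absB V2 x') (absB V2 x') (max_center V2 _ yy').
Qed.

(** The centres of any nested balls may be replaced by beta and beta' inside the maximum, so every
    admissible pair of sequences has the same limit and the choice made by [xget] is harmless. *)
Lemma hberk_dist_center z w beta beta' : center z beta -> center w beta' ->
  hberk_dist z w = 2 * ln (Num.max (Num.max (diam z) (diam w)) (abs2 (beta - beta')))
    - ln (diam z) - ln (diam w).
Proof.
move=> cz cw; set l := RHS.
have key a r b s : nested_balls_to a r z -> nested_balls_to b s w ->
    ball_dist abs (a n) (r n) (b n) (s n) @[n --> \oo] --> l.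
  move=> nz nw; have [_ _ _ rd] := nested_facts V nz; have [_ _ _ sd] := nested_facts V nw.
  have E n : ball_dist abs (a n) (r n) (b n) (s n) =
      2 * ln (Num.max (Num.max (r n) (s n)) (abs2 (beta - beta'))) - ln (r n) - ln (s n).
    rewrite /ball_dist -J_abs rmorphB; congr (2 * ln _ - _ - _).
    by rewrite (max_max_center (center_nested cz nz n) (center_nested cw nw n)).
  under eq_fun do rewrite E.
  have cln (f : nat -> R) (x : R) : 0 < x -> f n @[n --> \oo] --> x ->
      ln (f n) @[n --> \oo] --> ln x.
    by move=> x0 fx; apply: continuous_cvg => //; exact: continuous_ln.
  apply: cvgB; [apply: cvgB|]; [apply: cvgM; [exact: cvg_cst|]| |];
    apply: cln; rewrite ?lt_max ?diam_gt0//.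
  have cmax (f g : nat -> R) (x y : R) : f n @[n --> \oo] --> x ->
      g n @[n --> \oo] --> y -> Num.max (f n) (g n) @[n --> \oo] --> Num.max x y.
    by move=> fx gy; under eq_fun do rewrite maxr_absE; rewrite maxr_absE;
       apply: cvgM; [apply: cvgD; [exact: cvgD|apply: cvg_norm; exact: cvgB]|exact: cvg_cst].
  by apply: (cmax _ _ _ _); [exact: (cmax)|exact: cvg_cst].
rewrite /hberk_dist; case: xgetP => [x _ [a [r [b [s [nz nw lim]]]]]|/(_ l)].
  by apply: (cvg_unique _ lim (key _ _ _ _ nz nw)).
have [a [r [nz _ _]]] := nested_exists V z; have [b [s [nw _ _]]] := nested_exists V w.
by case; exists a, r, b, s; split=> //; exact: key.
Qed.

Lemma hberk_gauss z beta m (p : {poly K}) : center z beta -> (size p <= m)%N ->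
  z p = gauss abs2 m beta (diam z) (map_poly J p).
Proof.
move=> cz sp; have d0 := diam_gt0 V z.
rewrite -(ball_norm_gauss V2 _ d0); last by rewrite size_map_poly.
have [c [rs [E _]]] := poly_splits V p.
rewrite {1}E (hberk_split V) E map_polyZ rmorph_prod.
have -> : \prod_(w <- rs) map_poly J ('X - w%:P) = \prod_(w <- [seq J w | w <- rs]) ('X - w%:P).
  by rewrite big_map; apply: eq_bigr => w _; rewrite rmorphB /= map_polyX map_polyC.
by rewrite (ball_norm_split V2)// J_abs big_map; congr (_ * _); apply: eq_bigr.
Qed.

Lemma gauss_map m a r p : gauss abs2 m (J a) r (map_poly J p) = gauss abs m a r p.
Proof.
apply: eq_bigr => i _; rewrite -J_abs; congr (abs2 _ * _).
have -> : 'X + (J a)%:P = map_poly J ('X + a%:P) by rewrite rmorphD /= map_polyX map_polyC.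
by rewrite -map_comp_poly coef_map.
Qed.

Section PushCenter.
Variables (num den : {poly K}) (d : nat).
Hypothesis den0 : den != 0.
Hypothesis num_den : forall e, num - e *: den != 0.
Hypotheses (snum : (size num <= d.+1)%N) (sden : (size den <= d.+1)%N).
Variables (z : hberk abs) (beta : K2).
Hypothesis cz : center z beta.

Let N := map_poly J num.
Let D := map_poly J den.
Let G := gauss abs2 d.+1 beta (diam z).

Variable i0 : nat.
Hypotheses (i0d : (i0 < d.+1)%N)
  (Di0 : abs2 (D \Po ('X + beta%:P))`_i0 * diam z ^+ i0 = G D).

Let w0 := (N \Po ('X + beta%:P))`_i0 / (D \Po ('X + beta%:P))`_i0.
Let Rr := G (N - w0 *: D) / G D.
Let Bz := push_point V den0 num_den z.

Lemma push_GD : 0 < G D.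
Proof. by rewrite /G -(hberk_gauss cz sden) (hberk_gt0 V). Qed.

Lemma lin_push_center w : lin Bz w = Num.max Rr (abs2 (w0 - J w)).
Proof.
rewrite /Bz lin_push (hberk_gauss cz sden) (@hberk_gauss _ _ d.+1 _ cz); last first.
  by rewrite (leq_trans (size_polyD _ _))// geq_max snum size_polyN (leq_trans (size_scale_leq _ _)).
have GD := push_GD; have d0 := ltW (diam_gt0 V z).
rewrite rmorphB /= map_polyZ -/N -/D -/(G _).
rewrite {1}/G (gauss_optimal V2 _ d0 i0d Di0) ?gt_eqF// -/G -/w0.
rewrite maxr_pMl ?invr_ge0 ?(ltW GD)// mulfK// gt_eqF//.
Qed.

(** The lower bound is immediate. For the upper one w0 must be approached from K: the image centres
    wk of nested balls over K do so, and [gauss_radius] bounds the loss by (r k / diam z)^d, which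
    tends to 1. *)
Lemma diam_push : diam Bz = Rr.
Proof.
apply/eqP; rewrite eq_le; apply/andP; split; last first.
  by apply: le_diam => w; rewrite lin_push_center le_max lexx.
have [a [r [nest lr rd]]] := nested_exists V z.
have [_ _ dr _] := nested_facts V nest.
have d0 := diam_gt0 V z.
have r0 k : 0 < r k := lt_le_trans d0 (dr k).
suff h k : diam Bz <= (r k / diam z) ^+ d * Rr.
  have c1 : (r k / diam z) ^+ d * Rr @[k --> \oo] --> (diam z / diam z) ^+ d * Rr.
    apply: cvgM; last exact: cvg_cst.
    apply: (@continuous_cvg _ _ _ _ _ _ (fun x : R => x ^+ d)); first exact: exprn_continuous.
    by apply: cvgM => //; exact: cvg_cst.
  rewrite divff ?gt_eqF// expr1n mul1r in c1.
  rewrite -(cvg_lim _ c1)//; apply: limr_ge; first by apply/cvg_ex; exists Rr.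
  by near=> k; exact: h.
have Dk0 : 0 < gauss abs d.+1 (a k) (r k) den by rewrite (gauss_gt0 V).
have [i id Di] := gauss_argmax (lt0r_neq0 Dk0).
set wk := (num \Po ('X + (a k)%:P))`_i / (den \Po ('X + (a k)%:P))`_i.
have GD := push_GD.
have ck : abs2 (J (a k) - beta) <= r k by rewrite (absB V2) (center_nested cz nest).
have sND : (size (N - w0 *: D)%R <= d.+1)%N.
  rewrite (leq_trans (size_polyD _ _))// geq_max size_polyN.
  by rewrite (leq_trans (size_scale_leq _ _)) ?size_map_poly ?snum.
have Rge : 1 <= (r k / diam z) ^+ d by rewrite exprn_ege1// ler_pdivlMr ?mul1r.
have R0 : 0 <= Rr by rewrite divr_ge0 ?gauss_ge0.
have key : abs2 (J wk - w0) <= (r k / diam z) ^+ d * Rr.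
  have [g1 _] := gauss_radius V2 d0 (dr k) ck sND sND.
  have sD : (size D <= d.+1)%N by rewrite size_map_poly.
  have [_ g2] := gauss_radius V2 d0 (dr k) ck sD sD.
  have Pk : abs2 (D \Po ('X + (J (a k))%:P))`_i * r k ^+ i = gauss abs2 d.+1 (J (a k)) (r k) D.
    rewrite gauss_map -Di -J_abs; congr (abs2 _ * _).
    have -> : 'X + (J (a k))%:P = map_poly J ('X + (a k)%:P) by rewrite rmorphD /= map_polyX map_polyC.
    by rewrite -map_comp_poly coef_map.
  have wkE : J wk = (N \Po ('X + (J (a k))%:P))`_i / (D \Po ('X + (J (a k))%:P))`_i.
    have -> : 'X + (J (a k))%:P = map_poly J ('X + (a k)%:P) by rewrite rmorphD /= map_polyX map_polyC.
    by rewrite -!map_comp_poly !coef_map fmorph_div.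
  have Gk0 : 0 < gauss abs2 d.+1 (J (a k)) (r k) D by rewrite gauss_map.
  have := gauss_optimal V2 N (ltW (r0 k)) id Pk (lt0r_neq0 Gk0).
  rewrite -wkE => /(_ w0) opt.
  have le1 : abs2 (J wk - w0) * gauss abs2 d.+1 (J (a k)) (r k) D <=
     (r k / diam z) ^+ d * G (N - w0 *: D).
    by rewrite (le_trans _ g1)// opt le_max lexx orbT.
  rewrite /Rr mulrA ler_pdivlMr//; apply: le_trans le1.
  by rewrite ler_wpM2l ?(abs_ge0 V2).
rewrite (le_trans (diam_le _ wk))// lin_push_center ge_max (absB V2) key andbT.
by rewrite ler_peMl.
Unshelve. all: by end_near. Qed.

Lemma push_center : center Bz w0.
Proof. by move=> w; rewrite diam_push lin_push_center. Qed.

End PushCenter.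
End Center.

(** * The field of Puiseux series is valued and algebraically closed *)

Section PuiseuxValuation.
Variable R : realType.
Local Notation C := R[i].
Local Notation L := (puiseux R).
Local Notation mono := (@puiseux_monomial R).
Implicit Types a b : L.

Definition val_ge a (m : rat) : Prop := forall l, a l != 0 -> m <= l.

Lemma puiseux_coefD a b l : (a + b) l = a l + b l. Proof. by []. Qed.
Lemma puiseux_coefN a l : (- a) l = - a l. Proof. by []. Qed.
Lemma puiseux_coefB a b l : (a - b) l = a l - b l. Proof. by []. Qed.
Lemma puiseux_coef0 l : (0 : L) l = 0. Proof. by []. Qed.
Lemma puiseux_coef1 l : (1 : L) l = if l == 0 then 1 else 0. Proof. by []. Qed.

Lemma val_ge_coef a m l : val_ge a m -> l < m -> a l = 0.
Proof. by move=> am lm; apply/eqP; apply: contraLR lm => /am; rewrite leNgt. Qed.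

Lemma val_geW a m m' : val_ge a m -> m' <= m -> val_ge a m'.
Proof. by move=> am mm l /am; exact: le_trans. Qed.

Lemma val_ge0 m : val_ge 0 m. Proof. by move=> l; rewrite puiseux_coef0 eqxx. Qed.

Lemma val_geD a b m : val_ge a m -> val_ge b m -> val_ge (a + b) m.
Proof.
move=> am bm l; rewrite puiseux_coefD; have [->|/am//] := eqVneq (a l) 0.
by rewrite add0r => /bm.
Qed.

Lemma val_geN a m : val_ge a m -> val_ge (- a) m.
Proof. by move=> am l; rewrite puiseux_coefN oppr_eq0 => /am. Qed.

Lemma val_ge_sum (I : Type) (s : seq I) (P : pred I) (F : I -> L) m :
  (forall i, P i -> val_ge (F i) m) -> val_ge (\sum_(i <- s | P i) F i) m.
Proof. by move=> h; elim/big_rec: _ => [|i x /h]; [exact: val_ge0|exact: val_geD]. Qed.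

Lemma coefM_low a b m n : val_ge a m -> val_ge b n ->
  val_ge (a * b) (m + n) /\ (a * b) (m + n) = a m * b n.
Proof.
move=> am bn; split.
  move=> l; have [A HA] := puiseux_supp a (l - n).
  rewrite (puiseux_coefM bn HA) leNgt; apply: contra => lmn.
  apply/eqP; apply: big1 => k _; have [->|/am mk] := eqVneq (a k) 0; first by rewrite mul0r.
  by rewrite (val_ge_coef bn) ?mulr0//; lra.
have HA l : l <= m + n - n -> a l != 0 -> l \in [fset m]%fset.
  by move=> h /am ml; rewrite inE eq_le ml andbT; lra.
rewrite (puiseux_coefM bn HA) big_seq_fset1; congr (_ * b _); ring.
Qed.

Lemma val_geM a b m n : val_ge a m -> val_ge b n -> val_ge (a * b) (m + n).
Proof. by move=> am /(coefM_low am)[]. Qed.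

Lemma coef_mono l (c : C) m : mono l c m = if m == l then c else 0. Proof. by []. Qed.

Lemma val_mono l (c : C) : val_ge (mono l c) l.
Proof. by move=> m; rewrite coef_mono; case: (eqVneq m l) => [->|_] //=; rewrite eqxx. Qed.

Lemma coef_monoM l (c : C) a x : (mono l c * a) x = c * a (x - l).
Proof. exact: puiseux_monomialM. Qed.

Lemma monoM l m (c e : C) : mono l c * mono m e = mono (l + m) (c * e).
Proof.
apply: puiseuxP => x; rewrite coef_monoM !coef_mono subr_eq (addrC m).
by case: eqP => _; rewrite ?mulr0.
Qed.

Lemma mono_exp l n : mono l 1 ^+ n = mono (l * n%:R) 1.
Proof.
elim: n => [|n IH]; first by rewrite mulr0.
by rewrite exprS IH monoM mulr1 -[in RHS]add1n natrD mulrDr mulr1.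
Qed.

Definition const (c : C) : L := mono 0 c.

Lemma const_zmod_morphism : zmod_morphism const.
Proof.
move=> x y; apply: puiseuxP => l; rewrite puiseux_coefB !coef_mono.
by case: eqP; rewrite ?subr0.
Qed.

Lemma const_monoid_morphism : monoid_morphism const.
Proof. by split=> // x y; rewrite /const monoM addr0. Qed.

HB.instance Definition _ := GRing.isZmodMorphism.Build C L const const_zmod_morphism.
HB.instance Definition _ := GRing.isMonoidMorphism.Build C L const const_monoid_morphism.

Lemma val_const c : val_ge (const c) 0. Proof. exact: val_mono. Qed.

Lemma puiseux_neq0 a : a != 0 -> exists m, a m != 0 /\ val_ge a m.
Proof.
move=> a0; have [x ax] : exists x, a x != 0.
  apply/not_existsP => nE; case/eqP: a0; apply: puiseuxP => l.
  by have /negP := nE l; rewrite negbK => /eqP.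
exact: puiseux_min ax.
Qed.

Lemma puiseux_absE a m : a m != 0 -> val_ge a m -> puiseux_abs a = expR (- ratr m).
Proof.
move=> am ge; rewrite /puiseux_abs ifN; last first.
  by apply: contraNneq am => ->; rewrite puiseux_coef0.
congr (expR (- _)); apply/eqP; rewrite eq_le; apply/andP; split.
  apply: ge_inf; last by exists m.
  by exists (ratr m) => _ [l /= /ge ml <-]; rewrite ler_rat.
apply: lb_le_inf; first by exists (ratr m), m.
by move=> _ [l /= /ge ml <-]; rewrite ler_rat.
Qed.

Lemma puiseux_abs0 : puiseux_abs (0 : L) = 0. Proof. by rewrite /puiseux_abs eqxx. Qed.

Lemma puiseux_abs_le a m : puiseux_abs a <= expR (- ratr m) <-> val_ge a m.
Proof.
have [->|/puiseux_neq0[k [ak ge]]] := eqVneq a 0.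
  by rewrite puiseux_abs0 expR_ge0; split => // _; exact: val_ge0.
rewrite (puiseux_absE ak ge) ler_expR lerN2 ler_rat; split; first exact: val_geW.
exact.
Qed.

Lemma puiseux_abs_gt0 a : a != 0 -> 0 < puiseux_abs a.
Proof. by move=> /puiseux_neq0[m [am ge]]; rewrite (puiseux_absE am ge) expR_gt0. Qed.

Lemma puiseux_absM a b : puiseux_abs (a * b) = puiseux_abs a * puiseux_abs b.
Proof.
have [->|/puiseux_neq0[m [am gm]]] := eqVneq a 0; first by rewrite mul0r puiseux_abs0 mul0r.
have [->|/puiseux_neq0[n [bn gn]]] := eqVneq b 0; first by rewrite mulr0 puiseux_abs0 mulr0.
have [ge E] := coefM_low gm gn.
rewrite (puiseux_absE am gm) (puiseux_absE bn gn) (@puiseux_absE _ (m + n)) ?E ?mulf_neq0//.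
by rewrite rmorphD opprD expRD.
Qed.

Lemma puiseux_absD a b : puiseux_abs (a + b) <= Num.max (puiseux_abs a) (puiseux_abs b).
Proof.
have [->|/puiseux_neq0[m [am gm]]] := eqVneq a 0; first by rewrite add0r le_max lexx orbT.
have [->|/puiseux_neq0[n [bn gn]]] := eqVneq b 0; first by rewrite addr0 le_max lexx.
rewrite le_max (puiseux_absE am gm) (puiseux_absE bn gn).
have [mn|/ltW mn] := leP m n; apply/orP; [left|right]; apply/puiseux_abs_le.
  by apply: val_geD => //; exact: val_geW gn mn.
by apply: val_geD => //; exact: val_geW gm mn.
Qed.

Lemma puiseux_abs_mono l (c : C) : c != 0 -> puiseux_abs (mono l c) = expR (- ratr l).
Proof. by move=> c0; apply: puiseux_absE; [rewrite coef_mono eqxx|exact: val_mono]. Qed.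

Lemma puiseux_natr n : (n%:R : L) = const n%:R.
Proof. by rewrite rmorph_nat. Qed.

Lemma puiseux_abs_nat n : puiseux_abs (n.+1%:R : L) = 1.
Proof.
by rewrite puiseux_natr puiseux_abs_mono ?rmorph0 ?oppr0 ?expR0// pnatr_eq0.
Qed.

Lemma puiseux_dense (s r : R) : 0 < s -> s < r -> exists x : L, s < puiseux_abs x <= r.
Proof.
move=> s0 sr; have r0 := lt_trans s0 sr.
have : - ln r < - ln s by rewrite ltrN2 ltr_ln.
move=> /rat_in_itvoo[q]; rewrite in_itv /= => /andP[q1 q2].
exists (mono q 1); rewrite puiseux_abs_mono ?oner_neq0//.
rewrite -{1}(lnK s0) -[X in _ <= X](lnK r0) ltr_expR ler_expR; apply/andP; split; lra.
Qed.

Lemma ratr_natr (k : nat) : ratr k%:R = k%:R :> R. Proof. by rewrite ratr_nat. Qed.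

(** The coefficient at an exponent below k no longer changes from a k on; the limit is read off
    coefficientwise and inherits a left-finite support. *)
Lemma puiseux_cauchy (a : nat -> L) : (forall k, val_ge (a k.+1 - a k) k%:R) ->
  exists x : L, forall k, val_ge (x - a k) k%:R.
Proof.
move=> h.
have stab k n : (k <= n)%N -> val_ge (a n - a k) k%:R.
  move=> kn; rewrite -(subnKC kn); elim: (n - k)%N => [|j IH].
    by rewrite addn0 subrr; exact: val_ge0.
  rewrite addnS -(subrKA (a (k + j)%N)); apply: val_geD => //.
  by apply: val_geW (h _) _; rewrite ler_nat leq_addr.
have stabE k n l : (k <= n)%N -> l < k%:R -> a n l = a k l.
  move=> kn lk; apply/eqP; rewrite -subr_eq0 -puiseux_coefB.
  by rewrite (val_ge_coef (stab _ _ kn) lk).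
pose N (l : rat) := Num.bound `|l|.
have NP l : l < (N l)%:R by rewrite (le_lt_trans (ler_norm l))//; apply: archi_boundP.
pose b l := a (N l) l.
have bE n l : l < n%:R -> b l = a n l.
  move=> ln; have [le|/ltnW le] := leqP n (N l).
    by rewrite /b (stabE _ _ _ le ln).
  by rewrite /b -(stabE _ _ _ le (NP l)).
have bP : `[< left_finite b >].
  apply/asboolP => x; have /asboolP/(_ x) := coef_left_finite (a (N x)).
  by apply: sub_finite_set => l [lx]; rewrite (bE (N x)) ?(le_lt_trans lx).
exists (Puiseux bP) => k l; apply: contraNle => lk.
by rewrite puiseux_coefB -(bE k l lk) subrr.
Qed.

Lemma puiseux_complete (a : nat -> L) :
  (forall k, puiseux_abs (a k.+1 - a k) <= expR (- k%:R)) ->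
  exists x : L, forall k, puiseux_abs (x - a k) <= expR (- k%:R).
Proof.
move=> h; have [|x xP] := @puiseux_cauchy a.
  by move=> k; apply/puiseux_abs_le; rewrite ratr_nat.
by exists x => k; rewrite -ratr_natr; apply/puiseux_abs_le.
Qed.

End PuiseuxValuation.

(** * Hensel's lemma for polynomials over the Puiseux field *)

Section PuiseuxRoots.
Variable R : realType.
Local Notation C := R[i].
Local Notation L := (puiseux R).
Local Notation mono := (@puiseux_monomial R).
Local Notation lift := (map_poly (@const R)).

Definition poly_ge (p : {poly L}) (m : rat) : Prop := forall i, val_ge p`_i m.

Lemma poly_geD p q m : poly_ge p m -> poly_ge q m -> poly_ge (p + q) m.
Proof. by move=> pm qm i; rewrite coefD; exact: val_geD. Qed.

Lemma poly_geN p m : poly_ge p m -> poly_ge (- p) m.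
Proof. by move=> pm i; rewrite coefN; exact: val_geN. Qed.

Lemma poly_geM p q m n : poly_ge p m -> poly_ge q n -> poly_ge (p * q) (m + n).
Proof. by move=> pm qn i; rewrite coefM; apply: val_ge_sum => j _; exact: val_geM. Qed.

Lemma poly_geW p m m' : poly_ge p m -> m' <= m -> poly_ge p m'.
Proof. by move=> pm mm i; exact: val_geW (pm i) mm. Qed.

Lemma poly_ge_lift (p : {poly C}) : poly_ge (lift p) 0.
Proof. by move=> i; rewrite coef_map; exact: val_const. Qed.

Lemma poly_ge_sum (I : Type) (s : seq I) (F : I -> {poly L}) m :
  (forall i, poly_ge (F i) m) -> poly_ge (\sum_(i <- s) F i) m.
Proof. by move=> h i; rewrite coef_sum; apply: val_ge_sum => j _; exact: h. Qed.

(** Reduce the multiplier u of h modulo g; the degree of v is then forced, since g v = e - h u. The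
    degree bounds keep the corrections of Hensel's lemma below the leading terms. *)
Lemma bezout_coef (g h e : {poly C}) a b : coprimep g h ->
  size g = a.+1 -> size h = b.+1 -> (0 < b)%N -> (size e <= a + b)%N ->
  exists u v, [/\ e = g * v + h * u, (size u <= a)%N & (size v <= b)%N].
Proof.
move=> cop sg sh b0 se.
have g0 : g != 0 by rewrite -size_poly_gt0 sg.
have /Bezout_coprimepP[[s t] /= st1] := cop.
have [c c0 st] : exists2 c, c != 0 & s * g + t * h = c%:P.
  have := eqp_size st1; rewrite size_poly1 => /eqP/size_poly1P[c c0 E]; by exists c.
pose f := c^-1 *: e.
pose u := (f * t) %% g; pose q := (f * t) %/ g; pose v := f * s + q * h.
have E : e = g * v + h * u.
  have -> : e = f * c%:P by rewrite mulrC mul_polyC /f scalerA mulfV// scale1r.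
  have ft : f * t = q * g + u := divp_eq (f * t) g.
  by rewrite -st /v mulrDr (mulrA f t) ft; ring.
have su : (size u <= a)%N by rewrite -ltnS -sg ltn_modp.
exists u, v; split=> //; rewrite leqNgt; apply/negP => sv.
have v0 : v != 0 by rewrite -size_poly_gt0 (leq_trans _ sv).
have sgv : size (g * v) = (a + size v)%N by rewrite size_mul// sg.
have shu : (size (h * u)%R <= b + size u)%N by rewrite (leq_trans (size_polyMleq _ _))// sh.
have : (size (g * v)%R <= maxn (size e) (size (h * u)%R))%N.
  by have -> : g * v = e - h * u by [rewrite E addrK]; rewrite (leq_trans (size_polyD _ _))// size_polyN.
rewrite sgv leq_max => /orP[h1|h1].
  by have := leq_trans h1 se; rewrite leq_add2l leqNgt sv.
have := leq_trans h1 (leq_trans shu (_ : _ <= a + b)%N).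
by rewrite addnC leq_add2r leq_add2l su leqNgt sv => /(_ isT).
Qed.

Section Hensel.
Variables (g h : {poly C}) (a b : nat) (e : rat) (p : {poly L}).
Hypotheses (cop : coprimep g h) (sg : size g = a.+1) (sh : size h = b.+1).
Hypotheses (a0 : (0 < a)%N) (b0 : (0 < b)%N) (e0 : 0 < e).
Hypothesis sp : (size (p - lift (g * h))%R <= a + b)%N.

Definition approx (m : rat) (G H : {poly L}) : Prop :=
  [/\ poly_ge (p - G * H) m, poly_ge (G - lift g) e, poly_ge (H - lift h) e,
      (size (G - lift g)%R <= a)%N & (size (H - lift h)%R <= b)%N].

Lemma size_approx (q : {poly C}) (Q : {poly L}) n : size q = n.+1 ->
  (size (Q - lift q)%R <= n)%N -> size Q = n.+1.
Proof.
move=> sq sQ; have sl : size (lift q) = n.+1 by rewrite size_map_poly.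
by rewrite -(subrK (lift q) Q) addrC size_polyDl ?sl.
Qed.

Lemma size_lowM (n k : nat) (P Q : {poly L}) :
  (size P <= n)%N -> (size Q <= k.+1)%N -> (size (P * Q)%R <= n + k)%N.
Proof. by move=> sP sQ; apply: leq_trans (size_polyMleq _ _) _; lia. Qed.

Lemma approx_size m G H : approx m G H -> (size (p - G * H)%R <= a + b)%N.
Proof.
move=> [_ _ _ sG sH].
have -> : p - G * H = (p - lift (g * h)) - (G - lift g) * H - (H - lift h) * lift g.
  rewrite rmorphM /=; ring.
apply: leq_trans (size_polyD _ _) _; rewrite size_polyN geq_max; apply/andP; split; last first.
  by rewrite addnC size_lowM// size_map_poly sg.
apply: leq_trans (size_polyD _ _) _; rewrite size_polyN geq_max sp /=.
by rewrite size_lowM// (size_approx sh sH).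
Qed.

(** Solve g dh + h dg = E for the current error E. The new error consists of products of a
    correction with G - g, with H - h or with the other correction, so its valuation grows by e. *)
Lemma approx_step m G H : 0 <= m -> approx (e + m) G H -> exists G' H',
  [/\ approx (e + m + e) G' H', poly_ge (G' - G) (e + m) & poly_ge (H' - H) (e + m)].
Proof.
move=> m0 aGH; have sE := approx_size aGH; case: aGH => [Em Gg Hh sG sH].
set E := p - G * H in Em sE.
have sol i : exists uv : {poly C} * {poly C}, (i < a + b)%N ->
    [/\ 'X^i = g * uv.2 + h * uv.1, (size uv.1 <= a)%N & (size uv.2 <= b)%N].
  have [lt|_] := boolP (i < a + b)%N; last by exists (0, 0).
  have [|u [v uv]] := @bezout_coef g h 'X^i a b cop sg sh b0; last by exists (u, v).
  by rewrite size_polyXn.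
pose uv i := sval (cid (sol i)).
have uvP i : (i < a + b)%N -> [/\ 'X^i = g * (uv i).2 + h * (uv i).1,
  (size (uv i).1 <= a)%N & (size (uv i).2 <= b)%N] := svalP (cid (sol i)).
pose dg := \sum_(i < (a + b)%N) E`_i *: lift (uv i).1.
pose dh := \sum_(i < (a + b)%N) E`_i *: lift (uv i).2.
have ge_comb (F : nat -> {poly C}) : poly_ge (\sum_(i < (a + b)%N) E`_i *: lift (F i)) (e + m).
  apply: poly_ge_sum => i j; rewrite coefZ -[e + m]addr0.
  by apply: val_geM; [exact: Em|exact: poly_ge_lift].
have dg_ge : poly_ge dg (e + m) by exact: (ge_comb (fun i => (uv i).1)).
have dh_ge : poly_ge dh (e + m) by exact: (ge_comb (fun i => (uv i).2)).
have size_comb (F : nat -> {poly C}) n : (forall i, (i < a + b)%N -> (size (F i) <= n)%N) ->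
    (size (\sum_(i < (a + b)%N) E`_i *: lift (F i))%R <= n)%N.
  move=> Fn; apply: leq_trans (size_sum _ _ _) _; apply/bigmax_leqP => i _.
  by rewrite (leq_trans (size_scale_leq _ _))// size_map_poly Fn.
have sdg : (size dg <= a)%N.
  by apply: (size_comb (fun i => (uv i).1)) => i /uvP[].
have sdh : (size dh <= b)%N.
  by apply: (size_comb (fun i => (uv i).2)) => i /uvP[].
have EE : E = lift g * dh + lift h * dg.
  have {1}-> : E = \sum_(i < (a + b)%N) E`_i *: lift 'X^i.
    under eq_bigr do rewrite map_polyXn.
    rewrite -poly_def; apply/polyP => i; rewrite coef_poly.
    by case: ltnP => // le; rewrite nth_default// (leq_trans sE).
  rewrite !big_distrr -big_split /=; apply: eq_bigr => i _.
  by have [{1}-> _ _] := uvP i (ltn_ord i); rewrite rmorphD !rmorphM /= scalerDr -!scalerAr.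
exists (G + dg), (H + dh); rewrite !(addrAC _ dg) !(addrAC _ dh) !subrr !add0r.
split=> //; split; last 2 first.
- by rewrite addrAC (leq_trans (size_polyD _ _))// geq_max sG.
- by rewrite addrAC (leq_trans (size_polyD _ _))// geq_max sH.
- have -> : p - (G + dg) * (H + dh) =
      - ((G - lift g) * dh) - (H - lift h) * dg - dg * dh.
    have -> : p = E + G * H by rewrite /E subrK.
    by rewrite EE; ring.
  rewrite [e + m + e]addrC.
  apply: poly_geD; last by apply: poly_geN; apply: poly_geM => //; apply: poly_geW dg_ge _; rewrite lerDl.
  by apply: poly_geD; apply: poly_geN; exact: poly_geM.
- by rewrite addrAC; apply: poly_geD => //; apply: poly_geW dg_ge _; rewrite lerDl.
- by rewrite addrAC; apply: poly_geD => //; apply: poly_geW dh_ge _; rewrite lerDl.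
Qed.

(** Enough steps of size e to gain a full unit, the rate for which [puiseux_cauchy] is stated. *)
Lemma approx_unit m G H : 0 <= m -> approx (e + m) G H -> exists G' H',
  [/\ approx (e + (m + 1)) G' H', poly_ge (G' - G) (e + m) & poly_ge (H' - H) (e + m)].
Proof.
move=> m0 aGH.
have iter n : exists G' H', [/\ approx (e + (m + e * n%:R)) G' H',
     poly_ge (G' - G) (e + m) & poly_ge (H' - H) (e + m)].
  elim: n => [|n [G1 [H1 [a1 dG dH]]]].
    exists G, H; rewrite mulr0 addr0 !subrr; split=> //; move=> i; rewrite coef0; exact: val_ge0.
  have en : 0 <= e * n%:R by rewrite mulr_ge0 ?ler0n// ltW.
  have [|G2 [H2 [a2 dG2 dH2]]] := approx_step _ a1; first by rewrite addr_ge0.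
  exists G2, H2; split.
  - suff -> : e + (m + e * n.+1%:R) = e + (m + e * n%:R) + e by [].
    by rewrite -natr1; ring.
  - rewrite -(subrKA G1); apply: poly_geD => //; apply: poly_geW dG2 _; lra.
  - rewrite -(subrKA H1); apply: poly_geD => //; apply: poly_geW dH2 _; lra.
pose n := Num.bound `|e^-1|.
have en : 1 <= e * n%:R.
  rewrite -ler_pdivrMl// mulr1 (le_trans (ler_norm _))// ltW//.
  by apply: archi_boundP.
have [G' [H' [a' dG dH]]] := iter n.
exists G', H'; split=> //; case: a' => [pa ? ? ? ?]; split=> //.
by apply: poly_geW pa _; lra.
Qed.

Lemma hensel_factor : poly_ge (p - lift (g * h)) e ->
  exists G H, p = G * H /\ size G = a.+1.
Proof.
move=> pe.
have start : {GH : {poly L} * {poly L} | approx (e + 0) GH.1 GH.2}.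
  exists (lift g, lift h) => /=; rewrite addr0; split; rewrite ?subrr ?size_poly0//.
  - by rewrite -rmorphM.
  - by move=> i; rewrite coef0; exact: val_ge0.
  - by move=> i; rewrite coef0; exact: val_ge0.
have next (k : nat) (GH : {poly L} * {poly L}) : exists GH' : {poly L} * {poly L},
    approx (e + k%:R) GH.1 GH.2 -> [/\ approx (e + k.+1%:R) GH'.1 GH'.2,
     poly_ge (GH'.1 - GH.1) (e + k%:R) & poly_ge (GH'.2 - GH.2) (e + k%:R)].
  have [h1|h1] := pselect (approx (e + k%:R) GH.1 GH.2); last by exists GH.
  have [|G' [H' GH']] := approx_unit _ h1; first by rewrite ler0n.
  by exists (G', H') => _; rewrite -natr1.
pose s := fix s k := match k with 0%N => sval start | k'.+1 => sval (cid (next k' (s k'))) end.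
have sP k : approx (e + k%:R) (s k).1 (s k).2.
  elim: k => [|k IH]; first exact: svalP start.
  by have [] := svalP (cid (next k (s k))) IH.
have sd k : poly_ge ((s k.+1).1 - (s k).1) k%:R /\ poly_ge ((s k.+1).2 - (s k).2) k%:R.
  have [_ d1 d2] := svalP (cid (next k (s k))) (sP k).
  by split; [apply: poly_geW d1 _|apply: poly_geW d2 _]; rewrite lerDr ltW.
have lim (f : nat -> {poly L}) (q : {poly C}) n : size q = n.+1 ->
    (forall k, (size (f k - lift q)%R <= n)%N) ->
    (forall k, poly_ge (f k.+1 - f k) k%:R) ->
    exists F : {poly L}, size F = n.+1 /\ forall k, poly_ge (F - f k) k%:R.
  move=> sq sf fd.
  have ex i : exists x : L, forall k, val_ge (x - (f k)`_i) k%:R.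
    by apply: puiseux_cauchy => k; rewrite -coefB; exact: fd.
  pose x i := sval (cid (ex i)).
  have xP i k : val_ge (x i - (f k)`_i) k%:R := svalP (cid (ex i)) k.
  pose F := lift q + \poly_(i < n) (x i - (lift q)`_i); exists F; split.
    by apply: (size_approx sq); rewrite /F addrAC subrr add0r size_poly.
  move=> k i; rewrite coefB /F coefD [X in _ + X - _]coef_poly; case: (ltnP i n) => ni.
    by rewrite (addrC (lift q)`_i) subrK.
  have -> : (f k)`_i = (lift q)`_i.
    by apply/eqP; rewrite -subr_eq0 -coefB nth_default// (leq_trans (sf k)).
  by rewrite addr0 subrr; exact: val_ge0.
have [G [sG Gk]] : exists F : {poly L}, size F = a.+1 /\ forall k, poly_ge (F - (s k).1) k%:R.
  apply: lim sg _ _ => k; first by have [] := sP k.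
  by have [] := sd k.
have [H [sH Hk]] : exists F : {poly L}, size F = b.+1 /\ forall k, poly_ge (F - (s k).2) k%:R.
  apply: lim sh _ _ => k; first by have [] := sP k.
  by have [] := sd k.
exists G, H; split=> //.
have Hs_ge k : poly_ge (s k).2 0.
  have [_ _ hh _ _] := sP k; rewrite -(subrK (lift h) (s k).2).
  by apply: poly_geD; [apply: poly_geW hh (ltW e0)|exact: poly_ge_lift].
have G_ge : poly_ge G 0.
  have [_ gg _ _ _] := sP 0%N; rewrite -(subrK (s 0%N).1 G).
  apply: poly_geD; first exact: Gk.
  rewrite -(subrK (lift g) (s 0%N).1).
  by apply: poly_geD; [apply: poly_geW gg (ltW e0)|exact: poly_ge_lift].
have all_k k : poly_ge (p - G * H) k%:R.
  have -> : p - G * H = (p - (s k).1 * (s k).2) - (G - (s k).1) * (s k).2 - G * (H - (s k).2) by ring.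
  have [pk _ _ _ _] := sP k.
  apply: poly_geD; last first.
    by apply: poly_geN; rewrite -[k%:R]add0r; exact: poly_geM.
  apply: poly_geD; first by apply: poly_geW pk _; rewrite lerDr ltW.
  by apply: poly_geN; rewrite -[k%:R]addr0; exact: poly_geM.
apply/eqP; rewrite -subr_eq0; apply/eqP/polyP => i; rewrite coef0.
apply: puiseuxP => l; rewrite puiseux_coef0.
apply: (val_ge_coef (all_k (Num.bound `|l|) i)).
by rewrite (le_lt_trans (ler_norm l))//; apply: archi_boundP.
Qed.

End Hensel.
End PuiseuxRoots.

(** * The Newton-Puiseux theorem *)

Section ReducedPolynomials.
Variable F : fieldType.

Lemma coef_XsubC_exp (s : F) n : (('X - s%:P) ^+ n.+1)`_n = - (n.+1%:R * s).
Proof.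
have -> : ('X - s%:P) ^+ n.+1 = \prod_(x <- nseq n.+1 s) ('X - x%:P).
  by rewrite big_nseq iter_mulr_1.
have := @coefPn_prod_XsubC F (nseq n.+1 s); rewrite size_nseq => ->//.
by rewrite big_nseq iter_addr addr0 mulr_natl.
Qed.

(* Tschirnhaus: a translation kills the subleading coefficient. *)
Lemma depressed (p : {poly F}) n : n.+1%:R != 0 :> F -> size p = n.+2 -> p`_n.+1 = 1 ->
  exists s, let q := p \Po ('X - s%:P) in [/\ size q = n.+2, q`_n.+1 = 1 & q`_n = 0].
Proof.
move=> n0 sp p1; pose s := p`_n / n.+1%:R; exists s => q.
have sq : size q = n.+2 by rewrite size_comp_poly2 ?size_XsubC.
split=> //.
  have : lead_coef q = 1.
    rewrite lead_coef_comp ?size_XsubC// lead_coefXsubC expr1n mulr1.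
    by rewrite lead_coefE sp.
  by rewrite lead_coefE sq.
pose r := \poly_(i < n) p`_i.
have pE : p = 'X^(n.+1) + p`_n *: 'X^n + r.
  apply/polyP => i; rewrite !coefD coefZ !coefXn coef_poly.
  case: (ltngtP i n) => [lt|gt|->].
  - by rewrite (ltn_eqF (ltnW _))// ?(ltn_eqF lt) ?mulr0 ?add0r.
  - rewrite mulr0 !addr0; case: eqP => [->//|ne]; rewrite nth_default// sp.
    by lia.
  - by rewrite ltn_eqF// add0r addr0 mulr1.
rewrite /q pE !comp_polyD comp_polyZ !comp_Xn_poly !coefD coefZ coef_XsubC_exp.
have -> : (('X - s%:P) ^+ n)`_n = 1.
  have := lead_coef_exp ('X - s%:P) n; rewrite lead_coefXsubC expr1n lead_coefE.
  by rewrite size_exp_XsubC.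
have -> : (r \Po ('X - s%:P))`_n = 0.
  by rewrite nth_default// size_comp_poly2 ?size_XsubC// size_poly.
by rewrite addr0 mulr1 /s mulrCA divff// mulr1 addNr.
Qed.

End ReducedPolynomials.

(** Split off the full power of one root. If nothing remained, q would be (X - c)^(n+1); the
    vanishing subleading coefficient forces c = 0, and q would have no lower coefficients. *)
Lemma depressed_factor (F : closedFieldType) (q : {poly F}) n : n.+1%:R != 0 :> F ->
  size q = n.+2 -> q`_n.+1 = 1 -> q`_n = 0 -> (exists2 i, (i < n.+1)%N & q`_i != 0) ->
  exists g h a b, [/\ q = g * h, coprimep g h, size g = a.+1, size h = b.+1 & (0 < a)%N && (0 < b)%N].
Proof.
move=> n0 sq q1 qn [i im qi].
have q0 : q != 0 by rewrite -size_poly_gt0 sq.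
have [c rc] : exists c, root q c by apply/closed_rootP; rewrite sq.
case: (multiplicity_XsubC q c) => m [h]; rewrite q0 /= => rh E.
have h0 : h != 0 by apply: contraNneq rh => ->; rewrite root0.
have m0 : (0 < m)%N.
  by case: m E => // E; move: rh; rewrite -[h]mulr1 -(expr0 ('X - c%:P)) -E rc.
have sE : size q = (size h + m)%N.
  by rewrite E size_mul ?expf_neq0 ?polyXsubC_eq0// size_exp_XsubC addnS.
have [sh|sh] := leqP (size h) 1; last first.
  exists (('X - c%:P) ^+ m), h, m, (size h).-1; rewrite m0 size_exp_XsubC prednK ?(ltnW sh)//.
  split=> //; first by rewrite mulrC.
    by rewrite coprimep_expl// coprimep_sym coprimep_XsubC.
  by lia.
have hE := size1_polyC sh.
have mE : m = n.+1.
  by move: sE; rewrite sq; have := size_poly_gt0 h; rewrite h0; lia.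
have h1 : h`_0 = 1.
  rewrite -q1 E hE coefCM mE.
  have -> : (('X - c%:P) ^+ n.+1)`_n.+1 = 1.
    have := lead_coef_exp ('X - c%:P) n.+1; rewrite lead_coefXsubC expr1n lead_coefE.
    by rewrite size_exp_XsubC.
  by rewrite mulr1 coefC.
rewrite h1 in hE; rewrite hE mul1r mE in E.
have c0 : c = 0.
  by move/eqP: qn; rewrite E coef_XsubC_exp oppr_eq0 mulf_eq0 (negbTE n0) => /eqP.
move: qi; rewrite E c0 subr0 coefXn; case: (eqVneq i n.+1) => [e|_]; last by rewrite mulr0n eqxx.
by move: im; rewrite e ltnn.
Qed.

Section PuiseuxClosed.
Variable R : realType.
Local Notation C := R[i].
Local Notation L := (puiseux R).
Local Notation mono := (@puiseux_monomial R).
Local Notation lift := (map_poly (@const R)).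

Lemma val_gt0 (x : L) : (forall l, l <= 0 -> x l = 0) -> exists2 e, 0 < e & val_ge x e.
Proof.
move=> h; have [->|/puiseux_neq0[m [xm ge]]] := eqVneq x 0.
  by exists 1 => //; exact: val_ge0.
by exists m => //; rewrite ltNge; apply: contra xm => /h->.
Qed.

Lemma poly_gt0 (p : {poly L}) : (forall i l, l <= 0 -> p`_i l = 0) ->
  exists2 e, 0 < e & poly_ge p e.
Proof.
move=> h; have fin n : exists2 e, 0 < e & forall i, (i < n)%N -> val_ge p`_i e.
  elim: n => [|n [e e0 eP]]; first by exists 1.
  have [f f0 fP] := val_gt0 (h n).
  exists (Num.min e f); first by rewrite lt_min e0.
  move=> i; rewrite ltnS leq_eqVlt => /orP[/eqP->|/eP ge].
    by apply: val_geW fP _; rewrite ge_min lexx orbT.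
  by apply: val_geW ge _; rewrite ge_min lexx.
have [e e0 eP] := fin (size p); exists e => // i.
have [/eP//|le] := ltnP i (size p).
by rewrite nth_default//; exact: val_ge0.
Qed.

(* -l is the smallest slope of the Newton polygon. *)
Lemma newton_scaling (q : {poly L}) n : (exists2 i, (i < n)%N & q`_i != 0) ->
  exists l : rat, (forall i, (i < n)%N -> val_ge (mono (l * i%:R - l * n%:R) 1 * q`_i) 0) /\
    exists2 i, (i < n)%N & (mono (l * i%:R - l * n%:R) 1 * q`_i) 0 != 0.
Proof.
move=> [i0 i0n qi0].
pose v (x : L) := xget 0 [set m | x m != 0 /\ val_ge x m].
have vP (x : L) : x != 0 -> x (v x) != 0 /\ val_ge x (v x).
  move=> /puiseux_neq0[m mP]; rewrite /v; case: xgetP => [y _ //|/(_ m)[]//].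
have pos (i : nat) : (i < n)%N -> 0 < (n%:R - i%:R : rat) by move=> lt; rewrite subr_gt0 ltr_nat.
have [i1 /= qi1 minP] := @arg_minP _ _ _ (Ordinal i0n) (fun i : 'I_n => q`_i != 0)
   (fun i : 'I_n => v q`_i / (n%:R - i%:R)) qi0.
set l := v q`_i1 / _ in minP.
have le (i : nat) : l * i%:R - l * n%:R = - (l * (n%:R - i%:R)) by ring.
exists l; split.
  move=> i lt; have [->|qi] := eqVneq q`_i 0; first by rewrite mulr0; exact: val_ge0.
  have [_ ge] := vP _ qi.
  apply: val_geW (val_geM (@val_mono _ _ _) ge) _.
  have := minP (Ordinal lt) qi; rewrite /= ler_pdivlMr ?pos// le; lra.
exists i1 => //; have [ne ge] := vP _ qi1.
rewrite -[X in X != 0]/((mono (l * i1%:R - l * n%:R) 1 * q`_i1) 0).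
rewrite coef_monoM mul1r sub0r le opprK /l divfK// gt_eqF//; exact: pos.
Qed.

(** Induction on the degree: make p monic, depress it, rescale the variable by the Newton polygon,
    factor the reduction into coprime parts and lift by [hensel_factor]; a factor of smaller degree
    has a root. *)
Lemma puiseux_root (p : {poly L}) : (1 < size p)%N -> exists x, root p x.
Proof.
have [N] := ubnP (size p); elim: N p => // N IH p sN s1.
have nat0 k : k.+1%:R != 0 :> L.
  by apply/eqP => e; have := puiseux_abs_nat R k; rewrite e puiseux_abs0 => /eqP; rewrite eq_sym oner_eq0.
wlog p1 : p sN s1 / p`_(size p).-1 = 1.
  move=> wl; have lc : lead_coef p != 0 by rewrite lead_coef_eq0 -size_poly_gt0 ltnW.
  have sq : size ((lead_coef p)^-1 *: p) = size p by rewrite size_scale// invr_neq0.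
  have [|||x] := wl ((lead_coef p)^-1 *: p); rewrite ?sq//.
    by rewrite coefZ -lead_coefE mulVf.
  by rewrite rootZ ?invr_neq0//; exists x.
case sp : (size p) s1 p1 => [//|[//|n]] _ p1.
have [s [sq q1 qn]] := depressed (nat0 n) sp p1.
set q := p \Po _ in sq q1 qn.
suff [x rx] : exists x, root q x by exists ('X - s%:P).[x]; rewrite -root_comp.
have [nz|z] := pselect (exists2 i, (i < n.+1)%N & q`_i != 0); last first.
  exists 0; have -> : q = 'X^(n.+1).
    apply/polyP => i; rewrite coefXn; case: (ltngtP i n.+1) => [lt|gt|->//].
      by apply: contrapT => /eqP ne; apply: z; exists i.
    by rewrite nth_default// sq.
  by rewrite /root hornerXn expr0n.
have [l [lge [i1 i1n ne]]] := newton_scaling nz.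
pose c (i : nat) := mono (l * i%:R - l * n.+1%:R) 1.
(* Q(y) = t^(-l (n+1)) q(t^l y): integral coefficients, and some nonleading one with nonzero
   constant term. *)
pose Q := \poly_(i < n.+2) (c i * q`_i).
have Qi i : (i < n.+2)%N -> Q`_i = c i * q`_i by move=> lt; rewrite coef_poly lt.
have Qn1 : Q`_n.+1 = 1 by rewrite Qi// q1 mulr1 /c subrr.
have sQ : size Q = n.+2.
  apply/eqP; rewrite eqn_leq size_poly ltnNge; apply/negP => le.
  by move: Qn1; rewrite nth_default// => /eqP; rewrite eq_sym oner_eq0.
have Qge : poly_ge Q 0.
  move=> i; have [lt|le] := ltnP i n.+2; last by rewrite nth_default ?sQ//; exact: val_ge0.
  move: lt; rewrite ltnS leq_eqVlt => /orP[/eqP->|lt]; last by rewrite Qi ?(leqW lt)//; exact: lge.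
  by rewrite Qn1; exact: val_mono.
suff [y ry] : exists y, root Q y.
  exists (mono l 1 * y); move: ry; rewrite /root (horner_coef_wide _ (_ : (size Q <= n.+2)%N)) ?sQ//.
  rewrite (horner_coef_wide _ (_ : (size q <= n.+2)%N)) ?sq// => /eqP e0.
  have E : \sum_(i < n.+2) q`_i * (mono l 1 * y) ^+ i =
      mono (l * n.+1%:R) 1 * \sum_(i < n.+2) Q`_i * y ^+ i.
    rewrite big_distrr; apply: eq_bigr => i _; rewrite Qi ?ltn_ord// exprMn mono_exp.
    have -> : mono (l * i%:R) 1 = mono (l * n.+1%:R) 1 * c i.
      by rewrite /c monoM mulr1 addrC subrK.
    have A4 (u v w x : L) : u * (v * w * x) = v * (w * u * x) by ring.
    exact: A4.
  by rewrite E e0 mulr0.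
pose qb : {poly C} := \poly_(i < n.+2) (Q`_i 0).
have qbi i : qb`_i = Q`_i 0.
  by rewrite coef_poly; case: ltnP => // le; rewrite nth_default ?sQ.
have qb1 : qb`_n.+1 = 1 by rewrite qbi Qn1 puiseux_coef1 eqxx.
have sqb : size qb = n.+2.
  apply/eqP; rewrite eqn_leq size_poly ltnNge; apply/negP => le.
  by move: qb1; rewrite nth_default// => /eqP; rewrite eq_sym oner_eq0.
have nC : n.+1%:R != 0 :> C by rewrite pnatr_eq0.
have [||g [h [a [b [E cop sg sh /andP[a0 b0]]]]]] := @depressed_factor _ qb n nC sqb qb1.
- by rewrite qbi Qi// qn mulr0 puiseux_coef0.
- by exists i1 => //; rewrite qbi Qi// leqW.
have res i : (Q - lift qb)`_i = Q`_i - const (Q`_i 0) by rewrite coefB coef_map qbi.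
have [i w|e e0 eP] := @poly_gt0 (Q - lift qb).
  rewrite res puiseux_coefB coef_mono => w0.
  have [->|wn] := eqVneq w 0; first by rewrite subrr.
  by rewrite subr0 (val_ge_coef (Qge i))// lt_neqAle wn.
have sab : (a + b)%N = n.+1.
  have := sqb; rewrite E size_mul -?size_poly_gt0 ?sg ?sh//; lia.
have [||G [H [QE sG]]] := @hensel_factor R g h a b e Q cop sg sh a0 b0 e0.
- rewrite -E sab; apply/leq_sizeP => i; rewrite leq_eqVlt => /orP[/eqP<-|lt].
    by rewrite res Qn1 puiseux_coef1 eqxx subrr.
  by rewrite res nth_default ?sQ// puiseux_coef0 rmorph0 subrr.
- by rewrite -E.
have [||x rx] := IH G; rewrite ?sG//.
  by move: sN; rewrite sp; lia.
by exists x; rewrite QE rootM rx.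
Qed.

Lemma puiseux_valued_field : valued_field (@puiseux_abs R).
Proof.
split.
- exact: puiseux_abs0.
- exact: puiseux_abs_gt0.
- exact: puiseux_absM.
- exact: puiseux_absD.
- exact: puiseux_abs_nat.
- exact: puiseux_dense.
- exact: puiseux_root.
- exact: puiseux_complete.
Qed.

End PuiseuxClosed.

(** * The Robinson field is valued and spherically complete *)

Lemma ultra_bounded_cvg (R : realType) (U : set_system nat) (f : nat -> R) (m M : R) :
  UltraFilter U -> (\forall n \near U, m <= f n <= M) -> exists l : R, f @ U --> l.
Proof.
move=> uU fM; have pU : ProperFilter (f @ U) by exact: fmap_proper_filter.
have [|l [_ cl]] := @segment_compact R m M (f @ U) pU.
  by apply: filterS fM => n h /=; rewrite in_itv.
exists l => A Al; have [//|h] := in_ultra_setVsetC (f @^-1` A) uU.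
by have [x [/= nx xA]] := cl (~` A) A h Al.
Qed.

Lemma powR_root_le (R : realType) (r u c : R) : 0 < r -> 0 <= u ->
  (u `^ r^-1 <= expR c) = (u <= expR (c * r)).
Proof.
move=> r0; rewrite le_eqVlt => /orP[/eqP<-|u0].
  by rewrite powR0 ?invr_eq0 ?gt_eqF// !ltW ?expR_gt0.
by rewrite -{1 2}(lnK u0) -expRM !ler_expR ler_pdivrMr.
Qed.

Lemma powR_root_lt (R : realType) (r u c : R) : 0 < r -> 0 <= u ->
  (u `^ r^-1 < expR c) = (u < expR (c * r)).
Proof.
move=> r0; rewrite le_eqVlt => /orP[/eqP<-|u0].
  by rewrite powR0 ?invr_eq0 ?gt_eqF// !expR_gt0.
by rewrite -{1 2}(lnK u0) -expRM !ltr_expR ltr_pdivrMr.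
Qed.

Section RobinsonField.
Variables (R : realType) (S : scale R).
Local Notation C := R[i].
Local Notation omega := (ultra S).
Local Notation rho := (rho S).
#[local] Existing Instance ultra_omega.

Definition log_scale n : R := - ln (normc (rho n)).
Local Notation r := log_scale.

Lemma log_scale_gt0 n : 0 < r n.
Proof. by have /andP[p1 p2] := rho_disk S n; rewrite oppr_gt0 ln_lt0// p1. Qed.

Lemma normc_rho n : normc (rho n) = expR (- r n).
Proof. by rewrite opprK lnK//; have /andP[] := rho_disk S n. Qed.

Lemma normc_rhoX n N : normc (rho n) ^+ N = expR (- N%:R * r n).
Proof. by rewrite normc_rho -expRM_natl mulrN mulNr. Qed.

Lemma normc_rhoVX n N : normc (rho n) ^- N = expR (N%:R * r n).
Proof. by rewrite normc_rhoX -expRN mulNr opprK. Qed.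

Lemma log_scale_cvg M : \forall n \near omega, M <= r n.
Proof.
have e0 : (0 : C) < (expR (- M))%:C by rewrite ltcR expR_gt0.
have /cvgrPdist_lt/(_ _ e0)[N _ NP] := @rho_cvg0 _ S.
apply: (@ultra_eventually _ S _ N) => n Nn.
have := NP n Nn; rewrite sub0r normrN normc_def ltcR.
rewrite -[X in X < _ -> _]/(Num.sqrt (_ ^+ 2 + _ ^+ 2)).
have -> : Num.sqrt (complex.Re (rho n) ^+ 2 + complex.Im (rho n) ^+ 2) = normc (rho n).
  by case: (rho n).
by rewrite normc_rho ltr_expR ltrN2 => /ltW.
Qed.

Lemma log_scaleV_cvg : (r n)^-1 @[n --> omega] --> (0 : R).
Proof.
apply/cvgrPdist_lt => e e0; apply: filterS (log_scale_cvg (2 / e)) => n h.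
rewrite sub0r normrN ger0_norm; last by rewrite invr_ge0 ltW// log_scale_gt0.
rewrite -[X in _ < X]invrK ltf_pV2 ?posrE ?invr_gt0 ?log_scale_gt0//.
apply: lt_le_trans h; rewrite ltr_pMl ?invr_gt0// ltr1n//.
Qed.

(** Since |rho_n| = e^(-r_n), the limit of |x_n|^(1/r_n) is e^(-nu), the Robinson absolute value.
    Moderate means bounded and negligible means tending to 0 for this quantity ([moderateP],
    [sabs_eq0]). *)
Definition root_abs (x : nat -> C) n : R := normc (x n) `^ (r n)^-1.

Lemma root_abs_ge0 x n : 0 <= root_abs x n. Proof. exact: powR_ge0. Qed.

Lemma root_abs_le x n c : (root_abs x n <= expR c) = (normc (x n) <= expR (c * r n)).
Proof. by rewrite powR_root_le ?log_scale_gt0 ?normc_ge0. Qed.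

Lemma root_abs_lt x n c : (root_abs x n < expR c) = (normc (x n) < expR (c * r n)).
Proof. by rewrite powR_root_lt ?log_scale_gt0 ?normc_ge0. Qed.

Lemma moderateP x : reflect (exists c : R, \forall n \near omega, root_abs x n <= c) (x \in @moderate R S).
Proof.
rewrite -[_ \in _]/(`[< _ >]); apply: (iffP (asboolP _)) => [[N xN]|[c xc]].
  exists (expR N%:R); apply: filterS xN => n h; rewrite root_abs_le -normc_rhoVX; exact: ltW.
pose N := Num.bound (Num.max 1 c); exists N.
apply: filterS xc => n h; rewrite normc_rhoVX -root_abs_lt (le_lt_trans h)//.
have cN : Num.max 1 c < N%:R.
  by apply: archi_boundP; rewrite le_max ler01.
have c1 : c <= Num.max 1 c by rewrite le_max lexx orbT.
have := @expR_ge1Dx R N%:R; lra.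
Qed.

Definition sabs (x : nat -> C) : R := lim (root_abs x @ omega).

Lemma sabs_cvg x : x \in @moderate R S -> root_abs x @ omega --> sabs x.
Proof.
move=> /moderateP[c xc]; apply: cvgP; apply/cvg_ex.
have [|l xl] := @ultra_bounded_cvg R omega (root_abs x) 0 c (ultra_omega S); last by exists l.
by apply: filterS xc => n h; rewrite root_abs_ge0.
Qed.

Lemma sabs_unique x l : root_abs x @ omega --> l -> sabs x = l.
Proof. by move=> h; apply: cvg_lim. Qed.

Lemma sabs_ge0 x : x \in @moderate R S -> 0 <= sabs x.
Proof.
move=> /sabs_cvg/cvgr_to_ge; apply; apply: nearW => n; exact: root_abs_ge0.
Qed.

Lemma sabsM x y : x \in @moderate R S -> y \in @moderate R S ->
  sabs (fun n => x n * y n) = sabs x * sabs y.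
Proof.
move=> /sabs_cvg xm /sabs_cvg ym; apply: sabs_unique.
have E : root_abs (fun n => x n * y n) = (fun n => root_abs x n * root_abs y n).
  by apply/funext => n; rewrite /root_abs normcM powRM ?normc_ge0.
by rewrite E; exact: (cvgM xm ym).
Qed.

Lemma root_const_cvg (c : R) : 0 < c -> c `^ (r n)^-1 @[n --> omega] --> (1 : R).
Proof.
move=> c0; rewrite (_ : (fun n => _) = (fun n => expR (ln c * (r n)^-1))); last first.
  by apply/funext => n; rewrite -{1}(lnK c0) -expRM.
rewrite -expR0; apply: continuous_cvg; first exact: continuous_expR.
rewrite -[X in _ --> X](mulr0 (ln c)); apply: cvgM; first exact: cvg_cst.
exact: log_scaleV_cvg.
Qed.

Lemma cvg_max (F : set_system nat) (f g : nat -> R) (x y : R) : Filter F ->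
  f @ F --> x -> g @ F --> y -> Num.max (f n) (g n) @[n --> F] --> Num.max x y.
Proof.
move=> FF fx gy; under eq_fun do rewrite maxr_absE; rewrite maxr_absE.
by apply: cvgM; [apply: cvgD; [exact: cvgD|apply: cvg_norm; exact: cvgB]|exact: cvg_cst].
Qed.

Lemma normcD_le_max (x y : C) : normc (x + y) <= 2 * Num.max (normc x) (normc y).
Proof.
apply: le_trans (@le_normcD R x y) _; rewrite mulr_natl mulr2n.
by rewrite lerD// le_max lexx ?orbT.
Qed.

(** The triangle inequality becomes ultrametric because its constant contributes only 2^(1/r_n),
    which tends to 1. *)
Lemma sabsD x y : x \in @moderate R S -> y \in @moderate R S ->
  sabs (fun n => x n + y n) <= Num.max (sabs x) (sabs y).
Proof.
move=> xm ym; have xym : (fun n => x n + y n) \in @moderate R S by exact: rpredD.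
have lim2 : 2 `^ (r n)^-1 * Num.max (root_abs x n) (root_abs y n) @[n --> omega] -->
    1 * Num.max (sabs x) (sabs y).
  by apply: cvgM; [exact: root_const_cvg|apply: cvg_max; exact: sabs_cvg].
rewrite mul1r in lim2.
apply: (ler_cvg_to (sabs_cvg xym) lim2); apply: nearW => n.
have r0 : 0 <= (r n)^-1 by rewrite invr_ge0 ltW// log_scale_gt0.
have mx (u v : R) : 0 <= u -> 0 <= v -> Num.max u v `^ (r n)^-1 <= Num.max (u `^ (r n)^-1) (v `^ (r n)^-1).
  by move=> u0 v0; case: (leP u v) => _; rewrite le_max lexx ?orbT.
apply: (@le_trans _ _ ((2 * Num.max (normc (x n)) (normc (y n))) `^ (r n)^-1)).
  by rewrite ge0_ler_powR ?nnegrE ?normcD_le_max ?normc_ge0// mulr_ge0// le_max normc_ge0.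
rewrite powRM ?le_max ?normc_ge0// ler_wpM2l ?powR_ge0//.
by rewrite mx ?normc_ge0.
Qed.

Lemma sabsN (x : nat -> C) : sabs (fun n => - x n) = sabs x.
Proof.
rewrite /sabs (_ : root_abs (fun n => - x n) = root_abs x)//.
by apply/funext => n; rewrite /root_abs normcN.
Qed.

Lemma sabs_eq0 x : x \in @moderate R S -> sabs x = 0 <-> @Defs.negligible R S x.
Proof.
move=> xm; split=> [x0 N|xN].
  have := sabs_cvg xm; rewrite x0 => /cvgr_lt/(_ (expR (- N%:R)))/(_ (expR_gt0 _)).
  by apply: filterS => n; rewrite root_abs_lt normc_rhoX.
apply/eqP; rewrite eq_le sabs_ge0// andbT; apply: le_expN => k.
apply: (cvgr_to_le (sabs_cvg xm)); apply: filterS (xN k) => n.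
by rewrite root_abs_le normc_rhoX => /ltW.
Qed.

Lemma sabs_eq x y : x \in @moderate R S -> y \in @moderate R S ->
  sabs (fun n => x n - y n) = 0 -> sabs x = sabs y.
Proof.
have le (u v : nat -> C) : u \in @moderate R S -> v \in @moderate R S ->
    sabs (fun n => u n - v n) = 0 -> sabs u <= sabs v.
  move=> um vm uv.
  rewrite (_ : u = fun n => (u n - v n) + v n); last by apply/funext => n; rewrite subrK.
  apply: le_trans (sabsD _ vm) _; first exact: rpredB.
  by rewrite uv ge_max lexx sabs_ge0.
move=> xm ym xy; apply/eqP; rewrite eq_le !le//.
by rewrite -sabsN -xy; congr sabs; apply/funext => n; rewrite opprB.
Qed.

Lemma robinson_class_eq (s t : M0 S) :
  robinson_class s = robinson_class t <-> @Defs.negligible R S (fun n => s n - t n).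
Proof.
rewrite /robinson_class; split=> [/eqP|h].
  by rewrite -Quotient.idealrBE => /asboolP.
by apply/eqP; rewrite -Quotient.idealrBE; apply/asboolP.
Qed.

Lemma robinson_class_repr (x : robinson S) :
  x = robinson_class (repr (x : {ideal_quot (@M1 R S)})).
Proof. by rewrite /robinson_class reprK. Qed.

(** Independence of the representative picked by [repr]: sequences with negligible difference have
    the same limit. *)
Lemma robinson_absE (s : M0 S) : robinson_abs (robinson_class s) = sabs s.
Proof.
rewrite /robinson_abs; set t := repr _.
have ts : robinson_class t = robinson_class s by rewrite -robinson_class_repr.
have tm := M0_moderate t; have sm := M0_moderate s.
have E : sabs t = sabs s.
  apply: sabs_eq => //; apply/sabs_eq0; last exact/robinson_class_eq.
  exact: rpredB.
rewrite -E; case: eqP => [s0|s0].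
  symmetry; apply/sabs_eq0 => //; rewrite s0 in ts.
  have /robinson_class_eq : robinson_class t = robinson_class 0 by rewrite ts /robinson_class rmorph0.
  by under eq_fun do rewrite subr0.
have t0 : 0 < sabs t.
  rewrite lt0r sabs_ge0// andbT; apply/eqP => /(sabs_eq0 tm) h; apply: s0.
  rewrite -ts -(rmorph0 (@robinson_class R S)) .
  by apply/robinson_class_eq; under eq_fun do rewrite subr0.
have lim1 : ln (normc (t n)) / ln (normc (rho n)) @[n --> omega] --> - ln (sabs t).
  have h : - ln (root_abs t n) @[n --> omega] --> - ln (sabs t).
    by apply: cvgN; apply: continuous_cvg; [exact: continuous_ln|exact: sabs_cvg].
  apply: cvg_trans h; apply: near_eq_cvg.
  have := sabs_cvg tm => /cvgr_gt/(_ 0)/(_ t0); apply: filterS => n tn.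
  rewrite /root_abs ln_powR /log_scale invrN mulNr opprK mulrC//.
by rewrite (cvg_lim _ lim1)// opprK lnK.
Qed.

End RobinsonField.

(** * Saturation and algebraic closedness of the Robinson field *)

Section RobinsonValued.
Variables (R : realType) (S : scale R).
Local Notation C := R[i].
Local Notation omega := (ultra S).
Local Notation rho := (rho S).
Local Notation r := (log_scale S).
Local Notation rabs := (@robinson_abs R S).
#[local] Existing Instance ultra_omega.

HB.instance Definition _ :=
  GRing.RMorphism.copy (@robinson_class R S) (\pi_({ideal_quot (@M1 R S)}))%qT.

Lemma robinson_ind (P : robinson S -> Prop) :
  (forall s, P (robinson_class s)) -> forall x, P x.
Proof. by move=> h x; rewrite (robinson_class_repr x). Qed.

Lemma rabs0 : rabs 0 = 0. Proof. by rewrite /robinson_abs eqxx. Qed.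

Lemma robinson_class0 (s : M0 S) : robinson_class s = 0 <-> sabs S s = 0.
Proof.
rewrite (sabs_eq0 (M0_moderate s)) -(rmorph0 (@robinson_class R S)) robinson_class_eq.
by split=> h N; have := h N; apply: filterS => n; rewrite subr0.
Qed.

Lemma rabs_gt0 x : x != 0 -> 0 < rabs x.
Proof.
elim/robinson_ind: x => s s0; rewrite robinson_absE lt0r sabs_ge0 ?M0_moderate// andbT.
by apply: contraNneq s0 => h; apply/eqP/robinson_class0.
Qed.

Lemma rabsM x y : rabs (x * y) = rabs x * rabs y.
Proof.
elim/robinson_ind: x => s; elim/robinson_ind: y => t.
by rewrite -rmorphM !robinson_absE -sabsM ?M0_moderate.
Qed.

Lemma rabsD x y : rabs (x + y) <= Num.max (rabs x) (rabs y).
Proof.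
elim/robinson_ind: x => s; elim/robinson_ind: y => t.
by rewrite -rmorphD !robinson_absE; apply: sabsD; rewrite M0_moderate.
Qed.

Lemma M0_natE (k n : nat) : (k%:R : M0 S) n = k%:R.
Proof. by elim: k => // k IH; rewrite -!natr1 -IH. Qed.

Lemma rabs_nat k : rabs k.+1%:R = 1.
Proof.
rewrite -(rmorph_nat (@robinson_class R S)) robinson_absE; apply: sabs_unique.
have := @root_const_cvg R S k.+1%:R (ltr0Sn _ _); apply: cvg_trans.
apply: near_eq_cvg; apply: nearW => n; rewrite /root_abs M0_natE.
by rewrite -(rmorph_nat (@real_complex R)) normc_real ger0_norm.
Qed.

Lemma scale_moderate (c : R) : (fun n => (expR (c * r n))%:C) \in @moderate R S.
Proof.
apply/moderateP; exists (expR c); apply: nearW => n.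
by rewrite root_abs_le normc_real ger0_norm// ltW// expR_gt0.
Qed.

Definition scale_seq c : M0 S := MkM0 (scale_moderate c).

Lemma rabs_scale c : rabs (robinson_class (scale_seq c)) = expR c.
Proof.
rewrite robinson_absE; apply: sabs_unique.
rewrite (_ : root_abs S _ = fun=> expR c); first exact: cvg_cst.
apply/funext => n; rewrite /root_abs -[scale_seq c n]/(expR (c * r n))%:C.
rewrite normc_real ger0_norm ?expR_ge0//.
by rewrite expRM -powRrM mulfV ?powRr1 ?expR_ge0// gt_eqF// log_scale_gt0.
Qed.

Lemma rabs_dense (s t : R) : 0 < s -> s < t -> exists x, s < rabs x <= t.
Proof.
move=> s0 st; exists (robinson_class (scale_seq (ln t))).
by rewrite rabs_scale lnK ?lexx ?st// posrE (lt_trans s0).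
Qed.

(* Saturation: on U k the first k conditions hold up to 1/(k+1); the diagonal *)
(* sequence uses the last such k <= n.                                        *)
Lemma robinson_spherical : spherically_complete rabs.
Proof.
move=> a t t0 nest.
have FF : Filter omega by typeclasses eauto.
pose s k : M0 S := repr (a k : {ideal_quot (@M1 R S)}).
have sE k : a k = robinson_class (s k) := robinson_class_repr (a k).
have V0 k n : (k <= n)%N -> rabs (a n - a k) <= t k.
  move=> kn; rewrite -(subnKC kn); elim: (n - k)%N => [|m IH].
    by rewrite addn0 subrr rabs0 ltW.
  have tk : t (k + m)%N <= t k.
    by elim: m {IH} => [|m IH]; rewrite ?addn0// addnS (le_trans _ IH)//; case: (nest (k + m)%N).
  have st : rabs (a (k + m).+1 - a (k + m)%N) <= t k.
    by apply: le_trans tk; case: (nest (k + m)%N).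
  have := rabsD (a (k + m).+1 - a (k + m)%N) (a (k + m)%N - a k).
  by rewrite subrKA addnS => /le_trans; apply; rewrite ge_max; apply/andP; split; [exact: st|exact: IH].
pose U k : set nat := [set n | (k <= n)%N /\ forall j, (j <= k)%N ->
   root_abs S (fun n => s k n - s j n) n < t j + k.+1%:R^-1].
have UP k : omega (U k).
  have fin (m : nat) : (m <= k.+1)%N -> omega [set n | forall j, (j < m)%N ->
      root_abs S (fun n => s k n - s j n) n < t j + k.+1%:R^-1].
    elim: m => [|m IH] mk; first by apply: nearW => n j; rewrite ltn0.
    have lim : root_abs S (fun n => s k n - s m n) @ omega --> rabs (a k - a m).
      rewrite !sE -rmorphB robinson_absE; apply: sabs_cvg; exact: M0_moderate (s k - s m).
    have := V0 m k mk => le.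
    have lt : rabs (a k - a m) < t m + k.+1%:R^-1 by rewrite (le_lt_trans le)// ltrDl invr_gt0.
    have h0 := cvgr_lt _ lim _ lt; apply: filterS (filterI (h0 FF) (IH (ltnW mk))) => n [h2 h1] j.
    by rewrite ltnS leq_eqVlt => /orP[/eqP->//|]; exact: h1.
  apply: filterS (filterI (@ultra_eventually R S [set n | (k <= n)%N] k (fun n h => h)) (fin k.+1 (leqnn _))).
  by move=> n [kn h]; split=> // j jk; exact: h.
have U0 n : U 0%N n.
  split=> // j; rewrite leqn0 => /eqP->; rewrite /root_abs subrr normc0 powR0 ?invr_eq0 ?gt_eqF ?log_scale_gt0//.
  by rewrite addr_gt0// invr_gt0.
pose m n := [arg max_(k > (ord0 : 'I_n.+1) | `[< U k n >]) (k : nat)].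
have mP n : U (m n) n /\ forall k, U k n -> (k <= m n)%N.
  rewrite /m; case: arg_maxnP => [|i /asboolP Ui iP]; first exact/asboolP.
  split=> // k Uk; have kn : (k < n.+1)%N by case: Uk.
  by apply: (iP (Ordinal kn)); exact/asboolP.
pose beta n := s (m n) n.
have near j : \forall n \near omega, forall k, (j <= k)%N -> U k n ->
    root_abs S (fun n => beta n - s j n) n < t j + k.+1%:R^-1.
  apply: nearW => n k jk Uk; have [[_ h] max] := mP n; have km := max k Uk.
  have := h j (leq_trans jk km); rewrite /root_abs /beta => /lt_le_trans; apply.
  by rewrite lerD2l lef_pV2 ?posrE// ler_nat ltnS.
have dm : (fun n => beta n - s 0%N n) \in @moderate R S.
  apply/moderateP; exists (t 0%N + 1); apply: filterS (near 0%N) => n h.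
  by have := h 0%N (leqnn _) (U0 n); rewrite invr1 => /ltW.
have bm : beta \in @moderate R S.
  rewrite (_ : beta = (fun n => (beta n - s 0%N n) + s 0%N n)); last by apply/funext => n; rewrite subrK.
  by apply: rpredD => //; exact: M0_moderate.
exists (robinson_class (MkM0 bm)) => j.
rewrite sE -rmorphB robinson_absE.
have dj : (fun n => beta n - s j n) \in @moderate R S by apply: rpredB => //; exact: M0_moderate.
have lim := sabs_cvg dj.
apply/ler_addgt0Pr => e e0.
have [K Ke] : exists K : nat, K.+1%:R^-1 <= e.
  exists (Num.bound e^-1); rewrite -[leRHS]invrK lef_pV2 ?posrE ?invr_gt0//.
  have h : e^-1 < (Num.bound e^-1)%:R by apply: archi_boundP; rewrite invr_ge0 ltW.
  by rewrite (le_trans (ltW h))// ler_nat.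
apply: (cvgr_to_le lim).
apply: filterS (filterI (near j) (UP (maxn j K))) => n [h Un].
have := h _ (leq_maxl _ _) Un => /ltW/le_trans; apply; rewrite lerD2l (le_trans _ Ke)//.
by rewrite lef_pV2 ?posrE// ler_nat ltnS leq_maxr.
Qed.

Lemma robinson_complete (a : nat -> robinson S) :
  (forall k, rabs (a k.+1 - a k) <= expR (- k%:R)) ->
  exists x, forall k, rabs (x - a k) <= expR (- k%:R).
Proof.
move=> h; apply: (@robinson_spherical a (fun k => expR (- k%:R))) => [k|k]; first exact: expR_gt0.
by rewrite h ler_expR lerN2 ler_nat.
Qed.

Lemma root_bound (q : {poly C}) d (y : C) : size q = d.+2 -> q`_d.+1 = 1 -> root q y ->
  normc y <= 1 + \sum_(i < d.+1) normc q`_i.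
Proof.
move=> sq q1 /rootP; rewrite horner_coef sq big_ord_recr /= q1 mul1r => /eqP.
rewrite addr_eq0 => /eqP E; set B := \sum_(i < d.+1) normc q`_i.
have B0 : 0 <= B by apply: sumr_ge0 => i _; exact: normc_ge0.
have [y1|y1] := leP (normc y) 1; first by rewrite (le_trans y1)// lerDl.
have y0 : 0 < normc y by rewrite (lt_trans _ y1).
have h : normc y ^+ d.+1 <= B * normc y ^+ d.
  rewrite -normcX -[y ^+ d.+1]opprK -E normcN (le_trans (normc_sum _ _ _))// mulr_suml.
  apply: ler_sum => i _; rewrite normcM normcX ler_wpM2l ?normc_ge0//.
  by rewrite ler_weXn2l ?(ltW y1)// -ltnS.
rewrite exprS ler_pM2r ?exprn_gt0// in h.
by rewrite (le_trans h)// lerDr.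
Qed.

(** Choose for every n a root of the polynomial with the n-th representing coefficients;
    [root_bound] bounds it by these coefficients, so the sequence is moderate. *)
Lemma robinson_root (p : {poly robinson S}) : (1 < size p)%N -> exists x, root p x.
Proof.
wlog p1 : p / lead_coef p = 1.
  move=> wl s1; have lc : lead_coef p != 0 by rewrite lead_coef_eq0 -size_poly_gt0 ltnW.
  have [||x] := wl ((lead_coef p)^-1 *: p).
  - by rewrite lead_coefZ mulVf.
  - by rewrite size_scale// invr_neq0.
  - by rewrite rootZ ?invr_neq0//; exists x.
case sp : (size p) => [//|[//|d]] _.
(* The leading coefficient is represented by the constant 1, so that the polynomial is monic of full
   degree for every n. *)
pose s i : M0 S := if i == d.+1 then 1 else repr (p`_i : {ideal_quot (@M1 R S)}).
have sE i : p`_i = robinson_class (s i).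
  rewrite /s; case: eqP => [->|_]; last exact: robinson_class_repr.
  by rewrite rmorph1 -p1 lead_coefE sp.
pose q n : {poly C} := \poly_(i < d.+2) s i n.
have s1 n : s d.+1 n = 1 by rewrite /s eqxx.
have q1 n : (q n)`_d.+1 = 1 by rewrite coef_poly ltnSn s1.
have sq n : size (q n) = d.+2 by rewrite size_poly_eq //= s1 oner_neq0.
have ex n : exists y, root (q n) y by apply/closed_rootP; rewrite sq.
pose y n := sval (cid (ex n)).
have yr n : root (q n) (y n) := svalP (cid (ex n)).
pose B n : C := 1 + \sum_(i < d.+1) (normc (s i n))%:C.
have Bm : B \in @moderate R S.
  have -> : B = 1 + \sum_(i < d.+1) (fun n => (normc (s i n))%:C).
    apply/funext => n; rewrite /B /=; congr (_ + _).
    by elim/big_rec2: _ => // i f x _ ->.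
  apply: rpredD; first exact: rpred1.
  apply: rpred_sum => i _; have /moderateP[c h] := M0_moderate (s i).
  apply/moderateP; exists c; apply: filterS h => n.
  by rewrite /root_abs normc_real ger0_norm ?normc_ge0.
have ym : y \in @moderate R S.
  have /moderateP[c h] := Bm; apply/moderateP; exists c; apply: filterS h => n /(le_trans _); apply.
  have r0 : 0 <= (r n)^-1 by rewrite invr_ge0 ltW// log_scale_gt0.
  rewrite /root_abs ge0_ler_powR ?nnegrE ?normc_ge0//.
  have -> : B n = (1 + \sum_(i < d.+1) normc (q n)`_i)%:C.
    rewrite rmorphD rmorph1 rmorph_sum /B; congr (_ + _); apply: eq_bigr => i _.
    by rewrite coef_poly (leqW (ltn_ord i)).
  rewrite normc_real (le_trans (root_bound (sq n) (q1 n) (yr n)))// ler_norm//.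
exists (robinson_class (MkM0 ym)); apply/rootP.
rewrite horner_coef sp; under eq_bigr do rewrite sE -rmorphXn -rmorphM.
rewrite -rmorph_sum -(rmorph0 (@robinson_class R S)); congr robinson_class.
apply: val_inj; apply/funext => n.
have ev (F : 'I_d.+2 -> M0 S) : (\sum_(i < d.+2) F i) n = \sum_(i < d.+2) F i n.
  by elim/big_rec2: _ => // i f x _ <-.
have evX (x : M0 S) k : (x ^+ k) n = x n ^+ k.
  by elim: k => // k IH; rewrite !exprS -IH.
rewrite [LHS](ev (fun i => s i * MkM0 ym ^+ i)) -[RHS]/0.
have := rootP (yr n); rewrite horner_coef sq => {2}<-.
by apply: eq_bigr => i _; rewrite coef_poly ltn_ord -[y n]/(MkM0 ym n) -evX.
Qed.

Lemma robinson_valued_field : valued_field rabs.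
Proof.
split.
- exact: rabs0.
- exact: rabs_gt0.
- exact: rabsM.
- exact: rabsD.
- exact: rabs_nat.
- exact: rabs_dense.
- exact: robinson_root.
- exact: robinson_complete.
Qed.

End RobinsonValued.

(** * Evaluation of Puiseux series at the scale *)

Section Polar.
Variable R : realType.
Local Notation C := R[i].

Definition cis (t : R) : C := cos t +i* sin t.

Lemma cisD s t : cis (s + t) = cis s * cis t.
Proof.
by apply: complex_ext; rewrite ?reM ?imM /= ?cosD ?sinD//; ring.
Qed.

Lemma cis0 : cis 0 = 1. Proof. by rewrite /cis cos0 sin0. Qed.

Lemma normc_cis t : normc (cis t) = 1.
Proof. by rewrite /= cos2Dsin2 sqrtr1. Qed.

Lemma polar_form (z : C) : exists t, z = (normc z)%:C * cis t.
Proof.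
have [->|z0] := eqVneq z 0; first by exists 0; rewrite normc0 mul0r.
have n0 : 0 < normc z by rewrite normc_gt0.
case: z z0 n0 => x y z0; set n := normc _ => n0.
have nE : n ^+ 2 = x ^+ 2 + y ^+ 2 by rewrite sqr_sqrtr// addr_ge0 ?sqr_ge0.
pose u := x / n; pose v := y / n.
have uv : u ^+ 2 + v ^+ 2 = 1 by rewrite /u /v !expr_div_n -mulrDl -nE divff// expf_neq0// gt_eqF.
have u1 : -1 <= u <= 1.
  by apply/andP; split; have := sqr_ge0 v; nra.
have E t : cos t = u -> sin t = v -> x +i* y = n%:C * cis t.
  move=> ct st; rewrite /cis ct st; apply: complex_ext; rewrite ?reM ?imM /= !mul0r ?subr0 ?addr0.
    by rewrite /u mulrC divfK// gt_eqF.
  by rewrite /v mulrC divfK// gt_eqF.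
have cu : cos (acos u) = u by apply: acosK; rewrite in_itv.
have su : sin (acos u) = `|v|.
  by rewrite sin_acos// -uv addrC addKr sqrtr_sqr.
have [v0|v0] := leP 0 v.
  by exists (acos u); apply: E => //; rewrite su ger0_norm.
exists (- acos u); apply: E; first by rewrite cosN.
by rewrite sinN su ltr0_norm// opprK.
Qed.

Definition argument (z : C) : R := sval (cid (polar_form z)).

Lemma argumentE z : z = (normc z)%:C * cis (argument z).
Proof. exact: svalP (cid (polar_form z)). Qed.

(** One choice of argument for z serves all exponents, which makes these powers multiplicative in l;
    for integers they are the usual powers ([rat_pow_int]). *)
Definition rat_pow (z : C) (l : rat) : C :=
  (expR (ratr l * ln (normc z)))%:C * cis (ratr l * argument z).

Lemma rat_powD z l m : rat_pow z (l + m) = rat_pow z l * rat_pow z m.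
Proof. by rewrite /rat_pow rmorphD !mulrDl expRD cisD rmorphM mulrACA. Qed.

Lemma rat_pow0 z : rat_pow z 0 = 1.
Proof. by rewrite /rat_pow rmorph0 !mul0r expR0 cis0 mulr1. Qed.

Lemma rat_pow1 z : z != 0 -> rat_pow z 1 = z.
Proof.
by move=> z0; rewrite /rat_pow rmorph1 !mul1r lnK ?posrE ?normc_gt0// -argumentE.
Qed.

Lemma normc_rat_pow z l : normc (rat_pow z l) = expR (ratr l * ln (normc z)).
Proof. by rewrite normcM normc_cis mulr1 normc_real ger0_norm// expR_ge0. Qed.

Lemma rat_pow_int z (k : int) : z != 0 -> rat_pow z k%:~R = z ^ k.
Proof.
move=> z0; have nat (n : nat) : rat_pow z n%:R = z ^+ n.
  by elim: n => [|n IH]; rewrite ?rat_pow0// -natr1 rat_powD IH rat_pow1// exprSr.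
case: k => n; first exact: nat.
have := rat_powD z (Negz n)%:~R n.+1%:R; rewrite NegzE mulrNz.
rewrite -pmulrn addNr rat_pow0 nat => /esym h.
by rewrite -exprnN -[LHS](mulfK (expf_neq0 n.+1 z0)) h mul1r.
Qed.

End Polar.

Section RingIdentities.
Variable T : comNzRingType.
Implicit Types a b c u v : T.

Lemma sub_approxB a b c u v : a - (b - c) = (a - (u - v)) - ((b - u) - (c - v)).
Proof. ring. Qed.

Lemma sub_approxM a b c u : a - c * b = (a - c * u) - c * (b - u).
Proof. ring. Qed.

Lemma sub_prodB a b c u v : c = u * v -> a - b * v = a - c - (b - u) * v.
Proof. by move=> ->; ring. Qed.
End RingIdentities.

(** * Substitution of rho_n for t as an isometric field embedding *)

Section Embedding.
Variables (R : realType) (S : scale R).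
Local Notation C := R[i].
Local Notation L := (puiseux R).
Local Notation mono := (@puiseux_monomial R).
Local Notation K := (robinson S).
Local Notation rabs := (@robinson_abs R S).
Local Notation omega := (ultra S).
Local Notation rho := (rho S).
Local Notation V := (robinson_valued_field S).
#[local] Existing Instance ultra_omega.

Lemma const_moderate (c : C) : (fun _ : nat => c) \in @moderate R S.
Proof.
have [->|c0] := eqVneq c 0; first exact: rpred0.
apply/moderateP; exists 2; rewrite -normc_gt0 in c0.
have h : \forall n \near omega, normc c `^ (log_scale S n)^-1 <= 2.
  by apply: (cvgr_le 1 (root_const_cvg S c0)); rewrite ltr1n.
by apply: filterS h.
Qed.

Definition robinson_const (c : C) : K := robinson_class (MkM0 (const_moderate c)).
Local Notation cst := robinson_const.

Lemma robinson_constB c e : cst (c - e) = cst c - cst e.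
Proof. by rewrite -rmorphB; congr robinson_class; exact: val_inj. Qed.
Lemma robinson_constM c e : cst (c * e) = cst c * cst e.
Proof. by rewrite -rmorphM; congr robinson_class; exact: val_inj. Qed.
Lemma robinson_const1 : cst 1 = 1.
Proof. by rewrite -(rmorph1 (@robinson_class R S)); congr robinson_class; exact: val_inj. Qed.
Lemma robinson_const0 : cst 0 = 0. Proof. by rewrite -(subrr 0) robinson_constB subrr. Qed.

Lemma rabs_const c : c != 0 -> rabs (cst c) = 1.
Proof.
by move=> c0; rewrite robinson_absE; apply: sabs_unique; apply: root_const_cvg; rewrite normc_gt0.
Qed.

Lemma rabs_const_le c : rabs (cst c) <= 1.
Proof.
by have [->|/rabs_const->//] := eqVneq c 0; rewrite robinson_const0 rabs0.
Qed.

Lemma root_abs_pow l n : root_abs S (fun n => rat_pow (rho n) l) n = expR (- ratr l).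
Proof.
rewrite /root_abs normc_rat_pow -expRM normc_rho expRK; congr expR.
by rewrite mulrN mulNr mulfK// gt_eqF// log_scale_gt0.
Qed.

Lemma pow_moderate l : (fun n => rat_pow (rho n) l) \in @moderate R S.
Proof.
by apply/moderateP; exists (expR (- ratr l)); apply: nearW => n; rewrite root_abs_pow.
Qed.

Definition robinson_pow (l : rat) : K := robinson_class (MkM0 (pow_moderate l)).
Local Notation P := robinson_pow.

Lemma robinson_powD l m : P (l + m) = P l * P m.
Proof.
rewrite -rmorphM; congr robinson_class; apply: val_inj; apply/funext => n.
exact: rat_powD.
Qed.

Lemma rabs_pow l : rabs (P l) = expR (- ratr l).
Proof.
rewrite robinson_absE; apply: sabs_unique.
rewrite (_ : root_abs S _ = fun=> expR (- ratr l)); first exact: cvg_cst.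
by apply/funext => n; exact: root_abs_pow.
Qed.

Definition term (a : L) l : K := cst (a l) * P l.

Lemma rabs_term a l : rabs (term a l) <= expR (- ratr l).
Proof. by rewrite rabsM rabs_pow ler_piMl ?expR_ge0 ?rabs_const_le. Qed.

Lemma term0 (a : L) l : a l = 0 -> term a l = 0.
Proof. by rewrite /term => ->; rewrite robinson_const0 mul0r. Qed.

Lemma rabs_sum (I : Type) (s : seq I) (Q : pred I) (F : I -> K) (m : R) : 0 <= m ->
  (forall i, Q i -> rabs (F i) <= m) -> rabs (\sum_(i <- s | Q i) F i) <= m.
Proof.
move=> m0 h; elim/big_rec: _ => [|i x /h Fi xm]; first by rewrite rabs0.
by apply: le_trans (rabsD _ _) _; rewrite ge_max; apply/andP; split; [exact: Fi|exact: xm].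
Qed.

Lemma rabs_ballB (u v : K) (m : R) : rabs u <= m -> rabs v <= m -> rabs (u - v) <= m.
Proof.
move=> um vm; apply: le_trans (rabsD u (- v)) _.
by rewrite (absN V) ge_max; apply/andP; split; [exact: um|exact: vm].
Qed.

Lemma rabs_ball_trans (u v w : K) (m : R) :
  rabs (u - v) <= m -> rabs (v - w) <= m -> rabs (u - w) <= m.
Proof.
move=> uv vw; apply: le_trans (abs_subD V u v w) _.
by rewrite ge_max; apply/andP; split; [exact: uv|exact: vw].
Qed.

Definition covers (A : {fset rat}) (a : L) (x : rat) := forall l, l <= x -> a l != 0 -> l \in A.

Lemma covers_sum A B a x : covers A a x -> covers B a x ->
  \sum_(l <- A | l <= x) term a l = \sum_(l <- B | l <= x) term a l.
Proof.
have full (D : {fset rat}) : covers D a x -> \sum_(l <- D | l <= x) term a l =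
    \sum_(l <- [fset l in D | (l <= x) && (a l != 0)]%fset) term a l.
  move=> cD; rewrite -big_fset_condE [RHS]big_mkcondr; apply: eq_bigr => l _.
  by case: eqP => //= /term0.
move=> cA cB; rewrite full// full//; congr (\sum_(l <- enum_fset _) _); apply/fsetP => l.
rewrite !inE; case lx : (l <= x) => //=; rewrite ?andbF//.
by case al : (a l != 0); rewrite ?andbF// cA// cB.
Qed.

(** The finite part of the series with exponents at most x, evaluated at the scale. Evaluation of
    the whole series is the limit of these in the complete Robinson field, so no convergence of
    complex series is involved. *)
Definition trunc (a : L) (x : rat) : K :=
  \sum_(l <- sval (cid (puiseux_supp a x)) | l <= x) term a l.

Lemma truncE A a x : covers A a x -> trunc a x = \sum_(l <- A | l <= x) term a l.
Proof. by move=> cA; apply: covers_sum cA; exact: svalP (cid (puiseux_supp a x)). Qed.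

Lemma ratr_exp_le (l m : rat) : (expR (- ratr l) <= expR (- ratr m) :> R) = (m <= l).
Proof. by rewrite ler_expR lerN2 ler_rat. Qed.

Lemma rabs_trunc a m x : val_ge a m -> rabs (trunc a x) <= expR (- ratr m).
Proof.
move=> am; apply: rabs_sum => [|l _]; first exact: expR_ge0.
have [/term0->|/am ml] := eqVneq (a l) 0; first by rewrite rabs0 expR_ge0.
by rewrite (le_trans (rabs_term _ _))// ratr_exp_le.
Qed.

Lemma trunc_diff a x y : x <= y -> rabs (trunc a y - trunc a x) <= expR (- ratr x).
Proof.
move=> xy; have [A HA] := puiseux_supp a y.
have HA' : covers A a x by move=> l lx; apply: HA; exact: le_trans xy.
rewrite (truncE HA) (truncE HA') (bigID (fun l => l <= x)) /= addrC.
have -> : \sum_(l <- A | (l <= y) && (l <= x)) term a l = \sum_(l <- A | l <= x) term a l.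
  by apply: eq_bigl => l; rewrite andb_idl// => lx; exact: le_trans xy.
rewrite addrK; apply: rabs_sum => [|l /andP[_]]; first exact: expR_ge0.
by rewrite -ltNge => xl; rewrite (le_trans (rabs_term _ _))// ratr_exp_le ltW.
Qed.

Lemma embed_exists a : exists u : K, forall k : nat, rabs (u - trunc a k%:R) <= expR (- k%:R).
Proof.
apply: (vf_complete V) => k; rewrite -(ratr_nat R k).
by apply: trunc_diff; rewrite ler_nat.
Qed.

Definition embed (a : L) : K := sval (cid (embed_exists a)).
Local Notation J := embed.

Lemma embed_trunc a x : rabs (J a - trunc a x) <= expR (- ratr x).
Proof.
pose k := Num.bound `|x|.
have xk : x <= k%:R by rewrite (le_trans (ler_norm _))// ltW//; apply: archi_boundP.
have h := svalP (cid (embed_exists a)) k; rewrite -/(J a) -(ratr_nat R k) in h.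
apply: rabs_ball_trans (trunc_diff a xk).
by apply: le_trans h _; rewrite ratr_exp_le.
Qed.

Lemma rabs_embed_le a m : val_ge a m -> rabs (J a) <= expR (- ratr m).
Proof.
move=> am; rewrite -[J a]subr0; apply: rabs_ball_trans (embed_trunc a m) _.
by rewrite subr0; exact: rabs_trunc.
Qed.

Lemma robinson_small0 (u : K) (m : rat) : (forall x, rabs u <= expR (- ratr (x + m))) -> u = 0.
Proof.
move=> h; apply/eqP; rewrite -(abs_eq0 V) eq_le (abs_ge0 V) andbT.
by apply: le_expN => k; have := h (k%:R - m); rewrite subrK ratr_nat.
Qed.

Lemma embed_zmod_morphism : zmod_morphism J.
Proof.
move=> a b; apply/eqP; rewrite -subr_eq0; apply/eqP; apply: (@robinson_small0 _ 0) => x.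
rewrite addr0; have [A HA] := puiseux_supp a x; have [B HB] := puiseux_supp b x.
have cA : covers (A `|` B)%fset a x by move=> l lx al; rewrite inE HA.
have cB : covers (A `|` B)%fset b x by move=> l lx al; rewrite inE HB ?orbT.
have cAB : covers (A `|` B)%fset (a - b) x.
  move=> l lx; rewrite puiseux_coefB inE; have [a0|al _] := eqVneq (a l) 0; last by rewrite HA.
  by rewrite a0 sub0r oppr_eq0 => bl; rewrite HB ?orbT.
have E : trunc (a - b) x = trunc a x - trunc b x.
  rewrite (truncE cA) (truncE cB) (truncE cAB) -sumrB; apply: eq_bigr => l _.
  by rewrite /term puiseux_coefB robinson_constB mulrBl.
rewrite (sub_approxB _ _ _ (trunc a x) (trunc b x)) -E.
by apply: rabs_ballB (embed_trunc _ _) _; apply: rabs_ballB; exact: embed_trunc.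
Qed.

HB.instance Definition _ := GRing.isZmodMorphism.Build L K J embed_zmod_morphism.

Lemma embedB a b : J (a - b) = J a - J b. Proof. exact: embed_zmod_morphism. Qed.
Lemma embed0 : J 0 = 0. Proof. by rewrite -(subrr 0) embedB subrr. Qed.
Lemma embedD a b : J (a + b) = J a + J b.
Proof. by rewrite -[b]opprK embedB opprK -[- b]sub0r embedB embed0 sub0r opprK. Qed.

Lemma embed_monoM l c b : J (mono l c * b) = cst c * P l * J b.
Proof.
apply/eqP; rewrite -subr_eq0; apply/eqP; apply: (@robinson_small0 _ l) => x.
have [A HA] := puiseux_supp b x.
have cA : covers [fset (l + m)%R | m in A]%fset (mono l c * b) (x + l).
  move=> m mx; rewrite coef_monoM mulf_eq0 negb_or => /andP[_ bm].
  by apply/imfsetP; exists (m - l) => /=; [apply: HA => //; lra|rewrite addrC subrK].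
have E : trunc (mono l c * b) (x + l) = cst c * P l * trunc b x.
  rewrite (truncE cA) (truncE HA) big_mkcond big_imfset /=; last by move=> u v _ _ /addrI.
  rewrite big_distrr [RHS]big_mkcond /=; apply: eq_bigr => m _.
  rewrite (addrC x) lerD2l; case: ifP => // _.
  by rewrite /term coef_monoM addrAC subrr add0r robinson_constM robinson_powD mulrACA.
rewrite (sub_approxM _ _ _ (trunc b x)) -E.
apply: rabs_ballB (embed_trunc _ _) _; rewrite rabsM rabsM rabs_pow.
rewrite rmorphD opprD expRD mulrC ler_pM ?embed_trunc ?mulr_ge0 ?(abs_ge0 V) ?expR_ge0//.
by rewrite ler_piMl ?expR_ge0 ?rabs_const_le.
Qed.

Lemma embed_mono l c : J (mono l c) = cst c * P l.
Proof.
apply/eqP; rewrite -subr_eq0; apply/eqP; apply: (@robinson_small0 _ 0) => x; rewrite addr0.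
pose y := Num.max x l.
have cA : covers [fset l]%fset (mono l c) y.
  by move=> m _; rewrite coef_mono inE; case: (eqVneq m l) => // _; rewrite eqxx.
have E : trunc (mono l c) y = cst c * P l.
  rewrite (truncE cA) big_mkcond big_seq_fset1 le_max lexx orbT.
  by rewrite /term coef_mono eqxx.
by rewrite -E (le_trans (embed_trunc _ _))// ratr_exp_le le_max lexx.
Qed.

(** Multiplication by a finite sum f of monomials is handled term by term; for f the truncation of a
    at x, the error is governed by a - f and is small with x. *)
Lemma embed_monoid_morphism : monoid_morphism J.
Proof.
have J1 : J 1 = 1.
  rewrite -[1]/(mono 0 1) embed_mono robinson_const1 mul1r.
  rewrite -(rmorph1 (@robinson_class R S)); congr robinson_class; apply: val_inj.
  by apply/funext => n; exact: rat_pow0.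
split=> // a b.
apply/eqP; rewrite -subr_eq0; apply/eqP.
have [N bN] := puiseux_low b.
apply: (@robinson_small0 _ N) => x.
have [A HA] := puiseux_supp a x.
pose f : L := \sum_(l <- A | l <= x) mono l (a l).
have Jf : J (f * b) = J f * J b.
  rewrite /f; elim/big_rec: _ => [|l g _ IH]; first by rewrite mul0r embed0 mul0r.
  by rewrite mulrDl !embedD IH embed_monoM embed_mono mulrDl.
have gx : val_ge (a - f) x.
  move=> m; rewrite puiseux_coefB => am; rewrite leNgt; apply/negP => mx.
  case/eqP: am; apply/eqP; rewrite subr_eq0; apply/eqP.
  have fE (s : seq rat) : uniq s -> (\sum_(l <- s | l <= x) mono l (a l) : L) m =
      if m \in s then a m else 0.
    elim: s => [|l s IH] /=; first by rewrite big_nil.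
    move=> /andP[ls us]; rewrite big_cons inE.
    have [lx|xl] := leP l x.
      rewrite puiseux_coefD coef_mono IH//; case: (eqVneq m l) => [->|_] /=.
        by rewrite (negbTE ls) addr0.
      by rewrite add0r.
    by rewrite IH//; case: (eqVneq m l) => [ml|//]; move: xl; rewrite -ml ltNge (ltW mx).
  rewrite /f fE ?fset_uniq//; case: ifP => // /negbT mA.
  by apply/eqP; apply: contraNT mA => am; apply: HA => //; exact: ltW.
have -> : J (a * b) - J a * J b = J ((a - f) * b) - J (a - f) * J b.
  rewrite mulrBl (embedB (a * b) (f * b)) (embedB a f); exact: sub_prodB Jf.
apply: rabs_ballB; first by apply: rabs_embed_le; exact: val_geM.
by rewrite rabsM rmorphD opprD expRD ler_pM ?(abs_ge0 V) ?rabs_embed_le.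
Qed.

HB.instance Definition _ := GRing.isMonoidMorphism.Build L K J embed_monoid_morphism.

(** The leading term has exactly this absolute value and the rest is strictly smaller. *)
Lemma rabs_embed a : rabs (J a) = puiseux_abs a.
Proof.
have [->|a0] := eqVneq a 0; first by rewrite embed0 rabs0 puiseux_abs0.
have [m [am ge]] := puiseux_neq0 a0.
rewrite (puiseux_absE am ge); pose b := a - mono m (a m).
have [e e0 be] : exists2 e, 0 < e & val_ge (mono (- m) 1 * b) e.
  apply: val_gt0 => l l0; rewrite coef_monoM mul1r opprK puiseux_coefB coef_mono.
  case: (eqVneq (l + m) m) => [->|lm]; first by rewrite subrr.
  rewrite subr0 (val_ge_coef ge)// lt_neqAle lm /=; lra.
have {}be : val_ge b (m + e).
  move=> l bl; have := be (l - m); rewrite coef_monoM mul1r opprK subrK => /(_ bl); lra.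
have -> : J a = cst (a m) * P m + J b by rewrite /b embedB embed_mono addrC subrK.
have E : rabs (cst (a m) * P m) = expR (- ratr m) by rewrite rabsM rabs_pow rabs_const// mul1r.
rewrite (abs_strict V) E//; apply: le_lt_trans (rabs_embed_le be) _.
by rewrite ltr_expR ltrN2 ltr_rat ltrDl.
Qed.

End Embedding.

(** * Power series and Laurent expansions *)

Section PowerSeries.
Variable R : realType.
Local Notation C := R[i].
Local Notation L := (puiseux R).
Local Notation mono := (@puiseux_monomial R).

(* B is the expansion of g at 0, of radius of convergence at least 1/2. *)
Definition power_series_bound (g : C -> C) (B : L) (M : R) : Prop :=
  [/\ 0 <= M, forall l : rat, B l != 0 -> exists k : nat, l = k%:R,
      forall k : nat, normc (B k%:R) <= M * 2 ^+ k &
      forall t : C, 0 < normc t <= 4^-1 -> forall K : nat,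
        normc (g t - \sum_(k < K) B k%:R * t ^+ k) <= 2 * M * (2 * normc t) ^+ K].

Lemma geometric_tail (x : R) K n : 0 <= x <= 2^-1 -> (K <= n)%N ->
  \sum_(K <= k < n) x ^+ k <= 2 * x ^+ K.
Proof.
move=> /andP[x0 x2] Kn; suff: \sum_(K <= k < n) x ^+ k <= 2 * x ^+ K - 2 * x ^+ n.
  by have := exprn_ge0 n x0; lra.
rewrite -(subnKC Kn); elim: (n - K)%N => [|m IH].
  by rewrite addn0 big_geq// subrr.
rewrite addnS big_nat_recr ?leq_addr//= exprS.
have h : x * x ^+ (K + m) <= 2^-1 * x ^+ (K + m) by rewrite ler_wpM2r ?exprn_ge0.
by lra.
Qed.

Lemma normCE (z : C) : `|z| = (normc z)%:C.
Proof. by case: z => x y. Qed.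

Lemma cvg_bounded_terms (u : nat -> C) (l : C) :
  (series u : nat -> C^o) @ \oo --> (l : C^o) -> exists M, forall k, normc (u k) <= M.
Proof.
move=> cu; have c0 : (u : nat -> C^o) @ \oo --> (0 : C^o).
  by apply: cvg_series_cvg_0; apply/cvg_ex; exists l.
have /cvgrPdist_lt/(_ 1 ltr01)[N _ NP] := c0.
exists (1 + \sum_(k < N) normc (u k)) => k.
have S0 : 0 <= \sum_(k < N) normc (u k) by apply: sumr_ge0 => i _; exact: normc_ge0.
have [kN|Nk] := ltnP k N.
  rewrite (bigD1 (Ordinal kN))//= [_ + (_ + _)]addrCA lerDl addr_ge0//.
  by apply: sumr_ge0 => i _; exact: normc_ge0.
have := NP k Nk; rewrite /= sub0r normrN normCE -(rmorph1 (@real_complex R)) ltcR.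
by move=> /ltW h; rewrite (le_trans h)// lerDl.
Qed.

(** Convergence at t = 1/2 bounds the coefficients by M 2^k; the remainders for |t| <= 1/4 are then
    dominated by a geometric series of ratio at most 1/2. *)
Lemma laurent_power_series f A : laurent_expansion f A ->
  exists N M, power_series_bound (fun t => t ^+ N * f t) (mono N%:R 1 * A) M.
Proof.
move=> [Aint [N [Alow Aseries]]].
pose c k : C := A (k%:Z - N%:Z)%:~R.
have BE k : (mono N%:R 1 * A) k%:R = c k.
  by rewrite coef_monoM mul1r /c rmorphB.
have half : punctured_disk ((2^-1)%:C : C).
  change (is_true (0 < normc ((2^-1)%:C : C) < 1)); rewrite normc_real ger0_norm//.
  by apply/andP; split; lra.
have [M0 M0P] := cvg_bounded_terms (Aseries _ half).
have cM k : normc (c k) <= M0 * 2 ^+ k.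
  have := M0P k; rewrite -/(c k) normcM => h.
  have e : normc ((2^-1)%:C ^ (k%:Z - N%:Z) : C) = 2 ^+ N / 2 ^+ k.
    rewrite expfzDr; last by rewrite -normc_gt0 normc_real ger0_norm//; lra.
    rewrite -exprnN normcM normcV !normcX normc_real ger0_norm; last by lra.
    by rewrite !exprVn invrK mulrC.
  rewrite e mulrA ler_pdivrMr ?exprn_gt0// in h.
  by apply: le_trans h; rewrite ler_peMr ?normc_ge0// exprn_ege1// ler1n.
have M00 : 0 <= M0 by apply: le_trans (M0P 0%N); exact: normc_ge0.
exists N, M0; split=> //.
- move=> l; rewrite coef_monoM mul1r => Al; have [k lk] := Aint _ Al.
  have kN : - N%:Z <= k by rewrite leNgt; apply: contra Al; rewrite lk => /Alow->.
  exists (absz (k + N%:Z)); rewrite -[l](subrK N%:R) lk -[N%:R]/((N%:Z)%:~R) -rmorphD.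
  by rewrite pmulrn gez0_abs//; lia.
- by move=> k; rewrite BE.
- move=> t /andP[t0 t4] K; under eq_bigr do rewrite BE.
  have tn0 : t != 0 by rewrite -normc_gt0.
  have td : punctured_disk t by rewrite /punctured_disk /= t0 /=; lra.
  apply/ler_addgt0Pr => e e0.
  have eC : (0 : C) < e%:C by rewrite ltcR.
  have /cvgrPdist_lt/(_ _ eC)[n0 _ nP] := Aseries _ td.
  pose n := maxn n0 K.
  have := nP n (leq_maxl _ _); rewrite /= normCE ltcR => h1.
  have sE : t ^+ N * series (fun k : nat => c k * t ^ (k%:Z - N%:Z)) n = \sum_(k < n) c k * t ^+ k.
    rewrite /series /= big_mkord big_distrr; apply: eq_bigr => k _ /=.
    have e1 : t ^+ N * t ^ (k%:Z - N%:Z) = t ^+ k.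
      by rewrite (exprnP t N) -expfzDr// addrC subrK.
    by rewrite mulrCA e1.
  have split1 : \sum_(k < n) c k * t ^+ k = \sum_(k < K) c k * t ^+ k + \sum_(K <= k < n) c k * t ^+ k.
    by rewrite -!(big_mkord xpredT (fun k => c k * t ^+ k)) -big_cat_nat ?leq_maxr.
  have -> : t ^+ N * f t - \sum_(k < K) c k * t ^+ k =
     t ^+ N * (f t - series (fun k : nat => c k * t ^ (k%:Z - N%:Z)) n) + \sum_(K <= k < n) c k * t ^+ k.
    rewrite mulrBr sE split1; ring.
  apply: le_trans (@le_normcD R _ _) _; rewrite addrC lerD//; last first.
    rewrite normcM normcX (le_trans _ (ltW h1))// ler_piMl ?normc_ge0//.
    by rewrite exprn_ile1// ?normc_ge0//; lra.
  apply: le_trans (normc_sum _ _ _) _.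
  apply: (@le_trans _ _ (\sum_(K <= k < n) M0 * (2 * normc t) ^+ k)).
    apply: ler_sum => k _; rewrite normcM normcX exprMn mulrA.
    by rewrite ler_wpM2r ?exprn_ge0 ?normc_ge0.
  rewrite -big_distrr /= [2 * M0]mulrC -mulrA ler_wpM2l// geometric_tail ?leq_maxr//.
  by apply/andP; split; lra.
Qed.

Lemma power_series_shift g B M : power_series_bound g B M ->
  power_series_bound (fun t => t * g t) (mono 1 1 * B) M.
Proof.
move=> [M0 supp le tail].
have B0 : (mono 1 1 * B) 0%:R = 0.
  rewrite coef_monoM mul1r; apply/eqP; apply/negPn/negP => /supp[k].
  by rewrite sub0r => h; have := ler0n rat k; rewrite -h; lra.
have BS k : (mono 1 1 * B) k.+1%:R = B k%:R.
  by rewrite coef_monoM mul1r -natr1 addrK.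
split=> //.
- move=> l; rewrite coef_monoM mul1r => /supp[k lk].
  by exists k.+1; rewrite -natr1 -lk subrK.
- case=> [|k]; first by rewrite B0 normc0 mulr_ge0// exprn_ge0.
  rewrite BS (le_trans (le k))// ler_wpM2l// exprS ler_peMl ?exprn_ge0// ler1n//.
- move=> t t4 [|K].
    rewrite big_ord0 subr0 expr0 mulr1 normcM.
    have := tail t t4 0%N; rewrite big_ord0 subr0 expr0 mulr1 => h.
    by rewrite (le_trans _ h)// ler_piMl ?normc_ge0//; case/andP: t4 => _; lra.
  rewrite big_ord_recl B0 mul0r add0r.
  have -> : t * g t - \sum_(i < K) (mono 1 1 * B) (bump 0 i)%:R * t ^+ bump 0 i =
     t * (g t - \sum_(k < K) B k%:R * t ^+ k).
    rewrite mulrBr big_distrr; congr (_ - _); apply: eq_bigr => i _.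
    by rewrite -[LHS]/((mono 1 1 * B) i.+1%:R * t ^+ i.+1) BS exprS mulrCA.
  rewrite normcM exprS mulrCA; have h := tail t t4 K.
  have y0 : 0 <= 2 * M * (2 * normc t) ^+ K by rewrite !mulr_ge0// exprn_ge0// mulr_ge0// normc_ge0.
  apply: (@le_trans _ _ (normc t * (2 * M * (2 * normc t) ^+ K))).
    by rewrite ler_wpM2l ?normc_ge0.
  by rewrite ler_wpM2r// ler_peMl ?normc_ge0// ler1n.
Qed.

(** The pole order may be increased, so that one N serves all coefficients of the family. *)
Lemma laurent_power_series_ge f A : laurent_expansion f A ->
  exists N0, forall N, (N0 <= N)%N ->
    exists M, power_series_bound (fun t => t ^+ N * f t) (mono N%:R 1 * A) M.
Proof.
move=> /laurent_power_series[N0 [M PM]]; exists N0 => N /subnKC <-.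
exists M; elim: (N - N0)%N => [|k IH]; first by rewrite addn0.
have := power_series_shift IH; rewrite mulrA monoM mulr1 addnS.
have -> : 1 + (N0 + k)%:R = (N0 + k).+1%:R :> rat by rewrite -natr1 addrC.
by under eq_fun do rewrite mulrA -exprS.
Qed.

Lemma big_natr_fset (V : nmodType) (F : rat -> V) n :
  \sum_(l <- [fset (k%:R : rat) | k in iota 0 n]%fset) F l = \sum_(k < n) F k%:R.
Proof.
rewrite big_imfset /=; last by move=> i j _ _ /eqP; rewrite eqr_nat => /eqP.
by rewrite undup_id ?iota_uniq// -{1}(subn0 n) -/(index_iota 0 n) big_mkord.
Qed.

Lemma coef_mul_nat (A B : L) (m : nat) :
  (forall l : rat, A l != 0 -> exists k : nat, l = k%:R) ->
  (forall l : rat, B l != 0 -> exists k : nat, l = k%:R) ->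
  (A * B) m%:R = \sum_(i < m.+1) A i%:R * B (m - i)%:R.
Proof.
move=> HA HB; have B0 l : B l != 0 -> 0 <= l by move=> /HB[k ->]; exact: ler0n.
rewrite (@puiseux_coefM _ A B 0 m%:R [fset (k%:R : rat) | k in iota 0 m.+1]%fset B0); last first.
  move=> l; rewrite subr0 => lm /HA[k lk]; apply/imfsetP; exists k => //.
  by rewrite -[X in is_true X]/(k \in iota 0 m.+1) mem_iota add0n ltnS; rewrite lk ler_nat in lm.
rewrite big_natr_fset; by apply: eq_bigr => i _; rewrite natrB// -ltnS.
Qed.

Lemma le_half_pow (K : nat) : K%:R <= 2 ^+ K :> R.
Proof. by rewrite -natrX ler_nat ltnW// ltn_expl. Qed.

Lemma power_seriesM f g A B M M' t : power_series_bound f A M -> power_series_bound g B M' ->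
  0 < normc t <= 16^-1 -> exists c, forall K : nat,
    normc (f t * g t - \sum_(m < K) (A * B) m%:R * t ^+ m) <= c * 2^-1 ^+ K.
Proof.
move=> [M0 sA leA tA] [M0' sB leB tB] t16.
have t4 : 0 < normc t <= 4^-1 by case/andP: t16 => -> /=; lra.
have t0 : 0 <= normc t by exact: normc_ge0.
have MM : 0 <= M * M' by rewrite mulr_ge0.
exists (14 * (M * M')) => K.
set x := 2 * normc t in tA tB.
have x8 : 0 <= x <= 8^-1 by rewrite /x; apply/andP; split; case/andP: t16 => _; lra.
have xK1 : 0 <= x ^+ K <= 2^-1 ^+ K.
  case/andP: x8 => x0 x8; rewrite exprn_ge0// lerXn2r ?nnegrE//; lra.
have xK11 : x ^+ K <= 1 by case/andP: x8 => x0 x8; rewrite exprn_ile1//; lra.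
pose P : {poly C} := \poly_(k < K) A k%:R; pose Q : {poly C} := \poly_(k < K) B k%:R.
have PE : P.[t] = \sum_(k < K) A k%:R * t ^+ k by rewrite horner_poly.
have QE : Q.[t] = \sum_(k < K) B k%:R * t ^+ k by rewrite horner_poly.
have sPQ : (size (P * Q)%R <= K + K)%N.
  rewrite (leq_trans (size_polyMleq _ _))// (leq_trans (leq_pred _))// leq_add//; exact: size_poly.
have lowE m : (m < K)%N -> (P * Q)`_m = (A * B) m%:R.
  move=> mK; rewrite coefM coef_mul_nat//; apply: eq_bigr => i _.
  have im : (i <= m)%N by rewrite -ltnS.
  by rewrite !coef_poly (leq_ltn_trans im mK) (leq_ltn_trans (leq_subr _ _) mK).
have cle m : normc (P * Q)`_m <= m.+1%:R * (M * M' * 2 ^+ m).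
  rewrite coefM (le_trans (normc_sum _ _ _))//.
  rewrite (@le_trans _ _ (\sum_(i < m.+1) M * M' * 2 ^+ m))//; last first.
    by rewrite sumr_const card_ord -[leLHS]mulr_natl.
  apply: ler_sum => i _; rewrite normcM.
  have lp (F : nat -> C) (N : R) k : 0 <= N -> (forall k, normc (F k) <= N * 2 ^+ k) ->
      normc (\poly_(k < K) F k)`_k <= N * 2 ^+ k.
    move=> N0 FN; rewrite coef_poly; case: ifP => // _.
    by rewrite normc0 mulr_ge0// exprn_ge0.
  have im : (i <= m)%N by rewrite -ltnS.
  have -> : M * M' * 2 ^+ m = M * 2 ^+ i * (M' * 2 ^+ (m - i)).
    by rewrite mulrACA -exprD subnKC.
  rewrite ler_pM ?normc_ge0//.
    exact: (lp (fun k => A k%:R)).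
  exact: (lp (fun k => B k%:R)).
have PQE : P.[t] * Q.[t] = \sum_(m < K) (A * B) m%:R * t ^+ m + \sum_(K <= m < K + K) (P * Q)`_m * t ^+ m.
  rewrite -hornerM (horner_coef_wide _ sPQ) -(big_mkord xpredT (fun m => (P * Q)`_m * t ^+ m)).
  rewrite (big_cat_nat (n := K)) ?leq_addr//=; congr (_ + _).
  by rewrite big_mkord; apply: eq_bigr => i _; rewrite lowE.
have -> : f t * g t - \sum_(m < K) (A * B) m%:R * t ^+ m =
   (f t - P.[t]) * g t + P.[t] * (g t - Q.[t]) + \sum_(K <= m < K + K) (P * Q)`_m * t ^+ m.
  have -> : \sum_(K <= m < K + K) (P * Q)`_m * t ^+ m = P.[t] * Q.[t] - \sum_(m < K) (A * B) m%:R * t ^+ m.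
    by rewrite PQE addrC addKr.
  ring.
have gM : normc (g t) <= 2 * M'.
  by have := tB t t4 0%N; rewrite big_ord0 subr0 expr0 mulr1.
have fM : normc (f t) <= 2 * M.
  by have := tA t t4 0%N; rewrite big_ord0 subr0 expr0 mulr1.
have fP : normc (f t - P.[t]) <= 2 * M * x ^+ K by rewrite PE tA.
have gQ : normc (g t - Q.[t]) <= 2 * M' * x ^+ K by rewrite QE tB.
have PM : normc P.[t] <= 4 * M.
  have -> : P.[t] = f t + (- (f t - P.[t])) by ring.
  apply: le_trans (@le_normcD R _ _) _; rewrite normcN.
  have : 2 * M * x ^+ K <= 2 * M by rewrite ler_piMr// mulr_ge0.
  by lra.
have tailM : normc (\sum_(K <= m < K + K) (P * Q)`_m * t ^+ m) <= 2 * (M * M') * 2^-1 ^+ K.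
  apply: le_trans (normc_sum _ _ _) _.
  apply: (@le_trans _ _ (\sum_(K <= m < K + K) (2 * K%:R * (M * M') * 8^-1 ^+ K))).
    rewrite big_nat [leRHS]big_nat; apply: ler_sum => m /andP[Km mK].
    rewrite normcM normcX (le_trans (ler_wpM2r _ (cle m))) ?exprn_ge0//.
    rewrite -!mulrA -exprMn -/x.
    have m2 : m.+1%:R <= 2 * K%:R :> R by rewrite -natrM ler_nat mul2n -addnn.
    rewrite [leRHS]mulrA ler_pM ?mulr_ge0 ?exprn_ge0 ?(andP x8).1//.
    rewrite ler_wpM2l// ler_wpM2l//.
    case/andP: x8 => x0 x8.
    rewrite (@le_trans _ _ (x ^+ K))//; last by rewrite lerXn2r ?nnegrE//; lra.
    by rewrite ler_wiXn2l//; lra.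
  rewrite big_const_nat addKn iter_addr addr0 -[leLHS]mulr_natl.
  have -> : 8^-1 ^+ K = 2^-1 ^+ K * (2^-1 ^+ K * 2^-1 ^+ K) :> R.
    by rewrite -!exprMn; congr (_ ^+ K); lra.
  have k1 : K%:R * 2^-1 ^+ K <= 1 :> R.
    by rewrite exprVn ler_pdivrMr ?exprn_gt0// mul1r le_half_pow.
  have -> : K%:R * (2 * K%:R * (M * M') * (2^-1 ^+ K * (2^-1 ^+ K * 2^-1 ^+ K))) =
    2 * (M * M') * 2^-1 ^+ K * ((K%:R * 2^-1 ^+ K) * (K%:R * 2^-1 ^+ K)) by ring.
  have k0 : 0 <= K%:R * 2^-1 ^+ K :> R by rewrite mulr_ge0// exprn_ge0// invr_ge0.
  rewrite ler_piMr//; first by rewrite !mulr_ge0 ?exprn_ge0 ?invr_ge0.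
  by rewrite mulr_ile1.
apply: le_trans (@le_normcD R _ _) _.
have h1 : normc ((f t - P.[t]) * g t + P.[t] * (g t - Q.[t])) <= 12 * (M * M') * x ^+ K.
  apply: le_trans (@le_normcD R _ _) _; rewrite !normcM.
  have a1 := ler_pM (normc_ge0 _) (normc_ge0 _) fP gM.
  have a2 := ler_pM (normc_ge0 _) (normc_ge0 _) PM gQ.
  have e1 : 2 * M * x ^+ K * (2 * M') = 4 * (M * M') * x ^+ K by ring.
  have e2 : 4 * M * (2 * M' * x ^+ K) = 8 * (M * M') * x ^+ K by ring.
  by rewrite e1 in a1; rewrite e2 in a2; lra.
have h2 : 12 * (M * M') * x ^+ K <= 12 * (M * M') * 2^-1 ^+ K.
  by rewrite ler_wpM2l ?mulr_ge0//; case/andP: xK1.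
have := lerD (le_trans h1 h2) tailM; rewrite -mulrDl => /le_trans; apply.
by rewrite ler_wpM2r ?exprn_ge0 ?invr_ge0//; lra.
Qed.

Lemma power_series_mul_eq f g f' g' A B A' B' M1 M2 M3 M4 t :
  power_series_bound f A M1 -> power_series_bound g B M2 ->
  power_series_bound f' A' M3 -> power_series_bound g' B' M4 ->
  A * B = A' * B' -> 0 < normc t <= 16^-1 -> f t * g t = f' t * g' t.
Proof.
move=> p1 p2 p3 p4 E t16; have [c cP] := power_seriesM p1 p2 t16.
have [c' cP'] := power_seriesM p3 p4 t16; rewrite -E in cP'.
apply/eqP; rewrite -subr_eq0; apply/negPn; rewrite -normc_gt0; apply/negP => n0.
set n := normc _ in n0.
have h K : n <= (c + c') * 2^-1 ^+ K.
  have -> : n = normc ((f t * g t - \sum_(m < K) (A * B) m%:R * t ^+ m) -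
     (f' t * g' t - \sum_(m < K) (A * B) m%:R * t ^+ m)) by congr normc; ring.
  apply: le_trans (@le_normcD R _ _) _; rewrite normcN mulrDl.
  exact: lerD (cP K) (cP' K).
pose K := Num.bound `|(c + c') / n|.
have hK : (c + c') / n < 2 ^+ K.
  apply: lt_le_trans (le_half_pow K); apply: le_lt_trans (ler_norm _) _.
  exact: archi_boundP.
have := h K; rewrite leNgt exprVn ltr_pdivrMr ?exprn_gt0// mulrC -ltr_pdivrMr//.
by rewrite hK.
Qed.

End PowerSeries.

(** * Complex values at rho_n represent the embedded expansions; nondegeneracy of families *)

Section LaurentClass.
Variables (R : realType) (S : scale R).
Local Notation C := R[i].
Local Notation L := (puiseux R).
Local Notation mono := (@puiseux_monomial R).
Local Notation rabs := (@robinson_abs R S).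
Local Notation omega := (ultra S).
Local Notation rho := (rho S).
Local Notation V := (robinson_valued_field S).
#[local] Existing Instance ultra_omega.

Lemma rho_neq0 n : rho n != 0.
Proof. by rewrite -normc_gt0; have /andP[] := rho_disk S n. Qed.

(** The remainder after K terms is at most a constant times |rho_n|^K, hence of Robinson absolute
    value at most e^(-K); both sides are the limit of the same truncations. *)
Lemma power_series_class g B M : power_series_bound g B M ->
  exists mg : (fun n => g (rho n)) \in @moderate R S, robinson_class (MkM0 mg) = embed S B.
Proof.
move=> [Mge supp le tail].
pose w K : M0 S := \sum_(k < K) MkM0 (const_moderate S (B k%:R)) * MkM0 (pow_moderate S k%:R).
have wE K n : w K n = \sum_(k < K) B k%:R * rho n ^+ k.
  rewrite /w; elim: K => [|K IH]; first by rewrite !big_ord0.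
  rewrite !big_ord_recr -IH -[LHS]/(_ + _ * rat_pow _ _); congr (_ + _ * _).
  exact: (rat_pow_int K%:Z (rho_neq0 n)).
have wc K : robinson_class (w K.+1) = trunc S B K%:R.
  rewrite rmorph_sum (@truncE _ _ [fset (k%:R : rat) | k in iota 0 K.+1]%fset); last first.
    move=> l lK /supp[k lk]; apply/imfsetP; exists k => //.
    by rewrite -[X in is_true X]/(k \in iota 0 K.+1) mem_iota add0n ltnS; rewrite lk ler_nat in lK.
  rewrite [RHS]big_mkcond [RHS]big_natr_fset.
  apply: eq_bigr => i _; rewrite ler_nat -ltnS ltn_ord; exact: rmorphM.
have near4 : \forall n \near omega, normc (rho n) <= 4^-1.
  apply: filterS (log_scale_cvg S 3) => n h; rewrite normc_rho expRN lef_pV2 ?posrE ?expR_gt0//.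
  by have := expR_ge1Dx (log_scale S n); lra.
have bound K : \forall n \near omega, normc (g (rho n) - w K n) <= 2 * M * 2 ^+ K * normc (rho n) ^+ K.
  apply: filterS near4 => n h; rewrite wE -mulrA -exprMn; apply: tail.
  by rewrite h normc_gt0 rho_neq0.
pose c K : R := 2 * M * 2 ^+ K + 1.
have c0 K : 0 < c K by rewrite ltr_wpDl// !mulr_ge0 ?exprn_ge0.
have rbound K : \forall n \near omega, root_abs S (fun n => g (rho n) - w K n) n <=
     c K `^ (log_scale S n)^-1 * expR (- K%:R).
  apply: filterS (bound K) => n h.
  have r0 := log_scale_gt0 S n.
  have -> : expR (- K%:R) = (normc (rho n) ^+ K) `^ (log_scale S n)^-1 :> R.
    by rewrite normc_rhoX -expRM mulfK// gt_eqF.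
  rewrite -powRM ?(ltW (c0 K)) ?exprn_ge0 ?normc_ge0//.
  rewrite /root_abs ge0_ler_powR ?nnegrE ?normc_ge0 ?invr_ge0 ?(ltW r0)//.
    by rewrite mulr_ge0 ?(ltW (c0 K)) ?exprn_ge0 ?normc_ge0.
  by rewrite (le_trans h)// ler_wpM2r ?exprn_ge0 ?normc_ge0// lerDl.
have lim K : c K `^ (log_scale S n)^-1 * expR (- K%:R) @[n --> omega] --> expR (- K%:R).
  rewrite -[X in _ --> X]mul1r; apply: cvgM; [exact: root_const_cvg|exact: cvg_cst].
have dm K : (fun n => g (rho n) - w K n) \in @moderate R S.
  apply/moderateP; exists (expR (- K%:R) + 1).
  have h := cvgr_le _ (lim K) (expR (- K%:R) + 1); rewrite ltrDl ltr01 in h.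
  apply: filterS (filterI (rbound K) (h _ isT)) => n [h1 h2]; exact: le_trans h2.
have mg : (fun n => g (rho n)) \in @moderate R S.
  rewrite (_ : (fun n => _) = (fun n => (g (rho n) - w 0%N n) + w 0%N n)); last first.
    by apply/funext => n; rewrite subrK.
  by apply: rpredD => //; exact: M0_moderate.
exists mg.
have key K : rabs (robinson_class (MkM0 mg) - trunc S B K%:R) <= expR (- ratr K%:R).
  rewrite -wc -rmorphB robinson_absE ratr_nat.
  apply: (@le_trans _ _ (expR (- K.+1%:R))); last by rewrite ler_expR lerN2 ler_nat.
  exact: (ler_cvg_to (sabs_cvg (dm K.+1)) (lim K.+1) (rbound K.+1)).
apply/eqP; rewrite -subr_eq0.
have small (K : nat) : rabs (robinson_class (MkM0 mg) - embed S B) <= expR (- K%:R).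
  rewrite -(ratr_nat R K); apply: rabs_ball_trans (key K) _.
  by rewrite (absB V); exact: embed_trunc.
rewrite -(abs_eq0 V) eq_le (abs_ge0 V) andbT.
by apply: le_expN => K; exact: small.
Qed.

Lemma laurent_class f A : laurent_expansion f A ->
  exists mf : (fun n => f (rho n)) \in @moderate R S, robinson_class (MkM0 mf) = embed S A.
Proof.
move=> /laurent_power_series[N [M /power_series_class[mg E]]].
have fE n : f (rho n) = rat_pow (rho n) (- N%:R) * (rho n ^+ N * f (rho n)).
  rewrite mulrA -[X in _ * X * _](rat_pow_int N%:Z (rho_neq0 n)) -rat_powD addNr.
  by rewrite rat_pow0 mul1r.
have mf : (fun n => f (rho n)) \in @moderate R S.
  rewrite (_ : (fun n => _) = (fun n => rat_pow (rho n) (- N%:R) * (rho n ^+ N * f (rho n)))).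
    by apply: rpredM => //; exact: pow_moderate.
  by apply/funext => n.
exists mf; have -> : A = mono (- N%:R) 1 * (mono N%:R 1 * A).
  by rewrite mulrA monoM addNr mulr1 mul1r.
rewrite embed_monoM -E robinson_const1 mul1r -rmorphM.
by congr robinson_class; apply: val_inj; apply/funext => n; exact: fE.
Qed.

End LaurentClass.

Lemma coprimep_proportional (F : fieldType) (p q : {poly F}) d : (0 < d)%N ->
  coprimep p q -> maxn (size p) (size q) = d.+1 ->
  (forall i j, (i <= d)%N -> (j <= d)%N -> p`_i * q`_j = p`_j * q`_i) -> False.
Proof.
move=> d0 cop sz h.
have sp : (size p <= d.+1)%N by rewrite -sz leq_maxl.
have sq : (size q <= d.+1)%N by rewrite -sz leq_maxr.
have E j : (j <= d)%N -> q`_j *: p = p`_j *: q.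
  move=> jd; apply/polyP => i; rewrite !coefZ; have [id|di] := leqP i d.
    by rewrite mulrC h.
  by rewrite [p`_i]nth_default ?(leq_trans sp di)// [q`_i]nth_default ?(leq_trans sq di)// !mulr0.
have small (u v : {poly F}) c : coprimep u v -> u = c *: v -> (size v <= 1)%N.
  move=> cuv uv; have : coprimep v v.
    have : v %| u by rewrite uv -mul_polyC dvdp_mull.
    by move=> vu; exact: coprimep_dvdr vu cuv.
  by rewrite coprimepp => /eqP->.
have [q0|q0] := eqVneq q 0.
  move: cop sz; rewrite q0 coprimep0 size_poly0 maxn0 => /eqp_size.
  by rewrite size_poly1 => -> [e]; move: d0; rewrite -e.
have [qd jd] : q`_(size q).-1 != 0 /\ ((size q).-1 <= d)%N.
  rewrite -lead_coefE lead_coef_eq0; split=> //.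
  by rewrite -ltnS prednK ?size_poly_gt0.
have pE : p = (p`_(size q).-1 / q`_(size q).-1) *: q.
  by rewrite mulrC -scalerA -(E _ jd) scalerA mulVf// scale1r.
have s1 := small p q _ cop pE.
have s2 : (size p <= 1)%N by rewrite pE (leq_trans (size_scale_leq _ _)).
have : (maxn (size p) (size q) <= 1)%N by rewrite geq_max s2.
by rewrite sz ltnS leqNgt d0.
Qed.

Section Families.
Variable R : realType.
Local Notation C := R[i].
Local Notation L := (puiseux R).
Local Notation mono := (@puiseux_monomial R).
Variables (d : nat) (a b : nat -> C -> C) (A B : nat -> L).
Hypotheses (d0 : (0 < d)%N) (fam : rational_family d a b).
Hypothesis expansions : forall i, (i <= d)%N ->
  laurent_expansion (a i) (A i) /\ laurent_expansion (b i) (B i).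

(** Formal vanishing of the minors would give numerical vanishing at t = 1/16, where the power
    series estimates hold; numerator and denominator would be proportional there, against
    coprimality. *)
Lemma family_minors : ~ forall i j, (i <= d)%N -> (j <= d)%N -> A i * B j = A j * B i.
Proof.
move=> h; pose t : C := (16^-1)%:C.
have nt : normc t = 16^-1 by rewrite normc_real ger0_norm.
have t16 : 0 < normc t <= 16^-1 by rewrite nt lexx andbT.
have tn : t != 0 by rewrite -normc_gt0 nt.
have td : punctured_disk t by change (is_true (0 < normc t < 1)); rewrite nt; lra.
have [N NP] : exists N, forall i, (i <= d)%N ->
    (exists M, power_series_bound (fun t => t ^+ N * a i t) (mono N%:R 1 * A i) M) /\
    exists M, power_series_bound (fun t => t ^+ N * b i t) (mono N%:R 1 * B i) M.
  have fin m : (m <= d.+1)%N -> exists N, forall i, (i < m)%N -> forall N', (N <= N')%N ->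
    (exists M, power_series_bound (fun t => t ^+ N' * a i t) (mono N'%:R 1 * A i) M) /\
    exists M, power_series_bound (fun t => t ^+ N' * b i t) (mono N'%:R 1 * B i) M.
    elim: m => [_|m IH md]; first by exists 0%N.
    have [N NP] := IH (ltnW md).
    have [/laurent_power_series_ge[N1 P1] /laurent_power_series_ge[N2 P2]] := expansions md.
    exists (maxn N (maxn N1 N2)) => i; rewrite ltnS leq_eqVlt => /orP[/eqP->|im] N'.
      by rewrite !geq_max => /and3P[_ n1 n2]; split; [exact: P1|exact: P2].
    by rewrite !geq_max => /and3P[n _ _]; exact: NP.
  have [N NP] := fin d.+1 (leqnn _); exists N => i id; exact: NP.
have [cop sz] := fam.2 t td.
apply: (coprimep_proportional d0 cop sz) => i j id jd.
rewrite !coef_poly !ltnS id jd.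
have [[M1 p1] [M4 p4]] := NP i id; have [[M3 p3] [M2 p2]] := NP j jd.
have E : (mono N%:R 1 * A i) * (mono N%:R 1 * B j) = (mono N%:R 1 * A j) * (mono N%:R 1 * B i).
  by rewrite mulrACA h// mulrACA.
have := power_series_mul_eq p1 p2 p3 p4 E t16 => /=.
rewrite mulrACA [RHS]mulrACA => /(mulfI _); apply.
by rewrite mulf_neq0// expf_neq0.
Qed.

Let num := \poly_(i < d.+1) A i.
Let den := \poly_(i < d.+1) B i.

Lemma family_den : den != 0.
Proof.
apply/eqP => den0; apply: family_minors => i j id jd.
have B0 k : (k <= d)%N -> B k = 0.
  by move=> kd; have := coef_poly d.+1 B k; rewrite -/den den0 coef0 ltnS kd.
by rewrite !B0// !mulr0.
Qed.

Lemma family_num_den e : num - e *: den != 0.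
Proof.
rewrite subr_eq0; apply/eqP => E; apply: family_minors => i j id jd.
have AE k : (k <= d)%N -> A k = e * B k.
  move=> kd; have := congr1 (fun p : {poly L} => p`_k) E.
  by rewrite coefZ !coef_poly ltnS kd.
by rewrite !AE// -!mulrA (mulrC (B i)).
Qed.

End Families.

(** * Points of the asymptotic cone as balls *)

Section Asymptotics.
Variables (R : realType) (S : scale R).
Local Notation C := R[i].
Local Notation omega := (ultra S).
Local Notation r := (log_scale S).
Local Notation rabs := (@robinson_abs R S).
Local Notation V := (robinson_valued_field S).
#[local] Existing Instance ultra_omega.

Definition rescale (a : nat -> R) n : R := a n `^ (r n)^-1.

Lemma ln_root a n : ln (rescale a n) = ln (a n) / r n.
Proof. by rewrite /rescale ln_powR mulrC. Qed.

Lemma root_max a a' n : 0 <= a n -> 0 <= a' n ->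
  rescale (fun n => Num.max (a n) (a' n)) n = Num.max (rescale a n) (rescale a' n).
Proof.
move=> a0 a0'; have r0 : 0 <= (r n)^-1 by rewrite invr_ge0 ltW// log_scale_gt0.
rewrite /rescale; case: (leP (a n) (a' n)) => h.
  by rewrite (max_idPr _)// ge0_ler_powR ?nnegrE.
by rewrite (max_idPl _)// ge0_ler_powR ?nnegrE// ltW.
Qed.

Lemma cvg_const_scale (c : R) : c / r n @[n --> omega] --> (0 : R).
Proof. by rewrite -[X in _ --> X](mulr0 c); apply: cvgM; [exact: cvg_cst|exact: log_scaleV_cvg]. Qed.

(** The sum of three squares in [cdist] lies between m^2 and 3 m^2: up to a bounded error the
    hyperbolic distance is the formula for the distance of balls. *)
Lemma cdist_max (b : C) (a : R) b' a' : 0 < a -> 0 < a' ->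
  let m := Num.max (Num.max a a') (normc (b - b')) in
  2 * ln m - ln a - ln a' - ln 2 <= ln (cdist b a b' a') /\
  ln (2 * cdist b a b' a') <= 2 * ln m - ln a - ln a' + ln 3.
Proof.
move=> a0 a0' m; have m0 : 0 < m by rewrite !lt_max a0.
have c0 : 0 < cdist b a b' a' := lt_le_trans ltr01 (cdist_ge1 b b' a0 a0').
have lnm : 2 * ln m = ln (m ^+ 2) by rewrite lnXn// mulr_natl.
have sqb : sq (b - b') = normc (b - b') ^+ 2 by rewrite sq_normc.
have aa : 0 < a * a' by rewrite mulr_gt0.
have s0 : 0 < sq (b - b') + a ^+ 2 + a' ^+ 2 by rewrite ltr_wpDl ?exprn_gt0// addr_ge0 ?sq_ge0 ?sqr_ge0.
have [am am' bm] : [/\ a <= m, a' <= m & normc (b - b') <= m].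
  by rewrite /m !le_max !lexx ?orbT.
have sqle (x : R) : 0 <= x -> x <= m -> x ^+ 2 <= m ^+ 2.
  by move=> x0 xm; rewrite lerXn2r ?nnegrE// ltW.
split.
  have -> : 2 * ln m - ln a - ln a' - ln 2 = ln (m ^+ 2 / (2 * (a * a'))).
    rewrite lnm ln_div ?posrE ?exprn_gt0 ?mulr_gt0// !lnM ?posrE ?mulr_gt0//; ring.
  have aa2 : 0 < 2 * (a * a') by rewrite mulr_gt0.
  have q0 : 0 < m ^+ 2 / (2 * (a * a')) by rewrite divr_gt0 ?exprn_gt0.
  rewrite ler_ln ?posrE//.
  rewrite /cdist ler_pM2r; last by rewrite invr_gt0.
  have h1 := sqr_ge0 a; have h2 := sqr_ge0 a'; have h3 := sq_ge0 (b - b').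
  rewrite {1}/m; case: (leP (Num.max a a')); first by move=> _; rewrite -sqb; lra.
  by move=> _; case: (leP a a') => _; lra.
have -> : 2 * ln m - ln a - ln a' + ln 3 = ln (3 * m ^+ 2 / (a * a')).
  rewrite lnm ln_div ?posrE ?mulr_gt0 ?exprn_gt0// !lnM ?posrE ?exprn_gt0//; ring.
have q0 : 0 < 3 * m ^+ 2 / (a * a') by rewrite divr_gt0 ?mulr_gt0 ?exprn_gt0.
have q1 : 0 < 2 * cdist b a b' a' by rewrite mulr_gt0.
rewrite ler_ln ?posrE//.
have -> : 2 * cdist b a b' a' = (sq (b - b') + a ^+ 2 + a' ^+ 2) / (a * a').
  by rewrite /cdist; field; rewrite !gt_eqF.
rewrite ler_pM2r ?invr_gt0// sqb.
have := sqle _ (ltW a0) am; have := sqle _ (ltW a0') am'; have := sqle _ (normc_ge0 _) bm; lra.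
Qed.

Definition log_dist (del del' s : R) : R := 2 * ln (Num.max (Num.max del del') s) - ln del - ln del'.

Lemma hdist_asymptotic (b b' : nat -> C) (a a' : nat -> R) (del del' s : R) :
  (\forall n \near omega, 0 < a n) -> (\forall n \near omega, 0 < a' n) ->
  0 < del -> 0 < del' ->
  rescale a @ omega --> del -> rescale a' @ omega --> del' ->
  root_abs S (fun n => b n - b' n) @ omega --> s ->
  hdist (hp (b n) (a n)) (hp (b' n) (a' n)) / r n @[n --> omega] --> log_dist del del' s.
Proof.
move=> a0 a0' d0 d0' ad ad' bs.
pose m n := Num.max (Num.max (a n) (a' n)) (normc (b n - b' n)).
pose v n := 2 * ln (rescale m n) - ln (rescale a n) - ln (rescale a' n).
have vlim : v @ omega --> log_dist del del' s.
  have cln (f : nat -> R) (x : R) : 0 < x -> f @ omega --> x -> ln (f n) @[n --> omega] --> ln x.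
    by move=> x0 fx; apply: continuous_cvg => //; exact: continuous_ln.
  apply: cvgB; [apply: cvgB|]; [apply: cvgM; [exact: cvg_cst|]|exact: cln|exact: cln].
  apply: cln; first by rewrite !lt_max d0.
  have h : Num.max (Num.max (rescale a n) (rescale a' n)) (root_abs S (fun n => b n - b' n) n)
      @[n --> omega] --> Num.max (Num.max del del') s.
    by apply: cvg_max => //; exact: cvg_max.
  apply: cvg_trans h; apply: near_eq_cvg; apply: filterS (filterI a0 a0') => n [an an'].
  rewrite /m root_max ?normc_ge0 ?le_max ?(ltW an)// root_max ?(ltW an) ?(ltW an')//.
have l2 : v n - ln 2 / r n @[n --> omega] --> log_dist del del' s.
  by rewrite -[X in _ --> X]subr0; apply: cvgB => //; exact: cvg_const_scale.
have l3 : v n + ln 3 / r n @[n --> omega] --> log_dist del del' s.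
  by rewrite -[X in _ --> X]addr0; apply: cvgD => //; exact: cvg_const_scale.
apply: (squeeze_cvgr _ l2 l3); apply: filterS (filterI a0 a0') => n [an an'].
have r0 := log_scale_gt0 S n.
have [h1 h2] := cdist_max (b n) (b' n) an an'.
have /andP[h3 h4] := hdist_bounds (b n) (b' n) an an'.
rewrite /v !ln_root ler_pdivlMr// ler_pdivrMr//.
have e (x y z u : R) : (2 * (x / r n) - y / r n - z / r n - u / r n) * r n = 2 * x - y - z - u.
  by field; rewrite gt_eqF.
have e' (x y z u : R) : (2 * (x / r n) - y / r n - z / r n + u / r n) * r n = 2 * x - y - z + u.
  by field; rewrite gt_eqF.
rewrite e e'; apply/andP; split; [exact: le_trans h1 h3|exact: le_trans h4 h2].
Qed.

(* x is represented by points of the half-space at height a n above b n, where *)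
(* |a n|^(1/r n) --> del and (b n) represents beta: in the asymptotic cone it  *)
(* is the point of the ball B(beta, del).                                      *)
Definition locates (x : nat -> H3 R) (beta : robinson S) (del : R) : Prop :=
  0 < del /\ exists (b : M0 S) (a : nat -> R), [/\ robinson_class b = beta,
    \forall n \near omega, 0 < a n /\ x n = hp (b n) (a n) &
    rescale a @ omega --> del].

Lemma locates_dist x y beta beta' del del' : locates x beta del -> locates y beta' del' ->
  hdist (x n) (y n) / r n @[n --> omega] --> log_dist del del' (rabs (beta - beta')).
Proof.
move=> [d0 [b [a [<- xE ad]]]] [d0' [b' [a' [<- yE ad']]]].
have xE1 : \forall n \near omega, 0 < a n by apply: filterS xE => n [].
have yE1 : \forall n \near omega, 0 < a' n by apply: filterS yE => n [].
have := hdist_asymptotic xE1 yE1 d0 d0' ad ad' (sabs_cvg (M0_moderate (b - b'))).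
rewrite -robinson_absE rmorphB; apply: cvg_trans; apply: near_eq_cvg.
by apply: filterS (filterI xE yE) => n [[_ ->] [_ ->]].
Qed.

Lemma root_cvg_moderate (a : nat -> R) (c : R) (b : nat -> C) :
  (\forall n \near omega, normc (b n) <= a n) -> rescale a @ omega --> c ->
  b \in @moderate R S.
Proof.
move=> ba ac; apply/moderateP; exists (c + 1).
have h : \forall n \near omega, rescale a n <= c + 1.
  by apply: (cvgr_le c ac); rewrite ltrDl.
apply: filterS (filterI ba h) => n [bn an]; apply: le_trans an.
rewrite /root_abs /rescale ge0_ler_powR ?nnegrE ?normc_ge0// ?invr_ge0 ?(ltW (log_scale_gt0 _ _))//.
by apply: le_trans bn; exact: normc_ge0.
Qed.

Definition coordb (x : nat -> H3 R) n : C := sval (cid (hp_surj (x n))).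
Definition coorda (x : nat -> H3 R) n : R := sval (cid (svalP (cid (hp_surj (x n))))).
Lemma coordE x n : 0 < coorda x n /\ x n = hp (coordb x n) (coorda x n).
Proof. exact: svalP (cid (svalP (cid (hp_surj (x n))))). Qed.

Lemma cdist_close (b : C) (a : R) b' a' (E : R) : 0 < a -> 0 < a' -> hdist (hp b a) (hp b' a') <= ln E -> 0 < E ->
  [/\ a <= 2 * E * a', a' <= 2 * E * a & normc (b - b') <= 2 * E * a'].
Proof.
move=> a0 a0' hE E0; have /andP[h _] := hdist_bounds b b' a0 a0'.
have c1 := cdist_ge1 b b' a0 a0'.
have cE : cdist b a b' a' <= E.
  by have := le_trans h hE; rewrite ler_ln// posrE (lt_le_trans ltr01).
have E1 : 1 <= E by exact: le_trans cE.
have aa : 0 < 2 * (a * a') by rewrite !mulr_gt0.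
move: cE; rewrite /cdist ler_pdivrMr// => cE.
have h1 := sqr_ge0 a; have h2 := sqr_ge0 a'; have h3 := sq_ge0 (b - b').
have x1 : a <= 2 * E * a'.
  by rewrite -(ler_pM2l a0); move: cE; rewrite -expr2; lra.
have x2 : a' <= 2 * E * a.
  by rewrite -(ler_pM2l a0'); move: cE; rewrite -expr2; lra.
split=> //.
have y0 : 0 <= 2 * E * a' by rewrite !mulr_ge0// ltW.
rewrite -(ler_sqr (_ : normc (b - b') \in Num.nneg)) ?nnegrE ?normc_ge0// sq_normc.
have h4 : E * (2 * (a * a')) <= E * (2 * (2 * E * a' * a')).
  by rewrite ler_pM2l// ler_pM2l// ler_pM2r.
have e : E * (2 * (2 * E * a' * a')) = (2 * E * a') ^+ 2 by ring.
by rewrite e in h4; lra.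
Qed.

Lemma root_comparable (a a' : nat -> R) (c del : R) : 0 < c ->
  (\forall n \near omega, [/\ 0 < a n, a n <= c * a' n & a' n <= c * a n]) ->
  rescale a @ omega --> del -> rescale a' @ omega --> del.
Proof.
move=> c0 h ad.
have l1 : rescale (fun=> c^-1) n * rescale a n @[n --> omega] --> del.
  by rewrite -[X in _ --> X]mul1r; apply: cvgM => //; apply: root_const_cvg; rewrite invr_gt0.
have l2 : rescale (fun=> c) n * rescale a n @[n --> omega] --> del.
  by rewrite -[X in _ --> X]mul1r; apply: cvgM => //; exact: root_const_cvg.
apply: (squeeze_cvgr _ l1 l2); apply: filterS h => n [a0 h1 h2].
have r0 : 0 <= (r n)^-1 by rewrite invr_ge0 ltW// log_scale_gt0.
have ci : 0 <= c^-1 by rewrite invr_ge0 ltW.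
have a0' : 0 <= a' n by rewrite -(pmulr_rge0 _ c0) (le_trans _ h1)// ltW.
rewrite /rescale -!powRM ?(ltW c0) ?(ltW a0)//.
rewrite !ge0_ler_powR ?nnegrE ?mulr_ge0 ?(ltW c0) ?(ltW a0)//.
by rewrite mulrC ler_pdivrMr// mulrC.
Qed.

(** Points at bounded distance have comparable heights, and feet differing by at most a constant
    times the height; constants disappear under the power 1/r_n, so the ball is unchanged up to its
    centre. *)
Lemma locates_close x y beta del (c : R) : locates x beta del ->
  (\forall n \near omega, hdist (y n) (x n) <= c) ->
  exists2 beta', rabs (beta' - beta) <= del & locates y beta' del.
Proof.
move=> [d0 [b [a [<- xE ad]]]] yx; pose E := expR c.
have cl : \forall n \near omega, [/\ 0 < a n, a n <= 2 * E * coorda y n,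
    coorda y n <= 2 * E * a n & normc (coordb y n - b n) <= 2 * E * a n].
  apply: filterS (filterI xE yx) => n [[an xn] h].
  have [yn yE] := coordE y n; rewrite yE xn in h.
  rewrite -[c]expRK in h.
  by have [x1 x2 x3] := cdist_close yn an h (expR_gt0 _).
have E0 : 0 < 2 * E by rewrite mulr_gt0// expR_gt0.
have ya : rescale (coorda y) @ omega --> del.
  by apply: (root_comparable E0 _ ad); apply: filterS cl => n [].
have bnd : rescale (fun n => 2 * E * a n) @ omega --> del.
  apply: (root_comparable (a := a) (c := 2 * E + (2 * E)^-1)) ad.
    by rewrite addr_gt0// invr_gt0.
  apply: filterS cl => n [an _ _ _]; split=> //.
    by rewrite mulrDl mulKf ?gt_eqF// lerDr ?mulr_ge0 ?(ltW E0) ?(ltW an)// expR_ge0.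
  by rewrite ler_pM2r// lerDl invr_ge0 ltW.
have dm : (fun n => coordb y n - b n) \in @moderate R S.
  by apply: root_cvg_moderate bnd; apply: filterS cl => n [].
have ym : coordb y \in @moderate R S.
  rewrite (_ : coordb y = fun n => (coordb y n - b n) + b n); last by apply/funext => n; rewrite subrK.
  by apply: rpredD => //; exact: M0_moderate.
exists (robinson_class (MkM0 ym)).
  rewrite -rmorphB robinson_absE.
  apply: (ler_cvg_to (sabs_cvg dm) bnd); apply: filterS cl => n [an _ _ h].
  have r0 : 0 <= (r n)^-1 by rewrite invr_ge0 ltW// log_scale_gt0.
  by rewrite /rescale ge0_ler_powR ?nnegrE ?normc_ge0// mulr_ge0 ?(ltW E0)// ltW.
split=> //; exists (MkM0 ym), (coorda y); split=> //.
by apply: nearW => n; exact: coordE.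
Qed.

Lemma locates_bounded x beta del : locates x beta del ->
  exists c, \forall n \near omega, hdist (origin R) (x n) / r n <= c.
Proof.
move=> lx; have lo : locates (fun=> origin R) 0 1.
  split=> //; exists 0, (fun=> 1); split; first exact: rmorph0.
    by apply: nearW => n; split=> //; rewrite origin_hp.
  rewrite (_ : rescale _ = fun=> 1); first exact: cvg_cst.
  by apply/funext => n; rewrite /rescale powR1.
have lim := locates_dist lo lx.
exists (log_dist 1 del (rabs (0 - beta)) + 1).
by apply: (cvgr_le _ lim); rewrite ltrDl.
Qed.

(** At distance c r_n from the origin the height lies between e^(-c r_n) / 2 and 2 e^(c r_n), so its
    rescaling has a positive finite limit along the ultrafilter, and the feet are moderate. *)
Lemma bounded_locates x c : (\forall n \near omega, hdist (origin R) (x n) / r n <= c) ->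
  exists beta del, locates x beta del.
Proof.
move=> xc; pose E n := expR (c * r n).
have cl : \forall n \near omega, [/\ 1 <= 2 * E n * coorda x n, coorda x n <= 2 * E n &
    normc (coordb x n) <= 4 * E n * E n].
  apply: filterS xc => n; have [xn xE] := coordE x n.
  rewrite xE origin_hp ler_pdivrMr ?log_scale_gt0// => h.
  have E0 : 0 < E n := expR_gt0 _.
  rewrite -[c * r n]expRK in h.
  have [x1 x2 x3] := cdist_close ltr01 xn h E0; rewrite -/(E n) in x1 x2 x3.
  rewrite mulr1 in x2; split=> //.
  rewrite sub0r normcN in x3; apply: (le_trans x3).
  by rewrite (le_trans (ler_wpM2l _ x2)) ?mulr_ge0 ?(ltW E0)//; lra.
have rE n : rescale E n = expR c.
  by rewrite /rescale /E -expRM mulfK// gt_eqF// log_scale_gt0.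
have root2 (k : R) (f : nat -> R) (l : R) : 0 < k -> (forall n, 0 <= f n) -> rescale f @ omega --> l ->
    rescale (fun n => k * f n) @ omega --> l.
  move=> k0 f0 fl; rewrite (_ : rescale _ = fun n => rescale (fun=> k) n * rescale f n).
    by rewrite -[X in _ --> X]mul1r; apply: cvgM => //; exact: root_const_cvg.
  by apply/funext => n; rewrite /rescale powRM ?(ltW k0).
have Ec : rescale E @ omega --> expR c.
  by rewrite (_ : rescale E = fun=> expR c); [exact: cvg_cst|apply/funext].
have EEc : rescale (fun n => E n * E n) @ omega --> expR c * expR c.
  rewrite (_ : rescale _ = fun n => rescale E n * rescale E n); first exact: cvgM.
  by apply/funext => n; rewrite /rescale powRM ?expR_ge0.
have bm : coordb x \in @moderate R S.
  apply: (root_cvg_moderate (a := fun n => 4 * (E n * E n))).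
    by apply: filterS cl => n [_ _]; rewrite mulrA.
  by apply: root2 EEc => // n; rewrite mulr_ge0 ?expR_ge0.
have E2 : rescale (fun n => 2 * E n) @ omega --> expR c by apply: root2 Ec => // n; exact: expR_ge0.
have ra n : 0 <= (r n)^-1 by rewrite invr_ge0 ltW// log_scale_gt0.
have up : \forall n \near omega, rescale (coorda x) n <= expR c + 1.
  have h : \forall n \near omega, rescale (fun n => 2 * E n) n <= expR c + 1.
    by apply: (cvgr_le _ E2); rewrite ltrDl.
  apply: filterS (filterI cl h) => n [[_ h1 _]]; apply: le_trans.
  by rewrite /rescale ge0_ler_powR ?nnegrE ?mulr_ge0 ?expR_ge0// ltW//; case: (coordE x n).
have low : \forall n \near omega, (expR c + 1)^-1 <= rescale (coorda x) n.
  have h : \forall n \near omega, rescale (fun n => 2 * E n) n <= expR c + 1.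
    by apply: (cvgr_le _ E2); rewrite ltrDl.
  apply: filterS (filterI cl h) => n [[h1 _ _] h2].
  have c1 : 0 < expR c + 1 by rewrite addr_gt0 ?expR_gt0.
  have [x0 _] := coordE x n.
  have g0 : 0 < rescale (coorda x) n by rewrite powR_gt0.
  have : 1 <= rescale (fun n => 2 * E n) n * rescale (coorda x) n.
    rewrite /rescale -powRM ?mulr_ge0 ?expR_ge0 ?(ltW x0)//.
    have y0 : 0 <= 2 * E n * coorda x n by exact: le_trans h1.
    have := @ge0_ler_powR R (r n)^-1 (ra n) 1 (2 * E n * coorda x n).
    by rewrite !nnegrE powR1; apply.
  move=> h3; rewrite -[leLHS]mul1r ler_pdivrMr// mulrC (le_trans h3)//.
  by rewrite ler_wpM2r// ltW.
have [|del ad] := @ultra_bounded_cvg R omega (rescale (coorda x)) (expR c + 1)^-1 (expR c + 1) (ultra_omega S).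
  by apply: filterS (filterI up low) => n [-> ->].
have d0 : 0 < del.
  have : (expR c + 1)^-1 <= del by apply: (cvgr_to_ge ad low).
  by apply: lt_le_trans; rewrite invr_gt0 addr_gt0 ?expR_gt0.
exists (robinson_class (MkM0 bm)), del; split=> //.
exists (MkM0 bm), (coorda x); split=> //.
by apply: nearW => n; exact: coordE.
Qed.

End Asymptotics.

Lemma log_dist_eq0 (R : realType) (del del' s : R) : 0 < del -> 0 < del' ->
  log_dist del del' s = 0 <-> del = del' /\ s <= del.
Proof.
move=> d0 d0'; rewrite /log_dist; set m := Num.max _ s.
have dm : del <= m by rewrite !le_max lexx.
have dm' : del' <= m by rewrite !le_max lexx orbT.
have sm : s <= m by rewrite !le_max lexx orbT.
have m0 := lt_le_trans d0 dm.
split=> [E|[dd sd]]; last first.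
  have -> : m = del by rewrite /m -dd max_l ?max_l.
  by rewrite -dd; ring.
have l1 : ln del <= ln m by rewrite ler_ln.
have l2 : ln del' <= ln m by rewrite ler_ln.
have e1 : ln del = ln m by lra.
have e2 : ln del' = ln m by lra.
have E1 : del = m by apply: (@ln_inj R) e1; rewrite posrE.
have E2 : del' = m by apply: (@ln_inj R) e2; rewrite posrE.
by rewrite E2; split=> //; rewrite E1.
Qed.

(** * The asymptotic cone as the space of Robinson balls *)

Section Cone.
Variables (R : realType) (S : scale R).
Local Notation C := R[i].
Local Notation omega := (ultra S).
Local Notation r := (log_scale S).
Local Notation rabs := (@robinson_abs R S).
Local Notation V := (robinson_valued_field S).
Local Notation cone := (Defs.cone omega r).
Local Notation bseq := (Defs.bseq r).
Local Notation cls := (@cone_class R omega r).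
Implicit Types (beta gam : robinson S) (del eps : R).
#[local] Existing Instance ultra_omega.

Lemma locates_near (x y : nat -> H3 R) beta del : (\forall n \near omega, x n = y n) ->
  locates x beta del -> locates y beta del.
Proof.
move=> xy [d0 [b [a [E xE ad]]]]; split=> //; exists b, a; split=> //.
by apply: filterS (filterI xy xE) => n [<-].
Qed.

Lemma hdist_origin : hdist (origin R) (origin R) = 0.
Proof.
rewrite /hdist subrr /= /sqnorm3 /= !expr0n /= !addr0 mulr0 mul0r addr0 expr1n subrr sqrtr0.
by rewrite addr0 ln1.
Qed.

(** [bseq] requires a bound for every n; outside the almost sure set the sequence is replaced by the
    origin. *)
Lemma near_bseq (u : nat -> H3 R) beta del : locates u beta del ->
  exists2 x : bseq, \forall n \near omega, sval x n = u n & locates (sval x) beta del.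
Proof.
move=> lu; have [c uc] := locates_bounded lu.
pose x n := if hdist (origin R) (u n) / r n <= c then u n else origin R.
have xb : exists c, forall n, hdist (origin R) (x n) / r n <= c.
  exists (Num.max c 0) => n; rewrite /x; case: ifP => [h|_]; rewrite le_max ?h//.
  by rewrite hdist_origin mul0r lexx orbT.
have xu : \forall n \near omega, x n = u n by apply: filterS uc => n h; rewrite /x h.
exists (exist _ x xb) => //.
by apply: locates_near lu; apply: filterS xu.
Qed.

Lemma located_bseq beta del : 0 < del -> exists x : bseq, locates (sval x) beta del.
Proof.
move=> d0; elim/robinson_ind: beta => b.
have [|x _ lx] := @near_bseq (fun n => hp (b n) (expR (ln del * r n))) (robinson_class b) del; last by exists x.
split=> //; exists b, (fun n => expR (ln del * r n)); split=> //.
  by apply: nearW => n; rewrite expR_gt0.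
rewrite (_ : rescale S _ = fun=> del); first exact: cvg_cst.
by apply/funext => n; rewrite /rescale -expRM mulfK ?lnK// gt_eqF// log_scale_gt0.
Qed.

Lemma bseq_located (x : bseq) : exists beta del, locates (sval x) beta del.
Proof.
case: (svalP x) => c xc; apply: (@bounded_locates _ _ _ c); exact: nearW.
Qed.

Lemma seq_distE (x y : bseq) beta beta' del del' : locates (sval x) beta del ->
  locates (sval y) beta' del' -> seq_dist omega x y = log_dist del del' (rabs (beta - beta')).
Proof. by move=> lx ly; apply: cvg_lim => //; exact: locates_dist. Qed.

Lemma seq_dist_eq0 (x y : bseq) beta beta' del del' : locates (sval x) beta del ->
  locates (sval y) beta' del' ->
  seq_dist omega x y = 0 <-> del = del' /\ rabs (beta - beta') <= del.
Proof.
move=> lx ly; rewrite (seq_distE lx ly); apply: log_dist_eq0; [exact: lx.1|exact: ly.1].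
Qed.

Lemma log_dist_center del del' beta beta' gam : rabs (beta - beta') <= del ->
  log_dist del del' (rabs (beta - gam)) = log_dist del del' (rabs (beta' - gam)).
Proof.
move=> h.
have h' : rabs (beta - beta') <= Num.max del del' by rewrite le_max h.
have E := max_center V gam h'.
exact: (congr1 (fun u => 2 * ln u - ln del - ln del') E).
Qed.

Lemma cone_class_eq (x y : bseq) : cls x = cls y <-> seq_dist omega x y = 0.
Proof.
have [beta [del lx]] := bseq_located x; have [beta' [del' ly]] := bseq_located y.
split=> [/(congr1 sval) /= E|].
  have : [set z | seq_dist omega y z = 0] y.
    by apply/(seq_dist_eq0 ly ly); rewrite subrr rabs0 ltW//; case: ly.
  by rewrite -E.
move=> /(seq_dist_eq0 lx ly)[dd bb]; apply: eq_exist => /=.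
have D z : seq_dist omega x z = seq_dist omega y z.
  have [gam [eps lz]] := bseq_located z.
  rewrite (seq_distE lx lz) (seq_distE ly lz) -dd; exact: log_dist_center bb.
by apply/funext => z; rewrite /= D.
Qed.

Lemma cone_reprK (c : cone) : cls (cone_repr c) = c.
Proof.
rewrite /cone_repr; case: cid => x /= E; case: c E => s p /= E.
exact: eq_exist.
Qed.

Definition cone_at (c : cone) beta del : Prop :=
  exists2 x : bseq, c = cls x & locates (sval x) beta del.

Lemma cone_at_exists c : exists beta del, cone_at c beta del.
Proof.
have [beta [del lx]] := bseq_located (cone_repr c); exists beta, del, (cone_repr c) => //.
by rewrite cone_reprK.
Qed.

Lemma cone_at_gt0 c beta del : cone_at c beta del -> 0 < del.
Proof. by case=> x _ []. Qed.

Lemma cone_at_point beta del : 0 < del -> exists c, cone_at c beta del.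
Proof. by move=> /(located_bseq beta)[x lx]; exists (cls x), x. Qed.

Lemma cone_at_inj c beta del beta' del' : cone_at c beta del -> cone_at c beta' del' ->
  del = del' /\ rabs (beta - beta') <= del.
Proof.
move=> [x -> lx] [y E ly]; apply/(seq_dist_eq0 lx ly); exact/cone_class_eq.
Qed.

Lemma cone_at_eq c c' beta beta' del : cone_at c beta del -> cone_at c' beta' del ->
  rabs (beta - beta') <= del -> c = c'.
Proof.
by move=> [x -> lx] [y -> ly] h; apply/cone_class_eq; apply/(seq_dist_eq0 lx ly).
Qed.

Lemma cone_at_center c beta beta' del : cone_at c beta del -> rabs (beta - beta') <= del ->
  cone_at c beta' del.
Proof.
move=> cb h; have [c' cb'] := cone_at_point beta' (cone_at_gt0 cb).
by rewrite (cone_at_eq cb cb' h).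
Qed.

Lemma cone_distE c c' beta beta' del del' : cone_at c beta del -> cone_at c' beta' del' ->
  cone_dist c c' = log_dist del del' (rabs (beta - beta')).
Proof.
have repr_at d gam eps : cone_at d gam eps -> exists2 gam', rabs (gam' - gam) <= eps &
    locates (sval (cone_repr d)) gam' eps.
  move=> cd; have [gam' [eps' l]] := bseq_located (cone_repr d).
  have cd' : cone_at d gam' eps' by exists (cone_repr d) => //; rewrite cone_reprK.
  have [E h] := cone_at_inj cd cd'; subst eps'; exists gam'; last exact: l.
  by have h2 := absB V gam' gam; rewrite h2; exact: h.
move=> /repr_at[g h l] /repr_at[g' h' l'].
have E := max_max_center V h h'.
by rewrite /cone_dist (seq_distE l l'); exact: (congr1 (fun u => 2 * ln u - ln del - ln del') E).
Qed.

Section Points.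
Variables (K : fieldType) (abs : K -> R).
Hypothesis VK : valued_field abs.
Variable J : {rmorphism K -> robinson S}.
Hypothesis J_abs : forall x, rabs (J x) = abs x.
Local Notation center := (@center R K (robinson S) abs rabs J).

(** Used twice: with J the embedding of the Puiseux field it gives Phi, with J the identity of the
    Robinson field it gives the identification. *)
Lemma point_map_exists : exists Phi : hberk abs -> cone, forall z,
  exists2 beta, center z beta & cone_at (Phi z) beta (diam z).
Proof.
have ex (z : hberk abs) : exists c, exists2 beta, center z beta & cone_at c beta (diam z).
  have [beta cz] := center_exists VK V J_abs z (@robinson_spherical R S).
  have [c cc] := cone_at_point beta (diam_gt0 VK z); by exists c, beta.
by exists (fun z => sval (cid (ex z))) => z; exact: svalP (cid (ex z)).
Qed.

Lemma point_map_isometry (Phi : hberk abs -> cone) :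
  (forall z, exists2 beta, center z beta & cone_at (Phi z) beta (diam z)) ->
  forall z w, cone_dist (Phi z) (Phi w) = hberk_dist z w.
Proof.
move=> PhiP z w; have [beta cz az] := PhiP z; have [beta' cw aw] := PhiP w.
by rewrite (cone_distE az aw) (hberk_dist_center VK V J_abs cz cw).
Qed.

Lemma center_unique z beta beta' : center z beta -> center z beta' -> rabs (beta - beta') <= diam z.
Proof.
move=> c1 c2; have [a [s [nest _ sd]]] := nested_exists VK z.
apply: (cvgr_to_ge sd); apply: nearW => k.
apply: le_trans (abs_subD V _ (J (a k)) _) _; rewrite (absB V (J _)) ge_max.
apply/andP; split; [exact: (center_nested VK c1 nest)|exact: (center_nested VK c2 nest)].
Qed.

Lemma center_at Phi z beta :
  (forall z, exists2 beta, center z beta & cone_at (Phi z) beta (diam z)) ->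
  center z beta -> cone_at (Phi z) beta (diam z).
Proof.
move=> PhiP cz; have [beta' cz' az] := PhiP z.
exact: cone_at_center az (center_unique cz' cz).
Qed.

End Points.

Section Identification.
Local Notation HB := (hberk rabs).
Local Notation center := (@center R (robinson S) (robinson S) rabs rabs idfun).
Variable iota : HB -> cone.
Hypothesis iotaP : forall z, exists2 beta, center z beta & cone_at (iota z) beta (diam z).

Lemma ball_point_lin (z : HB) beta del : 0 < del -> is_ball_point z beta del ->
  center z beta /\ diam z = del.
Proof.
move=> d0 E; have lE w : lin z w = Num.max del (rabs (beta - w)).
  by rewrite /lin E (ball_norm_XsubC V).
have dE : diam z = del.
  apply/eqP; rewrite eq_le le_diam ?andbT; last by move=> w; rewrite lE le_max lexx.
  by rewrite (le_trans (diam_le z beta))// lE subrr rabs0 ge_max lexx ltW.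
by split=> // w; rewrite dE lE.
Qed.

(** Two points with the same diameter and centres within it agree on all linear polynomials, hence
    are equal; conversely every point of the cone is a ball B(beta, del), whose norm is a Berkovich
    point. *)
Lemma identification_bijective : bijective iota.
Proof.
have inj : injective iota.
  move=> z w E; have [b cz az] := iotaP z; have [b' cw aw] := iotaP w.
  rewrite E in az; have [dd bb] := cone_at_inj az aw.
  apply: (hberk_eq V) => u; have E1 := max_center V u bb.
  by rewrite -cz -cw -dd; exact: E1.
have surj c : exists z, iota z = c.
  have [beta [del cc]] := cone_at_exists c; have d0 := cone_at_gt0 cc.
  pose z := ball_point V beta d0.
  have [cz dz] := ball_point_lin d0 (erefl : is_ball_point z beta del).
  exists z; have := center_at V iotaP cz; rewrite dz => az.
  by apply: (cone_at_eq az cc); rewrite subrr rabs0 ltW.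
exists (fun c => sval (cid (surj c))) => [z|c]; last exact: svalP (cid (surj c)).
by apply: inj; exact: svalP (cid (surj (iota z))).
Qed.

Lemma moebius_origin_complex (b a : C) : a != 0 ->
  moebius_ball (mx2 a b 0 1) (val (origin R)) = val (hp b (normc a)).
Proof.
move=> a0; have n0 : 0 < normc a by rewrite normc_gt0.
rewrite origin_hp moebius_ball_hp// val_hp// /hp_val /gram !mxE !sum2 !mxE /=.
rewrite !(mulr0, mulr1, mul0r, add0r, addr0) sq0 sq1 sq_normc add0r addrC.
congr bpt; apply: complex_ext; rewrite !(reD, imD, reM, imM) /=; ring.
Qed.

Lemma identification_cone : is_cone_identification iota.
Proof.
move=> a b z a0 zE; have d0 : 0 < rabs (robinson_class a) by exact: rabs_gt0.
have [cz dz] := ball_point_lin d0 zE.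
have az := center_at V iotaP cz; rewrite dz in az.
have lim : rescale S (fun n => normc (a n)) @ omega --> rabs (robinson_class a).
  by rewrite robinson_absE; exact: sabs_cvg (M0_moderate a).
have an0 : \forall n \near omega, a n != 0.
  have h : \forall n \near omega, 0 < rescale S (fun n => normc (a n)) n.
    exact: cvgr_gt d0.
  apply: filterS h => n; have [an|//] := eqVneq (a n) 0.
  by rewrite /rescale an normc0 powR0 ?ltxx// invr_eq0 gt_eqF// log_scale_gt0.
have lu : locates (fun n => hp (b n) (normc (a n))) (robinson_class b) (rabs (robinson_class a)).
  split=> //; exists b, (fun n => normc (a n)); split=> //.
  by apply: filterS an0 => n; rewrite normc_gt0.
have [x xu lx] := near_bseq lu; exists x.
  apply: filterS (filterI xu an0) => n [-> an]; by rewrite moebius_origin_complex.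
by apply: (cone_at_eq az (_ : cone_at (cls x) (robinson_class b) _)); [exists x|rewrite subrr rabs0 ltW].
Qed.

End Identification.

End Cone.

(** * The limit of the barycentric extensions *)

Section ScaledGauss.
Variables (R : realType) (K : fieldType) (abs : K -> R).
Hypothesis V : valued_field abs.

Lemma coef_comp_scale (F : comNzRingType) (p : {poly F}) (c e : F) i :
  (p \Po (c *: 'X + e%:P))`_i = (p \Po ('X + e%:P))`_i * c ^+ i.
Proof.
have E : c *: 'X + e%:P = ('X + e%:P) \Po (c *: 'X) by rewrite comp_polyD comp_polyX comp_polyC.
rewrite E comp_polyA comp_polyE.
have -> : \sum_(j < size (p \Po ('X + e%:P))) (p \Po ('X + e%:P))`_j *: (c *: 'X) ^+ j =
    \poly_(j < size (p \Po ('X + e%:P))) ((p \Po ('X + e%:P))`_j * c ^+ j).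
  by rewrite poly_def; apply: eq_bigr => j _; rewrite exprZn scalerA.
by rewrite coef_poly; case: ltnP => // le; rewrite nth_default// mul0r.
Qed.

Lemma gauss_scaled m (alpha beta : K) (p : {poly K}) i : (i < m)%N ->
  (forall j, (j < m)%N -> abs (p \Po (alpha *: 'X + beta%:P))`_j <=
                           abs (p \Po (alpha *: 'X + beta%:P))`_i) ->
  abs (p \Po (alpha *: 'X + beta%:P))`_i = gauss abs m beta (abs alpha) p /\
  abs (p \Po ('X + beta%:P))`_i * abs alpha ^+ i = gauss abs m beta (abs alpha) p.
Proof.
move=> im h.
have E j : abs (p \Po (alpha *: 'X + beta%:P))`_j = abs (p \Po ('X + beta%:P))`_j * abs alpha ^+ j.
  by rewrite coef_comp_scale (vf_absM V) (absX V).
suff e : abs (p \Po ('X + beta%:P))`_i * abs alpha ^+ i = gauss abs m beta (abs alpha) p by rewrite E.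
apply/eqP; rewrite eq_le gauss_ge//=; apply: gauss_le => [|j jm].
  by rewrite mulr_ge0 ?exprn_ge0 ?(abs_ge0 V).
by rewrite -!E h.
Qed.

Lemma coef_scaled_ratio (N D : {poly K}) (alpha beta : K) i : alpha != 0 ->
  (N \Po (alpha *: 'X + beta%:P))`_i / (D \Po (alpha *: 'X + beta%:P))`_i =
  (N \Po ('X + beta%:P))`_i / (D \Po ('X + beta%:P))`_i.
Proof.
move=> a0; rewrite !coef_comp_scale -mulf_div divff ?mulr1//.
by rewrite expf_neq0.
Qed.

(** An index that dominates among the coefficients in the scaled variable attains the Gauss norm of
    the ball of radius |cls al|, and the quotient defining the centre does not see the scaling. *)
Lemma scaled_polys (T : comNzRingType) (cls : {rmorphism T -> K}) (nm dm : {poly T})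
    (N D : {poly K}) (al be w : T) m i0 j0 :
  let q := al *: 'X + be%:P in let NM := nm \Po q in let DM := dm \Po q in
  let PM := NM - w *: DM in let G := gauss abs m (cls be) (abs (cls al)) in
  map_poly cls nm = N -> map_poly cls dm = D -> cls al != 0 -> (i0 < m)%N -> (j0 < m)%N ->
  (forall i, (i < m)%N -> abs (cls DM`_i) <= abs (cls DM`_i0)) ->
  (forall i, (i < m)%N -> abs (cls PM`_i) <= abs (cls PM`_j0)) ->
  cls w = cls NM`_i0 / cls DM`_i0 ->
  [/\ abs (cls DM`_i0) = G D,
      abs (D \Po ('X + (cls be)%:P))`_i0 * abs (cls al) ^+ i0 = G D,
      cls w = (N \Po ('X + (cls be)%:P))`_i0 / (D \Po ('X + (cls be)%:P))`_i0 &
      abs (cls PM`_j0) = G (N - cls w *: D)].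
Proof.
move=> q NM DM PM G nN dD al0 i0m j0m imax jmax wE.
have qE : map_poly cls q = cls al *: 'X + (cls be)%:P.
  by rewrite rmorphD /= map_polyZ map_polyX map_polyC.
have NE i : cls NM`_i = (N \Po (cls al *: 'X + (cls be)%:P))`_i.
  by rewrite -coef_map map_comp_poly nN qE.
have DE i : cls DM`_i = (D \Po (cls al *: 'X + (cls be)%:P))`_i.
  by rewrite -coef_map map_comp_poly dD qE.
have PE i : cls PM`_i = ((N - cls w *: D) \Po (cls al *: 'X + (cls be)%:P))`_i.
  by rewrite coefB coefZ rmorphB rmorphM /= NE DE comp_polyB comp_polyZ coefB coefZ.
have [||g1 g2] := @gauss_scaled m (cls al) (cls be) D i0 => //.
  by move=> i im; rewrite -!DE; exact: imax.
have [||p1 _] := @gauss_scaled m (cls al) (cls be) (N - cls w *: D) j0 => //.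
  by move=> i im; rewrite -!PE; exact: jmax.
split=> //.
- by rewrite DE.
- by rewrite wE NE DE coef_scaled_ratio.
- by rewrite PE.
Qed.

Lemma proportional_minors (F : fieldType) (f : {rmorphism F -> K}) (A B : nat -> F) d (w : K) :
  map_poly f (\poly_(i < d.+1) A i) = w *: map_poly f (\poly_(i < d.+1) B i) ->
  forall i j, (i <= d)%N -> (j <= d)%N -> A i * B j = A j * B i.
Proof.
move=> E i j id jd; have AE k : (k <= d)%N -> f (A k) = w * f (B k).
  move=> kd; have := congr1 (fun p : {poly K} => p`_k) E.
  by rewrite coefZ !coef_map !coef_poly ltnS kd.
by apply: (fmorph_inj f); rewrite !rmorphM !AE// mulrAC.
Qed.

End ScaledGauss.

Section FamilyAsymptotics.
Variables (R : realType) (S : scale R).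
Local Notation C := R[i].
Local Notation omega := (ultra S).
Local Notation r := (log_scale S).
Local Notation rho := (rho S).
Local Notation K := (robinson S).
Local Notation rabs := (@robinson_abs R S).
Local Notation V := (robinson_valued_field S).
Local Notation J := (embed S).
Local Notation cls := (@robinson_class R S).
#[local] Existing Instance ultra_omega.

(** Polynomials over [M0 S] specialize by [ev n] to complex polynomials and by [cls] to Robinson
    ones; both being ring morphisms, compositions and quotients are computed once for both. *)
Definition ev (n : nat) (s : M0 S) : C := s n.
Fact ev_zmod n : zmod_morphism (ev n). Proof. by []. Qed.
Fact ev_monoid n : monoid_morphism (ev n). Proof. by []. Qed.
HB.instance Definition _ n := GRing.isZmodMorphism.Build (M0 S) C (ev n) (ev_zmod n).
HB.instance Definition _ n := GRing.isMonoidMorphism.Build (M0 S) C (ev n) (ev_monoid n).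

(** Among finitely many candidates the ultrafilter singles out one that is maximal almost surely. *)
Lemma ultra_argmax (F : nat -> nat -> R) d : exists2 i0, (i0 < d.+1)%N &
  \forall n \near omega, forall i, (i < d.+1)%N -> F i n <= F i0 n.
Proof.
elim: d => [|d [i0 i0d h]].
  by exists 0%N => //; apply: nearW => n [].
have [h1|h1] := in_ultra_setVsetC [set n | F d.+1 n <= F i0 n] (ultra_omega S).
  exists i0; first exact: leqW.
  apply: filterS (filterI h h1) => n [hn hd] i; rewrite ltnS leq_eqVlt => /orP[/eqP->//|].
  exact: hn.
exists d.+1 => //; apply: filterS (filterI h h1) => n [hn /negP]; rewrite -ltNge => /ltW hd i.
by rewrite ltnS leq_eqVlt => /orP[/eqP->//|/hn/le_trans]; apply.
Qed.

Lemma rabs_le (s t : M0 S) : (\forall n \near omega, normc (s n) <= normc (t n)) ->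
  rabs (cls s) <= rabs (cls t).
Proof.
move=> h; rewrite !robinson_absE.
apply: (ler_cvg_to (sabs_cvg (M0_moderate s)) (sabs_cvg (M0_moderate t))).
apply: filterS h => n h; have r0 : 0 <= (r n)^-1 by rewrite invr_ge0 ltW// log_scale_gt0.
by rewrite /root_abs ge0_ler_powR ?nnegrE ?normc_ge0.
Qed.

Lemma class_neq0 (s : M0 S) : cls s != 0 -> \forall n \near omega, s n != 0.
Proof.
move=> s0; have := rabs_gt0 s0; rewrite robinson_absE => p0.
have h : \forall n \near omega, 0 < root_abs S s n by exact: (cvgr_gt _ (sabs_cvg (M0_moderate s))).
apply: filterS h => n; have [sn|//] := eqVneq (s n) 0.
by rewrite /root_abs sn normc0 powR0 ?ltxx// invr_eq0 gt_eqF// log_scale_gt0.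
Qed.

Lemma root_div_cvg (s t : M0 S) : cls t != 0 ->
  rescale S (fun n => normc (s n) / normc (t n)) @ omega --> rabs (cls s) / rabs (cls t).
Proof.
move=> t0; have p0 := rabs_gt0 t0.
have ls := sabs_cvg (M0_moderate s); have lt := sabs_cvg (M0_moderate t).
rewrite !robinson_absE in p0 *.
have lim : root_abs S s n / root_abs S t n @[n --> omega] --> sabs S s / sabs S t.
  apply: (cvgM ls); apply: cvgV lt; rewrite gt_eqF//; exact: p0.
apply: cvg_trans lim; apply: near_eq_cvg; apply: nearW => n.
have V1 (x e : R) : 0 <= x -> x^-1 `^ e = (x `^ e)^-1.
  by move=> x0; rewrite -powR_inv1// -powRrM mulrC powRrM powR_inv1 ?powR_ge0.
by rewrite /root_abs /rescale powRM ?normc_ge0 ?invr_ge0 ?normc_ge0// V1 ?normc_ge0.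
Qed.

Lemma class_div (s t : M0 S) : cls t != 0 -> exists w : M0 S,
  (forall n, w n = s n / t n) /\ cls w = cls s / cls t.
Proof.
move=> t0; have im : (fun n => (t n)^-1) \in @moderate R S.
  have lim := @root_div_cvg 1 t t0.
  apply: (root_cvg_moderate (a := fun n => normc ((1 : M0 S) n) / normc (t n))) lim.
  by apply: nearW => n; rewrite -[(1 : M0 S) n]/(1 : C) normc1 mul1r normcV.
exists (s * MkM0 im); split=> //.
rewrite rmorphM; congr (_ * _); apply: (mulIf t0); rewrite mulVf// -rmorphM -(rmorph1 cls).
apply/robinson_class_eq => N; apply: filterS (class_neq0 t0) => n tn.
rewrite -[X in normc X]/((t n)^-1 * t n - 1) mulVf// subrr normc0 exprn_gt0//.
by have /andP[] := rho_disk S n.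
Qed.

Variables (d : nat) (a b : nat -> C -> C) (A B : nat -> puiseux R).
Hypotheses (d0 : (0 < d)%N) (fam : rational_family d a b).
Hypothesis expansions : forall i, (i <= d)%N ->
  laurent_expansion (a i) (A i) /\ laurent_expansion (b i) (B i).

Let num := \poly_(i < d.+1) A i.
Let den := \poly_(i < d.+1) B i.
Let N := map_poly J num.
Let D := map_poly J den.

Lemma coef_lift (f : nat -> C -> C) (F : nat -> puiseux R) :
  (forall i, (i <= d)%N -> laurent_expansion (f i) (F i)) ->
  exists p : {poly M0 S}, [/\ (size p <= d.+1)%N, map_poly cls p = map_poly J (\poly_(i < d.+1) F i) &
    forall n, map_poly (ev n) p = family_poly d f (rho n)].
Proof.
move=> h.
have ex i : exists s : M0 S, (i <= d)%N -> (forall n, s n = f i (rho n)) /\ cls s = J (F i).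
  have [id|_] := boolP (i <= d)%N; last by exists 0.
  by have [m E] := laurent_class S (h i id); exists (MkM0 m).
pose s i := sval (cid (ex i)).
have sP i : (i <= d)%N -> (forall n, s i n = f i (rho n)) /\ cls (s i) = J (F i) := svalP (cid (ex i)).
exists (\poly_(i < d.+1) s i); split; first exact: size_poly.
  apply/polyP => i; rewrite !coef_map !coef_poly ltnS; case: ifP => [/sP[]//|_].
  by rewrite !raddf0.
move=> n; apply/polyP => i; rewrite coef_map !coef_poly ltnS; case: ifP => [/sP[sE _]|_].
  exact: sE.
by rewrite raddf0.
Qed.

Lemma num_den_neq0 (w : K) : N - w *: D != 0.
Proof.
rewrite subr_eq0; apply/eqP => E; apply: (family_minors d0 fam expansions).
exact: proportional_minors E.
Qed.

Lemma den_neq0 : D != 0.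
Proof. by rewrite map_poly_eq0; exact: family_den d0 fam expansions. Qed.

End FamilyAsymptotics.

Lemma coefBZ (F : nzRingType) (p q : {poly F}) c i : (p - c *: q)`_i = p`_i - c * q`_i.
Proof. by rewrite coefB coefZ. Qed.

Section FamilyLocates.
Variables (R : realType) (S : scale R).
Local Notation C := R[i].
Local Notation omega := (ultra S).
Local Notation r := (log_scale S).
Local Notation rho := (rho S).
Local Notation K := (robinson S).
Local Notation rabs := (@robinson_abs R S).
Local Notation V := (robinson_valued_field S).
Local Notation J := (embed S).
Local Notation cls := (@robinson_class R S).
#[local] Existing Instance ultra_omega.

Lemma height_class (h : nat -> R) (del : R) : 0 < del -> (\forall n \near omega, 0 < h n) ->
  rescale S h @ omega --> del -> exists al : M0 S, [/\ forall n, al n = (h n)%:C,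
    rabs (cls al) = del & cls al != 0].
Proof.
move=> del0 h0 hd.
have am : (fun n => (h n)%:C) \in @moderate R S.
  apply: root_cvg_moderate hd; apply: filterS h0 => n hn.
  by rewrite normc_real gtr0_norm.
have alE : rabs (cls (MkM0 am)) = del.
  rewrite robinson_absE; apply: sabs_unique; apply: cvg_trans hd; apply: near_eq_cvg.
  apply: filterS h0 => n hn; rewrite /root_abs -[MkM0 am n]/(h n)%:C.
  by rewrite normc_real gtr0_norm.
exists (MkM0 am); split=> //; apply/eqP => e.
by move: alE del0; rewrite e rabs0 => <-; rewrite ltxx.
Qed.

Variables (d : nat) (a b : nat -> C -> C) (A B : nat -> puiseux R).
Hypotheses (d0 : (0 < d)%N) (fam : rational_family d a b).
Hypothesis expansions : forall i, (i <= d)%N ->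
  laurent_expansion (a i) (A i) /\ laurent_expansion (b i) (B i).

Let N := map_poly J (\poly_(i < d.+1) A i).
Let D := map_poly J (\poly_(i < d.+1) B i).

Definition image_center beta i0 : K := (N \Po ('X + beta%:P))`_i0 / (D \Po ('X + beta%:P))`_i0.
Definition image_radius beta del i0 : R :=
  gauss rabs d.+1 beta del (N - image_center beta i0 *: D) / gauss rabs d.+1 beta del D.
Definition dominant beta del i0 : Prop := (i0 < d.+1)%N /\
  rabs (D \Po ('X + beta%:P))`_i0 * del ^+ i0 = gauss rabs d.+1 beta del D.

Lemma image_den_gt0 beta del : 0 < del -> 0 < gauss rabs d.+1 beta del D.
Proof.
move=> del0; apply: (gauss_gt0 V _ del0); first exact: (den_neq0 S d0 fam expansions).
by rewrite size_map_poly size_poly.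
Qed.

Lemma image_num_gt0 beta del w : 0 < del -> 0 < gauss rabs d.+1 beta del (N - w *: D).
Proof.
move=> del0; apply: (gauss_gt0 V _ del0); first exact: (num_den_neq0 d0 fam expansions).
apply: leq_trans (size_polyD _ _) _; rewrite geq_max size_polyN; apply/andP; split.
  by rewrite size_map_poly size_poly.
by apply: leq_trans (size_scale_leq _ _) _; rewrite size_map_poly size_poly.
Qed.

(** Take almost surely dominant indices i0 and j0. For almost every n [bary_ext_close] puts the
    image within a constant of (w n, rr n), and these sequences represent the centre and radius of
    the image ball; [locates_close] absorbs the constant. *)
Lemma family_locates x beta del : locates x beta del ->
  exists2 i0, dominant beta del i0 &
  exists2 w, rabs (w - image_center beta i0) <= image_radius beta del i0 &
    locates (fun n => bary_ext (family_poly d a (rho n)) (family_poly d b (rho n)) (x n))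
      w (image_radius beta del i0).
Proof.
move=> [del0 [be [h [beE xE hd]]]]; subst beta.
have h0 : \forall n \near omega, 0 < h n by apply: filterS xE => n [].
have [al [alE aldel al0]] := height_class del0 h0 hd; subst del.
have [nm [snm nmJ nmev]] := coef_lift S (fun i id => (expansions id).1).
have [dm [sdm dmJ dmev]] := coef_lift S (fun i id => (expansions id).2).
pose q : {poly M0 S} := al *: 'X + be%:P.
pose NM := nm \Po q; pose DM := dm \Po q.
have [i0 i0d i0max] := @ultra_argmax R S (fun i n => normc (DM`_i n)) d.
have DMle i : (i < d.+1)%N -> rabs (cls DM`_i) <= rabs (cls DM`_i0).
  by move=> id; apply: rabs_le; apply: filterS i0max => n; exact.
have qev n : map_poly (@ev R S n) q = (h n)%:C *: 'X + (be n)%:P.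
  by rewrite rmorphD /= map_polyZ map_polyX map_polyC -alE.
have [D0 gD0] : cls DM`_i0 != 0 /\ rabs (cls DM`_i0) = gauss rabs d.+1 (cls be) (rabs (cls al)) D.
  have qJ : map_poly cls q = cls al *: 'X + (cls be)%:P.
    by rewrite rmorphD /= map_polyZ map_polyX map_polyC.
  have DE i : cls DM`_i = (D \Po (cls al *: 'X + (cls be)%:P))`_i.
    by rewrite -(coef_map cls) map_comp_poly dmJ qJ.
  have g : rabs (cls DM`_i0) = gauss rabs d.+1 (cls be) (rabs (cls al)) D.
    have h1 i : (i < d.+1)%N -> rabs (D \Po (cls al *: 'X + (cls be)%:P))`_i <=
        rabs (D \Po (cls al *: 'X + (cls be)%:P))`_i0.
      by move=> im; rewrite -!DE; exact: DMle i im.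
    have [g1 _] := gauss_scaled V i0d h1.
    exact: etrans (congr1 rabs (DE i0)) g1.
  split; last exact: g.
  have gp := image_den_gt0 (cls be) del0.
  have e1 : 0 < rabs (cls DM`_i0) := eq_ind_r (fun u => 0 < u) gp g.
  by apply/eqP => e; move: e1; rewrite e rabs0 ltxx.
have [w [wE wJ]] := class_div NM`_i0 D0.
pose PM := NM - w *: DM.
have [j0 j0d j0max] := @ultra_argmax R S (fun i n => normc (PM`_i n)) d.
have PMle i : (i < d.+1)%N -> rabs (cls PM`_i) <= rabs (cls PM`_j0).
  by move=> id; apply: rabs_le; apply: filterS j0max => n; exact.
have [g1 g2 w0E g3] := scaled_polys V nmJ dmJ al0 i0d j0d DMle PMle wJ.
exists i0; first exact: conj i0d g2.
have RE : image_radius (cls be) (rabs (cls al)) i0 = rabs (cls PM`_j0) / rabs (cls DM`_i0).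
  rewrite /image_radius (_ : image_center (cls be) i0 = cls w); last exact: esym w0E.
  exact: (f_equal2 (fun u v => u / v) (esym g3) (esym gD0)).
have P0 : cls PM`_j0 != 0.
  have gp := image_num_gt0 (cls be) (cls w) del0.
  have e1 : 0 < rabs (cls PM`_j0) := eq_ind_r (fun u => 0 < u) gp g3.
  by apply/eqP => e; move: e1; rewrite e rabs0 ltxx.
pose rr n := normc (PM`_j0 n) / normc (DM`_i0 n).
have rrlim : rescale S rr @ omega --> image_radius (cls be) (rabs (cls al)) i0.
  by rewrite RE; exact: root_div_cvg.
have Rr0 : 0 < image_radius (cls be) (rabs (cls al)) i0.
  by rewrite RE divr_gt0 ?rabs_gt0.
have lw : locates (fun n => hp (w n) (rr n)) (image_center (cls be) i0)
    (image_radius (cls be) (rabs (cls al)) i0).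
  split=> //; exists w, rr; split=> //.
  apply: filterS (filterI (class_neq0 P0) (class_neq0 D0)) => n [pn dn].
  by split=> //; rewrite divr_gt0 ?normc_gt0.
have close : \forall n \near omega,
    hdist (bary_ext (family_poly d a (rho n)) (family_poly d b (rho n)) (x n)) (hp (w n) (rr n))
      <= bary_const d :> R.
  apply: filterS (filterI (filterI xE (filterI i0max j0max))
    (filterI (class_neq0 P0) (class_neq0 D0))) => n [[[hn xn] [imax jmax]] [pn dn]].
  have [cop sz] : coprimep (family_poly d a (rho n)) (family_poly d b (rho n)) /\
      maxn (size (family_poly d a (rho n))) (size (family_poly d b (rho n))) = d.+1.
    by apply: fam.2; exact: rho_disk.
  have DE i : DM`_i n = (family_poly d b (rho n) \Po ((h n)%:C *: 'X + (be n)%:P))`_i.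
    rewrite -dmev -qev -map_comp_poly coef_map; exact: erefl.
  have NE i : NM`_i n = (family_poly d a (rho n) \Po ((h n)%:C *: 'X + (be n)%:P))`_i.
    rewrite -nmev -qev -map_comp_poly coef_map; exact: erefl.
  have PE i : PM`_i n = ((family_poly d a (rho n) \Po ((h n)%:C *: 'X + (be n)%:P)) -
     w n *: (family_poly d b (rho n) \Po ((h n)%:C *: 'X + (be n)%:P)))`_i.
    have e : PM`_i n = NM`_i n - w n * DM`_i n by rewrite /PM coefB coefZ.
    exact: etrans (etrans e (f_equal2 (fun u v => u - w n * v) (NE i) (DE i))) (esym (coefBZ _ _ _ _)).
  have wn : w n = (family_poly d a (rho n) \Po ((h n)%:C *: 'X + (be n)%:P))`_i0 /
      (family_poly d b (rho n) \Po ((h n)%:C *: 'X + (be n)%:P))`_i0 by rewrite -NE -DE.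
  rewrite xn /rr DE PE wn.
  apply: bary_ext_close => //.
  - by rewrite -DE.
  - by move=> i id; rewrite -!DE; exact: imax.
  - by rewrite -wn -PE.
  - by move=> i id; rewrite -wn -!PE; exact: jmax.
exact: locates_close lw close.
Qed.

End FamilyLocates.

Section OptimalUnique.
Variables (R : realType) (K : fieldType) (abs : K -> R).
Hypothesis V : valued_field abs.

Lemma gauss_recenter m (x y : K) (s : R) (p : {poly K}) : 0 < s -> abs (x - y) <= s ->
  (size p <= m)%N -> gauss abs m x s p = gauss abs m y s p.
Proof.
move=> s0 xy sp; have [h1 h2] := gauss_radius V s0 (lexx s) xy (leqnSn (size p)) sp.
by apply/eqP; rewrite eq_le h2 andbT (le_trans h1)// divff ?gt_eqF// expr1n mul1r.
Qed.

(** Both w and w' minimize the norm of N - u D over u, since the norm of a ball is independent of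
    its centre; hence the radii agree and the centres differ by at most that radius. *)
Lemma optimal_unique m (x y : K) (s : R) (N D : {poly K}) i j : 0 < s -> abs (x - y) <= s ->
  (size N <= m)%N -> (size D <= m)%N -> (i < m)%N -> (j < m)%N -> 0 < gauss abs m x s D ->
  abs (D \Po ('X + x%:P))`_i * s ^+ i = gauss abs m x s D ->
  abs (D \Po ('X + y%:P))`_j * s ^+ j = gauss abs m y s D ->
  let w := (N \Po ('X + x%:P))`_i / (D \Po ('X + x%:P))`_i in
  let w' := (N \Po ('X + y%:P))`_j / (D \Po ('X + y%:P))`_j in
  gauss abs m x s (N - w *: D) / gauss abs m x s D =
    gauss abs m y s (N - w' *: D) / gauss abs m y s D /\
  abs (w - w') <= gauss abs m x s (N - w *: D) / gauss abs m x s D.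
Proof.
move=> s0 xy sN sD im jm GD Di Dj w w'.
have sP u : (size (N - u *: D)%R <= m)%N.
  by rewrite (leq_trans (size_polyD _ _))// geq_max sN size_polyN (leq_trans (size_scale_leq _ _)).
have GD' : gauss abs m y s D != 0 by rewrite -(gauss_recenter s0 xy sD) gt_eqF.
have o1 := gauss_optimal V N (ltW s0) im Di (lt0r_neq0 GD).
have o2 := gauss_optimal V N (ltW s0) jm Dj GD'; rewrite -/w in o1; rewrite -/w' in o2.
have e1 : gauss abs m x s (N - w *: D) <= gauss abs m x s (N - w' *: D).
  by rewrite (o1 w') le_max lexx.
have e2 : gauss abs m x s (N - w' *: D) <= gauss abs m x s (N - w *: D).
  by rewrite !(gauss_recenter s0 xy (sP _)) (o2 w) le_max lexx.
have E : gauss abs m x s (N - w *: D) = gauss abs m x s (N - w' *: D).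
  by apply/eqP; rewrite eq_le e1 e2.
rewrite -(gauss_recenter s0 xy (sP w')) -(gauss_recenter s0 xy sD) E; split=> //.
by rewrite ler_pdivlMr// (o1 w') le_max lexx orbT.
Qed.

End OptimalUnique.

(** * The limiting map and its conjugacy with the Berkovich extension *)

Section LimitMap.
Variables (R : realType) (S : scale R).
Local Notation C := R[i].
Local Notation omega := (ultra S).
Local Notation r := (log_scale S).
Local Notation rho := (rho S).
Local Notation K := (robinson S).
Local Notation rabs := (@robinson_abs R S).
Local Notation V := (robinson_valued_field S).
Local Notation J := (embed S).
Local Notation cone := (Defs.cone omega r).
Local Notation bseq := (Defs.bseq r).
Local Notation cls := (@cone_class R omega r).
Local Notation L := (puiseux R).
Local Notation VL := (puiseux_valued_field R).
#[local] Existing Instance ultra_omega.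

Variables (d : nat) (a b : nat -> C -> C) (A B : nat -> L).
Hypotheses (d0 : (0 < d)%N) (fam : rational_family d a b).
Hypothesis expansions : forall i, (i <= d)%N ->
  laurent_expansion (a i) (A i) /\ laurent_expansion (b i) (B i).

Local Notation imc := (image_center (S := S) d A B).
Local Notation imr := (image_radius (S := S) d A B).
Local Notation dom := (dominant (S := S) d B).
Local Notation g := (fun n => bary_ext (family_poly d a (rho n)) (family_poly d b (rho n))).

Lemma image_unique beta beta' del i i' : 0 < del -> rabs (beta - beta') <= del ->
  dom beta del i -> dom beta' del i' ->
  imr beta del i = imr beta' del i' /\ rabs (imc beta i - imc beta' i') <= imr beta del i.
Proof.
move=> del0 bb [id Di] [id' Di'].
have GD := image_den_gt0 d0 fam expansions beta del0.
apply: (optimal_unique V del0 bb _ _ id id' GD Di Di').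
  by rewrite size_map_poly size_poly.
by rewrite size_map_poly size_poly.
Qed.

Lemma dominant_exists beta del : 0 < del -> exists i, dom beta del i.
Proof.
move=> del0; have GD := image_den_gt0 d0 fam expansions beta del0.
by have [i id Di] := gauss_argmax (lt0r_neq0 GD); exists i; exact: conj id Di.
Qed.

(* If the images of a bounded sequence were unbounded, some other ultrafilter *)
(* would see them tend to infinity, against the asymptotics along it.         *)
Lemma family_bounded (x : bseq) : exists c, forall n, hdist (origin R) (g n (sval x n)) / r n <= c.
Proof.
have [c xc] := svalP x.
pose v n := hdist (origin R) (g n (sval x n)) / r n.
have [[c' vc]|unb] := pselect (exists c, forall n, v n <= c); first by exists c'.
pose E (k : nat) := [set n | k%:R < v n].
have E0 k : exists n, E k n.
  apply/not_existsP => h; apply: unb; exists k%:R => n.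
  by rewrite leNgt; apply/negP => kn; apply: (h n).
pose F : set_system nat := [set U | exists k, E k `<=` U].
have FF : ProperFilter F.
  split; first by move=> [k h]; have [n /h] := E0 k.
  split; first by exists 0%N.
    move=> P Q [k hP] [k' hQ]; exists (maxn k k') => n En; split.
      by apply: hP; apply: le_lt_trans En; rewrite ler_nat leq_maxl.
    by apply: hQ; apply: le_lt_trans En; rewrite ler_nat leq_maxr.
  by move=> P Q PQ [k hP]; exists k; exact: subset_trans hP PQ.
have [U [uU FU]] := ultraFilterLemma FF.
have UE k : U (E k) by apply: FU; exists k.
have bnd (z : R) : exists k : nat, z < k%:R.
  exists (Num.bound `|z|); rewrite (le_lt_trans (ler_norm z))//; apply: archi_boundP.
  exact: normr_ge0.
have npU n : ~ U [set n].
  move=> Un; have [k kn] := bnd (v n).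
  have [m [/= mk mn]] := filter_ex (filterI (UE k) Un).
  by move: mk; rewrite /E /= mn ltNge (ltW kn).
(* Only the ultrafilter changes; the preceding asymptotics hold for every scale, in particular for
   this one. *)
pose S' := Scale uU npU (rho_disk S) (@rho_cvg0 R S).
have [beta [del lx]] : exists beta del, locates (S := S') (sval x) beta del.
  by apply: (@bounded_locates R S' (sval x) c); exact: (@nearW _ U).
have [i _ [w _ ly]] := @family_locates R S' d a b A B d0 fam expansions _ _ _ lx.
have [c' yc] := locates_bounded ly.
have [k kc] := bnd c'.
have [m [/= mk mc]] := filter_ex (filterI (UE k) yc).
exfalso; have h : v m <= c' := mc.
by have := lt_le_trans mk h; rewrite ltNge (ltW kc).
Qed.

Definition image_bseq (x : bseq) : bseq := exist _ (fun n => g n (sval x n)) (family_bounded x).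

Lemma image_at (x : bseq) beta del i : locates (sval x) beta del -> dom beta del i ->
  cone_at (cls (image_bseq x)) (imc beta i) (imr beta del i).
Proof.
move=> lx di; have del0 := lx.1.
have [j dj [w wj ly]] := family_locates d0 fam expansions lx.
have zero : rabs (beta - beta) <= del by rewrite subrr rabs0 ltW.
have [E h] := image_unique del0 zero dj di.
have c1 : cone_at (cls (image_bseq x)) w (imr beta del j) by exists (image_bseq x).
have c2 := cone_at_center c1 wj.
have c3 := cone_at_center c2 h.
exact: (eq_ind _ (fun u => cone_at (cls (image_bseq x)) (imc beta i) u) c3 _ E).
Qed.

Definition limit_map (c : cone) : cone := cls (image_bseq (cone_repr c)).

Lemma limit_map_at c beta del i : cone_at c beta del -> dom beta del i ->
  cone_at (limit_map c) (imc beta i) (imr beta del i).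
Proof.
move=> cc di; have del0 := cone_at_gt0 cc.
have [gam [eps l]] := bseq_located (cone_repr c).
have cg : cone_at c gam eps by exists (cone_repr c); [exact: esym (cone_reprK c)|exact: l].
have [E h] := cone_at_inj cg cc; subst eps.
have [j dj] := dominant_exists gam del0.
have c1 := image_at l dj.
have [E h1] := image_unique del0 h dj di.
have c3 := cone_at_center c1 h1.
exact: (eq_ind _ (fun u => cone_at (limit_map c) (imc beta i) u) c3 _ E).
Qed.

Lemma limit_mapP : is_limit_map g limit_map.
Proof.
move=> x; exists (image_bseq x) => //.
have [beta [del l]] := bseq_located x; have [i di] := dominant_exists beta l.1.
have c1 := image_at l di.
have cx : cone_at (cls x) beta del by exists x.
have c2 := limit_map_at cx di.
apply: (cone_at_eq c2 c1); rewrite subrr rabs0 ltW//; exact: cone_at_gt0 c1.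
Qed.

Variable Phi : hberk (@puiseux_abs R) -> cone.
Hypothesis PhiP : forall z, exists2 beta, center rabs J z beta & cone_at (Phi z) beta (diam z).

Lemma limit_map_conjugate :
  let Bf := push_point VL (family_den d0 fam expansions) (family_num_den d0 fam expansions) in
  Phi \o Bf = limit_map \o Phi.
Proof.
move=> Bf; apply/funext => z /=.
have [beta cz az] := PhiP z.
have [i [id Di]] := dominant_exists beta (diam_gt0 VL z).
have sn : (size (\poly_(i < d.+1) A i) <= d.+1)%N by exact: size_poly.
have sd : (size (\poly_(i < d.+1) B i) <= d.+1)%N by exact: size_poly.
have cB := push_center VL V (@rabs_embed R S) (family_den d0 fam expansions)
  (family_num_den d0 fam expansions) sn sd cz id Di.
have dB := diam_push VL V (@rabs_embed R S) (family_den d0 fam expansions)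
  (family_num_den d0 fam expansions) sn sd cz id Di.
have aB := center_at VL PhiP cB.
have aF := limit_map_at az (conj id Di).
have aB' := eq_ind _ (fun u => cone_at (Phi (Bf z)) (imc beta i) u) aB _ dB.
apply: (cone_at_eq aB' aF); rewrite subrr rabs0 ltW//; exact: cone_at_gt0 aF.
Qed.

End LimitMap.

Theorem theorem7p4 (R : realType)
    (omega : set_system nat) (omega_ultra : UltraFilter omega)
    (omega_nonprincipal : forall n, ~ omega [set n])
    (rho : nat -> R[i]) (rho_disk : forall n, 0 < normc (rho n) < 1)
    (rho_cvg0 : (rho : nat -> R[i]^o) @ \oo --> (0 : R[i]^o)) :
  let S := Scale omega_ultra omega_nonprincipal rho_disk rho_cvg0 in
  let r := fun n => - ln (normc (rho n)) in
  (* the asymptotic cone is identified with H_Berk of the Robinson field *)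
  (exists iota : hberk (@robinson_abs R S) -> cone omega r,
     [/\ is_cone_identification iota,
         bijective iota &
         forall z w, cone_dist (iota z) (iota w) = hberk_dist z w]) /\
  exists Phi : hberk (@puiseux_abs R) -> cone omega r,
    (forall z w, cone_dist (Phi z) (Phi w) = hberk_dist z w) /\
    forall (d : nat) (a b : nat -> R[i] -> R[i]) (A B : nat -> puiseux R),
      (1 < d)%N ->
      rational_family d a b ->
      (forall i, (i <= d)%N ->
         laurent_expansion (a i) (A i) /\ laurent_expansion (b i) (B i)) ->
      exists (Bf : hberk (@puiseux_abs R) -> hberk (@puiseux_abs R))
             (F : cone omega r -> cone omega r),
        [/\ is_berk_extension (\poly_(i < d.+1) A i) (\poly_(i < d.+1) B i) Bf,
            is_limit_map (fun n => bary_ext (family_poly d a (rho n))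
                                            (family_poly d b (rho n))) F &
            Phi \o Bf = F \o Phi].
Proof.
move=> S r; pose VR := robinson_valued_field S; pose VL := puiseux_valued_field R.
split.
  have idabs (x : robinson S) : robinson_abs (idfun x) = robinson_abs x by [].
  have [iota iotaP] := point_map_exists VR (J := idfun) idabs.
  exists iota; split.
  - exact: identification_cone iotaP.
  - exact: identification_bijective iotaP.
  - exact: (point_map_isometry VR idabs iotaP).
have [Phi PhiP] := point_map_exists VL (@rabs_embed R S).
exists Phi; split; first exact: (point_map_isometry VL (@rabs_embed R S) PhiP).
move=> d a b A B d1 fam expansions; have d0 := ltnW d1.
exists (push_point VL (family_den d0 fam expansions) (family_num_den d0 fam expansions)).
exists (@limit_map R S d a b A B d0 fam expansions); split.
- exact: push_berk_extension.
- exact: (@limit_mapP R S d a b A B d0 fam expansions).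
- exact: (@limit_map_conjugate R S d a b A B d0 fam expansions Phi PhiP).
Qed.
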